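(* Let $h_1$ and $h_2$ be elements of $\mathcal{S}_0$. Then $h_1$ and $h_2$ are relatively prime if and only if $$\mathcal{B}(h_1)\cap\mathcal{B}(h_2)=\{0\}.$$ In particular, every function $f\in\mathcal{N}_{sym}$ which is non-constant on $\mathbb{C}^+$ has a representation of the form $$f=\mathrm{i}\,\frac{h_2-h_1}{h_2+h_1}\quad\text{and}\quad \mathcal{B}(h_1)\cap\mathcal{B}(h_2)=\{0\}$$ with $h_1,h_2\in\mathcal{S}_0$.
   Context: $\mathbb{C}^+$ and $\mathbb{C}^-$ are the open upper and lower half-planes, and $\mathcal{H}^\infty(\mathbb{C}^{+})$ is the space of bounded analytic functions on $\mathbb{C}^+$ with the supremum norm. $\mathcal{N}(\mathbb{C}^+)$ is the set of meromorphic functions on $\mathbb{C}^+$ of the form $f_1/f_2$ with $f_1,f_2\in\mathcal{H}^\infty(\mathbb{C}^+)$, $f_2\not\equiv 0$; $\mathcal{N}(\mathbb{C}^-)$ is defined analogously. $\mathcal{N}(\mathbb{C}\setminus\mathbb{R})$ is the set of meromorphic functions $f$ on $\mathbb{C}\setminus\mathbb{R}$ with $f_{|\mathbb{C}^+}\in\mathcal{N}(\mathbb{C}^+)$ and $f_{|\mathbb{C}^-}\in\mathcal{N}(\mathbb{C}^-)$. For $g$ on $\mathbb{C}^+$, $SR(g)(z)=\overline{g(\overline{z})}$ on $\mathbb{C}^-$. $\mathcal{N}_{sym}=\{f\in\mathcal{N}(\mathbb{C}\setminus\mathbb{R}): f_{|\mathbb{C}^-}=SR(f_{|\mathbb{C}^+})\}$.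 For $f\in\mathcal{N}(\mathbb{C}\setminus\mathbb{R})$, $U_{ext}(f)$ is the union of the domain of analyticity of $f$ in $\mathbb{C}\setminus\mathbb{R}$ and all $\zeta\in\mathbb{R}$ for which there is an open interval $(a,b)\ni\zeta$ such that $f$ can be analytically extended through $(a,b)$ (there is an analytic function on an open neighbourhood of $(a,b)$ agreeing with $f$ off $\mathbb{R}$). $\mathcal{S}_0$ is the set of $h\in\mathcal{N}(\mathbb{C}\setminus\mathbb{R})$ with $h_{|\mathbb{C}^+}\in\mathcal{H}^\infty(\mathbb{C}^+)\setminus\{0\}$, $\|h_{|\mathbb{C}^+}\|_{\mathcal{H}^\infty(\mathbb{C}^+)}\le 1$ and $h_{|\mathbb{C}^-}=1/SR(h_{|\mathbb{C}^+})$. For $h_1,h_2\in\mathcal{S}_0$, $h_1$ divides $h_2$ if there is $h_3\in\mathcal{S}_0$ with $h_2=h_1h_3$. A function $h\in\mathcal{S}_0$ is non-trivial if $h_{|\mathbb{C}^+}$ is not a constant function of modulus one. $h_1,h_2\in\mathcal{S}_0$ are relatively prime if no non-trivial function in $\mathcal{S}_0$ divides both. For $h\in\mathcal{S}_0$, $\mathcal{B}(h)$ is the (unique, existing) reproducing kernel Hilbert space of analytic functions on $U_{ext}(h)$ with kernel $s_h(z,w)=\frac{1-h(z)\overline{h(w)}}{-\mathrm{i}(z-\overline{w})}$, $z\neq\overline{w}$, extended by continuity to $z=\overline{w}$. One has $\mathcal{B}(h)\subset\mathcal{N}(\mathbb{C}\setminus\mathbb{R})$, and intersections of such spaces are taken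 as sets of meromorphic functions on $\mathbb{C}\setminus\mathbb{R}$. *)

(* Defs.v *)
From Stdlib Require Export Reals.
From Coquelicot Require Export Coquelicot.

Open Scope R_scope.
Open Scope C_scope.

Definition upper_half (z : C) : Prop := (0 < Im z)%R.
Definition lower_half (z : C) : Prop := (Im z < 0)%R.
Definition off_real (z : C) : Prop := Im z <> 0%R.

Definition analytic_at (f : C -> C) (z : C) : Prop :=
  exists a : nat -> C, locally z (fun w => is_pseries a (w - z) (f w)).

Definition analytic_on (Omega : C -> Prop) (f : C -> C) : Prop :=
  forall z, Omega z -> analytic_at f z.

(* A meromorphic function on an open set is represented by a total function
   whose values at isolated points (such as its poles) carry no information;
   equality of meromorphic functions is [mero_eq], not [=]. *)
Definition mero_on (Omega : C -> Prop) (f : C -> C) : Prop :=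
  forall z, Omega z ->
  exists (n : nat) (g : C -> C),
    analytic_at g z /\ locally' z (fun w => f w = g w / (w - z) ^ n).

Definition mero_eq (Omega : C -> Prop) (f g : C -> C) : Prop :=
  forall z, Omega z -> locally' z (fun w => f w = g w).

Definition sup_norm (Omega : C -> Prop) (g : C -> C) : Rbar :=
  Lub_Rbar (fun r => exists z, Omega z /\ r = Cmod (g z)).

Definition Hinf (Omega : C -> Prop) (g : C -> C) : Prop :=
  analytic_on Omega g /\ Rbar_lt (sup_norm Omega g) p_infty.

Definition nonzero_on (Omega : C -> Prop) (g : C -> C) : Prop :=
  exists z, Omega z /\ g z <> 0.

Definition bounded_type (Omega : C -> Prop) (f : C -> C) : Prop :=
  mero_on Omega f /\
  exists f1 f2, Hinf Omega f1 /\ Hinf Omega f2 /\ nonzero_on Omega f2 /\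
    mero_eq Omega f (fun z => f1 z / f2 z).

Definition N_off_real (f : C -> C) : Prop :=
  mero_on off_real f /\ bounded_type upper_half f /\ bounded_type lower_half f.

Definition SR (g : C -> C) (z : C) : C := Cconj (g (Cconj z)).

Definition N_sym (f : C -> C) : Prop :=
  N_off_real f /\ mero_eq lower_half f (SR f).

Definition U_ext (f : C -> C) (z : C) : Prop :=
  (off_real z /\ exists g, analytic_at g z /\ locally' z (fun w => f w = g w))
  \/
  (Im z = 0%R /\
   exists a b : R, (a < Re z < b)%R /\
   exists (V : C -> Prop) (g : C -> C),
     open V /\ (forall x : R, (a < x < b)%R -> V (RtoC x)) /\
     analytic_on V g /\ mero_eq (fun w => V w /\ off_real w) f g).

Definition S0 (h : C -> C) : Prop :=
  N_off_real h /\
  exists g, Hinf upper_half g /\ nonzero_on upper_half g /\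
    Rbar_le (sup_norm upper_half g) 1%R /\
    mero_eq upper_half h g /\ mero_eq lower_half h (fun z => / SR g z).

Definition divides (h1 h2 : C -> C) : Prop :=
  exists h3, S0 h3 /\ mero_eq off_real h2 (fun z => h1 z * h3 z).

Definition nontrivial (h : C -> C) : Prop :=
  ~ exists c : C, Cmod c = 1%R /\ mero_eq upper_half h (fun _ => c).

Definition relatively_prime (h1 h2 : C -> C) : Prop :=
  ~ exists h, S0 h /\ nontrivial h /\ divides h h1 /\ divides h h2.

Definition s_kernel (h : C -> C) (k : C -> C -> C) : Prop :=
  exists he : C -> C,
    analytic_on (U_ext h) he /\ mero_eq off_real h he /\
    forall z w, U_ext h z -> U_ext h w ->
      (z <> Cconj w ->
         k z w = (1 - he z * Cconj (he w)) / (- Ci * (z - Cconj w))) /\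
      (z = Cconj w ->
         filterlim (fun z' => k z' w) (locally' z) (locally (k z w))).

(* Functions on [U] are represented by total functions; only their values on
   [U] matter, which is what [hs_ext] and [ip_ext] say. *)
Record Hilbert_function_space (U : C -> Prop) (H : (C -> C) -> Prop)
    (ip : (C -> C) -> (C -> C) -> C) : Prop := {
  hs_ext : forall f g, H f -> (forall z, U z -> f z = g z) -> H g;
  hs_zero : H (fun _ => 0);
  hs_lin : forall (c : C) f g, H f -> H g -> H (fun z => c * f z + g z);
  ip_ext : forall f g k, H f -> H g -> H k ->
    (forall z, U z -> f z = g z) -> ip f k = ip g k;
  ip_lin : forall (c : C) f g k, H f -> H g -> H k ->
    ip (fun z => c * f z + g z) k = c * ip f k + ip g k;
  ip_conj : forall f g, H f -> H g -> ip g f = Cconj (ip f g);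
  ip_pos : forall f, H f -> (0 <= Re (ip f f))%R;
  ip_def : forall f, H f -> ip f f = 0 -> forall z, U z -> f z = 0;
  hs_complete : forall u : nat -> C -> C, (forall n, H (u n)) ->
    let dist f g :=
      sqrt (Re (ip (fun z => f z - g z) (fun z => f z - g z))) in
    (forall eps : posreal, exists N : nat, forall n m : nat,
       (N <= n)%nat -> (N <= m)%nat -> (dist (u n) (u m) < eps)%R) ->
    exists f, H f /\ is_lim_seq (fun n => dist (u n) f) 0%R
}.

Definition RKHS (U : C -> Prop) (k : C -> C -> C) (H : (C -> C) -> Prop)
    (ip : (C -> C) -> (C -> C) -> C) : Prop :=
  Hilbert_function_space U H ip /\
  forall w, U w -> H (fun z => k z w) /\
    forall f, H f -> f w = ip f (fun z => k z w).

(* The kernel determines the space, so the existential below picks out the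
   elements of one space; they are then read as meromorphic functions off the
   real line. *)
Definition B_space (h : C -> C) (f : C -> C) : Prop :=
  exists k H ip,
    s_kernel h k /\ RKHS (U_ext h) k H ip /\
    (forall F, H F -> analytic_on (U_ext h) F) /\
    exists F, H F /\ mero_eq off_real f F.

(* Main.v *)
(* Off the real line the elements of S_0 are the extensions [ext g] of nonzero Schur functions [g] on the upper
   half-plane by [1 / SR g], and [h] divides [h_j] exactly when [|h_j| <= |h|] on the upper half-plane.

   Positivity of the kernel: on the discs [|z - i m| < m - 1/m] the function [(1 + t g) / (1 - t g)], [t < 1], has
   nonnegative real part, so its Herglotz representation writes the kernel of [t g] and its reflection as a mean of
   rank-one kernels; let [m] tend to infinity and [t] to [1]. Hence B(h) arises by the Moore-Aronszajn construction.

   If [h1] and [h2] have a nontrivial common divisor [h], then [s_h1 - s_h] and [s_h2 - s_h] are positive definite,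
   so the sections of [s_h] lie in both spaces.

   Conversely let [F <> 0] lie in both spaces. Each of B(h1), B(h2) and the Hardy space of the upper half-plane is
   invariant under [R_al : F |-> (F - F al) / (z - al)] and satisfies
   [<F, R_(conj al) G> - <R_al F, G> = - i F(al) conj (G (conj al))]; in the Hardy space, whose elements have no
   value at [conj al], any constant may stand for [G (conj al)]. Put [N1 + N2 - N0] on the intersection, where [Nj]
   are the squared norms of B(hj) and [N0] is that of the Hardy space. As [1 + 1 - 1 = 1] the identity persists, so
   the reproducing kernel of the intersection is [(1 - h z * conj (h w)) / (- i (z - conj w))] for some [h]; as
   [N0 <= N1, N2], the new norm dominates [N1] and [N2], whence [|h_j| <= |h|], i.e. [h] is a common divisor,
   nontrivial because [F <> 0].

   For the representation write [f = f1 / f2], [a1 = (i f2 - f1) / c] and [a2 = (i f2 + f1) / c], and cancel a common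
   divisor of least modulus at a point. *)
From Stdlib Require Import Psatz List ClassicalEpsilon FunctionalExtensionality.
Require Import Defs.

Open Scope R_scope.
Open Scope C_scope.

(** With [N1 + N2] alone the boundary form would carry the coefficient 2, and the kernel of the
    intersection would be half of one of the required shape; comparing diagonals would then give
    only [1 - |h|^2 <= 2 (1 - |h_j|^2)], from which no divisor results. Subtracting [N0] repairs the
    constant and keeps the domination of [N1] and [N2].

    Elements of B(h1) and B(h2) may have poles at different points of the lower half-plane, so the
    intersection is handled as a space of pairs agreeing on the common domain, and [al] is chosen so
    that its conjugate lies in that domain. As the two half-planes are not connected to each other,
    both are kept throughout: positivity is proved on all of [U_ext], which is why each disc is used
    together with its exterior. Real points and conjugate pairs, where the kernel is defined by
    continuity, are reached by shifting all points upwards by [1 / (n + 1)]. *)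

(** * Elementary estimates for complex numbers *)

Lemma Cmod_sub_le (a b c : C) : (Cmod (a - b) <= Cmod (a - c) + Cmod (c - b))%R.
Proof. replace (a - b) with ((a - c) + (c - b)) by ring. apply Cmod_triangle. Qed.

Lemma Cmod_sub_sym (a b : C) : Cmod (a - b) = Cmod (b - a).
Proof. replace (a - b) with (- (b - a)) by ring. apply Cmod_opp. Qed.

Lemma Cmod_diff0 (a : C) : Cmod (a - a) = 0%R.
Proof. replace (a - a) with (RtoC 0) by ring. apply Cmod_0. Qed.

Lemma Cmod_triangle_rev (a b : C) : (Cmod a - Cmod b <= Cmod (a - b))%R.
Proof.
  assert (H := Cmod_triangle (a - b) b).
  replace (a - b + b) with a in H by ring. lra.
Qed.

Lemma Cmod_zero_eq (a b : C) : (forall e : R, 0 < e -> Cmod (a - b) <= e)%R -> a = b.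
Proof.
  intros H. apply Ceq_minus, Cmod_eq_0.
  destruct (Rle_lt_or_eq_dec _ _ (Cmod_ge_0 (a - b))) as [h|h]; [|auto].
  specialize (H (Cmod (a - b) / 2)%R ltac:(lra)). lra.
Qed.

Lemma re_le (z : C) : (Re z <= Cmod z)%R.
Proof. assert (H := re_le_Cmod z). assert (h := Rle_abs (Re z)). lra. Qed.

Lemma im_le_Cmod (z : C) : (Rabs (Im z) <= Cmod z)%R.
Proof.
  assert (H := Rmax_Cmod z). assert (h := Rmax_r (Rabs (fst z)) (Rabs (snd z))).
  unfold Im. lra.
Qed.

Lemma Cmod_le_ReIm (z : C) : (Cmod z <= Rabs (Re z) + Rabs (Im z))%R.
Proof.
  assert (H : z = RtoC (Re z) + Ci * RtoC (Im z)).
  { destruct z as [x y]; unfold Re, Im, RtoC, Ci, Cplus, Cmult; simpl. f_equal; ring. }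
  rewrite H at 1. eapply Rle_trans; [apply Cmod_triangle|].
  rewrite Cmod_mult, Cmod_Ci, !Cmod_R. lra.
Qed.

Lemma Cmod_sqr (z : C) : (Cmod z * Cmod z = Re z * Re z + Im z * Im z)%R.
Proof. assert (H := Cmod2_alt z). simpl in H. lra. Qed.

Lemma Ceq (a b : C) : Re a = Re b -> Im a = Im b -> a = b.
Proof. destruct a, b; unfold Re, Im; simpl; intros; subst; reflexivity. Qed.

Lemma re_minus (a b : C) : Re (a - b) = (Re a - Re b)%R.
Proof. unfold Cminus. rewrite re_plus, re_opp. reflexivity. Qed.

Lemma im_minus (a b : C) : Im (a - b) = (Im a - Im b)%R.
Proof. unfold Cminus. rewrite im_plus, im_opp. reflexivity. Qed.

Lemma mult_conj_re (z : C) : z * Cconj z = RtoC (Cmod z * Cmod z).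
Proof.
  apply Ceq; rewrite ?re_mult, ?im_mult, re_conj, im_conj, ?re_RtoC, ?im_RtoC, ?Cmod_sqr; ring.
Qed.

Lemma conj_RtoC (x : R) : Cconj (RtoC x) = RtoC x.
Proof. apply Ceq; rewrite ?re_conj, ?im_conj, ?re_RtoC, ?im_RtoC; ring. Qed.

Lemma conj_Ci : Cconj Ci = - Ci.
Proof. apply Ceq; unfold Ci, Cconj, Re, Im, Copp; simpl; ring. Qed.

Lemma conj_nz (z : C) : z <> 0 -> Cconj z <> 0.
Proof. intros H e. apply H. rewrite <- (Cconj_conj z), e. apply conj_RtoC. Qed.

Lemma Cnz_Cmod (z : C) : (0 < Cmod z)%R -> z <> 0.
Proof. apply Cmod_gt_0. Qed.

(** The uniform structure of [C] is that of a product, so its balls are squares; squares and discs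
    are compared at the cost of a factor [sqrt 2]. *)
Lemma locally_C_ball (z : C) (P : C -> Prop) :
  locally z P <-> exists d : R, (0 < d)%R /\ forall w, (Cmod (w - z) < d)%R -> P w.
Proof.
  split.
  - intros [e He]. exists e. split; [apply cond_pos|]. intros w hw. apply He.
    apply (C_NormedModule_mixin_compat1 z w e). exact hw.
  - intros [d [Hd H]].
    assert (h2 : (0 < sqrt 2)%R) by (apply sqrt_lt_R0; lra).
    assert (hd : (0 < d / sqrt 2)%R) by (apply Rdiv_lt_0_compat; lra).
    exists (mkposreal _ hd). intros w hw. apply H.
    assert (K := C_NormedModule_mixin_compat2 z w (mkposreal _ hd) hw). simpl in K.
    replace (sqrt 2 * (d / sqrt 2))%R with d in K by (field; lra). exact K.
Qed.

Lemma locally'_C_ball (z : C) (P : C -> Prop) :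
  locally' z P <->
  exists d : R, (0 < d)%R /\ forall w, (Cmod (w - z) < d)%R -> w <> z -> P w.
Proof. unfold locally', within. rewrite locally_C_ball. reflexivity. Qed.

(** * Limits in the complex plane *)

Definition ctends (u : nat -> C) (l : C) : Prop :=
  forall e : R, (0 < e)%R -> exists N, forall n, (N <= n)%nat -> (Cmod (u n - l) < e)%R.

Definition ccont (f : C -> C) (z : C) : Prop :=
  forall e : R, (0 < e)%R -> exists d : R, (0 < d)%R /\
    forall w, (Cmod (w - z) < d)%R -> (Cmod (f w - f z) < e)%R.

(** Multiplied out by [w - z], so that no punctured neighbourhood appears. *)
Definition cder (f : C -> C) (z l : C) : Prop :=
  forall e : R, (0 < e)%R -> exists d : R, (0 < d)%R /\
    forall w, (Cmod (w - z) < d)%R ->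
      (Cmod (f w - f z - l * (w - z)) <= e * Cmod (w - z))%R.

Lemma ctends_is_lim (u : nat -> C) (l : C) :
  ctends u l <-> is_lim_seq (fun n => Re (u n)) (Re l) /\ is_lim_seq (fun n => Im (u n)) (Im l).
Proof.
  split.
  - intros H; split; apply is_lim_seq_spec; intros e; destruct (H e (cond_pos e)) as [N HN];
      exists N; intros n hn; specialize (HN n hn); rewrite Cmod_sub_sym in HN.
    + assert (K := re_le_Cmod (l - u n)). unfold Cminus in K. rewrite re_plus, re_opp in K.
      rewrite Rabs_minus_sym. unfold Cminus, Rminus in *. lra.
    + assert (K := im_le_Cmod (l - u n)). unfold Cminus in K. rewrite im_plus, im_opp in K.
      rewrite Rabs_minus_sym. unfold Cminus, Rminus in *. lra.
  - intros [H1 H2] e he.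
    apply is_lim_seq_spec in H1, H2.
    assert (he2 : (0 < e / 2)%R) by lra.
    destruct (H1 (mkposreal _ he2)) as [N1 K1]. destruct (H2 (mkposreal _ he2)) as [N2 K2].
    exists (N1 + N2)%nat. intros n hn.
    specialize (K1 n ltac:(lia)). specialize (K2 n ltac:(lia)). simpl in K1, K2.
    eapply Rle_lt_trans; [apply Cmod_le_ReIm|].
    unfold Cminus. rewrite re_plus, re_opp, im_plus, im_opp. unfold Rminus in *. lra.
Qed.

Lemma ctends_unique (u : nat -> C) (l l' : C) : ctends u l -> ctends u l' -> l = l'.
Proof.
  intros H H'. apply Cmod_zero_eq. intros e he.
  destruct (H (e/2)%R ltac:(lra)) as [N K]. destruct (H' (e/2)%R ltac:(lra)) as [N' K'].
  specialize (K (N + N')%nat (Nat.le_add_r _ _)). specialize (K' (N + N')%nat ltac:(lia)).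
  assert (T := Cmod_sub_le l l' (u (N + N')%nat)). rewrite (Cmod_sub_sym l (u _)) in T. lra.
Qed.

Lemma ctends_ext (u v : nat -> C) (l : C) : (forall n, u n = v n) -> ctends u l -> ctends v l.
Proof.
  intros E H e he. destruct (H e he) as [N K]. exists N. intros n hn.
  rewrite <- E. auto.
Qed.

Lemma ctends_ev_ext (u v : nat -> C) (l : C) (N : nat) :
  (forall n, (N <= n)%nat -> u n = v n) -> ctends u l -> ctends v l.
Proof.
  intros E H e he. destruct (H e he) as [N' K]. exists (N + N')%nat. intros n hn.
  rewrite <- E by lia. apply K; lia.
Qed.

Lemma ctends_const (l : C) : ctends (fun _ => l) l.
Proof. intros e he. exists 0%nat. intros n _. rewrite Cmod_diff0. exact he. Qed.

Lemma ctends_plus (u v : nat -> C) (l m : C) :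
  ctends u l -> ctends v m -> ctends (fun n => u n + v n) (l + m).
Proof.
  rewrite !ctends_is_lim. intros [A B] [A' B']. rewrite re_plus, im_plus. split.
  - apply (is_lim_seq_ext (fun n => Re (u n) + Re (v n))%R); [intros; symmetry; apply re_plus|].
    apply is_lim_seq_plus'; assumption.
  - apply (is_lim_seq_ext (fun n => Im (u n) + Im (v n))%R); [intros; symmetry; apply im_plus|].
    apply is_lim_seq_plus'; assumption.
Qed.

Lemma ctends_mult (u v : nat -> C) (l m : C) :
  ctends u l -> ctends v m -> ctends (fun n => u n * v n) (l * m).
Proof.
  rewrite !ctends_is_lim. intros [A B] [A' B']. rewrite re_mult, im_mult. split.
  - apply (is_lim_seq_ext (fun n => Re (u n) * Re (v n) - Im (u n) * Im (v n))%R);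
      [intros; symmetry; apply re_mult|].
    apply is_lim_seq_minus'; apply is_lim_seq_mult'; assumption.
  - apply (is_lim_seq_ext (fun n => Re (u n) * Im (v n) + Im (u n) * Re (v n))%R);
      [intros; symmetry; apply im_mult|].
    apply is_lim_seq_plus'; apply is_lim_seq_mult'; assumption.
Qed.

Lemma ctends_opp (u : nat -> C) (l : C) : ctends u l -> ctends (fun n => - u n) (- l).
Proof.
  intros H e he. destruct (H e he) as [N K]. exists N. intros n hn.
  replace (- u n - - l) with (- (u n - l)) by ring. rewrite Cmod_opp. auto.
Qed.

Lemma ctends_minus (u v : nat -> C) (l m : C) :
  ctends u l -> ctends v m -> ctends (fun n => u n - v n) (l - m).
Proof. intros. apply ctends_plus; [|apply ctends_opp]; assumption. Qed.

Lemma ctends_conj (u : nat -> C) (l : C) : ctends u l -> ctends (fun n => Cconj (u n)) (Cconj l).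
Proof.
  intros H e he. destruct (H e he) as [N K]. exists N. intros n hn.
  rewrite <- Cminus_conj, Cmod_conj. auto.
Qed.

Lemma ctends_comp (f : C -> C) (u : nat -> C) (l : C) :
  ccont f l -> ctends u l -> ctends (fun n => f (u n)) (f l).
Proof.
  intros Hf H e he. destruct (Hf e he) as [d [hd K]]. destruct (H d hd) as [N HN].
  exists N. auto.
Qed.

Lemma ccont_inv (z : C) : z <> 0 -> ccont Cinv z.
Proof.
  intros hz e he. assert (hm := proj1 (Cmod_gt_0 z) hz). set (m := Cmod z) in *.
  exists (Rmin (m / 2) (e * (m * m) / 2)). split.
  { apply Rmin_pos; [lra|]. apply Rdiv_lt_0_compat; [|lra]. apply Rmult_lt_0_compat; [lra|nra]. }
  intros w hw.
  assert (h1 := Rlt_le_trans _ _ _ hw (Rmin_l _ _)). assert (h2 := Rlt_le_trans _ _ _ hw (Rmin_r _ _)).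
  assert (hwm : (m / 2 < Cmod w)%R).
  { assert (T := Cmod_triangle_rev z w). rewrite Cmod_sub_sym in T. fold m in T. lra. }
  assert (hw0 : w <> 0) by (apply Cnz_Cmod; lra).
  replace (/ w - / z) with ((z - w) * / (w * z)) by (field; auto).
  rewrite Cmod_mult, Cmod_inv by (apply Cmult_neq_0; auto).
  rewrite Cmod_mult, (Cmod_sub_sym z w). fold m.
  apply (Rmult_lt_reg_r (Cmod w * m)). { nra. }
  rewrite Rmult_assoc, Rinv_l by nra. rewrite Rmult_1_r.
  eapply Rlt_trans; [exact h2|].
  assert (e * m * (m / 2) < e * m * Cmod w)%R by (apply Rmult_lt_compat_l; nra). nra.
Qed.

Lemma ctends_inv (u : nat -> C) (l : C) : l <> 0 -> ctends u l -> ctends (fun n => / u n) (/ l).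
Proof. intros hl H. apply (ctends_comp Cinv); [apply ccont_inv|]; assumption. Qed.

Lemma ctends_div (u v : nat -> C) (l m : C) :
  m <> 0 -> ctends u l -> ctends v m -> ctends (fun n => u n / v n) (l / m).
Proof. intros. apply ctends_mult; [|apply ctends_inv]; assumption. Qed.

Lemma ctends_Cmod (u : nat -> C) (l : C) : ctends u l -> is_lim_seq (fun n => Cmod (u n)) (Cmod l).
Proof.
  intros H. apply is_lim_seq_spec. intros e. destruct (H e (cond_pos e)) as [N K].
  exists N. intros n hn. specialize (K n hn).
  apply Rabs_def1.
  - assert (T := Cmod_triangle_rev (u n) l). lra.
  - assert (T := Cmod_triangle_rev l (u n)). rewrite Cmod_sub_sym in T. lra.
Qed.

Lemma ctends_Cmod_le (u : nat -> C) (l : C) (M : R) :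
  ctends u l -> (forall n, (Cmod (u n) <= M)%R) -> (Cmod l <= M)%R.
Proof.
  intros H HM. apply (is_lim_seq_le (fun n => Cmod (u n)) (fun _ => M) (Cmod l) M HM).
  - apply ctends_Cmod, H.
  - apply is_lim_seq_const.
Qed.

Lemma ctends_squeeze (u : nat -> C) (l : C) (b : nat -> R) :
  (forall n, (Cmod (u n - l) <= b n)%R) -> is_lim_seq b 0%R -> ctends u l.
Proof.
  intros Hb H e he. apply is_lim_seq_spec in H. destruct (H (mkposreal e he)) as [N K].
  exists N. intros n hn. specialize (K n hn). specialize (Hb n). simpl in K.
  assert (T := Rle_abs (b n - 0)). lra.
Qed.

Lemma ctends_Cauchy (u : nat -> C) :
  (forall e : R, (0 < e)%R -> exists N, forall n m, (N <= n)%nat -> (N <= m)%nat ->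
     (Cmod (u n - u m) < e)%R) -> exists l, ctends u l.
Proof.
  intros H.
  assert (HR : ex_finite_lim_seq (fun n => Re (u n))).
  { apply ex_lim_seq_cauchy_corr. intros e. destruct (H e (cond_pos e)) as [N K]. exists N.
    intros n m hn hm. specialize (K n m hn hm). assert (T := re_le_Cmod (u n - u m)).
    unfold Cminus in *. rewrite re_plus, re_opp in T. unfold Rminus. lra. }
  assert (HI : ex_finite_lim_seq (fun n => Im (u n))).
  { apply ex_lim_seq_cauchy_corr. intros e. destruct (H e (cond_pos e)) as [N K]. exists N.
    intros n m hn hm. specialize (K n m hn hm). assert (T := im_le_Cmod (u n - u m)).
    unfold Cminus in *. rewrite im_plus, im_opp in T. unfold Rminus. lra. }
  destruct HR as [x hx], HI as [y hy]. exists (x, y). apply ctends_is_lim. auto.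
Qed.

Lemma inv_INR_lim : is_lim_seq (fun n => / INR (S n))%R 0%R.
Proof.
  apply (is_lim_seq_incr_1 (fun n => / INR n)%R).
  apply (is_lim_seq_inv INR p_infty is_lim_seq_INR). discriminate.
Qed.

(** * Continuity and differentiability *)

Lemma cder_ccont (f : C -> C) (z l : C) : cder f z l -> ccont f z.
Proof.
  intros H e he. destruct (H 1%R ltac:(lra)) as [d [hd K]].
  assert (hm := Cmod_ge_0 l).
  exists (Rmin d (e / (Cmod l + 1))). split.
  { apply Rmin_pos; [lra|]. apply Rdiv_lt_0_compat; lra. }
  intros w hw.
  assert (h1 := Rlt_le_trans _ _ _ hw (Rmin_l _ _)). assert (h2 := Rlt_le_trans _ _ _ hw (Rmin_r _ _)).
  specialize (K w h1).
  replace (f w - f z) with ((f w - f z - l * (w - z)) + l * (w - z)) by ring.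
  eapply Rle_lt_trans; [apply Cmod_triangle|]. rewrite Cmod_mult.
  apply (Rmult_lt_compat_r (Cmod l + 1)) in h2; [|lra].
  unfold Rdiv in h2. rewrite Rmult_assoc, Rinv_l, Rmult_1_r in h2 by lra. nra.
Qed.

Lemma ccont_const (c z : C) : ccont (fun _ => c) z.
Proof. intros e he. exists 1%R. split; [lra|]. intros. rewrite Cmod_diff0. exact he. Qed.

Lemma ccont_id (z : C) : ccont (fun w => w) z.
Proof. intros e he. exists e. auto. Qed.

Lemma ccont_plus (f g : C -> C) (z : C) : ccont f z -> ccont g z -> ccont (fun w => f w + g w) z.
Proof.
  intros Hf Hg e he. destruct (Hf (e/2)%R ltac:(lra)) as [d [hd K]].
  destruct (Hg (e/2)%R ltac:(lra)) as [d' [hd' K']].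
  exists (Rmin d d'). split; [apply Rmin_pos; auto|]. intros w hw.
  specialize (K w (Rlt_le_trans _ _ _ hw (Rmin_l _ _))).
  specialize (K' w (Rlt_le_trans _ _ _ hw (Rmin_r _ _))).
  replace (f w + g w - (f z + g z)) with ((f w - f z) + (g w - g z)) by ring.
  eapply Rle_lt_trans; [apply Cmod_triangle|]. lra.
Qed.

(** Lets products, conjugates and compositions inherit continuity from the limit rules for
    sequences. If continuity fails for [e], a bad point chosen in each disc of radius [/ INR (S n)]
    contradicts the hypothesis. *)
Lemma ccont_seq (f : C -> C) (z : C) :
  (forall u, ctends u z -> ctends (fun n => f (u n)) (f z)) -> ccont f z.
Proof.
  intros H. apply NNPP. intros nc.
  assert (exists e : R, (0 < e)%R /\ forall d : R, (0 < d)%R ->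
    exists w, (Cmod (w - z) < d)%R /\ ~ (Cmod (f w - f z) < e)%R) as [e [he K]].
  { apply NNPP. intros K. apply nc. intros e he. apply NNPP. intros K'. apply K.
    exists e. split; [exact he|]. intros d hd. apply NNPP. intros K''. apply K'.
    exists d. split; [exact hd|]. intros w hw. apply NNPP. intros K3. apply K''. eauto. }
  assert (hp : forall n, (0 < / INR (S n))%R) by (intros n; apply Rinv_0_lt_compat, lt_0_INR; lia).
  set (u := fun n => proj1_sig (constructive_indefinite_description _ (K _ (hp n)))).
  assert (Hu : forall n, (Cmod (u n - z) < / INR (S n))%R /\ ~ (Cmod (f (u n) - f z) < e)%R).
  { intros n. unfold u. destruct (constructive_indefinite_description _ _); auto. }
  assert (T : ctends u z).
  { apply (ctends_squeeze _ _ (fun n => / INR (S n))%R); [|apply inv_INR_lim].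
    intros n. left. apply Hu. }
  destruct (H u T e he) as [N HN]. apply (proj2 (Hu N)). apply HN. lia.
Qed.

Lemma ccont_mult (f g : C -> C) (z : C) : ccont f z -> ccont g z -> ccont (fun w => f w * g w) z.
Proof. intros Hf Hg. apply ccont_seq. intros u hu. apply ctends_mult; apply ctends_comp; auto. Qed.

Lemma ccont_conj_comp (f : C -> C) (z : C) : ccont f z -> ccont (fun w => Cconj (f w)) z.
Proof. intros Hf. apply ccont_seq. intros u hu. apply ctends_conj. apply ctends_comp; auto. Qed.

Lemma ccont_comp (f g : C -> C) (z : C) : ccont f (g z) -> ccont g z -> ccont (fun w => f (g w)) z.
Proof.
  intros Hf Hg. apply ccont_seq. intros u hu.
  apply (ctends_comp f (fun n => g (u n))); auto. apply ctends_comp; auto.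
Qed.

Lemma ccont_inv_comp (f : C -> C) (z : C) : f z <> 0 -> ccont f z -> ccont (fun w => / f w) z.
Proof. intros. apply (ccont_comp Cinv); [apply ccont_inv|]; auto. Qed.

Lemma ccont_ext_near (f g : C -> C) (z : C) (d : R) : (0 < d)%R ->
  (forall w, (Cmod (w - z) < d)%R -> f w = g w) -> ccont f z -> ccont g z.
Proof.
  intros hd E Hf e he. destruct (Hf e he) as [d' [hd' K]].
  exists (Rmin d d'). split; [apply Rmin_pos; auto|]. intros w hw.
  rewrite <- (E w), <- (E z).
  - apply K. exact (Rlt_le_trans _ _ _ hw (Rmin_r _ _)).
  - rewrite Cmod_diff0. exact hd.
  - exact (Rlt_le_trans _ _ _ hw (Rmin_l _ _)).
Qed.

Lemma cder_ext_near (f g : C -> C) (z l : C) (d : R) : (0 < d)%R ->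
  (forall w, (Cmod (w - z) < d)%R -> f w = g w) -> cder f z l -> cder g z l.
Proof.
  intros hd E Hf e he. destruct (Hf e he) as [d' [hd' K]].
  exists (Rmin d d'). split; [apply Rmin_pos; auto|]. intros w hw.
  rewrite <- (E w), <- (E z).
  - apply K. exact (Rlt_le_trans _ _ _ hw (Rmin_r _ _)).
  - rewrite Cmod_diff0. exact hd.
  - exact (Rlt_le_trans _ _ _ hw (Rmin_l _ _)).
Qed.

Lemma cder_const (c z : C) : cder (fun _ => c) z 0.
Proof.
  intros e he. exists 1%R. split; [lra|]. intros w _.
  replace (c - c - 0 * (w - z)) with (RtoC 0) by ring. rewrite Cmod_0.
  apply Rmult_le_pos; [lra|apply Cmod_ge_0].
Qed.

Lemma cder_id (z : C) : cder (fun w => w) z 1.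
Proof.
  intros e he. exists 1%R. split; [lra|]. intros w _.
  replace (w - z - 1 * (w - z)) with (RtoC 0) by ring. rewrite Cmod_0.
  apply Rmult_le_pos; [lra|apply Cmod_ge_0].
Qed.

Lemma cder_plus (f g : C -> C) (z l m : C) :
  cder f z l -> cder g z m -> cder (fun w => f w + g w) z (l + m).
Proof.
  intros Hf Hg e he. destruct (Hf (e/2)%R ltac:(lra)) as [d [hd K]].
  destruct (Hg (e/2)%R ltac:(lra)) as [d' [hd' K']].
  exists (Rmin d d'). split; [apply Rmin_pos; auto|]. intros w hw.
  specialize (K w (Rlt_le_trans _ _ _ hw (Rmin_l _ _))).
  specialize (K' w (Rlt_le_trans _ _ _ hw (Rmin_r _ _))).
  replace (f w + g w - (f z + g z) - (l + m) * (w - z))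
    with ((f w - f z - l * (w - z)) + (g w - g z - m * (w - z))) by ring.
  eapply Rle_trans; [apply Cmod_triangle|]. lra.
Qed.

(* Caratheodory's form of differentiability reduces the derivative rules to continuity. *)
Lemma cder_caratheodory (f : C -> C) (z l : C) :
  cder f z l <-> exists q : C -> C, ccont q z /\ q z = l /\ forall w, f w - f z = q w * (w - z).
Proof.
  split.
  - intros H. exists (fun w => if Ceq_dec w z then l else (f w - f z) / (w - z)).
    assert (Q : (if Ceq_dec z z then l else (f z - f z) / (z - z)) = l)
      by (destruct (Ceq_dec z z); congruence).
    split; [|split; [exact Q|]].
    + intros e he. destruct (H (e/2)%R ltac:(lra)) as [d [hd K]]. exists d. split; [exact hd|].
      intros w hw. rewrite Q. destruct (Ceq_dec w z) as [E|E].
      { rewrite Cmod_diff0. exact he. }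
      assert (nz := Cminus_eq_contra _ _ E).
      replace ((f w - f z) / (w - z) - l) with ((f w - f z - l * (w - z)) / (w - z))
        by (field; exact nz).
      rewrite Cmod_div by exact nz. specialize (K w hw).
      assert (hp := proj1 (Cmod_gt_0 _) nz).
      apply (Rmult_lt_reg_r (Cmod (w - z)) _ _ hp). unfold Rdiv.
      rewrite Rmult_assoc, Rinv_l, Rmult_1_r by lra. nra.
    + intros w. destruct (Ceq_dec w z) as [E|E]; [subst; ring|].
      field. apply Cminus_eq_contra, E.
  - intros [q [Hq [<- E]]] e he. destruct (Hq e he) as [d [hd K]]. exists d. split; [exact hd|].
    intros w hw. rewrite E. replace (q w * (w - z) - q z * (w - z)) with ((q w - q z) * (w - z)) by ring.
    rewrite Cmod_mult. apply Rmult_le_compat_r; [apply Cmod_ge_0|]. left. auto.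
Qed.

Lemma cder_mult (f g : C -> C) (z l m : C) :
  cder f z l -> cder g z m -> cder (fun w => f w * g w) z (l * g z + f z * m).
Proof.
  intros Hf Hg. assert (Cg := cder_ccont _ _ _ Hg).
  apply cder_caratheodory in Hf as [p [Hp [<- Ep]]]. apply cder_caratheodory in Hg as [q [Hq [<- Eq]]].
  apply cder_caratheodory. exists (fun w => p w * g w + f z * q w). split; [|split].
  - apply ccont_plus; apply ccont_mult; auto. apply ccont_const.
  - reflexivity.
  - intros w. replace (f w * g w - f z * g z) with ((f w - f z) * g w + f z * (g w - g z)) by ring.
    rewrite Ep, Eq. ring.
Qed.

Lemma cder_comp (f g : C -> C) (z l m : C) :
  cder f (g z) l -> cder g z m -> cder (fun w => f (g w)) z (l * m).
Proof.
  intros Hf Hg. assert (Cg := cder_ccont _ _ _ Hg).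
  apply cder_caratheodory in Hf as [p [Hp [<- Ep]]]. apply cder_caratheodory in Hg as [q [Hq [<- Eq]]].
  apply cder_caratheodory. exists (fun w => p (g w) * q w). split; [|split].
  - apply ccont_mult; auto. apply ccont_comp; auto.
  - reflexivity.
  - intros w. rewrite Ep, Eq. ring.
Qed.

Lemma cder_inv (z : C) : z <> 0 -> cder Cinv z (- / (z * z)).
Proof.
  (* Caratheodory's identity must hold for every [w], including [0], where [Cinv] carries no
     information. There the function is redefined by its tangent at [z], whose slope is
     [- / (z * z)]. *)
  intros hz. apply (cder_ext_near (fun w => if Ceq_dec w 0 then / z - (w - z) * / (z * z) else / w) _ _ _ (Cmod z)).
  { apply Cmod_gt_0, hz. }
  { intros w hw. destruct (Ceq_dec w 0) as [->|]; [|reflexivity].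
    exfalso. replace (0 - z) with (- z) in hw by ring. rewrite Cmod_opp in hw. lra. }
  apply cder_caratheodory.
  exists (fun w => - / z * (if Ceq_dec w 0 then / z else / w)). split; [|split].
  - apply ccont_mult; [apply ccont_const|].
    apply (ccont_ext_near Cinv _ _ (Cmod z)); [apply Cmod_gt_0, hz| |apply ccont_inv, hz].
    intros w hw. destruct (Ceq_dec w 0) as [->|]; [|reflexivity].
    exfalso. replace (0 - z) with (- z) in hw by ring. rewrite Cmod_opp in hw. lra.
  - destruct (Ceq_dec z 0); [contradiction|]. field. exact hz.
  - intros w. destruct (Ceq_dec z 0); [contradiction|]. destruct (Ceq_dec w 0); field; auto.
Qed.

(** Continuity of the derivative is built in because the Cauchy formula is obtained by
    differentiating under the integral sign. *)
Definition holo (U : C -> Prop) (f : C -> C) : Prop :=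
  exists f' : C -> C, forall z, U z -> cder f z (f' z) /\ ccont f' z.

Lemma holo_sub (U V : C -> Prop) (f : C -> C) : (forall z, V z -> U z) -> holo U f -> holo V f.
Proof. intros S [f' H]. exists f'. auto. Qed.

Lemma holo_ccont (U : C -> Prop) (f : C -> C) (z : C) : holo U f -> U z -> ccont f z.
Proof. intros [f' H] hz. exact (cder_ccont _ _ _ (proj1 (H z hz))). Qed.

Lemma holo_const (U : C -> Prop) (c : C) : holo U (fun _ => c).
Proof. exists (fun _ => 0). intros z _. split; [apply cder_const|apply ccont_const]. Qed.

Lemma holo_id (U : C -> Prop) : holo U (fun w => w).
Proof. exists (fun _ => 1). intros z _. split; [apply cder_id|apply ccont_const]. Qed.

Lemma holo_plus (U : C -> Prop) (f g : C -> C) :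
  holo U f -> holo U g -> holo U (fun w => f w + g w).
Proof.
  intros [f' Hf] [g' Hg]. exists (fun w => f' w + g' w). intros z hz.
  destruct (Hf z hz), (Hg z hz). split; [apply cder_plus|apply ccont_plus]; auto.
Qed.

Lemma holo_mult (U : C -> Prop) (f g : C -> C) :
  holo U f -> holo U g -> holo U (fun w => f w * g w).
Proof.
  intros Hf0 Hg0. assert (Cf := fun z => holo_ccont U f z Hf0). assert (Cg := fun z => holo_ccont U g z Hg0).
  destruct Hf0 as [f' Hf], Hg0 as [g' Hg].
  exists (fun w => f' w * g w + f w * g' w). intros z hz.
  destruct (Hf z hz), (Hg z hz). split; [apply cder_mult; auto|].
  apply ccont_plus; apply ccont_mult; auto.
Qed.

Lemma holo_comp (U V : C -> Prop) (f g : C -> C) :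
  holo V f -> holo U g -> (forall z, U z -> V (g z)) -> holo U (fun w => f (g w)).
Proof.
  intros [f' Hf] Hg0 HV. assert (Cg := fun z => holo_ccont U g z Hg0). destruct Hg0 as [g' Hg].
  exists (fun w => f' (g w) * g' w). intros z hz.
  destruct (Hf _ (HV z hz)), (Hg z hz). split; [apply cder_comp; auto|].
  apply ccont_mult; auto. apply ccont_comp; auto.
Qed.

Lemma holo_inv (U : C -> Prop) (f : C -> C) :
  holo U f -> (forall z, U z -> f z <> 0) -> holo U (fun w => / f w).
Proof.
  intros Hf H. apply (holo_comp U (fun z => z <> 0) Cinv f); auto.
  exists (fun z => - / (z * z)). intros z hz. split; [apply cder_inv, hz|].
  apply (ccont_ext_near (fun w => (-(1)) * / (w * w)) _ _ 1%R); [lra|intros; ring|].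
  apply ccont_mult; [apply ccont_const|]. apply ccont_inv_comp.
  - apply Cmult_neq_0; auto.
  - apply ccont_mult; apply ccont_id.
Qed.

Lemma holo_div (U : C -> Prop) (f g : C -> C) :
  holo U f -> holo U g -> (forall z, U z -> g z <> 0) -> holo U (fun w => f w / g w).
Proof. intros. apply holo_mult; auto. apply holo_inv; auto. Qed.

Lemma holo_opp (U : C -> Prop) (f : C -> C) : holo U f -> holo U (fun w => - f w).
Proof.
  intros [f' Hf]. exists (fun w => - f' w). intros z hz. destruct (Hf z hz) as [A B].
  split; intros e he; [destruct (A e he) as [d [hd K]]|destruct (B e he) as [d [hd K]]];
    exists d; (split; [exact hd|]); intros w hw.
  - replace (- f w - - f z - - f' z * (w - z)) with (- (f w - f z - f' z * (w - z))) by ring.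
    rewrite Cmod_opp. auto.
  - replace (- f' w - - f' z) with (- (f' w - f' z)) by ring. rewrite Cmod_opp. auto.
Qed.

Lemma holo_minus (U : C -> Prop) (f g : C -> C) :
  holo U f -> holo U g -> holo U (fun w => f w - g w).
Proof. intros. apply holo_plus; [|apply holo_opp]; auto. Qed.

Lemma holo_ext (U : C -> Prop) (f g : C -> C) :
  (forall z, U z -> exists d : R, (0 < d)%R /\ forall w, (Cmod (w - z) < d)%R -> f w = g w) ->
  holo U f -> holo U g.
Proof.
  intros E [f' H]. exists f'. intros z hz. destruct (E z hz) as [d [hd K]], (H z hz).
  split; auto. apply (cder_ext_near f _ _ _ d); auto.
Qed.

Lemma holo_pow (U : C -> Prop) (f : C -> C) (n : nat) : holo U f -> holo U (fun w => f w ^ n).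
Proof.
  intros H. induction n as [|n IH]; [exact (holo_const U 1)|]. exact (holo_mult U f _ H IH).
Qed.

Lemma cder_conj (f : C -> C) (z l : C) : cder f z l -> cder (SR f) (Cconj z) (Cconj l).
Proof.
  intros H e he. destruct (H e he) as [d [hd K]]. exists d. split; [exact hd|].
  intros w hw. unfold SR. rewrite Cconj_conj.
  rewrite <- (Cmod_conj (w - Cconj z)) in *. rewrite Cminus_conj, Cconj_conj in *.
  specialize (K _ hw). rewrite <- Cmod_conj in K.
  rewrite !Cminus_conj, Cmult_conj, Cminus_conj, Cconj_conj in K. exact K.
Qed.

Lemma holo_SR (U : C -> Prop) (f : C -> C) : holo U f -> holo (fun z => U (Cconj z)) (SR f).
Proof.
  intros [f' H]. exists (SR f'). intros z hz. destruct (H _ hz) as [A B]. split.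
  - assert (K := cder_conj _ _ _ A). rewrite Cconj_conj in K. exact K.
  - unfold SR. apply ccont_seq. intros u hu. apply ctends_conj. apply (ctends_comp f' (fun n => Cconj (u n))); auto.
    apply ctends_conj, hu.
Qed.

(** * Circle means and the Cauchy formula *)

(** Continuity on the line is phrased through [F (Re z)] at real points, so that the rules for
    [ccont] apply unchanged. *)
Definition rcont (F : R -> C) : Prop := forall x : R, ccont (fun z => F (Re z)) (RtoC x).

Definition rmean (f : R -> R) : R := (RInt f 0 (2 * PI) / (2 * PI))%R.

Definition mean (F : R -> C) : C := (rmean (fun t => Re (F t)), rmean (fun t => Im (F t))).

Lemma rcont_Re (F : R -> C) (x : R) : rcont F -> continuous (fun t => Re (F t)) x.
Proof.
  intros H. apply continuity_pt_filterlim. intros e he.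
  destruct (H x e he) as [d [hd K]]. exists d. split; [exact hd|].
  intros y [_ hy]. simpl in *. unfold R_dist in *.
  specialize (K (RtoC y)). rewrite <- RtoC_minus, Cmod_R, !re_RtoC in K. specialize (K hy).
  eapply Rle_lt_trans; [|exact K].
  assert (T := re_le_Cmod (F y - F x)). unfold Cminus in T. rewrite re_plus, re_opp in T. exact T.
Qed.

Lemma rcont_mult (F G : R -> C) : rcont F -> rcont G -> rcont (fun t => F t * G t).
Proof. intros HF HG x. apply ccont_mult; [apply HF|apply HG]. Qed.

Lemma rcont_plus (F G : R -> C) : rcont F -> rcont G -> rcont (fun t => F t + G t).
Proof. intros HF HG x. apply ccont_plus; [apply HF|apply HG]. Qed.

Lemma rcont_const (c : C) : rcont (fun _ => c).
Proof. intros x. apply ccont_const. Qed.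

Lemma rcont_conj (F : R -> C) : rcont F -> rcont (fun t => Cconj (F t)).
Proof. intros HF x. apply ccont_conj_comp, HF. Qed.

Lemma rcont_inv (F : R -> C) : (forall t, F t <> 0) -> rcont F -> rcont (fun t => / F t).
Proof. intros Hn HF x. apply (ccont_inv_comp (fun z => F (Re z))); [apply Hn|apply HF]. Qed.

Lemma rcont_comp (f : C -> C) (F : R -> C) :
  (forall t, ccont f (F t)) -> rcont F -> rcont (fun t => f (F t)).
Proof. intros Hf HF x. apply (ccont_comp f (fun z => F (Re z))); [apply Hf|apply HF]. Qed.

Lemma rcont_opp (F : R -> C) : rcont F -> rcont (fun t => - F t).
Proof.
  intros HF x e he. destruct (HF x e he) as [d [hd K]]. exists d. split; [exact hd|].
  intros w hw. replace (- F (Re w) - - F (Re (RtoC x))) with (- (F (Re w) - F (Re (RtoC x)))) by ring.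
  rewrite Cmod_opp. auto.
Qed.

Lemma rcont_ext (F G : R -> C) : (forall t, F t = G t) -> rcont F -> rcont G.
Proof. intros E H. replace G with F; [exact H|]. apply functional_extensionality, E. Qed.

Lemma rcont_Im (F : R -> C) (x : R) : rcont F -> continuous (fun t => Im (F t)) x.
Proof.
  intros H. assert (K := rcont_Re _ x (rcont_mult _ _ (rcont_const (- Ci)) H)).
  apply (continuous_ext (fun t => Re (- Ci * F t))); [|exact K].
  intros t. rewrite re_mult. unfold Copp, Ci, Re, Im; simpl. ring.
Qed.

Lemma rcont_Cmod (F : R -> C) : rcont F -> rcont (fun t => RtoC (Cmod (F t))).
Proof.
  intros H x e he. destruct (H x e he) as [d [hd K]]. exists d. split; [exact hd|].
  intros w hw. specialize (K w hw). rewrite <- RtoC_minus, Cmod_R.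
  apply Rabs_def1.
  - assert (T := Cmod_triangle_rev (F (Re w)) (F (Re x))). lra.
  - assert (T := Cmod_triangle_rev (F (Re x)) (F (Re w))). rewrite Cmod_sub_sym in T. lra.
Qed.

Lemma rcont_int_Re (F : R -> C) : rcont F -> ex_RInt (fun t => Re (F t)) 0 (2 * PI).
Proof. intros H. apply (ex_RInt_continuous (V := R_CompleteNormedModule)). intros z _. apply rcont_Re, H. Qed.

Lemma rcont_int_Im (F : R -> C) : rcont F -> ex_RInt (fun t => Im (F t)) 0 (2 * PI).
Proof. intros H. apply (ex_RInt_continuous (V := R_CompleteNormedModule)). intros z _. apply rcont_Im, H. Qed.

Lemma rmean_plus (f g : R -> R) : ex_RInt f 0 (2 * PI) -> ex_RInt g 0 (2 * PI) ->
  rmean (fun t => f t + g t)%R = (rmean f + rmean g)%R.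
Proof.
  intros Hf Hg. unfold rmean. assert (E := RInt_plus (V := R_CompleteNormedModule) f g 0 (2 * PI) Hf Hg).
  unfold plus in E; simpl in E. rewrite E. field. apply PI_neq0.
Qed.

Lemma rmean_scal (c : R) (f : R -> R) : ex_RInt f 0 (2 * PI) ->
  rmean (fun t => c * f t)%R = (c * rmean f)%R.
Proof.
  intros Hf. unfold rmean. assert (E := RInt_scal (V := R_CompleteNormedModule) f 0 (2 * PI) c Hf).
  unfold scal, mult in E; simpl in E. unfold mult in E; simpl in E. rewrite E. field. apply PI_neq0.
Qed.

Lemma rmean_ext (f g : R -> R) : (forall t, f t = g t) -> rmean f = rmean g.
Proof. intros E. f_equal. apply functional_extensionality, E. Qed.

Lemma rmean_const (c : R) : rmean (fun _ => c) = c.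
Proof.
  unfold rmean. rewrite RInt_const. unfold scal, mult; simpl. unfold mult; simpl. field. apply PI_neq0.
Qed.

Lemma rmean_le (f g : R -> R) : ex_RInt f 0 (2 * PI) -> ex_RInt g 0 (2 * PI) ->
  (forall t, f t <= g t)%R -> (rmean f <= rmean g)%R.
Proof.
  intros Hf Hg H. unfold rmean. assert (P := PI_RGT_0).
  apply Rmult_le_compat_r; [left; apply Rinv_0_lt_compat; lra|].
  apply RInt_le; auto. lra.
Qed.

Lemma mean_Re (F : R -> C) : Re (mean F) = rmean (fun t => Re (F t)).
Proof. reflexivity. Qed.

Lemma mean_Im (F : R -> C) : Im (mean F) = rmean (fun t => Im (F t)).
Proof. reflexivity. Qed.

Lemma mean_plus (F G : R -> C) : rcont F -> rcont G ->
  mean (fun t => F t + G t) = mean F + mean G.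
Proof.
  intros HF HG. unfold mean, Cplus; simpl. f_equal.
  - rewrite <- rmean_plus; [reflexivity|apply rcont_int_Re; auto|apply rcont_int_Re; auto].
  - rewrite <- rmean_plus; [reflexivity|apply rcont_int_Im; auto|apply rcont_int_Im; auto].
Qed.

Lemma mean_scal (c : C) (F : R -> C) : rcont F -> mean (fun t => c * F t) = c * mean F.
Proof.
  intros HF. assert (A := rcont_int_Re _ HF). assert (B := rcont_int_Im _ HF).
  assert (S : forall (a : R) (f : R -> R), ex_RInt f 0 (2 * PI) -> ex_RInt (fun t => a * f t)%R 0 (2 * PI)).
  { intros a f Hf. apply (ex_RInt_scal (V := R_NormedModule)), Hf. }
  apply Ceq.
  - rewrite re_mult, !mean_Re, mean_Im.
    rewrite <- !rmean_scal by auto.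
    replace (rmean (fun t => Re c * Re (F t)) - rmean (fun t => Im c * Im (F t)))%R
      with (rmean (fun t => Re c * Re (F t)) + (-1) * rmean (fun t => Im c * Im (F t)))%R by ring.
    rewrite <- rmean_scal, <- rmean_plus by auto.
    apply rmean_ext. intros t. rewrite re_mult. ring.
  - rewrite im_mult, !mean_Im, mean_Re.
    rewrite <- !rmean_scal by auto. rewrite <- rmean_plus by auto.
    apply rmean_ext. intros t. rewrite im_mult. ring.
Qed.

Lemma mean_const (c : C) : mean (fun _ => c) = c.
Proof. unfold mean. rewrite !rmean_const. destruct c; reflexivity. Qed.

Lemma mean_ext (F G : R -> C) : (forall t, F t = G t) -> mean F = mean G.
Proof. intros E. f_equal. apply functional_extensionality, E. Qed.

Lemma mean_conj (F : R -> C) : rcont F -> mean (fun t => Cconj (F t)) = Cconj (mean F).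
Proof.
  intros HF. apply Ceq; rewrite ?re_conj, ?im_conj, ?mean_Re, ?mean_Im.
  - reflexivity.
  - replace (- rmean (fun t => Im (F t)))%R with ((-1) * rmean (fun t => Im (F t)))%R by ring.
    rewrite <- rmean_scal by (apply rcont_int_Im, HF). apply rmean_ext. intros t. rewrite im_conj. ring.
Qed.

Lemma mean_le (F : R -> C) (g : R -> R) : rcont F -> rcont (fun t => RtoC (g t)) ->
  (forall t, Cmod (F t) <= g t)%R -> (Cmod (mean F) <= rmean g)%R.
Proof.
  intros HF Hg H. assert (Ig := rcont_int_Re _ Hg).
  apply (ex_RInt_ext _ g) in Ig; [|intros; apply re_RtoC].
  destruct (Rle_lt_or_eq_dec _ _ (Cmod_ge_0 (mean F))) as [hm|hm].
  (* Multiplication by [Cconj (mean F)] turns the squared modulus into the real part of a mean,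
     where the real comparison applies. *)
  - apply (Rmult_le_reg_l (Cmod (mean F))); [exact hm|].
    rewrite <- rmean_scal by exact Ig.
    replace (Cmod (mean F) * Cmod (mean F))%R with (Re (Cconj (mean F) * mean F)).
    2:{ rewrite Cmult_comm, mult_conj_re. apply re_RtoC. }
    rewrite <- mean_scal by exact HF. rewrite mean_Re. apply rmean_le.
    + apply rcont_int_Re. apply rcont_mult; [apply rcont_const|exact HF].
    + apply (ex_RInt_scal (V := R_NormedModule)), Ig.
    + intros t. eapply Rle_trans; [apply re_le|]. rewrite Cmod_mult, Cmod_conj.
      apply Rmult_le_compat_l; [lra|apply H].
  - rewrite <- hm. rewrite <- (rmean_const 0). apply rmean_le; [apply ex_RInt_const|exact Ig|].
    intros t. eapply Rle_trans; [apply Cmod_ge_0|apply H].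
Qed.

(** * The unit circle and derivatives along curves *)

Definition cexp (t : R) : C := RtoC (cos t) + Ci * RtoC (sin t).

Lemma Cmod_cexp (t : R) : Cmod (cexp t) = 1%R.
Proof.
  assert (H := Cmod_sqr (cexp t)). assert (P := Cmod_ge_0 (cexp t)).
  replace (Re (cexp t)) with (cos t) in H by (unfold cexp, Re, Ci, RtoC, Cplus, Cmult; simpl; ring).
  replace (Im (cexp t)) with (sin t) in H by (unfold cexp, Im, Ci, RtoC, Cplus, Cmult; simpl; ring).
  assert (T := sin2_cos2 t). unfold Rsqr in T. nra.
Qed.

Lemma ccont_real (g : R -> R) (p : C -> R) (z : C) : continuity_pt g (p z) ->
  (forall w, Rabs (p w - p z) <= Cmod (w - z))%R -> ccont (fun w => RtoC (g (p w))) z.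
Proof.
  intros Hg Hp e he. destruct (Hg e he) as [d [hd K]]. exists d. split; [exact hd|].
  intros w hw. rewrite <- RtoC_minus, Cmod_R.
  destruct (Req_dec (p w) (p z)) as [E|E].
  - rewrite E, Rminus_diag, Rabs_R0. exact he.
  - apply K. split; [split; [exact I|auto]|]. simpl. unfold R_dist.
    eapply Rle_lt_trans; [apply Hp|exact hw].
Qed.

Lemma Re_lip (w z : C) : (Rabs (Re w - Re z) <= Cmod (w - z))%R.
Proof. assert (T := re_le_Cmod (w - z)). unfold Cminus in T. rewrite re_plus, re_opp in T. exact T. Qed.

Lemma Im_lip (w z : C) : (Rabs (Im w - Im z) <= Cmod (w - z))%R.
Proof. assert (T := im_le_Cmod (w - z)). unfold Cminus in T. rewrite im_plus, im_opp in T. exact T. Qed.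

Lemma ccont_Re (z : C) : ccont (fun w => RtoC (Re w)) z.
Proof.
  apply (ccont_real (fun x => x) Re); [|intros w; apply Re_lip].
  apply derivable_continuous_pt, derivable_pt_id.
Qed.

Lemma ccont_cexp_Re (z : C) : ccont (fun w => cexp (Re w)) z.
Proof.
  apply ccont_plus; [|apply ccont_mult; [apply ccont_const|]].
  - apply (ccont_real cos Re); [apply continuity_cos|intros; apply Re_lip].
  - apply (ccont_real sin Re); [apply continuity_sin|intros; apply Re_lip].
Qed.

Lemma ccont_cexp_Im (z : C) : ccont (fun w => cexp (Im w)) z.
Proof.
  apply ccont_plus; [|apply ccont_mult; [apply ccont_const|]].
  - apply (ccont_real cos Im); [apply continuity_cos|intros; apply Im_lip].
  - apply (ccont_real sin Im); [apply continuity_sin|intros; apply Im_lip].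
Qed.

Lemma rcont_cexp : rcont cexp.
Proof. intros x. apply ccont_cexp_Re. Qed.

Definition rder (F : R -> C) (x : R) (l : C) : Prop :=
  forall e : R, (0 < e)%R -> exists d : R, (0 < d)%R /\
    forall y, (Rabs (y - x) < d)%R -> (Cmod (F y - F x - l * RtoC (y - x)) <= e * Rabs (y - x))%R.

Lemma rder_comp (f : C -> C) (F : R -> C) (x : R) (l m : C) :
  cder f (F x) l -> rder F x m -> rder (fun t => f (F t)) x (l * m).
Proof.
  intros Hf HF e he.
  assert (hl := Cmod_ge_0 l). assert (hm := Cmod_ge_0 m).
  set (e1 := (e / 2 / (Cmod m + 1))%R).
  assert (he1 : (0 < e1)%R) by (unfold e1; apply Rdiv_lt_0_compat; lra).
  assert (E1 : (e1 * (Cmod m + 1) = e / 2)%R) by (unfold e1; field; lra).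
  set (e2 := Rmin 1 (e / 2 / (Cmod l + 1))).
  assert (he2 : (0 < e2)%R) by (apply Rmin_pos; [lra|apply Rdiv_lt_0_compat; lra]).
  assert (E2 : (Cmod l * e2 <= e / 2)%R).
  { apply Rle_trans with ((Cmod l + 1) * (e / 2 / (Cmod l + 1)))%R; [|right; field; lra].
    apply Rmult_le_compat; try lra. apply Rmin_r. }
  assert (E3 : (e2 <= 1)%R) by apply Rmin_l.
  destruct (Hf e1 he1) as [d [hd K]]. destruct (HF e2 he2) as [d' [hd' K']].
  exists (Rmin d' (d / (Cmod m + 1))). split.
  { apply Rmin_pos; [lra|apply Rdiv_lt_0_compat; lra]. }
  intros y hy. assert (h1 := Rlt_le_trans _ _ _ hy (Rmin_l _ _)).
  assert (h2 := Rlt_le_trans _ _ _ hy (Rmin_r _ _)). specialize (K' y h1).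
  assert (hy0 := Rabs_pos (y - x)).
  assert (B : (Cmod (F y - F x) <= (Cmod m + 1) * Rabs (y - x))%R).
  { replace (F y - F x) with ((F y - F x - m * RtoC (y - x)) + m * RtoC (y - x)) by ring.
    eapply Rle_trans; [apply Cmod_triangle|]. rewrite Cmod_mult, Cmod_R. nra. }
  assert (B' : (Cmod (F y - F x) < d)%R).
  { eapply Rle_lt_trans; [exact B|]. apply (Rmult_lt_compat_l (Cmod m + 1)) in h2; [|lra].
    replace ((Cmod m + 1) * (d / (Cmod m + 1)))%R with d in h2 by (field; lra). exact h2. }
  specialize (K _ B').
  replace (f (F y) - f (F x) - l * m * RtoC (y - x))
    with ((f (F y) - f (F x) - l * (F y - F x)) + l * (F y - F x - m * RtoC (y - x))) by ring.
  eapply Rle_trans; [apply Cmod_triangle|]. rewrite Cmod_mult.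
  assert (e1 * Cmod (F y - F x) <= e1 * ((Cmod m + 1) * Rabs (y - x)))%R by (apply Rmult_le_compat_l; lra).
  assert (Cmod l * Cmod (F y - F x - m * RtoC (y - x)) <= Cmod l * (e2 * Rabs (y - x)))%R
    by (apply Rmult_le_compat_l; lra).
  assert (Cmod l * e2 * Rabs (y - x) <= e / 2 * Rabs (y - x))%R by (apply Rmult_le_compat_r; lra).
  assert (e1 * (Cmod m + 1) * Rabs (y - x) = e / 2 * Rabs (y - x))%R by (rewrite E1; ring).
  lra.
Qed.

Lemma rder_affine (a b : C) (F : R -> C) (x : R) (l : C) :
  rder F x l -> rder (fun t => a + b * F t) x (b * l).
Proof.
  intros H. apply (rder_comp (fun z => a + b * z)); [|exact H].
  intros e he. exists 1%R. split; [lra|]. intros w _.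
  replace (a + b * w - (a + b * F x) - b * (w - F x)) with (RtoC 0) by ring. rewrite Cmod_0.
  apply Rmult_le_pos; [lra|apply Cmod_ge_0].
Qed.

Lemma rder_id (x : R) : rder RtoC x 1.
Proof.
  intros e he. exists 1%R. split; [lra|]. intros y _.
  replace (RtoC y - RtoC x - 1 * RtoC (y - x)) with (RtoC 0) by (rewrite RtoC_minus; ring). rewrite Cmod_0.
  apply Rmult_le_pos; [lra|apply Rabs_pos].
Qed.

Lemma is_derive_rder (f : R -> R) (x l : R) : is_derive f x l -> rder (fun t => RtoC (f t)) x (RtoC l).
Proof.
  intros H e he. apply is_derive_Reals in H. destruct (H e he) as [d K].
  exists d. split; [apply cond_pos|]. intros y hy.
  destruct (Req_dec y x) as [->|E].
  { replace (RtoC (f x) - RtoC (f x) - RtoC l * RtoC (x - x)) with (RtoC 0)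
      by (rewrite Rminus_diag; ring). rewrite Cmod_0. apply Rmult_le_pos; [lra|apply Rabs_pos]. }
  assert (h0 : (y - x <> 0)%R) by lra.
  specialize (K (y - x)%R h0 hy). replace (x + (y - x))%R with y in K by ring.
  rewrite <- RtoC_mult, <- !RtoC_minus, Cmod_R.
  replace (f y - f x - l * (y - x))%R with (((f y - f x) / (y - x) - l) * (y - x))%R by (field; exact h0).
  rewrite Rabs_mult. apply Rmult_le_compat_r; [apply Rabs_pos|lra].
Qed.

Lemma rder_cexp (t : R) : rder cexp t (Ci * cexp t).
Proof.
  assert (A := is_derive_rder _ _ _ (is_derive_cos t)). assert (B := is_derive_rder _ _ _ (is_derive_sin t)).
  intros e he. destruct (A (e / 2)%R ltac:(lra)) as [d [hd K]]. destruct (B (e / 2)%R ltac:(lra)) as [d' [hd' K']].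
  exists (Rmin d d'). split; [apply Rmin_pos; lra|]. intros y hy.
  specialize (K y (Rlt_le_trans _ _ _ hy (Rmin_l _ _))). specialize (K' y (Rlt_le_trans _ _ _ hy (Rmin_r _ _))).
  replace (cexp y - cexp t - Ci * cexp t * RtoC (y - t))
    with ((RtoC (cos y) - RtoC (cos t) - RtoC (- sin t) * RtoC (y - t))
          + Ci * (RtoC (sin y) - RtoC (sin t) - RtoC (cos t) * RtoC (y - t))).
  - eapply Rle_trans; [apply Cmod_triangle|]. rewrite Cmod_mult, Cmod_Ci. lra.
  - unfold cexp. rewrite RtoC_opp.
    assert (I2 : Ci * Ci = - (1)) by (apply Ceq; unfold Ci, RtoC, Re, Im, Copp, Cmult; simpl; ring).
    replace (Ci * (RtoC (cos t) + Ci * RtoC (sin t)) * RtoC (y - t))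
      with (Ci * RtoC (cos t) * RtoC (y - t) + (Ci * Ci) * RtoC (sin t) * RtoC (y - t)) by ring.
    rewrite I2. ring.
Qed.

(** The factor [k] lets one real statement serve both components: [k = 1] gives the real part,
    [k = - Ci] the imaginary part. *)
Lemma rder_is_derive (k : C) (F : R -> C) (x : R) (l : C) :
  rder F x l -> is_derive (fun t => Re (k * F t)) x (Re (k * l)).
Proof.
  intros H. assert (H' := rder_affine 0 k F x l H). apply is_derive_Reals. intros e he.
  destruct (H' (e / 2)%R ltac:(lra)) as [d [hd K]]. exists (mkposreal d hd). intros h h0 hh. simpl in hh.
  specialize (K (x + h)%R). replace (x + h - x)%R with h in K by ring. specialize (K hh).
  assert (hp : (0 < Rabs h)%R) by (apply Rabs_pos_lt; exact h0).
  apply (Rmult_lt_reg_r (Rabs h) _ _ hp). rewrite <- Rabs_mult.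
  replace (((Re (k * F (x + h)%R) - Re (k * F x)) / h - Re (k * l)) * h)%R
    with (Re (0 + k * F (x + h)%R - (0 + k * F x) - k * l * RtoC h)).
  - eapply Rle_lt_trans; [apply re_le_Cmod|]. nra.
  - unfold Cminus. rewrite !re_plus, !re_opp, !re_plus, !re_scal_r, !re_RtoC. field. exact h0.
Qed.

Definition disc (c : C) (r : R) (z : C) : Prop := (Cmod (z - c) < r)%R.

Lemma RInt_derive_periodic (F dF : R -> R) : F (2 * PI)%R = F 0%R ->
  (forall t, is_derive F t (dF t)) -> (forall t, continuous dF t) -> RInt dF 0 (2 * PI) = 0%R.
Proof.
  intros E H Hc. apply is_RInt_unique.
  assert (K := is_RInt_derive (V := R_CompleteNormedModule) F dF 0 (2 * PI) (fun t _ => H t) (fun t _ => Hc t)).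
  unfold minus, plus, opp in K; simpl in K. rewrite E, Rplus_opp_r in K. exact K.
Qed.

Lemma RInt_scal_real (f : R -> R) (a b k : R) : ex_RInt f a b ->
  RInt (fun t => k * f t)%R a b = (k * RInt f a b)%R.
Proof. exact (RInt_scal (V := R_CompleteNormedModule) f a b k). Qed.

(** * Cauchy's formula by radial contraction of the circle *)

Section CauchyFormula.

Variables (f f' : C -> C) (c w : C) (r R0 : R).
Hypothesis Hf : forall z, disc c R0 z -> cder f z (f' z) /\ ccont f' z.
Hypothesis Hr : (0 < r < R0)%R.
Hypothesis Hw : disc c r w.

Let gam (t : R) : C := c + RtoC r * cexp t.

Lemma gam_neq (t : R) : gam t - w <> 0.
Proof.
  apply Cminus_eq_contra. intros E. unfold disc in Hw. rewrite <- E in Hw. unfold gam in Hw.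
  replace (c + RtoC r * cexp t - c) with (RtoC r * cexp t) in Hw by ring.
  rewrite Cmod_mult, Cmod_R, Cmod_cexp, Rabs_pos_eq in Hw by lra. lra.
Qed.

Lemma gam_rcont : rcont gam.
Proof. apply rcont_plus; [apply rcont_const|apply rcont_mult; [apply rcont_const|apply rcont_cexp]]. Qed.

Let pt (s t : R) : C := w + RtoC s * (gam t - w).

(** For [s] in [[0, 1]] convexity keeps [pt s t] in the closed disc of radius [r]. Derivatives at
    the two ends of that interval are two-sided, so [s] must be allowed to leave it slightly; a
    change of [s] moves the point by at most [2 * r] times that change, hence the value of [eta]. *)
Lemma pt_disc (s : R) : (0 <= s <= 1)%R ->
  exists eta : R, (0 < eta)%R /\ forall s', (Rabs (s' - s) < eta)%R -> forall t, disc c R0 (pt s' t).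
Proof.
  intros hs. exists ((R0 - r) / (2 * r))%R. split; [apply Rdiv_lt_0_compat; lra|].
  intros s' hs' t. unfold disc, pt, gam in *.
  replace (w + RtoC s' * (c + RtoC r * cexp t - w) - c)
    with (RtoC (1 - s) * (w - c) + RtoC s * (RtoC r * cexp t)
          + RtoC (s' - s) * (RtoC r * cexp t - (w - c))) by (rewrite !RtoC_minus; ring).
  assert (A : (Cmod (RtoC r * cexp t) = r)%R) by (rewrite Cmod_mult, Cmod_R, Cmod_cexp, Rabs_pos_eq; lra).
  assert (B : (Cmod (RtoC r * cexp t - (w - c)) <= 2 * r)%R).
  { unfold Cminus at 1. eapply Rle_trans; [apply Cmod_triangle|]. rewrite Cmod_opp. lra. }
  eapply Rle_lt_trans; [apply Cmod_triangle|].
  assert (D : (Cmod (RtoC (1 - s) * (w - c) + RtoC s * (RtoC r * cexp t)) <= r)%R).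
  { eapply Rle_trans; [apply Cmod_triangle|]. rewrite !(Cmod_mult (RtoC _) (_ - _)), (Cmod_mult (RtoC s)), A, !Cmod_R.
    rewrite !Rabs_pos_eq by lra. nra. }
  rewrite Cmod_mult, Cmod_R.
  assert (E : (Rabs (s' - s) * Cmod (RtoC r * cexp t - (w - c)) <= Rabs (s' - s) * (2 * r))%R)
    by (apply Rmult_le_compat_l; [apply Rabs_pos|exact B]).
  assert (F : (Rabs (s' - s) * (2 * r) < (R0 - r) / (2 * r) * (2 * r))%R) by (apply Rmult_lt_compat_r; lra).
  replace ((R0 - r) / (2 * r) * (2 * r))%R with (R0 - r)%R in F by (field; lra). lra.
Qed.

Let ker (t : R) : C := RtoC r * cexp t / (gam t - w).

Lemma ker_rcont : rcont ker.
Proof.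
  apply rcont_mult; [apply rcont_mult; [apply rcont_const|apply rcont_cexp]|].
  apply rcont_inv; [apply gam_neq|]. apply rcont_plus; [apply gam_rcont|apply rcont_const].
Qed.

Lemma pt_rcont (s : R) : rcont (pt s).
Proof.
  apply rcont_plus; [apply rcont_const|]. apply rcont_mult; [apply rcont_const|].
  apply rcont_plus; [apply gam_rcont|apply rcont_const].
Qed.

Lemma fpt_rcont (s : R) : (forall t, disc c R0 (pt s t)) -> rcont (fun t => f (pt s t)).
Proof.
  intros H. apply rcont_comp; [|apply pt_rcont]. intros t. apply (cder_ccont f _ _ (proj1 (Hf _ (H t)))).
Qed.

Lemma dpt_rcont (s : R) : (forall t, disc c R0 (pt s t)) -> rcont (fun t => f' (pt s t)).
Proof. intros H. apply rcont_comp; [|apply pt_rcont]. intros t. apply (Hf _ (H t)). Qed.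

(** Differentiating in [s] produces the factor [gam t - w], which cancels the denominator of
    [ker]. *)
Lemma pt_ds (k : C) (s t : R) : disc c R0 (pt s t) ->
  is_derive (fun s => Re (k * (f (pt s t) * ker t))) s (Re (k * (f' (pt s t) * (RtoC r * cexp t)))).
Proof.
  intros H. replace (k * (f' (pt s t) * (RtoC r * cexp t)))
    with (k * ker t * (f' (pt s t) * ((gam t - w) * 1))).
  2:{ unfold ker. field. apply gam_neq. }
  apply (is_derive_ext (fun s => Re (k * ker t * f (pt s t)))); [intros; f_equal; ring|].
  apply rder_is_derive. apply (rder_comp f (fun s => pt s t)); [apply Hf, H|].
  assert (D := rder_affine w (gam t - w) RtoC s 1 (rder_id s)).
  intros e he. destruct (D e he) as [d [hd K]]. exists d. split; [exact hd|]. intros y hy.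
  unfold pt. rewrite !(Cmult_comm (RtoC _) (gam t - w)). apply K, hy.
Qed.

(** For [s <> 0] the expression [f' (pt s t) * (RtoC r * cexp t)] is [- Ci / s] times the
    [t]-derivative of the periodic function [f (pt s t)]; for [s = 0] it is a constant multiple of
    [cexp]. *)
Lemma pt_dt (k : C) (s : R) : (forall t, disc c R0 (pt s t)) ->
  RInt (fun t => Re (k * (f' (pt s t) * (RtoC r * cexp t)))) 0 (2 * PI) = 0%R.
Proof.
  assert (E2 : cexp (2 * PI) = cexp 0) by (unfold cexp; rewrite cos_2PI, sin_2PI, cos_0, sin_0; reflexivity).
  assert (II : Ci * Ci = - (1)) by (apply Ceq; unfold Ci, RtoC, Re, Im, Copp, Cmult; simpl; ring).
  intros H. destruct (Req_dec s 0) as [E|E].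
  - subst s. apply (RInt_derive_periodic (fun t => Re (- Ci * (k * f' w) * (RtoC r * cexp t)))).
    + rewrite E2. reflexivity.
    + intros t. replace (pt 0 t) with w by (unfold pt; ring).
      replace (k * (f' w * (RtoC r * cexp t))) with (- Ci * (k * f' w) * (RtoC r * (Ci * cexp t))).
      2:{ transitivity (- (Ci * Ci) * (k * f' w) * (RtoC r * cexp t)); [ring|rewrite II; ring]. }
      apply rder_is_derive.
      assert (D := rder_affine 0 (RtoC r) cexp t _ (rder_cexp t)).
      intros e he. destruct (D e he) as [d [hd K']]. exists d. split; [exact hd|]. intros y hy.
      specialize (K' y hy). rewrite !Cplus_0_l in K'. exact K'.
    + intros t. apply rcont_Re. apply rcont_mult; [apply rcont_const|].
      apply rcont_mult; [apply dpt_rcont, H|apply rcont_mult; [apply rcont_const|apply rcont_cexp]].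
  - apply (Rmult_eq_reg_l s); [|exact E]. rewrite Rmult_0_r.
    assert (RC : rcont (fun t => k * (f' (pt s t) * (RtoC r * cexp t)))).
    { apply rcont_mult; [apply rcont_const|].
      apply rcont_mult; [apply dpt_rcont, H|apply rcont_mult; [apply rcont_const|apply rcont_cexp]]. }
    rewrite <- RInt_scal_real by exact (rcont_int_Re _ RC).
    apply (RInt_derive_periodic (fun t => Re (- Ci * k * f (pt s t)))).
    + unfold pt, gam. rewrite E2. reflexivity.
    + intros t.
      replace (s * Re (k * (f' (pt s t) * (RtoC r * cexp t))))%R
        with (Re (- Ci * k * (f' (pt s t) * (RtoC s * RtoC r * (Ci * cexp t))))).
      2:{ rewrite <- re_scal_l. f_equal.
          transitivity (- (Ci * Ci) * (RtoC s * (k * (f' (pt s t) * (RtoC r * cexp t))))); [ring|rewrite II; ring]. }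
      apply rder_is_derive. apply (rder_comp f (pt s)); [apply Hf, H|].
      assert (D := rder_affine (w + RtoC s * (c - w)) (RtoC s * RtoC r) cexp t _ (rder_cexp t)).
      intros e he. destruct (D e he) as [d [hd K']]. exists d. split; [exact hd|]. intros y hy.
      specialize (K' y hy). unfold pt, gam.
      replace (w + RtoC s * (c + RtoC r * cexp y - w)) with (w + RtoC s * (c - w) + RtoC s * RtoC r * cexp y) by ring.
      replace (w + RtoC s * (c + RtoC r * cexp t - w)) with (w + RtoC s * (c - w) + RtoC s * RtoC r * cexp t) by ring.
      exact K'.
    + intros t. apply (continuous_ext (fun t => Re (RtoC s * (k * (f' (pt s t) * (RtoC r * cexp t)))))).
      { intros. apply re_scal_l. }
      apply rcont_Re. apply rcont_mult; [apply rcont_const|exact RC].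
Qed.

Lemma pt_int_zero (k : C) (s : R) : (0 <= s <= 1)%R ->
  is_derive (fun s => RInt (fun t => Re (k * (f (pt s t) * ker t))) 0 (2 * PI)) s 0%R.
Proof.
  intros hs. destruct (pt_disc s hs) as [eta [heta Heta]].
  assert (H0 : forall t, disc c R0 (pt s t)) by (apply Heta; rewrite Rminus_diag, Rabs_R0; lra).
  enough (D : is_derive (fun s => RInt (fun t => Re (k * (f (pt s t) * ker t))) 0 (2 * PI)) s
    (RInt (fun t => Derive (fun s => Re (k * (f (pt s t) * ker t))) s) 0 (2 * PI))).
  { rewrite (RInt_ext _ (fun t => Re (k * (f' (pt s t) * (RtoC r * cexp t))))) in D.
    - rewrite (pt_dt k s H0) in D. exact D.
    - intros t _. apply is_derive_unique, pt_ds, H0. }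
  apply (is_derive_RInt_param (fun s t => Re (k * (f (pt s t) * ker t)))).
  - exists (mkposreal eta heta). intros s' hs' t _. eexists. apply pt_ds. apply Heta. exact hs'.
  - intros t _.
    (* The pair [(s, t)] is read as a complex number, which makes joint continuity of the
       [s]-derivative a [ccont] statement. *)
    set (p := fun z : C => w + RtoC (Re z) * (c + RtoC r * cexp (Im z) - w)).
    assert (Cp : ccont p (s, t)).
    { apply ccont_plus; [apply ccont_const|]. apply ccont_mult; [apply ccont_Re|].
      apply ccont_plus; [|apply ccont_const]. apply ccont_plus; [apply ccont_const|].
      apply ccont_mult; [apply ccont_const|apply ccont_cexp_Im]. }
    assert (CC : ccont (fun z => k * (f' (p z) * (RtoC r * cexp (Im z)))) (s, t)).
    { apply ccont_mult; [apply ccont_const|]. apply ccont_mult.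
      - apply ccont_comp; [|exact Cp]. exact (proj2 (Hf _ (H0 t))).
      - apply ccont_mult; [apply ccont_const|apply ccont_cexp_Im]. }
    intros e. destruct (CC e (cond_pos e)) as [d [hd K]].
    assert (hd2 : (0 < Rmin eta (d / 2))%R) by (apply Rmin_pos; lra).
    exists (mkposreal _ hd2). intros u v hu hv. simpl in hu, hv.
    assert (hu' : (Rabs (u - s) < eta)%R) by (eapply Rlt_le_trans; [exact hu|apply Rmin_l]).
    assert (D1 := is_derive_unique _ _ _ (pt_ds k u v (Heta u hu' v))).
    assert (D2 := is_derive_unique _ _ _ (pt_ds k s t (H0 t))).
    match goal with |- (Rabs (?x - ?y) < _)%R =>
      match type of D1 with ?l = _ => change x with l end;
      match type of D2 with ?l = _ => change y with l end end.
    rewrite D1, D2.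
    specialize (K (u, v)).
    assert (Z : (Cmod ((u, v) - (s, t)) < d)%R).
    { eapply Rle_lt_trans; [apply Cmod_le_ReIm|].
      change (Rabs (u - s) + Rabs (v - t) < d)%R.
      assert (T := Rmin_r eta (d / 2)). lra. }
    specialize (K Z). eapply Rle_lt_trans; [|exact K].
    eapply Rle_trans; [|apply re_le_Cmod]. rewrite re_minus. right. reflexivity.
  - exists (mkposreal eta heta). intros s' hs'. apply rcont_int_Re.
    apply rcont_mult; [apply rcont_const|]. apply rcont_mult; [|apply ker_rcont].
    apply fpt_rcont. apply Heta. exact hs'.
Qed.

(** By [pt_int_zero] the integral over [t] does not depend on [s]. At [s = 1] the point [pt s t] is
    on the circle, at [s = 0] it is [w]. *)
Lemma cauchy_radial : mean (fun t => f (gam t) * ker t) = f w * mean ker.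
Proof.
  rewrite <- mean_scal by apply ker_rcont.
  assert (K : forall k, RInt (fun t => Re (k * (f (pt 0 t) * ker t))) 0 (2 * PI) =
                        RInt (fun t => Re (k * (f (pt 1 t) * ker t))) 0 (2 * PI)).
  { intros k. apply (eq_is_derive (V := R_NormedModule)
      (fun s => RInt (fun t => Re (k * (f (pt s t) * ker t))) 0 (2 * PI)) 0 1); [|lra].
    intros s hs. apply pt_int_zero. exact hs. }
  assert (P0 : forall t, pt 0 t = w) by (intros; unfold pt; ring).
  assert (P1 : forall t, pt 1 t = gam t) by (intros; unfold pt; ring).
  assert (K' : forall k, RInt (fun t => Re (k * (f (gam t) * ker t))) 0 (2 * PI) =
                        RInt (fun t => Re (k * (f w * ker t))) 0 (2 * PI)).
  { intros k. specialize (K k). symmetry.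
    rewrite (RInt_ext _ (fun t => Re (k * (f (pt 0 t) * ker t)))) by (intros; rewrite P0; reflexivity).
    rewrite K. apply RInt_ext. intros. rewrite P1. reflexivity. }
  apply Ceq.
  - rewrite !mean_Re. unfold rmean. f_equal. specialize (K' 1).
    rewrite (RInt_ext _ (fun t => Re (1 * (f (gam t) * ker t)))) by (intros; rewrite Cmult_1_l; reflexivity).
    rewrite K'. apply RInt_ext. intros. rewrite Cmult_1_l. reflexivity.
  - rewrite !mean_Im. unfold rmean. f_equal. specialize (K' (- Ci)).
    assert (J : forall z, Im z = Re (- Ci * z)).
    { intros z. rewrite re_mult. unfold Copp, Ci, Re, Im; simpl. ring. }
    rewrite (RInt_ext _ (fun t => Re (- Ci * (f (gam t) * ker t)))) by (intros; apply J).
    rewrite K'. apply RInt_ext. intros. symmetry. apply J.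
Qed.

End CauchyFormula.

Definition circ (c : C) (r : R) (t : R) : C := c + RtoC r * cexp t.

Lemma circ_dist (c : C) (r t : R) : (0 < r)%R -> Cmod (circ c r t - c) = r.
Proof.
  intros h. unfold circ. replace (c + RtoC r * cexp t - c) with (RtoC r * cexp t) by ring.
  rewrite Cmod_mult, Cmod_R, Cmod_cexp, Rabs_pos_eq by lra. lra.
Qed.

Lemma disc_center (c : C) (r : R) : (0 < r)%R -> disc c r c.
Proof. intros h. unfold disc. rewrite Cmod_diff0. exact h. Qed.

Lemma disc_le (c : C) (r s : R) (z : C) : (r <= s)%R -> disc c r z -> disc c s z.
Proof. unfold disc. lra. Qed.

Lemma cexp_nz (t : R) : cexp t <> 0.
Proof. apply Cnz_Cmod. rewrite Cmod_cexp. lra. Qed.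

Lemma RtoC_nz (r : R) : (r <> 0)%R -> RtoC r <> 0.
Proof. intros h e. apply h. apply RtoC_inj in e. exact e. Qed.

Lemma circ_rcont (c : C) (r : R) : rcont (circ c r).
Proof. apply rcont_plus; [apply rcont_const|apply rcont_mult; [apply rcont_const|apply rcont_cexp]]. Qed.

Lemma holo_circ_rcont (f : C -> C) (c : C) (r R0 : R) : holo (disc c R0) f -> (0 < r < R0)%R ->
  rcont (fun t => f (circ c r t)).
Proof.
  intros H hr. apply rcont_comp; [|apply circ_rcont]. intros t. apply (holo_ccont _ _ _ H).
  unfold disc. rewrite circ_dist; lra.
Qed.

Lemma mean_value (f : C -> C) (c : C) (r R0 : R) : holo (disc c R0) f -> (0 < r < R0)%R ->
  mean (fun t => f (circ c r t)) = f c.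
Proof.
  intros [f' H] hr. assert (K := cauchy_radial f f' c c r R0 H hr (disc_center c r (proj1 hr))).
  cbv beta zeta in K.
  assert (E : forall t, RtoC r * cexp t / (c + RtoC r * cexp t - c) = 1).
  { intros t. replace (c + RtoC r * cexp t - c) with (RtoC r * cexp t) by ring.
    apply Cinv_r, Cmult_neq_0; [apply RtoC_nz; lra|apply cexp_nz]. }
  rewrite (mean_ext (fun t => RtoC r * cexp t / (c + RtoC r * cexp t - c)) (fun _ => 1) E), mean_const, Cmult_1_r in K.
  rewrite <- K. apply mean_ext. intros t. rewrite E, Cmult_1_r. reflexivity.
Qed.

Lemma cauchy_formula (f : C -> C) (c w : C) (r R0 : R) : holo (disc c R0) f -> (0 < r < R0)%R ->
  disc c r w -> mean (fun t => f (circ c r t) * (RtoC r * cexp t / (circ c r t - w))) = f w.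
Proof.
  intros [f' H] hr hw. assert (K := cauchy_radial f f' c w r R0 H hr hw). cbv beta zeta in K.
  unfold circ at 1 2. rewrite K.
  enough (E : mean (fun t => RtoC r * cexp t / (c + RtoC r * cexp t - w)) = 1) by (rewrite E; ring).
  (* The kernel is the conjugate of [1 / (1 - conj q * z)] on the unit circle, a holomorphic function of [z] there. *)
  set (q := (w - c) / RtoC r).
  assert (r0 := RtoC_nz r ltac:(lra)).
  assert (hq : (Cmod q < 1)%R).
  { unfold q. rewrite Cmod_div, Cmod_R, Rabs_pos_eq by (auto; lra). unfold disc in hw.
    apply (Rmult_lt_reg_r r); [lra|]. unfold Rdiv. rewrite Rmult_assoc, Rinv_l; lra. }
  assert (hqp := Cmod_ge_0 q).
  assert (hq2 : (0 < (1 + Cmod q) / 2 < 1)%R) by lra.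
  (* A radius above [1] on which [Cmod q * R1 < 1]; unlike a multiple of [/ Cmod q] it also makes
     sense for [q = 0]. *)
  set (R1 := (2 / (1 + Cmod q))%R).
  assert (hR1 : (R1 * ((1 + Cmod q) / 2) = 1)%R) by (unfold R1; field; lra).
  assert (hR1' : (1 < R1)%R) by nra.
  assert (nz : forall z, disc 0 R1 z -> 1 - Cconj q * z <> 0).
  { intros z hz. apply Cnz_Cmod. assert (T := Cmod_triangle_rev 1 (Cconj q * z)).
    rewrite Cmod_1, Cmod_mult, Cmod_conj in T. unfold disc in hz.
    replace (z - 0) with z in hz by ring. assert (Z := Cmod_ge_0 z). nra. }
  assert (HO : holo (disc 0 R1) (fun z => / (1 - Cconj q * z))).
  { apply holo_inv; [|exact nz]. apply holo_minus; [apply holo_const|apply holo_mult; [apply holo_const|apply holo_id]]. }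
  assert (MV := mean_value _ 0 1 R1 HO ltac:(lra)).
  cbv beta in MV. rewrite Cmult_0_r in MV. replace (/ (1 - 0)) with (RtoC 1) in MV by (field; apply C1_nz).
  assert (RC := holo_circ_rcont _ 0 1 R1 HO ltac:(lra)).
  apply (f_equal Cconj) in MV. rewrite conj_RtoC in MV. rewrite <- mean_conj in MV by exact RC.
  rewrite <- MV. apply mean_ext. intros t. cbv beta.
  assert (NZ : 1 - Cconj q * circ 0 1 t <> 0) by (apply nz; unfold disc; rewrite circ_dist; lra).
  rewrite Cinv_conj by exact NZ. rewrite Cminus_conj, Cmult_conj, Cconj_conj, conj_RtoC.
  unfold circ in *. rewrite Cplus_0_l, Cmult_1_l in *.
  assert (U : cexp t * Cconj (cexp t) = 1).
  { rewrite mult_conj_re, Cmod_cexp. f_equal. ring. }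
  apply conj_nz in NZ. rewrite Cminus_conj, Cmult_conj, Cconj_conj, conj_RtoC in NZ.
  assert (D : c + RtoC r * cexp t - w = RtoC r * cexp t * (1 - q * Cconj (cexp t))).
  { unfold q. transitivity (RtoC r * cexp t - (w - c) * (cexp t * Cconj (cexp t))); [rewrite U; ring|field; exact r0]. }
  rewrite D. field. split; [exact NZ|split; [apply cexp_nz|exact r0]].
Qed.

(** * Power series *)

Fixpoint csum (u : nat -> C) (n : nat) : C :=
  match n with O => 0 | S m => csum u m + u m end.

Definition pser (a : nat -> C) (z l : C) : Prop := ctends (csum (fun k => a k * z ^ k)) l.

Definition clim (u : nat -> C) : C := epsilon (inhabits (RtoC 0)) (ctends u).

Lemma clim_correct (u : nat -> C) : (exists l, ctends u l) -> ctends u (clim u).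
Proof. exact (epsilon_spec (inhabits (RtoC 0)) (ctends u)). Qed.

Lemma csum_ext (u v : nat -> C) (n : nat) : (forall k, (k < n)%nat -> u k = v k) -> csum u n = csum v n.
Proof.
  induction n as [|n IH]; intros H; [reflexivity|]. simpl. rewrite IH, (H n) by auto. reflexivity.
Qed.

Lemma sum_n_csum (u : nat -> C) (n : nat) : sum_n u n = csum u (S n).
Proof.
  induction n as [|n IH].
  - rewrite sum_O. simpl. ring.
  - rewrite sum_Sn, IH. reflexivity.
Qed.

Lemma pow_n_Cpow (z : C) (k : nat) : pow_n (K := C_Ring) z k = z ^ k.
Proof. induction k as [|k IH]; [reflexivity|]. simpl. rewrite IH. reflexivity. Qed.

Lemma ctends_filterlim (u : nat -> C) (l : C) :
  filterlim u eventually (locally (T := C_UniformSpace) l) <-> ctends u l.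
Proof.
  split.
  - intros H e he. apply (H (fun y => Cmod (y - l) < e)%R). apply locally_C_ball. exists e. auto.
  - intros H P HP. apply locally_C_ball in HP. destruct HP as [d [hd K]]. destruct (H d hd) as [N HN].
    exists N. auto.
Qed.

Lemma ctends_shift (u : nat -> C) (l : C) : ctends u l <-> ctends (fun n => u (S n)) l.
Proof.
  split; intros H e he; destruct (H e he) as [N K].
  - exists N. intros n hn. apply K. lia.
  - exists (S N). intros [|n] hn; [lia|]. apply K. lia.
Qed.

Lemma is_pseries_pser (a : nat -> C) (z l : C) :
  is_pseries (K := C_AbsRing) (V := C_NormedModule) a z l <-> pser a z l.
Proof.
  assert (E : forall n, sum_n (fun k => scal (V := C_ModuleSpace) (pow_n (K := C_Ring) z k) (a k)) n
    = csum (fun k => a k * z ^ k) (S n)).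
  { intros n. rewrite sum_n_csum. apply csum_ext. intros k _. rewrite pow_n_Cpow. apply Cmult_comm. }
  unfold is_pseries, is_series, pser.
  rewrite (ctends_shift (csum _)), <- ctends_filterlim.
  split; apply filterlim_ext; intros n; [|symmetry]; apply E.
Qed.

Lemma csum_tail (u : nat -> C) (M q : R) : (0 <= q < 1)%R -> (forall k, Cmod (u k) <= M * q ^ k)%R ->
  forall n p, (Cmod (csum u (n + p) - csum u n) <= M * q ^ n / (1 - q))%R.
Proof.
  intros hq H n p.
  assert (hM : (0 <= M)%R) by (assert (T := H 0%nat); assert (T' := Cmod_ge_0 (u 0%nat)); simpl in T; lra).
  enough (K : (Cmod (csum u (n + p) - csum u n) <= M * q ^ n * (1 - q ^ p) / (1 - q))%R).
  { eapply Rle_trans; [exact K|]. unfold Rdiv. apply Rmult_le_compat_r; [left; apply Rinv_0_lt_compat; lra|].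
    rewrite <- (Rmult_1_r (M * q ^ n)) at 2. apply Rmult_le_compat_l.
    - apply Rmult_le_pos; [exact hM|apply pow_le; lra].
    - assert (T := pow_le q p (proj1 hq)). lra. }
  induction p as [|p IH].
  - rewrite Nat.add_0_r, Cmod_diff0. simpl. right. field. lra.
  - rewrite Nat.add_succ_r. simpl csum.
    replace (csum u (n + p) + u (n + p)%nat - csum u n) with ((csum u (n + p) - csum u n) + u (n + p)%nat) by ring.
    eapply Rle_trans; [apply Cmod_triangle|]. specialize (H (n + p)%nat). rewrite pow_add in H.
    replace (M * q ^ n * (1 - q ^ S p) / (1 - q))%R
      with (M * q ^ n * (1 - q ^ p) / (1 - q) + M * (q ^ n * q ^ p))%R by (simpl; field; lra).
    lra.
Qed.

Lemma pow_lim0 (q M : R) : (0 <= q < 1)%R -> is_lim_seq (fun n => M * q ^ n / (1 - q))%R 0%R.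
Proof.
  intros hq. replace (Finite 0) with (Rbar_mult (M / (1 - q))%R 0%R) by (simpl; f_equal; ring).
  apply (is_lim_seq_ext (fun n => M / (1 - q) * q ^ n)%R); [intros; field; lra|].
  apply is_lim_seq_scal_l. apply is_lim_seq_geom. rewrite Rabs_pos_eq; lra.
Qed.

Lemma csum_conv (u : nat -> C) (M q : R) : (0 <= q < 1)%R -> (forall k, Cmod (u k) <= M * q ^ k)%R ->
  exists l, ctends (csum u) l.
Proof.
  intros hq H. apply ctends_Cauchy. intros e he.
  assert (L := pow_lim0 q M hq). apply is_lim_seq_spec in L. destruct (L (mkposreal e he)) as [N K]. simpl in K.
  exists N.
  assert (A : forall n m, (N <= n)%nat -> (n <= m)%nat -> (Cmod (csum u m - csum u n) < e)%R).
  { intros n m hn hm. assert (T := csum_tail u M q hq H n (m - n)). replace (n + (m - n))%nat with m in T by lia.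
    specialize (K n hn). rewrite Rminus_0_r in K. assert (T' := Rle_abs (M * q ^ n / (1 - q))). lra. }
  intros n m hn hm. destruct (Nat.le_ge_cases n m); [rewrite Cmod_sub_sym|]; apply A; auto.
Qed.

Lemma csum_lim_tail (u : nat -> C) (l : C) (M q : R) : (0 <= q < 1)%R ->
  (forall k, Cmod (u k) <= M * q ^ k)%R -> ctends (csum u) l ->
  forall n, (Cmod (l - csum u n) <= M * q ^ n / (1 - q))%R.
Proof.
  intros hq H Hl n. apply (ctends_Cmod_le (fun p => csum u (n + p) - csum u n)).
  - apply ctends_minus; [|apply ctends_const]. intros e he. destruct (Hl e he) as [N K].
    exists N. intros p hp. apply K. lia.
  - apply csum_tail; auto.
Qed.

(** The Cauchy estimates at radius [s]. They majorise the series at [z] by a geometric one of ratio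
    [Cmod z / s], and all convergence below rests on this. *)
Definition cbound (a : nat -> C) (s M : R) : Prop := forall k, (Cmod (a k) * s ^ k <= M)%R.

Lemma cbound_geom (a : nat -> C) (s M : R) (z : C) : (0 < s)%R -> cbound a s M ->
  forall k, (Cmod (a k * z ^ k) <= M * (Cmod z / s) ^ k)%R.
Proof.
  intros hs H k. rewrite Cmod_mult, Cmod_pow. unfold Rdiv. rewrite Rpow_mult_distr, pow_inv.
  assert (sk := pow_lt s k hs).
  replace (Cmod (a k) * Cmod z ^ k)%R with ((Cmod (a k) * s ^ k) * (Cmod z ^ k * / s ^ k))%R by (field; lra).
  apply Rmult_le_compat_r; [|apply H].
  apply Rmult_le_pos; [apply pow_le, Cmod_ge_0|left; apply Rinv_0_lt_compat, sk].
Qed.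

Lemma quot_lt1 (z : C) (s : R) : (Cmod z < s)%R -> (0 <= Cmod z / s < 1)%R.
Proof.
  intros h. assert (p := Cmod_ge_0 z). split.
  - apply Rmult_le_pos; [exact p|left; apply Rinv_0_lt_compat; lra].
  - apply (Rmult_lt_reg_r s); [lra|]. unfold Rdiv. rewrite Rmult_assoc, Rinv_l; lra.
Qed.

Lemma pser_conv (a : nat -> C) (s M : R) (z : C) : (0 < s)%R -> cbound a s M -> (Cmod z < s)%R ->
  exists l, pser a z l.
Proof.
  intros hs H hz. apply (csum_conv _ M (Cmod z / s)); [apply quot_lt1, hz|]. apply cbound_geom; auto.
Qed.

(** Two consecutive partial sums within distance [1] of the limit bound the term between them by
    [2]; the finitely many earlier terms have a maximum. *)
Lemma pser_cbound (a : nat -> C) (z l : C) : pser a z l -> exists M, cbound a (Cmod z) M.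
Proof.
  intros H. destruct (H 1%R ltac:(lra)) as [N K].
  assert (B : forall k, (N <= k)%nat -> (Cmod (a k) * Cmod z ^ k <= 2)%R).
  { intros k hk. assert (K1 := K k hk). assert (K2 := K (S k) ltac:(lia)). simpl in K2.
    rewrite <- Cmod_pow, <- Cmod_mult.
    set (p := csum (fun k => a k * z ^ k) k) in *.
    replace (a k * z ^ k) with ((p + a k * z ^ k - l) + (l - p)) by ring.
    eapply Rle_trans; [apply Cmod_triangle|]. rewrite (Cmod_sub_sym l p). lra. }
  assert (F : exists M, forall k, (k < N)%nat -> (Cmod (a k) * Cmod z ^ k <= M)%R).
  { clear. induction N as [|N [M IH]]; [exists 0%R; lia|].
    exists (Rmax M (Cmod (a N) * Cmod z ^ N)). intros k hk. destruct (Nat.eq_dec k N) as [->|].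
    - apply Rmax_r.
    - eapply Rle_trans; [apply IH; lia|apply Rmax_l]. }
  destruct F as [M F]. exists (Rmax M 2). intros k. destruct (Nat.lt_ge_cases k N) as [h|h].
  - eapply Rle_trans; [apply F, h|apply Rmax_l].
  - eapply Rle_trans; [apply B, h|apply Rmax_r].
Qed.

Lemma cbound_le (a : nat -> C) (s t M : R) : (0 <= t <= s)%R -> cbound a s M -> cbound a t M.
Proof.
  intros h H k. eapply Rle_trans; [|apply (H k)]. apply Rmult_le_compat_l; [apply Cmod_ge_0|].
  apply pow_incr. exact h.
Qed.

(** Bernoulli's inequality for [(s / t) ^ k] absorbs the factor [INR (S k)] when the radius shrinks
    from [s] to [t]. *)
Lemma cbound_deriv (a : nat -> C) (s t M : R) : (0 < t < s)%R -> cbound a s M ->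
  exists M', cbound (fun k => RtoC (INR (S k)) * a (S k)) t M'.
Proof.
  intros h H. set (d := (s / t - 1)%R).
  assert (hd : (0 < d)%R).
  { unfold d. assert (T : (1 < s / t)%R); [|lra]. apply (Rmult_lt_reg_r t); [lra|].
    unfold Rdiv. rewrite Rmult_assoc, Rinv_l; lra. }
  exists ((1 + / d) * (M / s))%R. intros k.
  rewrite Cmod_mult, Cmod_R, Rabs_pos_eq by apply pos_INR.
  assert (P := poly k d hd).
  replace (1 + d)%R with (s / t)%R in P by (unfold d; ring).
  assert (hd' := Rinv_0_lt_compat d hd).
  assert (A : (INR (S k) <= (1 + / d) * (s / t) ^ k)%R).
  { rewrite S_INR. eapply Rle_trans; [|apply Rmult_le_compat_l; [lra|exact P]].
    assert (ik := pos_INR k). replace ((1 + / d) * (1 + INR k * d))%R with (1 + INR k * d + / d + INR k)%R by (field; lra).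
    nra. }
  assert (tk := pow_lt t k (proj1 h)). assert (sk := pow_lt s k ltac:(lra)).
  assert (HS := H (S k)). simpl pow in HS. assert (ca := Cmod_ge_0 (a (S k))).
  apply Rle_trans with ((1 + / d) * (s / t) ^ k * Cmod (a (S k)) * t ^ k)%R.
  { apply Rmult_le_compat_r; [lra|]. apply Rmult_le_compat_r; [exact ca|exact A]. }
  unfold Rdiv. rewrite Rpow_mult_distr, pow_inv.
  replace ((1 + / d) * (s ^ k * / t ^ k) * Cmod (a (S k)) * t ^ k)%R
    with ((1 + / d) * (Cmod (a (S k)) * s ^ k))%R by (field; lra).
  apply Rmult_le_compat_l; [lra|]. apply (Rmult_le_reg_r s); [lra|].
  rewrite (Rmult_assoc M), Rinv_l by lra. lra.
Qed.

Lemma ccont_uniform (q : C -> C) (c : nat -> C -> C) (z : C) (d : R) (B : nat -> R) :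
  (0 < d)%R -> is_lim_seq B 0%R ->
  (forall w n, disc z d w -> (Cmod (q w - csum (fun k => c k w) n) <= B n)%R) ->
  (forall k, ccont (c k) z) -> ccont q z.
Proof.
  intros hd HB H Hc e he.
  apply is_lim_seq_spec in HB. assert (he3 : (0 < e / 3)%R) by lra.
  destruct (HB (mkposreal _ he3)) as [N K]. specialize (K N (le_n N)). simpl in K.
  assert (CN : ccont (fun w => csum (fun k => c k w) N) z).
  { clear K. induction N as [|N IH]; [exact (ccont_const 0 z)|]. exact (ccont_plus _ _ _ IH (Hc N)). }
  destruct (CN _ he3) as [d' [hd' K']]. exists (Rmin d d'). split; [apply Rmin_pos; auto|].
  intros w hw. specialize (K' w (Rlt_le_trans _ _ _ hw (Rmin_r _ _))).
  assert (A := H w N (Rlt_le_trans _ _ _ hw (Rmin_l _ _))). assert (A' := H z N (disc_center z d hd)).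
  rewrite Rminus_0_r in K. assert (T := Rle_abs (B N)).
  set (x := csum (fun k => c k w) N) in *. set (y := csum (fun k => c k z) N) in *.
  replace (q w - q z) with ((q w - x) + (x - y) + (y - q z)) by ring.
  eapply Rle_lt_trans; [apply Cmod_triangle|]. eapply Rle_lt_trans; [apply Rplus_le_compat_r, Cmod_triangle|].
  rewrite (Cmod_sub_sym y). lra.
Qed.

(* [hsym w z k] is the sum of [w^i z^j] over [i + j = k]. *)
Fixpoint hsym (w z : C) (k : nat) : C :=
  match k with O => 1 | S m => w * hsym w z m + z ^ S m end.

Lemma hsym_spec (w z : C) (k : nat) : w ^ S k - z ^ S k = hsym w z k * (w - z).
Proof.
  induction k as [|k IH]; [simpl; ring|].
  change (hsym w z (S k)) with (w * hsym w z k + z ^ S k).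
  replace ((w * hsym w z k + z ^ S k) * (w - z)) with (w * (hsym w z k * (w - z)) + z ^ S k * (w - z)) by ring.
  rewrite <- IH. rewrite (Cpow_S w (S k)), (Cpow_S z (S k)). ring.
Qed.

Lemma hsym_diag (z : C) (k : nat) : hsym z z k = RtoC (INR (S k)) * z ^ k.
Proof.
  induction k as [|k IH]; [simpl; ring|].
  change (hsym z z (S k)) with (z * hsym z z k + z ^ S k). rewrite IH, (S_INR (S k)), RtoC_plus.
  rewrite (Cpow_S z k). ring.
Qed.

Lemma hsym_bound (w z : C) (s : R) (k : nat) : (Cmod w <= s)%R -> (Cmod z <= s)%R ->
  (Cmod (hsym w z k) <= INR (S k) * s ^ k)%R.
Proof.
  intros hw hz. assert (w0 := Cmod_ge_0 w). assert (z0 := Cmod_ge_0 z).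
  induction k as [|k IH]; [simpl; rewrite Cmod_1; lra|].
  change (hsym w z (S k)) with (w * hsym w z k + z ^ S k).
  eapply Rle_trans; [apply Cmod_triangle|]. rewrite Cmod_mult, Cmod_pow, (S_INR (S k)).
  assert (P := pow_incr (Cmod z) s (S k) (conj z0 hz)).
  assert (Q : (Cmod w * Cmod (hsym w z k) <= s * (INR (S k) * s ^ k))%R).
  { apply Rmult_le_compat; auto. apply Cmod_ge_0. }
  change (s ^ S k)%R with (s * s ^ k)%R in *. lra.
Qed.

Lemma ccont_pow (z : C) (k : nat) : ccont (fun w => w ^ k) z.
Proof.
  induction k as [|k IH]; [exact (ccont_const 1 z)|]. apply (ccont_mult (fun w => w) _ z); [apply ccont_id|exact IH].
Qed.

Lemma ccont_hsym (z0 z : C) (k : nat) : ccont (fun w => hsym w z0 k) z.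
Proof.
  induction k as [|k IH]; [exact (ccont_const 1 z)|].
  exact (ccont_plus _ _ _ (ccont_mult _ _ _ (ccont_id z) IH) (ccont_const (z0 ^ S k) z)).
Qed.

Definition pfun (a : nat -> C) (z : C) : C := clim (csum (fun k => a k * z ^ k)).

Lemma pfun_correct (a : nat -> C) (s M : R) (z : C) : (0 < s)%R -> cbound a s M -> (Cmod z < s)%R ->
  pser a z (pfun a z).
Proof. intros. apply clim_correct. eapply pser_conv; eauto. Qed.

Lemma disc_slack (z : C) (s : R) : (Cmod z < s)%R ->
  exists t d : R, (0 < d)%R /\ (0 < t < s)%R /\ forall w, disc z d w -> (Cmod w < t)%R.
Proof.
  intros h. assert (p := Cmod_ge_0 z). exists ((2 * s + Cmod z) / 3)%R, ((s - Cmod z) / 3)%R.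
  split; [lra|]. split; [lra|]. intros w hw. unfold disc in hw.
  assert (T := Cmod_triangle_rev w z). lra.
Qed.

Lemma pfun_ccont (a : nat -> C) (s M : R) (z : C) : (0 < s)%R -> cbound a s M -> (Cmod z < s)%R ->
  ccont (pfun a) z.
Proof.
  intros hs H hz. destruct (disc_slack z s hz) as [t [d [hd [ht Ht]]]].
  assert (hq : (0 <= t / s < 1)%R).
  { assert (T := quot_lt1 (RtoC t) s). rewrite Cmod_R, Rabs_pos_eq in T by lra. apply T. lra. }
  apply (ccont_uniform _ (fun k w => a k * w ^ k) z d (fun n => M * (t / s) ^ n / (1 - t / s))%R hd).
  - apply pow_lim0, hq.
  - intros w n hw. apply csum_lim_tail; [exact hq| |].
    + intros k. assert (G := cbound_geom a s M (RtoC t) hs H k).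
      rewrite Cmod_R, Rabs_pos_eq in G by lra. eapply Rle_trans; [|exact G].
      rewrite !Cmod_mult, !Cmod_pow, Cmod_R, Rabs_pos_eq by lra.
      apply Rmult_le_compat_l; [apply Cmod_ge_0|]. apply pow_incr.
      split; [apply Cmod_ge_0|left; apply Ht, hw].
    + apply (pfun_correct a s M); auto. assert (T := Ht w hw). lra.
  - intros k. apply ccont_mult; [apply ccont_const|apply ccont_pow].
Qed.

(** Caratheodory's quotient is itself a series, with terms [a (S k) * hsym w z k]. It has the same
    geometric majorant as the differentiated series, so it converges uniformly near [z] and is
    continuous there. *)
Lemma pfun_cder (a : nat -> C) (s M : R) (z : C) : (0 < s)%R -> cbound a s M -> (Cmod z < s)%R ->
  cder (pfun a) z (pfun (fun k => RtoC (INR (S k)) * a (S k)) z).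
Proof.
  intros hs H hz. destruct (disc_slack z s hz) as [t [d [hd [ht Ht]]]].
  set (t' := ((t + s) / 2)%R). assert (ht' : (t < t' < s)%R) by (unfold t'; lra).
  destruct (cbound_deriv a s t' M ltac:(lra) H) as [M' H'].
  set (b := fun k => RtoC (INR (S k)) * a (S k)) in *.
  assert (hq : (0 <= t / t' < 1)%R).
  { assert (T := quot_lt1 (RtoC t) t'). rewrite Cmod_R, Rabs_pos_eq in T by lra. apply T. lra. }
  assert (zt : (Cmod z < t)%R) by (apply Ht, disc_center, hd).
  assert (B : forall w, disc z d w -> forall k, (Cmod (a (S k) * hsym w z k) <= M' * (t / t') ^ k)%R).
  { intros w hw k. assert (G := cbound_geom b t' M' (RtoC t) ltac:(lra) H' k).
    rewrite Cmod_R, Rabs_pos_eq in G by lra. eapply Rle_trans; [|exact G].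
    unfold b. rewrite !Cmod_mult, !Cmod_pow, !Cmod_R, !Rabs_pos_eq by (try apply pos_INR; lra).
    assert (Y := hsym_bound w z t k (Rlt_le _ _ (Ht w hw)) (Rlt_le _ _ zt)).
    assert (ca := Cmod_ge_0 (a (S k))). nra. }
  set (q := fun w => clim (csum (fun k => a (S k) * hsym w z k))).
  assert (Q : forall w, disc z d w -> ctends (csum (fun k => a (S k) * hsym w z k)) (q w)).
  { intros w hw. apply clim_correct. apply (csum_conv _ M' (t / t') hq). apply B, hw. }
  (* Outside the disc the function is redefined so that the identity with the quotient [q] holds for
     all [w]. *)
  apply (cder_ext_near (fun w => if Rlt_dec (Cmod (w - z)) d then pfun a w else pfun a z + q w * (w - z)) _ _ _ d hd).
  { intros w hw. destruct (Rlt_dec (Cmod (w - z)) d); [reflexivity|lra]. }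
  apply cder_caratheodory. exists q. split; [|split].
  - apply (ccont_uniform _ (fun k w => a (S k) * hsym w z k) z d (fun n => M' * (t / t') ^ n / (1 - t / t'))%R hd).
    + apply pow_lim0, hq.
    + intros w n hw. apply csum_lim_tail; auto.
    + intros k. apply ccont_mult; [apply ccont_const|apply ccont_hsym].
  - apply (ctends_unique (csum (fun k => b k * z ^ k))).
    + eapply ctends_ext; [|apply Q, disc_center, hd]. intros n. apply csum_ext. intros k _.
      rewrite hsym_diag. unfold b. ring.
    + apply (pfun_correct b t' M'); auto; lra.
  - intros w. rewrite Cmod_diff0. destruct (Rlt_dec 0 d); [|contradiction].
    destruct (Rlt_dec (Cmod (w - z)) d) as [hw|]; [|ring].
    apply (ctends_unique (fun n => csum (fun k => a k * w ^ k) (S n) - csum (fun k => a k * z ^ k) (S n))).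
    + apply ctends_minus.
      * apply (proj1 (ctends_shift (csum (fun k => a k * w ^ k)) _)).
        apply (pfun_correct a s M); auto. assert (T := Ht w hw). lra.
      * apply (proj1 (ctends_shift (csum (fun k => a k * z ^ k)) _)). apply (pfun_correct a s M); auto.
    + eapply ctends_ext; [|apply ctends_mult; [apply Q, hw|apply ctends_const]].
      intros n. cbv beta. induction n as [|n IH].
      * simpl. ring.
      * simpl csum in IH |- *. rewrite Cmult_plus_distr_r, IH.
        replace (a (S n) * hsym w z n * (w - z)) with (a (S n) * (hsym w z n * (w - z))) by ring.
        rewrite <- hsym_spec. simpl. ring.
Qed.

Lemma pfun_holo (a : nat -> C) (s M : R) : (0 < s)%R -> cbound a s M -> holo (disc 0 s) (pfun a).
Proof.
  intros hs H. exists (pfun (fun k => RtoC (INR (S k)) * a (S k))). intros z hz.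
  unfold disc in hz. replace (z - 0) with z in hz by ring. split.
  - apply (pfun_cder a s M); auto.
  - destruct (disc_slack z s hz) as [t [d [hd [ht Ht]]]].
    destruct (cbound_deriv a s t M ht H) as [M' H'].
    apply (pfun_ccont _ t M'); [lra|exact H'|]. apply Ht, disc_center, hd.
Qed.

Lemma pser_0 (a : nat -> C) : pser a 0 (a 0%nat).
Proof.
  apply ctends_shift. apply (ctends_ext (fun _ => a 0%nat)); [|apply ctends_const].
  intros n. induction n as [|n IH]; [simpl; ring|].
  change (a 0%nat = csum (fun k => a k * 0 ^ k) (S n) + a (S n) * (0 * 0 ^ n)). rewrite <- IH. ring.
Qed.

Lemma pser_shift (a : nat -> C) (z l : C) : z <> 0 -> pser a z l ->
  pser (fun k => a (S k)) z ((l - a 0%nat) / z).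
Proof.
  intros hz H. apply (ctends_ext (fun n => (csum (fun k => a k * z ^ k) (S n) - a 0%nat) / z)).
  - intros n. induction n as [|n IH]; [simpl; field; exact hz|].
    simpl csum in *. rewrite <- IH. simpl. field. exact hz.
  - apply ctends_div; [exact hz| |apply ctends_const].
    apply ctends_minus; [|apply ctends_const]. apply (proj1 (ctends_shift _ _)), H.
Qed.

Lemma pser_shift_bound (a : nat -> C) (s M : R) : (0 < s)%R -> cbound a s M ->
  cbound (fun k => a (S k)) s (M / s).
Proof.
  intros hs H k. assert (K := H (S k)). simpl pow in K. apply (Rmult_le_reg_r s); [exact hs|].
  unfold Rdiv. rewrite (Rmult_assoc M), Rinv_l by lra. lra.
Qed.

Lemma seq_to_center (z : C) (d : R) : (0 < d)%R ->
  exists u : nat -> C, ctends u z /\ forall n, u n <> z /\ disc z d (u n).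
Proof.
  intros hd. exists (fun n => z + RtoC (d / 2 * / INR (S n))). 
  assert (A : forall n, (0 < / INR (S n) <= 1)%R).
  { intros n. assert (h : (1 <= INR (S n))%R) by (rewrite S_INR; assert (T := pos_INR n); lra).
    split; [apply Rinv_0_lt_compat; lra|]. rewrite <- Rinv_1. apply Rinv_le_contravar; lra. }
  assert (E : forall n, Cmod (z + RtoC (d / 2 * / INR (S n)) - z) = (d / 2 * / INR (S n))%R).
  { intros n. replace (z + RtoC (d / 2 * / INR (S n)) - z) with (RtoC (d / 2 * / INR (S n))) by ring.
    rewrite Cmod_R, Rabs_pos_eq; [reflexivity|]. specialize (A n). nra. }
  split.
  - apply (ctends_squeeze _ _ (fun n => d / 2 * / INR (S n))%R).
    + intros n. rewrite E. lra.
    + replace (Finite 0) with (Rbar_mult (d / 2)%R 0%R) by (simpl; f_equal; ring).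
      apply is_lim_seq_scal_l, inv_INR_lim.
  - intros n. specialize (A n). split.
    + intros e. specialize (E n). rewrite e, Cmod_diff0 in E. nra.
    + unfold disc. rewrite E. nra.
Qed.

(** Division by [z] shifts the coefficients. The shifted series vanishes off [0], hence by
    continuity at [0] too, so the induction applies to it. *)
Lemma pser_zero (s : R) : (0 < s)%R -> forall (n : nat) (a : nat -> C) M, cbound a s M ->
  (forall z, (Cmod z < s)%R -> pser a z 0) -> a n = 0.
Proof.
  intros hs n. induction n as [|n IH]; intros a M' H Hz.
  - apply (ctends_unique _ _ _ (pser_0 a)). apply Hz. rewrite Cmod_0. exact hs.
  - assert (a0 : a 0%nat = 0).
    { apply (ctends_unique _ _ _ (pser_0 a)). apply Hz. rewrite Cmod_0. exact hs. }
    apply (IH (fun k => a (S k)) (M' / s)%R); [apply pser_shift_bound; auto|].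
    assert (K : forall z : C, z <> 0 -> (Cmod z < s)%R -> pser (fun k => a (S k)) z 0).
    { intros z z0 hz. replace (RtoC 0) with ((0 - a 0%nat) / z) by (rewrite a0; field; exact z0).
      apply pser_shift; auto. }
    intros z hz. destruct (Ceq_dec z 0) as [->|z0]; [|apply K; auto].
    assert (SB := pser_shift_bound a s M' hs H).
    assert (Cc := pfun_ccont _ s _ 0 hs SB hz).
    assert (PC := fun z h => pfun_correct _ s _ z hs SB h).
    replace (RtoC 0) with (pfun (fun k => a (S k)) 0) at 2; [apply PC, hz|].
    destruct (seq_to_center 0 s hs) as [u [Hu Hu']].
    apply (ctends_unique (fun n => pfun (fun k => a (S k)) (u n))); [apply ctends_comp; auto|].
    apply (ctends_ext (fun _ => 0)); [|apply ctends_const]. intros m. destruct (Hu' m) as [nz hm].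
    unfold disc in hm. replace (u m - 0) with (u m) in hm by ring.
    apply (ctends_unique _ _ _ (K _ nz hm)). apply PC, hm.
Qed.

Lemma pser_minus (a b : nat -> C) (z l m : C) : pser a z l -> pser b z m ->
  pser (fun k => a k - b k) z (l - m).
Proof.
  intros H K. eapply ctends_ext; [|apply ctends_minus; [exact H|exact K]].
  intros n. induction n as [|n IH]; simpl; [ring|]. rewrite <- IH. ring.
Qed.

Lemma pser_unique (a b : nat -> C) (s M : R) (f : C -> C) : (0 < s)%R -> cbound a s M -> cbound b s M ->
  (forall z, (Cmod z < s)%R -> pser a z (f z) /\ pser b z (f z)) -> forall n, a n = b n.
Proof.
  intros hs Ha Hb H n. apply Ceq_minus.
  apply (pser_zero s hs n (fun k => a k - b k) (M + M)%R).
  - intros k. assert (A := Ha k). assert (B := Hb k). assert (p := pow_lt s k hs).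
    assert (T := Cmod_triangle (a k) (- b k)). rewrite Cmod_opp in T. unfold Cminus. nra.
  - intros z hz. destruct (H z hz) as [A B]. assert (T := pser_minus a b z _ _ A B).
    replace (f z - f z) with (RtoC 0) in T by ring. exact T.
Qed.

(** Cauchy's integral for the [k]-th Taylor coefficient at [c], taken over the circle of radius
    [r]. *)
Definition tcoef (f : C -> C) (c : C) (r : R) (k : nat) : C :=
  mean (fun t => f (circ c r t) * (/ (RtoC r * cexp t)) ^ k).

Lemma rcont_pow (F : R -> C) (n : nat) : rcont F -> rcont (fun t => F t ^ n).
Proof.
  intros H. induction n as [|n IH]; [exact (rcont_const 1)|]. exact (rcont_mult _ _ H IH).
Qed.

Lemma rcexp_nz (r t : R) : (0 < r)%R -> RtoC r * cexp t <> 0.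
Proof. intros h. apply Cmult_neq_0; [apply RtoC_nz; lra|apply cexp_nz]. Qed.

Lemma rcexp_inv_rcont (r : R) : (0 < r)%R -> rcont (fun t => / (RtoC r * cexp t)).
Proof.
  intros h. apply rcont_inv; [intros; apply rcexp_nz, h|].
  apply rcont_mult; [apply rcont_const|apply rcont_cexp].
Qed.

Lemma Cmod_rcexp_inv (r t : R) : (0 < r)%R -> Cmod (/ (RtoC r * cexp t)) = (/ r)%R.
Proof.
  intros h. rewrite Cmod_inv by (apply rcexp_nz, h).
  rewrite Cmod_mult, Cmod_R, Cmod_cexp, Rabs_pos_eq, Rmult_1_r by lra. reflexivity.
Qed.

Lemma tcoef_bound_mean (f : C -> C) (c : C) (r R0 : R) : holo (disc c R0) f -> (0 < r < R0)%R ->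
  cbound (tcoef f c r) r (rmean (fun t => Cmod (f (circ c r t)))).
Proof.
  intros H hr k. assert (RC := holo_circ_rcont f c r R0 H hr).
  assert (rk := pow_lt r k (proj1 hr)).
  assert (RM := rcont_Cmod _ RC).
  assert (I : ex_RInt (fun t => Cmod (f (circ c r t))) 0 (2 * PI)).
  { apply (ex_RInt_ext (fun t => Re (RtoC (Cmod (f (circ c r t)))))); [intros; apply re_RtoC|].
    apply rcont_int_Re, RM. }
  assert (B : (Cmod (tcoef f c r k) <= rmean (fun t => / r ^ k * Cmod (f (circ c r t))))%R).
  { apply mean_le.
    - apply rcont_mult; [exact RC|]. apply rcont_pow, rcexp_inv_rcont, hr.
    - apply (rcont_ext (fun t => RtoC (/ r ^ k) * RtoC (Cmod (f (circ c r t))))); [intros; symmetry; apply RtoC_mult|].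
      apply rcont_mult; [apply rcont_const|exact RM].
    - intros t. rewrite Cmod_mult, Cmod_pow, Cmod_rcexp_inv, pow_inv by lra. lra. }
  rewrite rmean_scal in B by exact I.
  apply (Rmult_le_compat_r (r ^ k)) in B; [|lra].
  replace (/ r ^ k * rmean (fun t => Cmod (f (circ c r t))) * r ^ k)%R
    with (rmean (fun t => Cmod (f (circ c r t)))) in B by (field; lra). exact B.
Qed.

Lemma tcoef_bound (f : C -> C) (c : C) (r R0 M : R) : holo (disc c R0) f -> (0 < r < R0)%R ->
  (forall z, disc c R0 z -> (Cmod (f z) <= M)%R) -> cbound (tcoef f c r) r M.
Proof.
  intros H hr HM k. eapply Rle_trans; [apply (tcoef_bound_mean f c r R0 H hr)|].
  rewrite <- (rmean_const M).
  assert (RM := rcont_Cmod _ (holo_circ_rcont f c r R0 H hr)).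
  apply rmean_le; [|apply ex_RInt_const|].
  - apply (ex_RInt_ext (fun t => Re (RtoC (Cmod (f (circ c r t)))))); [intros; apply re_RtoC|].
    apply rcont_int_Re, RM.
  - intros t. apply HM. unfold disc. rewrite circ_dist; lra.
Qed.

(** The Cauchy kernel is expanded as a geometric series in [x t], whose modulus is the constant
    [q < 1]; [g n] is the integrand of the remainder after [n] terms. *)
Lemma tcoef_pser (f : C -> C) (c w : C) (r R0 : R) : holo (disc c R0) f -> (0 < r < R0)%R ->
  disc c r w -> pser (tcoef f c r) (w - c) (f w).
Proof.
  intros H hr hw. assert (RC := holo_circ_rcont f c r R0 H hr).
  set (x := fun t => (w - c) * / (RtoC r * cexp t)).
  assert (Rx : rcont x).
  { apply rcont_mult; [apply rcont_const|apply rcexp_inv_rcont; lra]. }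
  assert (q1 := quot_lt1 (w - c) r hw). set (q := (Cmod (w - c) / r)%R) in *.
  assert (xq : forall t, Cmod (x t) = q).
  { intros t. unfold x. rewrite Cmod_mult, Cmod_rcexp_inv by lra. reflexivity. }
  assert (x1 : forall t, (1 - q <= Cmod (1 - x t))%R).
  { intros t. assert (T := Cmod_triangle_rev 1 (x t)). rewrite xq, Cmod_1 in T. lra. }
  assert (x1n : forall t, 1 - x t <> 0) by (intros t; apply Cnz_Cmod; specialize (x1 t); lra).
  set (g := fun n t => f (circ c r t) * (/ (1 - x t) * x t ^ n)).
  assert (RK : rcont (fun t => / (1 - x t))).
  { apply rcont_inv; [exact x1n|]. apply rcont_plus; [apply rcont_const|apply rcont_opp, Rx]. }
  assert (Rg : forall n, rcont (g n)).
  { intros n. apply rcont_mult; [exact RC|]. apply rcont_mult; [exact RK|apply rcont_pow, Rx]. }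
  assert (G0 : mean (g 0%nat) = f w).
  { rewrite <- (cauchy_formula f c w r R0 H hr hw). apply mean_ext. intros t. unfold g. f_equal.
    assert (n1 := x1n t). assert (n2 := rcexp_nz r t (proj1 hr)).
    assert (E : circ c r t - w = (RtoC r * cexp t) * (1 - x t)).
    { unfold x, circ. field. split; [apply cexp_nz|apply RtoC_nz; lra]. }
    rewrite E. change (x t ^ 0) with (RtoC 1). unfold Cdiv. field.
    split; [exact n1|]. split; [apply cexp_nz|apply RtoC_nz; lra]. }
  assert (GS : forall n, mean (g n) = tcoef f c r n * (w - c) ^ n + mean (g (S n))).
  { intros n. unfold tcoef. rewrite Cmult_comm, <- mean_scal.
    2:{ apply rcont_mult; [exact RC|]. apply rcont_pow, rcexp_inv_rcont, hr. }
    rewrite <- mean_plus.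
    - apply mean_ext. intros t. unfold g.
      assert (E : (w - c) ^ n * (f (circ c r t) * (/ (RtoC r * cexp t)) ^ n) = f (circ c r t) * x t ^ n).
      { unfold x. rewrite Cpow_mult_l. ring. }
      rewrite E, Cpow_S. field. apply x1n.
    - apply rcont_mult; [apply rcont_const|]. apply rcont_mult; [exact RC|]. apply rcont_pow, rcexp_inv_rcont, hr.
    - apply Rg. }
  assert (GN : forall n, csum (fun k => tcoef f c r k * (w - c) ^ k) n - f w = - mean (g n)).
  { intros n. induction n as [|n IH]; [rewrite G0; simpl; ring|].
    simpl csum. rewrite GS in IH. 
    transitivity ((csum (fun k => tcoef f c r k * (w - c) ^ k) n - f w) + tcoef f c r n * (w - c) ^ n); [ring|].
    rewrite IH. ring. }
  apply (ctends_squeeze _ _ (fun n => rmean (fun t => Cmod (f (circ c r t))) * q ^ n / (1 - q))%R); [|apply pow_lim0, q1].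
  intros n. rewrite GN, Cmod_opp.
  assert (RM := rcont_Cmod _ RC).
  assert (I : ex_RInt (fun t => Cmod (f (circ c r t))) 0 (2 * PI)).
  { apply (ex_RInt_ext (fun t => Re (RtoC (Cmod (f (circ c r t)))))); [intros; apply re_RtoC|].
    apply rcont_int_Re, RM. }
  replace (rmean (fun t => Cmod (f (circ c r t))) * q ^ n / (1 - q))%R
    with (q ^ n / (1 - q) * rmean (fun t => Cmod (f (circ c r t))))%R by (field; lra).
  rewrite <- rmean_scal by exact I. apply mean_le; [apply Rg| |].
  - apply (rcont_ext (fun t => RtoC (q ^ n / (1 - q)) * RtoC (Cmod (f (circ c r t))))); [intros; symmetry; apply RtoC_mult|].
    apply rcont_mult; [apply rcont_const|exact RM].
  - intros t. unfold g. rewrite !Cmod_mult, Cmod_pow, xq, Cmod_inv by apply x1n.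
    rewrite (Rmult_comm (Cmod (f _))). apply Rmult_le_compat_r; [apply Cmod_ge_0|].
    unfold Rdiv. rewrite Rmult_comm. apply Rmult_le_compat_l; [apply pow_le; lra|].
    apply Rinv_le_contravar; [lra|apply x1].
Qed.

(** Coefficients computed at different radii coincide by uniqueness, so one sequence serves on the
    whole disc. The last clause, a bound at the full radius [R0], is what makes the coefficients of
    a bounded family uniformly bounded. *)
Lemma taylor (f : C -> C) (c : C) (R0 : R) : (0 < R0)%R -> holo (disc c R0) f ->
  exists a : nat -> C, (forall w, disc c R0 w -> pser a (w - c) (f w)) /\
    (forall r, (0 < r < R0)%R -> exists M, cbound a r M) /\
    (forall M, (forall z, disc c R0 z -> (Cmod (f z) <= M)%R) -> cbound a R0 M).
Proof.
  intros hR H. exists (tcoef f c (R0 / 2)).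
  assert (E : forall r, (0 < r < R0)%R -> forall k, tcoef f c r k = tcoef f c (R0 / 2) k).
  { intros r hr.
    assert (B1 := tcoef_bound_mean f c r R0 H hr). assert (B2 := tcoef_bound_mean f c (R0 / 2) R0 H ltac:(lra)).
    set (M1 := rmean _) in B1. set (M2 := rmean _) in B2.
    set (s := Rmin r (R0 / 2)). assert (hs : (0 < s)%R) by (apply Rmin_pos; lra).
    assert (s1 : (s <= r)%R) by apply Rmin_l. assert (s2 : (s <= R0 / 2)%R) by apply Rmin_r.
    apply (pser_unique _ _ s (Rmax M1 M2) (fun z => f (z + c)) hs).
    - intros k. eapply Rle_trans; [|apply Rmax_l]. apply (cbound_le _ r s); [lra|exact B1].
    - intros k. eapply Rle_trans; [|apply Rmax_r]. apply (cbound_le _ (R0 / 2) s); [lra|exact B2].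
    - intros z hz. replace z with (z + c - c) at 1 3 by ring.
      split; apply (tcoef_pser f c (z + c) _ R0 H); try lra; unfold disc; replace (z + c - c) with z by ring; lra. }
  split; [|split].
  - intros w hw. unfold disc in hw. set (r := ((Cmod (w - c) + R0) / 2)%R).
    assert (p := Cmod_ge_0 (w - c)).
    assert (hr : (0 < r < R0)%R) by (unfold r; lra).
    assert (P := tcoef_pser f c w r R0 H hr ltac:(unfold disc, r; lra)).
    eapply ctends_ext; [|exact P]. intros n. apply csum_ext. intros k _. rewrite (E r hr). reflexivity.
  - intros r hr. eexists. intros k. rewrite <- (E r hr). apply (tcoef_bound_mean f c r R0 H hr).
  - intros M HM k.
    (* The radii [R0 * (1 - 1 / (n + 2))] increase to [R0]; starting from [n + 2] keeps them
       positive. *)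
    apply (is_lim_seq_le (fun n => Cmod (tcoef f c (R0 / 2) k) * (R0 * (1 - / INR (S (S n)))) ^ k)%R (fun _ => M)
      (Cmod (tcoef f c (R0 / 2) k) * R0 ^ k)%R M).
    + intros n. assert (h : (2 <= INR (S (S n)))%R) by (rewrite !S_INR; assert (T := pos_INR n); lra).
      assert (h1 : (0 < / INR (S (S n)) <= / 2)%R).
      { split; [apply Rinv_0_lt_compat; lra|apply Rinv_le_contravar; lra]. }
      assert (hr : (0 < R0 * (1 - / INR (S (S n))) < R0)%R) by nra.
      rewrite <- (E _ hr). apply (tcoef_bound f c _ R0 M H hr HM).
    + apply (is_lim_seq_scal_l _ _ (R0 ^ k)%R).
      assert (L : is_lim_seq (fun n => R0 * (1 - / INR (S (S n))))%R R0).
      { replace (Finite R0) with (Rbar_mult R0 (1 - 0)%R) by (simpl; f_equal; ring).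
        apply is_lim_seq_scal_l. apply is_lim_seq_minus'; [apply is_lim_seq_const|].
        apply (is_lim_seq_incr_1 (fun n => / INR (S n))%R). apply inv_INR_lim. }
      clear - L. induction k as [|k IH]; simpl; [apply is_lim_seq_const|]. apply is_lim_seq_mult'; auto.
    + apply is_lim_seq_const.
Qed.

(** * Equivalence of complex differentiability and local power series *)

Lemma cder_unique (f : C -> C) (z l m : C) : cder f z l -> cder f z m -> l = m.
Proof.
  intros H K. apply cder_caratheodory in H as [p [Hp [<- Ep]]]. apply cder_caratheodory in K as [q [Hq [<- Eq]]].
  destruct (seq_to_center z 1 ltac:(lra)) as [u [Hu Hn]].
  apply (ctends_unique (fun n => p (u n))); [apply ctends_comp; auto|].
  apply (ctends_ext (fun n => q (u n))); [|apply ctends_comp; auto].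
  intros n. destruct (Hn n) as [nz _]. apply Cminus_eq_contra in nz.
  transitivity ((q (u n) * (u n - z)) / (u n - z)); [field; exact nz|].
  rewrite <- Eq, Ep. field. exact nz.
Qed.

Lemma disc_open (c z : C) (r : R) : disc c r z -> exists d : R, (0 < d)%R /\ forall w, disc z d w -> disc c r w.
Proof.
  intros h. unfold disc in *. exists (r - Cmod (z - c))%R. split; [lra|]. intros w hw.
  assert (T := Cmod_sub_le w c z). lra.
Qed.

(** Derivatives are unique, so choosing one at every point gives a global [f'] that agrees with each
    local one and is therefore continuous. *)
Lemma holo_local (U : C -> Prop) (f : C -> C) :
  (forall z, U z -> exists d : R, (0 < d)%R /\ holo (disc z d) f) -> holo U f.
Proof.
  intros H. exists (fun z => epsilon (inhabits (RtoC 0)) (cder f z)). intros z hz.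
  destruct (H z hz) as [d [hd [f' Hf']]].
  assert (E : forall w, disc z d w -> f' w = epsilon (inhabits (RtoC 0)) (cder f w)).
  { intros w hw. destruct (Hf' w hw) as [A _]. apply (cder_unique f w); [exact A|].
    apply epsilon_spec. eauto. }
  assert (hc := disc_center z d hd). split.
  - rewrite <- (E z hc). apply Hf', hc.
  - apply (ccont_ext_near f' _ z d hd E). apply Hf', hc.
Qed.

Lemma analytic_at_holo (f : C -> C) (z : C) :
  analytic_at f z <-> exists d : R, (0 < d)%R /\ holo (disc z d) f.
Proof.
  split.
  - intros [a Ha]. apply locally_C_ball in Ha. destruct Ha as [d [hd K]].
    assert (P : forall w, disc z d w -> pser a (w - z) (f w)).
    { intros w hw. apply is_pseries_pser, K, hw. }
    (* Convergence at a single point at distance [d / 2] bounds the coefficients, which makes the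
       sum holomorphic on the disc of that radius. *)
    assert (Q : disc z d (z + RtoC (d / 2))).
    { unfold disc. replace (z + RtoC (d / 2) - z) with (RtoC (d / 2)) by ring. rewrite Cmod_R, Rabs_pos_eq; lra. }
    destruct (pser_cbound _ _ _ (P _ Q)) as [M HM].
    replace (z + RtoC (d / 2) - z) with (RtoC (d / 2)) in HM by ring. rewrite Cmod_R, Rabs_pos_eq in HM by lra.
    assert (hd2 : (0 < d / 2)%R) by lra.
    exists (d / 2)%R. split; [exact hd2|].
    apply (holo_ext _ (fun w => pfun a (w - z))).
    + intros w hw. destruct (disc_open z w (d / 2) hw) as [e [he Ke]]. exists e. split; [exact he|].
      intros x hx. specialize (Ke x hx). unfold disc in Ke.
      apply (ctends_unique (csum (fun k => a k * (x - z) ^ k))).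
      * apply (pfun_correct a (d / 2) M); auto.
      * apply P. unfold disc. lra.
    + apply (holo_comp _ (disc 0 (d / 2)) (pfun a) (fun w => w - z)); [apply (pfun_holo a _ M); auto| |].
      * apply holo_minus; [apply holo_id|apply holo_const].
      * intros w hw. unfold disc in *. replace (w - z - 0) with (w - z) by ring. exact hw.
  - intros [d [hd H]]. destruct (taylor f z d hd H) as [a [Ha _]]. exists a. apply locally_C_ball.
    exists d. split; [exact hd|]. intros w hw. apply is_pseries_pser, Ha, hw.
Qed.

Lemma analytic_on_holo (U : C -> Prop) (f : C -> C) : analytic_on U f -> holo U f.
Proof. intros H. apply holo_local. intros z hz. apply analytic_at_holo, H, hz. Qed.

Definition isopen (U : C -> Prop) : Prop :=
  forall z, U z -> exists d : R, (0 < d)%R /\ forall w, disc z d w -> U w.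

Lemma holo_analytic_on (U : C -> Prop) (f : C -> C) : isopen U -> holo U f -> analytic_on U f.
Proof.
  intros HU H z hz. apply analytic_at_holo. destruct (HU z hz) as [d [hd K]]. exists d. split; [exact hd|].
  apply (holo_sub U); auto.
Qed.

(** * Normal families *)

Lemma bounded_adherent (u : nat -> R) (B : R) : (forall n, Rabs (u n) <= B)%R ->
  exists l : R, forall N e, (0 < e)%R -> exists p, (N <= p)%nat /\ (Rabs (u p - l) < e)%R.
Proof.
  intros H.
  destruct (Bolzano_Weierstrass u (fun x => - B <= x <= B)%R (compact_P3 _ _)) as [l Hl].
  - intros n. specialize (H n). apply Rabs_le_between in H. exact H.
  - exists l. intros N e he.
    destruct (Hl (fun x => Rabs (x - l) < e)%R N) as [p [hp K]].
    + exists (mkposreal e he). intros x hx. exact hx.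
    + exists p. auto.
Qed.

(** Extractions are maps [psi] with [n <= psi n]: this makes them tend to infinity and is stable
    under composition. *)
Lemma bounded_extract_R (u : nat -> R) (B : R) : (forall n, Rabs (u n) <= B)%R ->
  exists (psi : nat -> nat) (l : R), (forall n, (n <= psi n)%nat) /\ is_lim_seq (fun n => u (psi n)) l.
Proof.
  intros H. destruct (bounded_adherent u B H) as [l Hl].
  assert (hp : forall n, (0 < / INR (S n))%R) by (intros n; apply Rinv_0_lt_compat, lt_0_INR; lia).
  assert (K : forall n, exists p, (n <= p)%nat /\ (Rabs (u p - l) < / INR (S n))%R) by (intros; auto).
  exists (fun n => proj1_sig (constructive_indefinite_description _ (K n))), l. split.
  - intros n. destruct (constructive_indefinite_description _ (K n)) as [p [h1 h2]]. exact h1.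
  - apply is_lim_seq_spec. intros e.
    assert (L := inv_INR_lim). apply is_lim_seq_spec in L. destruct (L e) as [N HN]. exists N. intros n hn.
    destruct (constructive_indefinite_description _ (K n)) as [p [h1 h2]]. simpl.
    specialize (HN n hn). rewrite Rminus_0_r in HN. assert (T := Rle_abs (/ INR (S n))). lra.
Qed.

Lemma is_lim_seq_extract (u : nat -> R) (l : Rbar) (psi : nat -> nat) : (forall n, (n <= psi n)%nat) ->
  is_lim_seq u l -> is_lim_seq (fun n => u (psi n)) l.
Proof.
  intros H. apply filterlim_comp. intros P [N K]. exists N. intros n hn. apply K. specialize (H n). lia.
Qed.

Lemma ctends_extract (u : nat -> C) (l : C) (psi : nat -> nat) : (forall n, (n <= psi n)%nat) ->
  ctends u l -> ctends (fun n => u (psi n)) l.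
Proof.
  intros H K e he. destruct (K e he) as [N HN]. exists N. intros n hn. apply HN. specialize (H n). lia.
Qed.

Lemma bounded_extract (u : nat -> C) (B : R) : (forall n, Cmod (u n) <= B)%R ->
  exists psi : nat -> nat, (forall n, (n <= psi n)%nat) /\ exists l, ctends (fun n => u (psi n)) l.
Proof.
  intros H.
  destruct (bounded_extract_R (fun n => Re (u n)) B) as [p [x [hp hx]]].
  { intros n. eapply Rle_trans; [apply re_le_Cmod|apply H]. }
  destruct (bounded_extract_R (fun n => Im (u (p n))) B) as [q [y [hq hy]]].
  { intros n. eapply Rle_trans; [apply im_le_Cmod|apply H]. }
  exists (fun n => p (q n)). split.
  - intros n. specialize (hp (q n)). specialize (hq n). lia.
  - exists (x, y). apply ctends_is_lim. split; [|exact hy].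
    apply (is_lim_seq_extract (fun n => Re (u (p n))) x q hq hx).
Qed.

(** [phi (S k)] makes column [k] converge and refines [phi k]. By [T] the diagonal [phi n n] is, for
    [n > k], an extraction from [phi (S k)]. *)
Lemma diagonal_extract (a : nat -> nat -> C) (B : nat -> R) : (forall n k, Cmod (a n k) <= B k)%R ->
  exists psi : nat -> nat, (forall n, (n <= psi n)%nat) /\
    forall k, exists l, ctends (fun n => a (psi n) k) l.
Proof.
  intros H.
  assert (K : forall (p : nat -> nat) k, exists q : nat -> nat, (forall n, (n <= q n)%nat) /\
    exists l, ctends (fun n => a (p (q n)) k) l).
  { intros p k. apply (bounded_extract (fun n => a (p n) k) (B k)). intros n. apply H. }
  set (E := fun p k => proj1_sig (constructive_indefinite_description _ (K p k))).
  assert (HE : forall p k, (forall n, (n <= E p k n)%nat) /\ exists l, ctends (fun n => a (p (E p k n)) k) l).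
  { intros p k. unfold E. destruct (constructive_indefinite_description _ (K p k)); auto. }
  set (phi := fix phi k := match k with O => fun n => n | S m => fun n => phi m (E (phi m) m n) end).
  assert (T : forall k j, exists th : nat -> nat, (forall n, (n <= th n)%nat) /\
    forall n, phi (k + j)%nat n = phi k (th n)).
  { intros k j. induction j as [|j [th [h1 h2]]].
    - exists (fun n => n). split; [auto|]. intros n. rewrite Nat.add_0_r. reflexivity.
    - exists (fun n => th (E (phi (k + j)%nat) (k + j)%nat n)). split.
      + intros n. assert (A := proj1 (HE (phi (k + j)%nat) (k + j)%nat) n). specialize (h1 (E (phi (k + j)%nat) (k + j)%nat n)). lia.
      + intros n. rewrite Nat.add_succ_r. simpl. apply h2. }
  exists (fun n => phi n n). split.
  - intros n. destruct (T 0%nat n) as [th [h1 h2]]. rewrite h2. apply h1.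
  - intros k. destruct (HE (phi k) k) as [_ [l Hl]]. exists l.
    intros e he. destruct (Hl e he) as [N HN]. exists (N + S k)%nat. intros n hn.
    destruct (T (S k) (n - S k)%nat) as [th [h1 h2]].
    replace (S k + (n - S k))%nat with n in h2 by lia. rewrite h2. simpl. apply HN. specialize (h1 n). lia.
Qed.

Lemma ctends_csum (u : nat -> nat -> C) (v : nat -> C) (N : nat) : (forall k, ctends (fun n => u n k) (v k)) ->
  ctends (fun n => csum (u n) N) (csum v N).
Proof.
  intros H. induction N as [|N IH]; [exact (ctends_const 0)|]. exact (ctends_plus _ _ _ _ IH (H N)).
Qed.

(** The Taylor coefficients are bounded by [M / R0 ^ k], so a diagonal extraction makes all of them
    converge. At each point of the disc the tails are uniformly small, so the values converge to the
    sum of the limit series. *)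
Lemma montel (f : nat -> C -> C) (c : C) (R0 M : R) : (0 < R0)%R ->
  (forall n, holo (disc c R0) (f n)) -> (forall n z, disc c R0 z -> (Cmod (f n z) <= M)%R) ->
  exists psi : nat -> nat, (forall n, (n <= psi n)%nat) /\
    exists g, holo (disc c R0) g /\ forall z, disc c R0 z -> ctends (fun n => f (psi n) z) (g z).
Proof.
  intros hR H HM.
  assert (K : forall n, exists a : nat -> C, (forall w, disc c R0 w -> pser a (w - c) (f n w)) /\ cbound a R0 M).
  { intros n. destruct (taylor (f n) c R0 hR (H n)) as [a [A [_ B]]]. exists a. split; [exact A|]. apply B. auto. }
  set (a := fun n => proj1_sig (constructive_indefinite_description _ (K n))).
  assert (Ha : forall n, (forall w, disc c R0 w -> pser (a n) (w - c) (f n w)) /\ cbound (a n) R0 M).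
  { intros n. unfold a. destruct (constructive_indefinite_description _ (K n)); auto. }
  destruct (diagonal_extract a (fun k => M / R0 ^ k)%R) as [psi [hpsi Hl]].
  { intros n k. assert (B := proj2 (Ha n) k). assert (p := pow_lt R0 k hR).
    apply (Rmult_le_reg_r (R0 ^ k)); [exact p|]. unfold Rdiv. rewrite Rmult_assoc, Rinv_l; lra. }
  exists psi. split; [exact hpsi|].
  set (l := fun k => clim (fun n => a (psi n) k)).
  assert (Hl' : forall k, ctends (fun n => a (psi n) k) (l k)) by (intros; apply clim_correct, Hl).
  assert (Bl : cbound l R0 M).
  { intros k. assert (p := pow_lt R0 k hR).
    assert (T : (Cmod (l k) <= M / R0 ^ k)%R).
    { apply (ctends_Cmod_le _ _ _ (Hl' k)). intros n. assert (B := proj2 (Ha (psi n)) k).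
      apply (Rmult_le_reg_r (R0 ^ k)); [exact p|]. unfold Rdiv. rewrite Rmult_assoc, Rinv_l; lra. }
    apply (Rmult_le_compat_r (R0 ^ k)) in T; [|lra]. unfold Rdiv in T. rewrite Rmult_assoc, Rinv_l in T; lra. }
  exists (fun z => pfun l (z - c)). split.
  - apply (holo_comp _ (disc 0 R0) (pfun l) (fun w => w - c)); [apply (pfun_holo l _ M); auto| |].
    + apply holo_minus; [apply holo_id|apply holo_const].
    + intros w hw. unfold disc in *. replace (w - c - 0) with (w - c) by ring. exact hw.
  - intros z hz e he. assert (hz' := hz). unfold disc in hz'.
    assert (q1 := quot_lt1 (z - c) R0 hz'). set (q := (Cmod (z - c) / R0)%R) in *.
    assert (L := pow_lim0 q M q1). apply is_lim_seq_spec in L.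
    assert (he3 : (0 < e / 3)%R) by lra. destruct (L (mkposreal _ he3)) as [N HN]. specialize (HN N (le_n N)). simpl in HN.
    rewrite Rminus_0_r in HN. assert (T := Rle_abs (M * q ^ N / (1 - q))).
    assert (S : ctends (fun n => csum (fun k => a (psi n) k * (z - c) ^ k) N) (csum (fun k => l k * (z - c) ^ k) N)).
    { apply ctends_csum. intros k. apply ctends_mult; [apply Hl'|apply ctends_const]. }
    destruct (S _ he3) as [N' HN']. exists N'. intros n hn. specialize (HN' n hn).
    destruct (Ha (psi n)) as [P Q].
    assert (A1 := csum_lim_tail _ _ M q q1 (cbound_geom _ _ _ (z - c) hR Q) (P z hz) N).
    assert (A2 := csum_lim_tail _ _ M q q1 (cbound_geom _ _ _ (z - c) hR Bl) (pfun_correct l R0 M (z - c) hR Bl hz') N).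
    set (x := csum _ N) in A1. set (y := csum _ N) in A2. fold x y in HN'.
    replace (f (psi n) z - pfun l (z - c)) with ((f (psi n) z - x) + (x - y) + (y - pfun l (z - c))) by ring.
    eapply Rle_lt_trans; [apply Cmod_triangle|]. eapply Rle_lt_trans; [apply Rplus_le_compat_r, Cmod_triangle|].
    rewrite (Cmod_sub_sym y). lra.
Qed.

(** The pointwise limit must coincide with the holomorphic limit of any Montel subsequence. *)
Lemma vitali (f : nat -> C -> C) (g : C -> C) (c : C) (R0 M : R) : (0 < R0)%R ->
  (forall n, holo (disc c R0) (f n)) -> (forall n z, disc c R0 z -> (Cmod (f n z) <= M)%R) ->
  (forall z, disc c R0 z -> ctends (fun n => f n z) (g z)) -> holo (disc c R0) g.
Proof.
  intros hR H HM Hg. destruct (montel f c R0 M hR H HM) as [psi [hpsi [g' [Hg' K]]]].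
  apply (holo_ext _ g'); [|exact Hg'].
  intros z hz. destruct (disc_open c z R0 hz) as [d [hd Kd]]. exists d. split; [exact hd|].
  intros w hw. apply (ctends_unique (fun n => f (psi n) w)); [apply K, Kd, hw|].
  apply (ctends_extract (fun n => f n w)); auto.
Qed.

(** * Analytic functions on the half-plane *)

(* [cay al] maps the unit disc onto the upper half-plane and [0] to [al]; its inverse is [cayi al]. *)
Definition cay (al z : C) : C := (al - Cconj al * z) / (1 - z).
Definition cayi (al z : C) : C := (z - al) / (z - Cconj al).

Lemma upper_open : isopen upper_half.
Proof.
  intros z hz. unfold upper_half in *. exists (Im z). split; [exact hz|]. intros w hw. unfold disc in hw.
  assert (T := Im_lip w z). assert (T' := Rle_abs (Im z - Im w)). rewrite Rabs_minus_sym in T'. lra.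
Qed.

Lemma conj_upper_neq (al z : C) : upper_half al -> upper_half z -> z - Cconj al <> 0.
Proof.
  unfold upper_half. intros ha hz e. apply (f_equal Im) in e. rewrite im_minus, im_conj, im_RtoC in e. lra.
Qed.

Lemma one_minus_neq (z : C) : disc 0 1 z -> 1 - z <> 0.
Proof.
  unfold disc. intros h. replace (z - 0) with z in h by ring. apply Cnz_Cmod.
  assert (T := Cmod_triangle_rev 1 z). rewrite Cmod_1 in T. lra.
Qed.

Lemma im_div (a b : C) : b <> 0 -> (Im (a / b) = Im (a * Cconj b) / (Cmod b * Cmod b))%R.
Proof.
  intros hb. assert (hm := proj1 (Cmod_gt_0 b) hb).
  assert (E : a / b = a * Cconj b * RtoC (/ (Cmod b * Cmod b))).
  { rewrite RtoC_inv by nra. rewrite <- mult_conj_re. field. split; [apply conj_nz|]; exact hb. }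
  rewrite E, im_scal_r. reflexivity.
Qed.

Lemma cay_upper (al z : C) : upper_half al -> disc 0 1 z -> upper_half (cay al z).
Proof.
  intros ha hz. unfold upper_half, cay in *. assert (nz := one_minus_neq z hz).
  rewrite im_div by exact nz. assert (hm := proj1 (Cmod_gt_0 _) nz).
  apply Rdiv_lt_0_compat; [|nra].
  unfold disc in hz. replace (z - 0) with z in hz by ring.
  assert (S := Cmod_sqr z). assert (p := Cmod_ge_0 z).
  rewrite Cminus_conj, im_mult, !im_minus, !re_minus, im_mult, re_mult, !re_conj, !im_conj, !re_RtoC, !im_RtoC.
  assert (K : (0 < Im al * (1 - (Re z * Re z + Im z * Im z)))%R) by (apply Rmult_lt_0_compat; nra).
  nra.
Qed.

Lemma cayi_disc (al z : C) : upper_half al -> upper_half z -> disc 0 1 (cayi al z).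
Proof.
  intros ha hz. assert (nz := conj_upper_neq al z ha hz). unfold upper_half, cayi, disc in *.
  replace ((z - al) / (z - Cconj al) - 0) with ((z - al) / (z - Cconj al)) by ring.
  rewrite Cmod_div by exact nz. assert (hm := proj1 (Cmod_gt_0 _) nz).
  apply (Rmult_lt_reg_r (Cmod (z - Cconj al))); [exact hm|].
  unfold Rdiv. rewrite Rmult_assoc, Rinv_l, Rmult_1_l, Rmult_1_r by lra.
  assert (A := Cmod_sqr (z - al)). assert (B := Cmod_sqr (z - Cconj al)).
  rewrite re_minus, im_minus in A, B. rewrite re_conj, im_conj in B.
  assert (p := Cmod_ge_0 (z - al)). apply Rnot_le_lt. intros h. nra.
Qed.

Lemma cay_cayi (al z : C) : upper_half al -> upper_half z -> cay al (cayi al z) = z.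
Proof.
  intros ha hz. assert (nz := conj_upper_neq al z ha hz).
  assert (nz2 : al - Cconj al <> 0) by (apply (conj_upper_neq al al ha ha)).
  unfold cay, cayi. field. split; [exact nz|].
  replace (z - Cconj al - (z - al)) with (al - Cconj al) by ring. exact nz2.
Qed.

Lemma cay_holo (al : C) : holo (disc 0 1) (cay al).
Proof.
  apply holo_div.
  - apply holo_minus; [apply holo_const|apply holo_mult; [apply holo_const|apply holo_id]].
  - apply holo_minus; [apply holo_const|apply holo_id].
  - apply one_minus_neq.
Qed.

Lemma cayi_holo (al : C) : upper_half al -> holo upper_half (cayi al).
Proof.
  intros ha. apply holo_div.
  - apply holo_minus; [apply holo_id|apply holo_const].
  - apply holo_minus; [apply holo_id|apply holo_const].
  - intros z hz. apply conj_upper_neq; auto.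
Qed.

Lemma holo_cay (g : C -> C) (al : C) : upper_half al -> holo upper_half g ->
  holo (disc 0 1) (fun z => g (cay al z)).
Proof. intros ha H. apply (holo_comp _ upper_half); [exact H|apply cay_holo|]. intros z. apply cay_upper, ha. Qed.

Lemma holo_cayi (g : C -> C) (al : C) : upper_half al -> holo (disc 0 1) g ->
  holo upper_half (fun z => g (cayi al z)).
Proof. intros ha H. apply (holo_comp _ (disc 0 1)); [exact H|apply cayi_holo, ha|]. intros z. apply cayi_disc, ha. Qed.

Lemma pfun_factor (n : nat) : forall a : nat -> C, (forall k, (k < n)%nat -> a k = 0) ->
  (forall r, (0 < r < 1)%R -> exists M, cbound a r M) ->
  forall z, disc 0 1 z -> pfun a z = z ^ n * pfun (fun k => a (n + k)%nat) z.
Proof.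
  induction n as [|n IH]; intros a H0 HB z hz.
  { simpl. rewrite Cmult_1_l. reflexivity. }
  assert (HB' : forall r, (0 < r < 1)%R -> exists M, cbound (fun k => a (S k)) r M).
  { intros r hr. destruct (HB r hr) as [M HM]. exists (M / r)%R. apply pser_shift_bound; [lra|exact HM]. }
  assert (E : pfun a z = z * pfun (fun k => a (S k)) z).
  { assert (a0 : a 0%nat = 0) by (apply H0; lia).
    assert (hz' := hz). unfold disc in hz'. replace (z - 0) with z in hz' by ring. assert (p := Cmod_ge_0 z).
    set (r := ((Cmod z + 1) / 2)%R). assert (hr : (0 < r < 1)%R) by (unfold r; lra).
    assert (zr : (Cmod z < r)%R) by (unfold r; lra).
    destruct (HB r hr) as [M HM], (HB' r hr) as [M' HM'].
    assert (P := pfun_correct a r M z (proj1 hr) HM zr).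
    destruct (Ceq_dec z 0) as [->|nz].
    - rewrite (ctends_unique _ _ _ P (pser_0 a)), a0. ring.
    - assert (S := pser_shift a z _ nz P). rewrite a0 in S.
      rewrite (ctends_unique _ _ _ (pfun_correct _ r M' z (proj1 hr) HM' zr) S). field. exact nz. }
  rewrite E, (IH (fun k => a (S k))); auto.
  - rewrite Cpow_S. replace (fun k => a (S (n + k))) with (fun k => a (S n + k)%nat) by reflexivity. ring.
  - intros k hk. apply H0. lia.
Qed.

(** The Cayley map sends [al] to the centre of a disc on which a single Taylor series represents [g]
    everywhere. A nonzero value anywhere therefore forces a nonzero coefficient, and no
    connectedness argument enters. *)
Lemma zero_factor (g : C -> C) (al : C) : upper_half al -> holo upper_half g -> nonzero_on upper_half g ->
  exists (n : nat) (u : C -> C), holo upper_half u /\ u al <> 0 /\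
    forall z, upper_half z -> g z = (z - al) ^ n * u z.
Proof.
  intros ha H [z0 [hz0 gz0]].
  destruct (taylor _ 0 1 ltac:(lra) (holo_cay g al ha H)) as [a [Ha [HB _]]]. cbv beta in Ha.
  assert (Hp : forall z, disc 0 1 z -> g (cay al z) = pfun a z).
  { intros z hz. assert (P := Ha z hz). replace (z - 0) with z in P by ring.
    apply (ctends_unique _ _ _ P). apply clim_correct. eauto. }
  assert (NZ : exists n, a n <> 0).
  { apply NNPP. intros N. apply gz0. rewrite <- (cay_cayi al z0 ha hz0), Hp by (apply cayi_disc; auto).
    apply (ctends_unique (csum (fun k => a k * cayi al z0 ^ k))).
    - apply clim_correct. exists (g (cay al (cayi al z0))).
      assert (P := Ha (cayi al z0) (cayi_disc al z0 ha hz0)).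
      replace (cayi al z0 - 0) with (cayi al z0) in P by ring. exact P.
    - apply (ctends_ext (fun _ => 0)); [|apply ctends_const]. intros n. induction n as [|n IH]; [reflexivity|].
      simpl. rewrite <- IH. replace (a n) with (RtoC 0); [ring|].
      symmetry. apply NNPP. intros h. apply N. eauto. }
  assert (Min : exists n, a n <> 0 /\ forall k, (k < n)%nat -> a k = 0).
  { destruct NZ as [n hn]. induction n as [n IH] using (well_founded_induction Wf_nat.lt_wf).
    destruct (classic (exists k, (k < n)%nat /\ a k <> 0)) as [[k [hk K]]|N]; [exact (IH k hk K)|].
    exists n. split; [exact hn|]. intros k hk. apply NNPP. intros h. apply N. eauto. }
  destruct Min as [n [an a0]].
  assert (HB' : forall r, (0 < r < 1)%R -> exists M, cbound (fun k => a (n + k)%nat) r M).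
  { clear - HB. intros r hr. revert r hr. induction n as [|n IH]; [exact HB|].
    intros r hr. destruct (IH r hr) as [M HM]. exists (M / r)%R.
    assert (K := pser_shift_bound _ r M (proj1 hr) HM).
    intros k. specialize (K k). replace (S n + k)%nat with (n + S k)%nat by lia. exact K. }
  set (u0 := pfun (fun k => a (n + k)%nat)).
  assert (Hu0 : holo (disc 0 1) u0).
  { apply holo_local. intros z hz. unfold disc in hz. replace (z - 0) with z in hz by ring.
    assert (p := Cmod_ge_0 z). set (r := ((Cmod z + 1) / 2)%R). assert (hr : (0 < r < 1)%R) by (unfold r; lra).
    destruct (HB' r hr) as [M HM].
    destruct (disc_open 0 z r) as [d [hd K]]. { unfold disc. replace (z - 0) with z by ring. unfold r; lra. }
    exists d. split; [exact hd|]. apply (holo_sub (disc 0 r)); [exact K|]. apply (pfun_holo _ r M); [lra|exact HM]. }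
  (* [cayi al z ^ n] is [(z - al) ^ n] up to a zero-free factor, which is put into [u]. *)
  exists n, (fun z => (/ (z - Cconj al)) ^ n * u0 (cayi al z)). split; [|split].
  - apply holo_mult; [|apply holo_cayi; auto]. apply holo_pow. apply holo_inv.
    + apply holo_minus; [apply holo_id|apply holo_const].
    + intros z hz. apply conj_upper_neq; auto.
  - apply Cmult_neq_0.
    + apply Cpow_nz. intros e. apply (f_equal (Cmult (al - Cconj al))) in e.
      rewrite Cinv_r in e by (apply conj_upper_neq; auto). rewrite Cmult_0_r in e. exact (C1_nz e).
    + replace (cayi al al) with (RtoC 0).
      2:{ unfold cayi. field. apply conj_upper_neq; auto. }
      destruct (HB' (1/2)%R ltac:(lra)) as [M HM].
      replace (u0 0) with (a n); [exact an|].
      apply (ctends_unique (csum (fun k => a (n + k)%nat * 0 ^ k))).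
      * assert (P := pser_0 (fun k => a (n + k)%nat)). cbv beta in P. rewrite Nat.add_0_r in P. exact P.
      * apply (pfun_correct _ (1/2) M); [lra|exact HM|rewrite Cmod_0; lra].
  - intros z hz. rewrite <- (cay_cayi al z ha hz) at 1. rewrite Hp by (apply cayi_disc; auto).
    rewrite (pfun_factor n a a0 HB) by (apply cayi_disc; auto). fold u0.
    unfold cayi at 1. unfold Cdiv. rewrite Cpow_mult_l. ring.
Qed.

Lemma ccont_nz_near (u : C -> C) (z : C) : ccont u z -> u z <> 0 ->
  exists d : R, (0 < d)%R /\ forall w, disc z d w -> u w <> 0.
Proof.
  intros H hz. assert (p := proj1 (Cmod_gt_0 _) hz). destruct (H _ p) as [d [hd K]]. exists d. split; [exact hd|].
  intros w hw e. specialize (K w hw). rewrite e in K. replace (0 - u z) with (- u z) in K by ring.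
  rewrite Cmod_opp in K. lra.
Qed.

Lemma zeros_isolated (g : C -> C) (al : C) : upper_half al -> holo upper_half g -> nonzero_on upper_half g ->
  exists d : R, (0 < d)%R /\ forall w, disc al d w -> w <> al -> upper_half w /\ g w <> 0.
Proof.
  intros ha H Hn. destruct (zero_factor g al ha H Hn) as [n [u [Hu [ua E]]]].
  destruct (ccont_nz_near u al (holo_ccont _ _ _ Hu ha) ua) as [d [hd K]].
  destruct (upper_open al ha) as [d' [hd' K']].
  exists (Rmin d d'). split; [apply Rmin_pos; auto|]. intros w hw nw. unfold disc in hw.
  assert (uw : upper_half w) by (apply K'; exact (Rlt_le_trans _ _ _ hw (Rmin_r _ _))).
  split; [exact uw|]. rewrite E by exact uw. apply Cmult_neq_0.
  - apply Cpow_nz, Cminus_eq_contra, nw.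
  - apply K. exact (Rlt_le_trans _ _ _ hw (Rmin_l _ _)).
Qed.

(* [reg f] fills in the isolated junk values of [f] by its limits along vertical half-lines. *)
Definition reg (f : C -> C) (z : C) : C := clim (fun n => f (z + Ci * RtoC (/ INR (S n)))).

Lemma vert_tends (z : C) : ctends (fun n => z + Ci * RtoC (/ INR (S n))) z.
Proof.
  apply (ctends_squeeze _ _ (fun n => / INR (S n))%R); [|apply inv_INR_lim]. intros n.
  replace (z + Ci * RtoC (/ INR (S n)) - z) with (Ci * RtoC (/ INR (S n))) by ring.
  rewrite Cmod_mult, Cmod_Ci, Cmod_R, Rabs_pos_eq; [lra|].
  left. apply Rinv_0_lt_compat, lt_0_INR. lia.
Qed.

Lemma vert_above (z : C) (n : nat) : (Im z < Im (z + Ci * RtoC (/ INR (S n))))%R.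
Proof.
  assert (h : (0 < / INR (S n))%R) by (apply Rinv_0_lt_compat, lt_0_INR; lia).
  rewrite im_plus, im_scal_r. change (Im Ci) with 1%R. lra.
Qed.

(** Agreement is asked only strictly above [z], since the limit is vertical; this covers real [z],
    where the two functions are compared off the line only. *)
Lemma reg_eq (f g : C -> C) (z : C) (d : R) : (0 < d)%R ->
  (forall w, disc z d w -> (Im z < Im w)%R -> f w = g w) -> ccont g z -> reg f z = g z.
Proof.
  intros hd E Hg. assert (V := vert_tends z).
  assert (L : ctends (fun n => f (z + Ci * RtoC (/ INR (S n)))) (g z)).
  { destruct (V d hd) as [N HN].
    apply (ctends_ev_ext (fun n => g (z + Ci * RtoC (/ INR (S n)))) _ _ N).
    - intros n hn. symmetry. apply E; [exact (HN n hn)|apply vert_above].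
    - apply (ctends_comp g); auto. }
  apply (ctends_unique _ _ _ (clim_correct _ (ex_intro _ _ L)) L).
Qed.

Lemma reg_eq_disc (f g : C -> C) (z : C) (d : R) :
  (forall w, disc z d w -> w <> z -> f w = g w) -> (forall w, disc z d w -> ccont g w) ->
  forall w, disc z d w -> reg f w = g w.
Proof.
  intros E Hg w hw. destruct (disc_open z w d hw) as [d' [hd' K]].
  destruct (Ceq_dec w z) as [->|nz].
  - apply (reg_eq f g z d'); auto. intros w' hw' im. apply E; [apply K, hw'|]. intros ->. lra.
  - assert (p := proj1 (Cmod_gt_0 _) (Cminus_eq_contra _ _ nz)).
    apply (reg_eq f g w (Rmin d' (Cmod (w - z)))); [apply Rmin_pos; auto| |apply Hg, hw].
    intros x hx _. unfold disc in hx. apply E.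
    + apply K. exact (Rlt_le_trans _ _ _ hx (Rmin_l _ _)).
    + intros ->. rewrite Cmod_sub_sym in hx. assert (T := Rmin_r d' (Cmod (w - z))). lra.
Qed.

(** The bound forces [g1] to vanish at least to the order of [g], so the quotient has removable
    singularities, which [reg] removes. *)
Lemma quotient_holo (g1 g : C -> C) : holo upper_half g1 -> nonzero_on upper_half g1 -> holo upper_half g ->
  (forall z, upper_half z -> Cmod (g1 z) <= Cmod (g z))%R ->
  exists k, holo upper_half k /\ (forall z, upper_half z -> g1 z = k z * g z) /\
    (forall z, upper_half z -> Cmod (k z) <= 1)%R.
Proof.
  intros H1 N1 H Hle.
  assert (N : nonzero_on upper_half g).
  { destruct N1 as [z [hz nz]]. exists z. split; [exact hz|]. intros e. specialize (Hle z hz).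
    rewrite e, Cmod_0 in Hle. apply Cmod_gt_0 in nz. lra. }
  assert (L : forall al, upper_half al -> exists (d : R) (q : C -> C), (0 < d)%R /\ holo (disc al d) q /\
    (forall w, disc al d w -> upper_half w /\ g1 w = q w * g w) /\
    (forall w, disc al d w -> w <> al -> g w <> 0)).
  { intros al ha.
    destruct (zero_factor g1 al ha H1 N1) as [m [v [Hv [va Ev]]]].
    destruct (zero_factor g al ha H N) as [n [u [Hu [ua Eu]]]].
    destruct (ccont_nz_near u al (holo_ccont _ _ _ Hu ha) ua) as [d [hd K]].
    destruct (upper_open al ha) as [d' [hd' K']].
    set (e := Rmin d d'). assert (he : (0 < e)%R) by (apply Rmin_pos; auto).
    assert (I1 : forall w, disc al e w -> u w <> 0).
    { intros w hw. apply K. exact (Rlt_le_trans _ _ _ hw (Rmin_l _ _)). }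
    assert (I2 : forall w, disc al e w -> upper_half w).
    { intros w hw. apply K'. exact (Rlt_le_trans _ _ _ hw (Rmin_r _ _)). }
    (* Otherwise division of the bound by [(s j - al) ^ m] and passage to the limit give
       [v al = 0]. *)
    assert (mn : (n <= m)%nat).
    { destruct (Nat.le_gt_cases n m) as [h|h]; [exact h|]. exfalso. apply va.
      destruct (seq_to_center al e he) as [s [Hs Hs']].
      apply Cmod_eq_0. apply Rle_antisym; [|apply Cmod_ge_0].
      apply (is_lim_seq_le (fun j => Cmod (v (s j))) (fun j => Cmod ((s j - al) ^ (n - m) * u (s j)))
        (Cmod (v al)) 0%R).
      - intros j. destruct (Hs' j) as [nz hj]. specialize (Hle (s j) (I2 _ hj)).
        rewrite Ev, Eu in Hle by (apply I2, hj). replace n with (m + (n - m))%nat in Hle by lia.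
        rewrite Cpow_add_r, <- Cmult_assoc, !(Cmod_mult ((s j - al) ^ m)) in Hle.
        apply Rmult_le_reg_l in Hle; [exact Hle|]. apply Cmod_gt_0, Cpow_nz, Cminus_eq_contra, nz.
      - apply ctends_Cmod. apply ctends_comp; [apply (holo_ccont _ _ _ Hv ha)|exact Hs].
      - rewrite <- Cmod_0. apply ctends_Cmod.
        replace (RtoC 0) with ((al - al) ^ (n - m) * u al).
        2:{ replace (n - m)%nat with (S (n - m - 1)) by lia. rewrite Cpow_S. ring. }
        apply ctends_mult; [|apply ctends_comp; [apply (holo_ccont _ _ _ Hu ha)|exact Hs]].
        apply (ctends_comp (fun w => w ^ (n - m))); [apply ccont_pow|].
        apply ctends_minus; [exact Hs|apply ctends_const]. }
    exists e, (fun w => (w - al) ^ (m - n) * (v w / u w)). split; [exact he|]. split; [|split].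
    - apply holo_mult.
      + apply holo_pow, holo_minus; [apply holo_id|apply holo_const].
      + apply holo_div; [apply (holo_sub upper_half); auto|apply (holo_sub upper_half); auto|exact I1].
    - intros w hw. split; [apply I2, hw|]. rewrite Ev, Eu by (apply I2, hw).
      replace m with ((m - n) + n)%nat at 1 by lia. rewrite Cpow_add_r. field. apply I1, hw.
    - intros w hw nw. rewrite Eu by (apply I2, hw). apply Cmult_neq_0; [|apply I1, hw].
      apply Cpow_nz, Cminus_eq_contra, nw. }
  set (k := reg (fun z => g1 z / g z)).
  assert (Lk : forall al, upper_half al -> exists (d : R) (q : C -> C), (0 < d)%R /\ holo (disc al d) q /\
    (forall w, disc al d w -> upper_half w /\ g1 w = q w * g w) /\ (forall w, disc al d w -> k w = q w)).
  { intros al ha. destruct (L al ha) as [d [q [hd [Hq [A B]]]]]. exists d, q. split; [exact hd|]. split; [exact Hq|].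
    split; [exact A|]. apply reg_eq_disc.
    - intros w hw nw. rewrite (proj2 (A w hw)). field. apply B; auto.
    - intros w hw. apply (holo_ccont _ _ _ Hq hw). }
  assert (Hk : holo upper_half k).
  { apply holo_local. intros al ha. destruct (Lk al ha) as [d [q [hd [Hq [A B]]]]]. exists d. split; [exact hd|].
    apply (holo_ext _ q); [|exact Hq]. intros z hz. destruct (disc_open _ _ _ hz) as [e [he K]].
    exists e. split; [exact he|]. intros w hw. symmetry. apply B, K, hw. }
  assert (Ek : forall z, upper_half z -> g1 z = k z * g z).
  { intros z hz. destruct (Lk z hz) as [d [q [hd [Hq [A B]]]]]. assert (hc := disc_center z d hd).
    rewrite (B z hc). apply A, hc. }
  exists k. split; [exact Hk|]. split; [exact Ek|].
  intros z hz. destruct (zeros_isolated g z hz H N) as [d [hd K]].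
  destruct (seq_to_center z d hd) as [s [Hs Hs']].
  apply (ctends_Cmod_le (fun n => k (s n))).
  - apply ctends_comp; [apply (holo_ccont _ _ _ Hk hz)|exact Hs].
  - intros n. destruct (Hs' n) as [nz hn]. destruct (K _ hn nz) as [us gs].
    specialize (Hle _ us). rewrite Ek, Cmod_mult in Hle by exact us.
    apply Cmod_gt_0 in gs. nra.
Qed.

Lemma montel_upper (f : nat -> C -> C) (M : R) :
  (forall n, holo upper_half (f n)) -> (forall n z, upper_half z -> (Cmod (f n z) <= M)%R) ->
  exists psi : nat -> nat, (forall n, (n <= psi n)%nat) /\
    exists g, holo upper_half g /\ forall z, upper_half z -> ctends (fun n => f (psi n) z) (g z).
Proof.
  intros H HM.
  assert (ui : upper_half Ci) by (unfold upper_half, Ci, Im; simpl; lra).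
  destruct (montel (fun n z => f n (cay Ci z)) 0 1 M ltac:(lra)) as [psi [hpsi [g [Hg K]]]].
  - intros n. apply holo_cay; auto.
  - intros n z hz. apply HM, cay_upper; auto.
  - exists psi. split; [exact hpsi|]. exists (fun z => g (cayi Ci z)). split; [apply holo_cayi; auto|].
    intros z hz. specialize (K (cayi Ci z) (cayi_disc _ _ ui hz)). cbv beta in K.
    rewrite cay_cayi in K by auto. exact K.
Qed.

(** * Semi-inner product spaces *)

(* [lc c u v] plays the role of [c * u + v]; nothing else is required of the carrier, so that
   formal linear combinations, functions and pairs of functions are all covered. *)
Record preH (V : Type) (lc : C -> V -> V -> V) (ip : V -> V -> C) : Prop := {
  ph_lin : forall c u v w, ip (lc c u v) w = c * ip u w + ip v w;
  ph_conj : forall u v, ip v u = Cconj (ip u v);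
  ph_pos : forall u, (0 <= Re (ip u u))%R
}.

Section PreHilbert.

Variables (V : Type) (lc : C -> V -> V -> V) (ip : V -> V -> C).
Hypothesis P : preH V lc ip.

Definition nrm2 (u : V) : R := Re (ip u u).
Definition psub (u v : V) : V := lc (- (1)) v u.
Definition pcauchy (u : nat -> V) : Prop :=
  forall e : R, (0 < e)%R -> exists N, forall n m, (N <= n)%nat -> (N <= m)%nat ->
    (nrm2 (psub (u n) (u m)) < e)%R.
Definition plim (u : nat -> V) (f : V) : Prop :=
  forall e : R, (0 < e)%R -> exists N, forall n, (N <= n)%nat -> (nrm2 (psub (u n) f) < e)%R.
Definition pcomplete : Prop := forall u, pcauchy u -> exists f, plim u f.

Lemma ip_lin_r (c : C) (u v w : V) : ip w (lc c u v) = Cconj c * ip w u + ip w v.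
Proof.
  rewrite (ph_conj _ _ _ P (lc c u v)), (ph_lin _ _ _ P), Cplus_conj, Cmult_conj.
  rewrite <- !(ph_conj _ _ _ P). reflexivity.
Qed.

Lemma ip_self (u : V) : ip u u = RtoC (nrm2 u).
Proof.
  apply Ceq; [rewrite re_RtoC; reflexivity|]. rewrite im_RtoC.
  assert (E := f_equal Im (ph_conj _ _ _ P u u)). rewrite im_conj in E. lra.
Qed.

Lemma nrm2_ge0 (u : V) : (0 <= nrm2 u)%R.
Proof. apply (ph_pos _ _ _ P). Qed.

Lemma nrm2_lc (c : C) (u v : V) :
  nrm2 (lc c u v) = (Cmod c * Cmod c * nrm2 u + 2 * Re (c * ip u v) + nrm2 v)%R.
Proof.
  unfold nrm2 at 1. rewrite (ph_lin _ _ _ P), !ip_lin_r, (ip_self u), (ip_self v), (ph_conj _ _ _ P u v).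
  set (p := ip u v).
  replace (c * (Cconj c * RtoC (nrm2 u) + p) + (Cconj c * Cconj p + RtoC (nrm2 v)))
    with (c * Cconj c * RtoC (nrm2 u) + (c * p + Cconj (c * p)) + RtoC (nrm2 v)) by (rewrite Cmult_conj; ring).
  rewrite mult_conj_re, <- RtoC_mult, !re_plus, re_conj, !re_RtoC. ring.
Qed.

Lemma nrm2_sub (u v : V) : nrm2 (psub u v) = (nrm2 u + nrm2 v - 2 * Re (ip u v))%R.
Proof.
  unfold psub. rewrite nrm2_lc, Cmod_m1.
  replace (- (1) * ip v u) with (- ip v u) by ring. rewrite re_opp, (ph_conj _ _ _ P u v), re_conj. ring.
Qed.

(** The discriminant argument, in a form that allows [a = 0], since the inner products are only
    semidefinite. In that case [s = (b + 1) / p] would make the quadratic negative. *)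
Lemma quad_nonneg (a b p : R) : (0 <= a)%R -> (forall s, 0 <= s * s * p * a - 2 * s * p + b)%R ->
  (0 <= p)%R -> (p <= a * b)%R.
Proof.
  intros ha H hp. destruct (Rle_lt_or_eq_dec _ _ ha) as [h|h].
  - specialize (H (/ a)%R). replace (/ a * / a * p * a - 2 * / a * p + b)%R with (b - p * / a)%R in H by (field; lra).
    replace p with (a * (p * / a))%R by (field; lra). apply Rmult_le_compat_l; lra.
  - subst a. rewrite Rmult_0_l. destruct (Rle_lt_or_eq_dec _ _ hp) as [h|h]; [|lra].
    assert (H0 := H 0%R). specialize (H ((b + 1) / p)%R).
    replace ((b + 1) / p * ((b + 1) / p) * p * 0 - 2 * ((b + 1) / p) * p + b)%R with (- b - 2)%R in H by (field; lra).
    lra.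
Qed.

Lemma cauchy_schwarz (u v : V) : (Cmod (ip u v) * Cmod (ip u v) <= nrm2 u * nrm2 v)%R.
Proof.
  set (p := ip u v). apply quad_nonneg; [apply nrm2_ge0| |assert (h := Cmod_ge_0 p); nra].
  intros s. assert (K := nrm2_ge0 (lc (RtoC (- s) * Cconj p) u v)). rewrite nrm2_lc in K. fold p in K.
  rewrite Cmod_mult, Cmod_R, Cmod_conj, Rabs_Ropp in K.
  replace (RtoC (- s) * Cconj p * p) with (RtoC (- s) * (p * Cconj p)) in K by ring.
  rewrite mult_conj_re, re_scal_l, re_RtoC in K.
  assert (E : (Rabs s * Rabs s = s * s)%R) by (rewrite <- Rabs_mult; apply Rabs_pos_eq; nra).
  replace (Rabs s * Cmod p * (Rabs s * Cmod p))%R with (Rabs s * Rabs s * (Cmod p * Cmod p))%R in K by ring.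
  rewrite E in K. nra.
Qed.

(** The square of [(a - b) - (b - c)] is nonnegative. This triangle inequality for squared norms
    avoids square roots. *)
Lemma nrm2_sub3 (a b c : V) : (nrm2 (psub a c) <= 2 * nrm2 (psub a b) + 2 * nrm2 (psub b c))%R.
Proof.
  assert (K := nrm2_ge0 (psub (psub a b) (psub b c))).
  rewrite (nrm2_sub (psub a b)) in K. rewrite !nrm2_sub in *.
  unfold psub in K. rewrite (ph_lin _ _ _ P), !ip_lin_r in K.
  rewrite !re_plus in K. rewrite (ip_self b) in K.
  replace (Cconj (- (1))) with (- (1) : C) in K by (rewrite Copp_conj, conj_RtoC; reflexivity).
  rewrite re_mult, !re_plus, im_plus, !re_mult, !im_mult, !re_RtoC, !im_RtoC in K.
  replace (Re (- (1))) with (-1)%R in K by (unfold Re, Copp, RtoC; simpl; ring).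
  replace (Im (- (1))) with 0%R in K by (unfold Im, Copp, RtoC; simpl; ring).
  rewrite (ph_conj _ _ _ P c b) in *. rewrite ?re_conj in *. lra.
Qed.

Lemma ip_cont (u : nat -> V) (f v : V) : plim u f -> ctends (fun n => ip (u n) v) (ip f v).
Proof.
  intros H e he. assert (hv := nrm2_ge0 v).
  destruct (H (e * e / (nrm2 v + 1))%R) as [N K]. { apply Rdiv_lt_0_compat; nra. }
  exists N. intros n hn. specialize (K n hn).
  replace (ip (u n) v - ip f v) with (ip (psub (u n) f) v) by (unfold psub; rewrite (ph_lin _ _ _ P); ring).
  assert (CS := cauchy_schwarz (psub (u n) f) v). assert (c0 := Cmod_ge_0 (ip (psub (u n) f) v)).
  assert (n0 := nrm2_ge0 (psub (u n) f)).
  apply (Rmult_lt_compat_r (nrm2 v + 1)) in K; [|lra].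
  unfold Rdiv in K. rewrite Rmult_assoc, Rinv_l, Rmult_1_r in K by lra.
  apply Rnot_le_lt. intros h. nra.
Qed.

Lemma ip_cont_r (u : nat -> V) (f v : V) : plim u f -> ctends (fun n => ip v (u n)) (ip v f).
Proof.
  intros H. rewrite (ph_conj _ _ _ P f v). apply (ctends_ext (fun n => Cconj (ip (u n) v))).
  - intros n. symmetry. apply (ph_conj _ _ _ P).
  - apply ctends_conj, ip_cont, H.
Qed.

Lemma pcauchy_bounded (u : nat -> V) : pcauchy u -> exists B, (0 <= B)%R /\ exists N, forall n, (N <= n)%nat -> (nrm2 (u n) <= B)%R.
Proof.
  intros H. destruct (H 1%R ltac:(lra)) as [N K].
  exists (2 * nrm2 (u N) + 2)%R. split; [assert (T := nrm2_ge0 (u N)); lra|]. exists N. intros n hn. specialize (K n N hn (le_n N)).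
  assert (Q := nrm2_ge0 (psub (psub (u n) (u N)) (u N))).
  rewrite nrm2_sub in Q. rewrite nrm2_sub in Q, K. unfold psub in Q.
  rewrite (ph_lin _ _ _ P), (ip_self (u N)), re_plus, re_mult, re_RtoC, im_RtoC in Q.
  replace (Re (- (1))) with (-1)%R in Q by (unfold Re, Copp, RtoC; simpl; ring).
  lra.
Qed.

Section Riesz.

Variables (L : V -> C) (B : R) (v0 : V).
Hypothesis Llin : forall c u v, L (lc c u v) = c * L u + L v.
Hypothesis HB0 : (0 <= B)%R.
Hypothesis HB : forall u, (Cmod (L u) * Cmod (L u) <= B * nrm2 u)%R.

Let J (u : V) : R := (nrm2 u - 2 * Re (L u))%R.

Lemma J_below (u : V) : (- B <= J u)%R.
Proof.
  unfold J. assert (h := re_le (L u)). assert (K := HB u). assert (n0 := nrm2_ge0 u). assert (c0 := Cmod_ge_0 (L u)).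
  assert ((2 * Cmod (L u)) * (2 * Cmod (L u)) <= (nrm2 u + B) * (nrm2 u + B))%R by (assert (Q := Rle_0_sqr (nrm2 u - B)); unfold Rsqr in Q; lra).
  assert (2 * Cmod (L u) <= nrm2 u + B)%R by (apply Rnot_lt_le; intros h'; nra). lra.
Qed.

Lemma J_inf : exists m, (forall u, m <= J u)%R /\ forall e : R, (0 < e)%R -> exists u, (J u < m + e)%R.
Proof.
  destruct (completeness (fun x => exists u, x = (- J u)%R)) as [m [Hm1 Hm2]].
  - exists B. intros x [u ->]. assert (T := J_below u). lra.
  - exists (- J v0)%R, v0. reflexivity.
  - exists (- m)%R. split.
    + intros u. assert (T := Hm1 (- J u)%R (ex_intro _ u eq_refl)). lra.
    + intros e he. apply NNPP. intros N. assert (T : (m <= m - e)%R); [|lra].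
      apply Hm2. intros x [u ->]. apply Rnot_lt_le. intros h. apply N. exists u. lra.
Qed.

Lemma J_lc (c : C) (v u : V) :
  J (lc c v u) = (J u + 2 * Re (c * (ip v u - L v)) + Cmod c * Cmod c * nrm2 v)%R.
Proof.
  unfold J. rewrite nrm2_lc, Llin, re_plus.
  replace (c * (ip v u - L v)) with (c * ip v u - c * L v) by ring. rewrite re_minus. ring.
Qed.

(* Minimising [|u|^2 - 2 Re (L u)]: the parallelogram identity makes minimising sequences Cauchy. *)
Lemma riesz_seq : exists u : nat -> V, pcauchy u /\ forall v, ctends (fun n => ip v (u n)) (L v).
Proof.
  destruct J_inf as [m [Hm1 Hm2]].
  assert (hp : forall n, (0 < / INR (S n))%R) by (intros n; apply Rinv_0_lt_compat, lt_0_INR; lia).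
  set (u := fun n => proj1_sig (constructive_indefinite_description _ (Hm2 _ (hp n)))).
  assert (Hu : forall n, (J (u n) < m + / INR (S n))%R).
  { intros n. unfold u. destruct (constructive_indefinite_description _ _); auto. }
  clearbody u.
  assert (small : forall e : R, (0 < e)%R -> exists N, forall n, (N <= n)%nat -> (/ INR (S n) < e)%R).
  { intros e he. assert (T := inv_INR_lim). apply is_lim_seq_spec in T. destruct (T (mkposreal e he)) as [N K].
    exists N. intros n hn. specialize (K n hn). simpl in K. rewrite Rminus_0_r in K. assert (A := Rle_abs (/ INR (S n))).
    simpl INR in *. lra. }
  exists u. split.
  - intros e he. destruct (small (e / 4)%R ltac:(lra)) as [N HN]. exists N. intros n k hn hk.
    assert (A := HN n hn). assert (A' := HN k hk). assert (B1 := Hu n). assert (B2 := Hu k).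
    (* half sum = u k + (u n - u k)/2 *)
    assert (M := Hm1 (lc (RtoC (1 / 2)) (psub (u n) (u k)) (u k))).
    rewrite J_lc, Cmod_R, Rabs_pos_eq in M by lra.
    rewrite re_scal_l, re_minus in M. unfold psub at 1 2 in M. rewrite (ph_lin _ _ _ P), Llin in M.
    rewrite (ip_self (u k)) in M. rewrite !re_plus, !re_mult, re_RtoC, im_RtoC in M.
    replace (Re (- (1))) with (-1)%R in M by (unfold Re, Copp, RtoC; simpl; ring).
    replace (Im (- (1))) with 0%R in M by (unfold Im, Copp, RtoC; simpl; ring).
    rewrite nrm2_sub in *. unfold J in *. lra.
  - intros v e he. assert (N0 := nrm2_ge0 v).
    destruct (small (e * e / (nrm2 v + 1))%R) as [N HN]. { apply Rdiv_lt_0_compat; nra. }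
    exists N. intros n hn. specialize (HN n hn). specialize (Hu n).
    set (d := ip v (u n) - L v). set (s := (/ (nrm2 v + 1))%R).
    (* Moving from [u n] by [- s * Cconj d] along [v] lowers [J] by at least [s * |d|^2], and
       near-minimality allows a drop of at most [/ INR (S n)]. The choice [s = / (nrm2 v + 1)] is
       close to optimal and tolerates [nrm2 v = 0]. *)
    assert (M := Hm1 (lc (RtoC (- s) * Cconj d) v (u n))). rewrite J_lc in M. fold d in M.
    replace (RtoC (- s) * Cconj d * d) with (RtoC (- s) * (d * Cconj d)) in M by ring.
    rewrite mult_conj_re, re_scal_l, re_RtoC, Cmod_mult, Cmod_R, Cmod_conj, Rabs_Ropp in M.
    assert (hs : (0 < s)%R) by (apply Rinv_0_lt_compat; lra). rewrite Rabs_pos_eq in M by lra.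
    assert (E : (s * (nrm2 v + 1) = 1)%R) by (unfold s; field; lra).
    set (D := (Cmod d * Cmod d)%R). assert (D0 : (0 <= D)%R) by (unfold D; assert (T := Cmod_ge_0 d); nra).
    assert (M' : (s * D <= / INR (S n))%R).
    { replace (s * Cmod d * (s * Cmod d) * nrm2 v)%R with (s * D * (s * nrm2 v))%R in M by (unfold D; ring).
      replace (s * nrm2 v)%R with (1 - s)%R in M by lra. fold D in M.
      assert (0 <= s * D * s)%R by (apply Rmult_le_pos; [apply Rmult_le_pos|]; lra). nra. }
    assert (M2 : (D < e * e)%R).
    { replace D with ((s * D) * (nrm2 v + 1))%R by (transitivity (s * (nrm2 v + 1) * D)%R; [ring|rewrite E; ring]).
      apply Rlt_le_trans with (e * e / (nrm2 v + 1) * (nrm2 v + 1))%R; [|right; field; lra].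
      apply Rmult_lt_compat_r; lra. }
    unfold D in M2. assert (T := Cmod_ge_0 d). apply Rnot_le_lt. intros h. nra.
Qed.

(** The sequence version [riesz_seq] is kept separate because it is also applied to formal
    combinations, a space that need not be complete. *)
Lemma riesz : pcomplete -> exists g, (forall v, L v = ip v g) /\ (nrm2 g <= B)%R.
Proof.
  intros HC. destruct riesz_seq as [u [Hu HL]]. destruct (HC u Hu) as [g Hg]. exists g.
  assert (E : forall v, L v = ip v g).
  { intros v. apply (ctends_unique (fun n => ip v (u n))); [apply HL|apply ip_cont_r, Hg]. }
  split; [exact E|]. assert (K := HB g). rewrite E, ip_self, Cmod_R, Rabs_pos_eq in K by apply nrm2_ge0.
  assert (n0 := nrm2_ge0 g). apply Rnot_lt_le. intros h. nra.
Qed.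

End Riesz.

End PreHilbert.

(** * Reproducing kernel Hilbert spaces *)

(* A list of pairs [(a, w)] stands for the formal combination of the sections [k(., w)] with coefficients [a]. *)
Definition flist := list (C * C).
Definition over (X : C -> Prop) (l : flist) : Prop := List.Forall (fun p => X (snd p)) l.

Fixpoint comb (k : C -> C -> C) (l : flist) (z : C) : C :=
  match l with nil => 0 | p :: l' => fst p * k z (snd p) + comb k l' z end.

(** By the reproducing property this is the inner product of [comb k l] with [f], hence conjugate
    linear in [f]. *)
Fixpoint pair (f : C -> C) (l : flist) : C :=
  match l with nil => 0 | p :: l' => fst p * Cconj (f (snd p)) + pair f l' end.

(** The conjugation restores the order of the arguments: in a reproducing kernel space this is the
    product of [comb k l] with [comb k m]. *)
Definition gram (k : C -> C -> C) (l m : flist) : C := Cconj (pair (comb k l) m).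

Definition lscal (c : C) (l : flist) : flist := map (fun p => (c * fst p, snd p)) l.

Definition fsub (X : C -> Prop) : Type := {l : flist | over X l}.

Lemma over_lc (X : C -> Prop) (c : C) (l m : fsub X) : over X (lscal c (proj1_sig l) ++ proj1_sig m).
Proof.
  apply Forall_app. split; [|exact (proj2_sig m)]. destruct l as [l Hl]. simpl.
  induction Hl; constructor; auto.
Qed.

Definition flc (X : C -> Prop) (c : C) (l m : fsub X) : fsub X :=
  exist _ (lscal c (proj1_sig l) ++ proj1_sig m) (over_lc X c l m).

Lemma comb_lc (k : C -> C -> C) (c : C) (l m : flist) (z : C) :
  comb k (lscal c l ++ m) z = c * comb k l z + comb k m z.
Proof. induction l as [|p l IH]; simpl; [ring|]. rewrite IH. ring. Qed.

Lemma pair_lc (f : C -> C) (c : C) (l m : flist) : pair f (lscal c l ++ m) = c * pair f l + pair f m.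
Proof. induction l as [|p l IH]; simpl; [ring|]. rewrite IH. ring. Qed.

Lemma pair_lin (c : C) (f g : C -> C) (l : flist) :
  pair (fun z => c * f z + g z) l = Cconj c * pair f l + pair g l.
Proof. induction l as [|p l IH]; simpl; [ring|]. rewrite IH, Cplus_conj, Cmult_conj. ring. Qed.

Lemma pair_ext (X : C -> Prop) (f g : C -> C) (l : flist) : over X l -> (forall w, X w -> f w = g w) ->
  pair f l = pair g l.
Proof. intros H E. induction H as [|p l hp H IH]; simpl; [reflexivity|]. rewrite IH, E by exact hp. reflexivity. Qed.

Lemma gram_single (k : C -> C -> C) (l : flist) (w : C) : gram k l ((RtoC 1, w) :: nil) = comb k l w.
Proof. unfold gram. simpl. rewrite Cplus_0_r, Cmult_1_l, Cconj_conj. reflexivity. Qed.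

Definition herm (X : C -> Prop) (k : C -> C -> C) : Prop :=
  forall z w, X z -> X w -> k w z = Cconj (k z w).

(** The hermitian clause makes the quadratic form real, so its real part is the whole form. *)
Definition posdef (X : C -> Prop) (k : C -> C -> C) : Prop :=
  herm X k /\ forall l, over X l -> (0 <= Re (gram k l l))%R.

Lemma gram_sym (X : C -> Prop) (k : C -> C -> C) (l m : flist) : herm X k -> over X l -> over X m ->
  gram k m l = Cconj (gram k l m).
Proof.
  intros Hk Hl Hm. unfold gram. rewrite Cconj_conj.
  induction Hl as [|[a w] l hw Hl IH].
  - simpl. rewrite conj_RtoC. induction Hm as [|[b v] m hv Hm IH']; simpl in *; [reflexivity|]. rewrite <- IH', conj_RtoC. ring.
  - simpl in *. rewrite Cplus_conj, IH, Cmult_conj, Cconj_conj. clear IH.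
    rewrite (pair_lin a (fun z => k z w)). f_equal. f_equal.
    induction Hm as [|[b v] m hv Hm IH']; simpl in *; [reflexivity|].
    rewrite <- IH', (Hk v w hv hw). reflexivity.
Qed.

Lemma fsub_preH (X : C -> Prop) (k : C -> C -> C) : posdef X k ->
  preH (fsub X) (flc X) (fun l m => gram k (proj1_sig l) (proj1_sig m)).
Proof.
  intros [Hk HP]. split.
  - intros c u v w. simpl. unfold gram.
    rewrite (pair_ext X _ (fun z => c * comb k (proj1_sig u) z + comb k (proj1_sig v) z)).
    + rewrite pair_lin, Cplus_conj, Cmult_conj, Cconj_conj. reflexivity.
    + exact (proj2_sig w).
    + intros z _. apply comb_lc.
  - intros u v. apply (gram_sym X); auto; apply proj2_sig.
  - intros u. apply HP, proj2_sig.
Qed.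

Section FunctionSpace.

Variables (H : (C -> C) -> Prop) (ip : (C -> C) -> (C -> C) -> C).
Hypothesis Hlin : forall (c : C) f g, H f -> H g -> H (fun z => c * f z + g z).

Definition hsub : Type := {f : C -> C | H f}.
Definition hlc (c : C) (f g : hsub) : hsub :=
  exist _ (fun z => c * proj1_sig f z + proj1_sig g z) (Hlin c _ _ (proj2_sig f) (proj2_sig g)).
Definition hip (f g : hsub) : C := ip (proj1_sig f) (proj1_sig g).

Lemma hsub_preH :
  (forall (c : C) f g k, H f -> H g -> H k -> ip (fun z => c * f z + g z) k = c * ip f k + ip g k) ->
  (forall f g, H f -> H g -> ip g f = Cconj (ip f g)) ->
  (forall f, H f -> (0 <= Re (ip f f))%R) -> preH hsub hlc hip.
Proof.
  intros A B D. split.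
  - intros c [u hu] [v hv] [w hw]. apply A; auto.
  - intros [u hu] [v hv]. apply B; auto.
  - intros [u hu]. apply D; auto.
Qed.

Lemma hsub_sub (f g : hsub) :
  proj1_sig (psub _ hlc f g) = fun z => proj1_sig f z - proj1_sig g z.
Proof. apply functional_extensionality. intros z. simpl. ring. Qed.

End FunctionSpace.

Section Rkhs.

Variables (U : C -> Prop) (k : C -> C -> C) (H : (C -> C) -> Prop) (ip : (C -> C) -> (C -> C) -> C).
Hypothesis HR : RKHS U k H ip.

Let HH := proj1 HR.
Let Hlin := hs_lin _ _ _ HH.

Lemma rk_preH : preH (hsub H) (hlc H Hlin) (hip H ip).
Proof. apply hsub_preH; [exact (ip_lin _ _ _ HH)|exact (ip_conj _ _ _ HH)|exact (ip_pos _ _ _ HH)]. Qed.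

Lemma sqrt_lt_sq (x e : R) : (0 < e)%R -> (sqrt x < e)%R -> (x < e * e)%R.
Proof.
  intros he hx. destruct (Rle_lt_dec x 0) as [h|h]; [nra|].
  assert (T := sqrt_sqrt x (Rlt_le _ _ h)). assert (p := sqrt_pos x). nra.
Qed.

Lemma rk_complete : pcomplete (hsub H) (hlc H Hlin) (hip H ip).
Proof.
  intros u Hu.
  destruct (hs_complete _ _ _ HH (fun n => proj1_sig (u n)) (fun n => proj2_sig (u n))) as [f [hf Hf]].
  - intros e. assert (he := cond_pos e). destruct (Hu (e * e)%R ltac:(nra)) as [N K].
    exists N. intros n m hn hm. specialize (K n m hn hm).
    unfold nrm2, hip in K. rewrite hsub_sub in K.
    rewrite <- (sqrt_square e) by lra. apply sqrt_lt_1_alt. split; [|exact K].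
    assert (T := ph_pos _ _ _ rk_preH (psub _ (hlc H Hlin) (u n) (u m))). unfold hip in T. rewrite hsub_sub in T. exact T.
  - exists (exist _ f hf). intros e he. apply is_lim_seq_spec in Hf.
    assert (hs := sqrt_lt_R0 e he). destruct (Hf (mkposreal _ hs)) as [N K]. exists N. intros n hn.
    specialize (K n hn). simpl in K. rewrite Rminus_0_r in K.
    unfold nrm2, hip. rewrite hsub_sub. simpl.
    assert (K' := Rle_lt_trans _ _ _ (Rle_abs _) K). apply sqrt_lt_sq in K'; [|exact hs].
    rewrite sqrt_sqrt in K' by lra. exact K'.
Qed.

Lemma rk_section (w : C) : U w -> H (fun z => k z w).
Proof. intros hw. apply (proj2 HR w hw). Qed.

Lemma rk_eval (w : C) (f : C -> C) : U w -> H f -> f w = ip f (fun z => k z w).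
Proof. intros hw. apply (proj2 HR w hw). Qed.

Lemma rk_comb (l : flist) : over U l -> H (comb k l).
Proof.
  intros Hl. induction Hl as [|[a w] l hw Hl IH]; [exact (hs_zero _ _ _ HH)|].
  exact (Hlin a _ _ (rk_section w hw) IH).
Qed.

Lemma rk_ip_zero (g : C -> C) : H g -> ip (fun _ => 0) g = 0.
Proof.
  intros hg. assert (E := ip_lin _ _ _ HH 1 (fun _ => 0) (fun _ => 0) g (hs_zero _ _ _ HH) (hs_zero _ _ _ HH) hg).
  cbv beta in E. replace (fun _ : C => 1 * 0 + 0) with (fun _ : C => RtoC 0) in E by (apply functional_extensionality; intros; ring).
  set (x := ip (fun _ => 0) g) in *. apply (f_equal (fun y => y - x)) in E.
  replace (x - x) with (RtoC 0) in E by ring. replace (1 * x + x - x) with x in E by ring. symmetry. exact E.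
Qed.

Lemma rk_ip_comb (l : flist) (g : C -> C) : over U l -> H g -> ip (comb k l) g = pair g l.
Proof.
  intros Hl hg. induction Hl as [|[a w] l hw Hl IH]; [apply rk_ip_zero, hg|].
  simpl in *. rewrite <- IH. change (ip (fun z => a * k z w + comb k l z) g = a * Cconj (g w) + ip (comb k l) g).
  rewrite (ip_lin _ _ _ HH) by (auto using rk_section, rk_comb). f_equal. f_equal.
  rewrite (rk_eval w g hw hg). apply (ip_conj _ _ _ HH); auto using rk_section.
Qed.

Lemma rk_gram (l m : flist) : over U l -> over U m -> gram k l m = ip (comb k l) (comb k m).
Proof.
  intros Hl Hm. unfold gram. rewrite <- rk_ip_comb by auto using rk_comb.
  symmetry. apply (ip_conj _ _ _ HH); apply rk_comb; auto.
Qed.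

Lemma rk_eval_bound (w : C) (f : C -> C) : U w -> H f ->
  (Cmod (f w) * Cmod (f w) <= Re (ip f f) * Re (k w w))%R.
Proof.
  intros hw hf. rewrite (rk_eval w f hw hf), (rk_eval w _ hw (rk_section w hw)).
  exact (cauchy_schwarz _ _ _ rk_preH (exist _ f hf) (exist _ _ (rk_section w hw))).
Qed.

Lemma rk_herm : herm U k.
Proof.
  intros z w hz hw. rewrite (rk_eval w _ hw (rk_section z hz)), (rk_eval z _ hz (rk_section w hw)).
  apply (ip_conj _ _ _ HH); auto using rk_section.
Qed.

Lemma rk_posdef (X : C -> Prop) : (forall z, X z -> U z) -> posdef X k.
Proof.
  intros HX. assert (O : forall l, over X l -> over U l).
  { intros l. apply Forall_impl. auto. }
  split.
  - intros z w hz hw. apply rk_herm; auto.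
  - intros l Hl. rewrite rk_gram by auto. apply (ip_pos _ _ _ HH), rk_comb, O, Hl.
Qed.

(** The interpolation criterion: the hypothesis says that pairing with [f] is a bounded functional
    on the formal combinations over [X]. Its Riesz sequence is Cauchy there, so the corresponding
    functions converge in [H], and the limit takes the values of [f] on [X]. *)
Lemma rk_criterion (X : C -> Prop) (f : C -> C) (c : R) : (forall z, X z -> U z) -> (0 <= c)%R ->
  (forall l, over X l -> Cmod (pair f l) * Cmod (pair f l) <= c * Re (gram k l l))%R ->
  exists F, H F /\ (forall w, X w -> F w = f w) /\ (Re (ip F F) <= c)%R.
Proof.
  intros HX hc Hf.
  assert (O : forall l : fsub X, over U (proj1_sig l)).
  { intros [l Hl]. simpl. revert Hl. apply Forall_impl. auto. }
  set (cb := fun l : fsub X => exist _ (comb k (proj1_sig l)) (rk_comb _ (O l)) : hsub H).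
  assert (PV := fsub_preH X k (rk_posdef X HX)). set (ipV := fun l m : fsub X => gram k (proj1_sig l) (proj1_sig m)) in PV.
  assert (PH := rk_preH).
  assert (E : forall l m, ipV l m = hip H ip (cb l) (cb m)) by (intros; apply rk_gram; apply O).
  destruct (riesz_seq (fsub X) (flc X) ipV PV (fun l => pair f (proj1_sig l)) c (exist _ nil (List.Forall_nil _)))
    as [u [Hu HL]].
  - intros a l m. simpl. apply pair_lc.
  - exact hc.
  - intros l. apply Hf, proj2_sig.
  - assert (Hcu : pcauchy _ (hlc H Hlin) (hip H ip) (fun n => cb (u n))).
    { intros e he. destruct (Hu e he) as [N K]. exists N. intros n m hn hm. specialize (K n m hn hm).
      rewrite nrm2_sub in K by exact PV. rewrite nrm2_sub by exact PH.
      unfold nrm2 in *. rewrite !E in K. exact K. }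
    destruct (rk_complete _ Hcu) as [[F hF] HF].
    assert (EL : forall l, pair f (proj1_sig l) = hip H ip (cb l) (exist _ F hF)).
    { intros l. apply (ctends_unique (fun n => ipV l (u n))); [apply HL|].
      apply (ctends_ext (fun n => hip H ip (cb l) (cb (u n)))); [intros; symmetry; apply E|].
      apply (ip_cont_r _ _ _ PH _ _ _ HF). }
    exists F. split; [exact hF|]. split.
    + intros w hw. assert (Ow : over X ((RtoC 1, w) :: nil)) by (constructor; [exact hw|constructor]).
      assert (T : pair f ((RtoC 1, w) :: nil) = ip (comb k ((RtoC 1, w) :: nil)) F) by exact (EL (exist _ _ Ow)).
      rewrite rk_ip_comb in T; [|apply (O (exist _ _ Ow))|exact hF]. simpl in T.
      rewrite !Cmult_1_l, !Cplus_0_r in T. rewrite <- (Cconj_conj (F w)), <- T. apply Cconj_conj.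
    + change (Re (ip F F)) with (nrm2 _ (hip H ip) (exist _ F hF)).
      set (G := exist _ F hF : hsub H) in *.
      assert (n0 := nrm2_ge0 _ _ _ PH G).
      (* The hypothesis is tested on the approximating combinations themselves and passed to the
         limit. *)
      assert (A : (nrm2 _ (hip H ip) G * nrm2 _ (hip H ip) G <= c * nrm2 _ (hip H ip) G)%R).
      { apply (is_lim_seq_le (fun n => Cmod (hip H ip (cb (u n)) G) * Cmod (hip H ip (cb (u n)) G))%R
          (fun n => (c * nrm2 _ (hip H ip) (cb (u n)))%R) (nrm2 _ (hip H ip) G * nrm2 _ (hip H ip) G)%R
          (c * nrm2 _ (hip H ip) G)%R).
        - intros n. rewrite <- EL. eapply Rle_trans; [apply Hf, proj2_sig|]. right. f_equal.
          unfold nrm2. rewrite <- E. reflexivity.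
        - assert (T := ctends_Cmod _ _ (ip_cont _ _ _ PH _ _ G HF)).
          rewrite (ip_self _ _ _ PH G), Cmod_R, Rabs_pos_eq in T by exact n0.
          apply is_lim_seq_mult'; exact T.
        - apply (is_lim_seq_scal_l _ c (nrm2 _ (hip H ip) G)).
          apply is_lim_seq_spec. intros e.
          (* |u_n|^2 = |u_n - G|^2 - |G|^2 + 2 Re <u_n, G> *)
          assert (T1 := proj1 (proj1 (ctends_is_lim _ _) (ip_cont _ _ _ PH _ _ G HF))).
          apply is_lim_seq_spec in T1. assert (he := cond_pos e). assert (he4 : (0 < e / 4)%R) by lra.
          destruct (T1 (mkposreal _ he4)) as [N1 K1]. destruct (HF (e / 4)%R he4) as [N2 K2].
          exists (N1 + N2)%nat. intros n hn. specialize (K1 n ltac:(lia)). specialize (K2 n ltac:(lia)).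
          assert (K3 := nrm2_ge0 _ _ _ PH (psub _ (hlc H Hlin) (cb (u n)) G)).
          rewrite nrm2_sub in K2, K3 by exact PH. simpl in K1. rewrite (ip_self _ _ _ PH G), re_RtoC in K1.
          apply Rabs_lt_between in K1. apply Rabs_lt_between.
          change (nrm2 _ (hip H ip) (exist _ F hF)) with (nrm2 _ (hip H ip) G) in *. lra. }
      apply Rnot_lt_le. intros h. nra.
Qed.

End Rkhs.

(** * Cauchy sequences in semi-inner product spaces *)

Section Completion.

Variables (V : Type) (lc : C -> V -> V -> V) (ip : V -> V -> C).
Hypothesis P : preH V lc ip.

Local Notation nrm := (nrm2 V ip).
Local Notation sub := (psub V lc).
Local Notation cauchy := (pcauchy V lc ip).

Lemma nrm2_eqv (x y : V) : (forall w, ip x w = ip y w) -> nrm x = nrm y.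
Proof.
  intros E. unfold nrm2. rewrite (E x), (ph_conj _ _ _ P x y), (E y), re_conj. reflexivity.
Qed.

Lemma nrm2_lc_le (c : C) (u v : V) : (nrm (lc c u v) <= 2 * (Cmod c * Cmod c) * nrm u + 2 * nrm v)%R.
Proof.
  assert (K := nrm2_ge0 _ _ _ P (lc (- c) u v)). rewrite nrm2_lc in * by exact P.
  rewrite Cmod_opp in K. replace (- c * ip u v) with (- (c * ip u v)) in K by ring. rewrite re_opp in K. lra.
Qed.

Lemma pcauchy_lc (c : C) (u v : nat -> V) : cauchy u -> cauchy v -> cauchy (fun n => lc c (u n) (v n)).
Proof.
  intros Hu Hv e he. set (m := (Cmod c * Cmod c)%R).
  assert (hm : (0 <= m)%R) by (unfold m; assert (T := Cmod_ge_0 c); nra).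
  destruct (Hu (e / (4 * (m + 1)))%R) as [N K]. { apply Rdiv_lt_0_compat; lra. }
  destruct (Hv (e / 4)%R ltac:(lra)) as [N' K'].
  exists (N + N')%nat. intros n p hn hp. specialize (K n p ltac:(lia) ltac:(lia)). specialize (K' n p ltac:(lia) ltac:(lia)).
  rewrite (nrm2_eqv _ (lc c (sub (u n) (u p)) (sub (v n) (v p)))).
  2:{ intros w. unfold psub. rewrite !(ph_lin _ _ _ P). ring. }
  eapply Rle_lt_trans; [apply nrm2_lc_le|]. fold m.
  apply (Rmult_lt_compat_r (4 * (m + 1))) in K; [|lra].
  unfold Rdiv in K. rewrite Rmult_assoc, Rinv_l, Rmult_1_r in K by lra.
  assert (n0 := nrm2_ge0 _ _ _ P (sub (u n) (u p))). nra.
Qed.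

Lemma pcauchy_const (u : V) : cauchy (fun _ => u).
Proof.
  intros e he. exists 0%nat. intros n m _ _. rewrite nrm2_sub by exact P. unfold nrm2. lra.
Qed.

Lemma ip_small (a b : V) (e B : R) : (0 < e)%R -> (0 <= B)%R -> (nrm b <= B)%R ->
  (nrm a < e * e / (B + 1))%R -> (Cmod (ip a b) < e)%R.
Proof.
  intros he hB hb ha. assert (CS := cauchy_schwarz _ _ _ P a b). assert (a0 := nrm2_ge0 _ _ _ P a).
  assert (b0 := nrm2_ge0 _ _ _ P b). assert (c0 := Cmod_ge_0 (ip a b)).
  apply (Rmult_lt_compat_r (B + 1)) in ha; [|lra].
  unfold Rdiv in ha. rewrite Rmult_assoc, Rinv_l, Rmult_1_r in ha by lra.
  apply Rnot_le_lt. intros h. nra.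
Qed.

Lemma pcauchy_ip (u v : nat -> V) : cauchy u -> cauchy v -> exists l, ctends (fun n => ip (u n) (v n)) l.
Proof.
  intros Hu Hv.
  destruct (pcauchy_bounded _ _ _ P u Hu) as [B [hB [N1 HB]]].
  destruct (pcauchy_bounded _ _ _ P v Hv) as [B' [hB' [N2 HB']]].
  apply ctends_Cauchy. intros e he. assert (he2 : (0 < e / 2)%R) by lra.
  destruct (Hu (e / 2 * (e / 2) / (B' + 1))%R) as [N3 K3]. { apply Rdiv_lt_0_compat; nra. }
  destruct (Hv (e / 2 * (e / 2) / (B + 1))%R) as [N4 K4]. { apply Rdiv_lt_0_compat; nra. }
  exists (N1 + N2 + N3 + N4)%nat. intros n m hn hm.
  replace (ip (u n) (v n) - ip (u m) (v m)) with (ip (sub (u n) (u m)) (v n) + ip (u m) (sub (v n) (v m))).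
  2:{ unfold psub. rewrite (ph_lin _ _ _ P), (ip_lin_r _ _ _ P), Copp_conj, conj_RtoC. ring. }
  eapply Rle_lt_trans; [apply Cmod_triangle|].
  assert (A1 := ip_small (sub (u n) (u m)) (v n) (e / 2) B' he2 hB' (HB' n ltac:(lia)) (K3 n m ltac:(lia) ltac:(lia))).
  assert (A2 := ip_small (sub (v n) (v m)) (u m) (e / 2) B he2 hB (HB m ltac:(lia)) (K4 n m ltac:(lia) ltac:(lia))).
  rewrite (ph_conj _ _ _ P (u m)), Cmod_conj in A2. lra.
Qed.

(** The squared norm of [u n] splits as the product of [u n - u N] with [u n] plus that of [u N]
    with [u n]: the first is small by the Cauchy property, the second by weak convergence. *)
Lemma pcauchy_weak_zero (u : nat -> V) : cauchy u -> (forall v, ctends (fun n => ip (u n) v) 0) ->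
  forall e : R, (0 < e)%R -> exists N, forall n, (N <= n)%nat -> (nrm (u n) < e)%R.
Proof.
  intros Hu H0 e he.
  destruct (pcauchy_bounded _ _ _ P u Hu) as [B [hB [N1 HB]]].
  destruct (Hu (e / 2 * (e / 2) / (B + 1))%R) as [N2 K2]. { apply Rdiv_lt_0_compat; nra. }
  destruct (H0 (u N2) (e / 2)%R ltac:(lra)) as [N3 K3].
  exists (N1 + N2 + N3)%nat. intros n hn.
  assert (A1 := ip_small (sub (u n) (u N2)) (u n) (e / 2) B ltac:(lra) hB (HB n ltac:(lia)) (K2 n N2 ltac:(lia) ltac:(lia))).
  specialize (K3 n ltac:(lia)). replace (ip (u n) (u N2) - 0) with (ip (u n) (u N2)) in K3 by ring.
  assert (E : ip (u n) (u n) = ip (sub (u n) (u N2)) (u n) + ip (u N2) (u n)).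
  { unfold psub. rewrite (ph_lin _ _ _ P). ring. }
  rewrite (ph_conj _ _ _ P (u n) (u N2)) in E.
  assert (T : (nrm (u n) <= Cmod (ip (u n) (u n)))%R) by apply re_le.
  rewrite E in T. assert (T' := Cmod_triangle (ip (sub (u n) (u N2)) (u n)) (Cconj (ip (u n) (u N2)))).
  rewrite Cmod_conj in T'. lra.
Qed.

End Completion.

(** * The Moore-Aronszajn construction of a space from its kernel *)

Section MooreAronszajn.

Variables (U : C -> Prop) (k : C -> C -> C).
Hypothesis HP : posdef U k.

Let lcU := flc U.
Let ipU := fun l m : fsub U => gram k (proj1_sig l) (proj1_sig m).
Let PV : preH (fsub U) lcU ipU := fsub_preH U k HP.

(** The completion is realised directly by functions: an element is the pointwise limit on [U] of a
    norm-Cauchy sequence of combinations. *)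
Definition ma_rep (u : nat -> fsub U) (f : C -> C) : Prop :=
  pcauchy (fsub U) (flc U) (fun l m => gram k (proj1_sig l) (proj1_sig m)) u /\
  forall z, U z -> ctends (fun n => comb k (proj1_sig (u n)) z) (f z).

Definition ma_space (f : C -> C) : Prop := exists u, ma_rep u f.

(* The limit does not depend on the representing sequences, since a Cauchy sequence of combinations that tends
   pointwise to [0] tends to [0] in norm. *)
Definition ma_ip (f g : C -> C) : C :=
  epsilon (inhabits (RtoC 0)) (fun c => forall u v, ma_rep u f -> ma_rep v g ->
    ctends (fun n => gram k (proj1_sig (u n)) (proj1_sig (v n))) c).

Lemma ma_rep_lc (c : C) (u v : nat -> fsub U) (f g : C -> C) : ma_rep u f -> ma_rep v g ->
  ma_rep (fun n => lcU c (u n) (v n)) (fun z => c * f z + g z).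
Proof.
  intros [Hu Ru] [Hv Rv]. split; [apply (pcauchy_lc _ _ _ PV); auto|].
  intros z hz. apply (ctends_ext (fun n => c * comb k (proj1_sig (u n)) z + comb k (proj1_sig (v n)) z)).
  - intros n. symmetry. apply comb_lc.
  - apply ctends_plus; [apply ctends_mult; [apply ctends_const|]|]; auto.
Qed.

Lemma ma_rep_weak (u : nat -> fsub U) : ma_rep u (fun _ => 0) -> forall v, ctends (fun n => ipU (u n) v) 0.
Proof.
  intros [_ Ru] [m Hm]. unfold ipU. simpl. unfold gram.
  rewrite <- (conj_RtoC 0). apply ctends_conj. induction Hm as [|[b w] m hw Hm IH]; [exact (ctends_const 0)|].
  simpl in *. replace (RtoC 0) with (b * Cconj 0 + 0) by (rewrite conj_RtoC; ring).
  apply ctends_plus; [|exact IH]. apply ctends_mult; [apply ctends_const|]. apply ctends_conj, Ru, hw.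
Qed.

Lemma ma_rep_diff (u u' : nat -> fsub U) (f : C -> C) : ma_rep u f -> ma_rep u' f ->
  forall e : R, (0 < e)%R -> exists N, forall n, (N <= n)%nat -> (nrm2 _ ipU (psub _ lcU (u n) (u' n)) < e)%R.
Proof.
  intros Hu Hu'. assert (R := ma_rep_lc (- (1)) u' u f f Hu' Hu).
  assert (R0 : ma_rep (fun n => psub _ lcU (u n) (u' n)) (fun _ => 0)).
  { destruct R as [A B]. split; [exact A|]. intros z hz. specialize (B z hz). cbv beta in B.
    replace (- (1) * f z + f z) with (RtoC 0) in B by ring. exact B. }
  apply (pcauchy_weak_zero _ _ _ PV); [apply R0|]. apply ma_rep_weak, R0.
Qed.

Lemma ma_ip_spec (u v : nat -> fsub U) (f g : C -> C) : ma_rep u f -> ma_rep v g ->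
  ctends (fun n => ipU (u n) (v n)) (ma_ip f g).
Proof.
  intros Hu Hv. unfold ma_ip.
  apply (epsilon_spec (inhabits (RtoC 0)) (fun c => forall u v, ma_rep u f -> ma_rep v g ->
    ctends (fun n => gram k (proj1_sig (u n)) (proj1_sig (v n))) c)); [|exact Hu|exact Hv].
  destruct (pcauchy_ip _ _ _ PV u v (proj1 Hu) (proj1 Hv)) as [c Hc]. exists c.
  intros u' v' Hu' Hv'. change (ctends (fun n => ipU (u' n) (v' n)) c).
  (* The two representing sequences are exchanged one at a time. Each error tends to [0], because
     the difference does so in norm while the other factor stays bounded. *)
  assert (step : forall a a' b : nat -> fsub U, pcauchy _ lcU ipU b ->
    (forall e : R, (0 < e)%R -> exists N, forall n, (N <= n)%nat -> (nrm2 _ ipU (psub _ lcU (a n) (a' n)) < e)%R) ->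
    ctends (fun n => ipU (a n) (b n) - ipU (a' n) (b n)) 0).
  { intros a a' b Hb Ha e he. destruct (pcauchy_bounded _ _ _ PV b Hb) as [B [hB [N1 HB]]].
    destruct (Ha (e * e / (B + 1))%R) as [N2 K2]. { apply Rdiv_lt_0_compat; nra. }
    exists (N1 + N2)%nat. intros n hn.
    assert (T := ip_small _ _ _ PV _ _ e B he hB (HB n ltac:(lia)) (K2 n ltac:(lia))).
    replace (ipU (a n) (b n) - ipU (a' n) (b n) - 0) with (ipU (psub _ lcU (a n) (a' n)) (b n)); [exact T|].
    unfold psub. rewrite (ph_lin _ _ _ PV). ring. }
  assert (S1 := step u' u v (proj1 Hv) (ma_rep_diff u' u f Hu' Hu)).
  assert (S2 := step v' v u' (proj1 Hu') (ma_rep_diff v' v g Hv' Hv)). apply ctends_conj in S2. rewrite conj_RtoC in S2.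
  apply (ctends_ext (fun n => (ipU (u n) (v n) + (ipU (u' n) (v n) - ipU (u n) (v n)))
     + Cconj (ipU (v' n) (u' n) - ipU (v n) (u' n)))).
  - intros n. rewrite Cminus_conj, <- !(ph_conj _ _ _ PV). ring.
  - replace c with (c + 0 + 0) by ring. apply ctends_plus; [apply ctends_plus|]; auto.
Qed.

Lemma ma_rep_const (l : fsub U) : ma_rep (fun _ => l) (comb k (proj1_sig l)).
Proof. split; [apply (pcauchy_const _ _ _ PV)|]. intros z _. apply ctends_const. Qed.

Lemma ma_ip_lin (c : C) (f g h : C -> C) : ma_space f -> ma_space g -> ma_space h ->
  ma_ip (fun z => c * f z + g z) h = c * ma_ip f h + ma_ip g h.
Proof.
  intros [u Hu] [v Hv] [w Hw].
  apply (ctends_unique _ _ _ (ma_ip_spec _ _ _ _ (ma_rep_lc c u v f g Hu Hv) Hw)).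
  apply (ctends_ext (fun n => c * ipU (u n) (w n) + ipU (v n) (w n))).
  - intros n. symmetry. apply (ph_lin _ _ _ PV).
  - apply ctends_plus; [apply ctends_mult; [apply ctends_const|]|]; apply ma_ip_spec; auto.
Qed.

Lemma ma_ip_conj (f g : C -> C) : ma_space f -> ma_space g -> ma_ip g f = Cconj (ma_ip f g).
Proof.
  intros [u Hu] [v Hv]. apply (ctends_unique _ _ _ (ma_ip_spec _ _ _ _ Hv Hu)).
  apply (ctends_ext (fun n => Cconj (ipU (u n) (v n)))).
  - intros n. symmetry. apply (ph_conj _ _ _ PV).
  - apply ctends_conj, ma_ip_spec; auto.
Qed.

Lemma ma_ip_pos (f : C -> C) : ma_space f -> (0 <= Re (ma_ip f f))%R.
Proof.
  intros [u Hu]. assert (T := proj1 (proj1 (ctends_is_lim _ _) (ma_ip_spec _ _ _ _ Hu Hu))).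
  apply (is_lim_seq_le (fun _ => 0%R) (fun n => Re (ipU (u n) (u n))) 0%R (Re (ma_ip f f))).
  - intros n. apply (ph_pos _ _ _ PV).
  - apply is_lim_seq_const.
  - exact T.
Qed.

Lemma ma_lin (c : C) (f g : C -> C) : ma_space f -> ma_space g -> ma_space (fun z => c * f z + g z).
Proof. intros [u Hu] [v Hv]. eexists. apply (ma_rep_lc c u v f g Hu Hv). Qed.

Let PH : preH (hsub ma_space) (hlc ma_space ma_lin) (hip ma_space ma_ip) :=
  hsub_preH ma_space ma_ip ma_lin ma_ip_lin ma_ip_conj ma_ip_pos.

Lemma ma_section (w : C) : U w -> ma_space (fun z => k z w).
Proof.
  intros hw. assert (O : over U ((RtoC 1, w) :: nil)) by (constructor; [exact hw|constructor]).
  exists (fun _ => exist _ _ O). destruct (ma_rep_const (exist _ _ O)) as [A B]. split; [exact A|].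
  intros z hz. specialize (B z hz). simpl in *. rewrite Cmult_1_l, Cplus_0_r in B. rewrite Cmult_1_l, Cplus_0_r. exact B.
Qed.

Lemma ma_eval (w : C) (f : C -> C) : U w -> ma_space f -> f w = ma_ip f (fun z => k z w).
Proof.
  intros hw [u Hu]. assert (O : over U ((RtoC 1, w) :: nil)) by (constructor; [exact hw|constructor]).
  assert (R : ma_rep (fun _ => exist _ _ O) (fun z => k z w)).
  { destruct (ma_rep_const (exist _ _ O)) as [A B]. split; [exact A|].
    intros z hz. specialize (B z hz). simpl in *. rewrite Cmult_1_l, Cplus_0_r in B. rewrite Cmult_1_l, Cplus_0_r. exact B. }
  apply (ctends_unique _ _ _ (proj2 Hu w hw)).
  apply (ctends_ext (fun n => ipU (u n) (exist _ _ O))); [|apply ma_ip_spec; auto].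
  intros n. apply gram_single.
Qed.

Lemma ma_comb (l : fsub U) : ma_space (comb k (proj1_sig l)).
Proof. exists (fun _ => l). apply ma_rep_const. Qed.

Let cb (l : fsub U) : hsub ma_space := exist _ (comb k (proj1_sig l)) (ma_comb l).

(** The squared distance from [u n] to [f] is the limit in [m] of that from [u n] to [u m]. *)
Lemma ma_approx (u : nat -> fsub U) (f : hsub ma_space) : ma_rep u (proj1_sig f) ->
  plim _ (hlc ma_space ma_lin) (hip ma_space ma_ip) (fun n => cb (u n)) f.
Proof.
  intros Hu e he. destruct (proj1 Hu (e / 2)%R ltac:(lra)) as [N K]. exists N. intros n hn.
  rewrite nrm2_sub by exact PH.
  assert (A1 := ma_ip_spec _ _ _ _ (ma_rep_const (u n)) (ma_rep_const (u n))).
  assert (A2 := ma_ip_spec _ _ _ _ Hu Hu). assert (A3 := ma_ip_spec _ _ _ _ (ma_rep_const (u n)) Hu).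
  apply ctends_is_lim in A1, A2, A3. destruct A1 as [A1 _], A2 as [A2 _], A3 as [A3 _].
  assert (T : (nrm2 _ (hip ma_space ma_ip) (cb (u n)) + nrm2 _ (hip ma_space ma_ip) f
    - 2 * Re (hip ma_space ma_ip (cb (u n)) f) <= e / 2)%R); [|lra].
  apply (is_lim_seq_le_loc (fun m => Re (ipU (u n) (u n)) + Re (ipU (u m) (u m)) - 2 * Re (ipU (u n) (u m)))%R
    (fun _ => e / 2)%R (nrm2 _ (hip ma_space ma_ip) (cb (u n)) + nrm2 _ (hip ma_space ma_ip) f
    - 2 * Re (hip ma_space ma_ip (cb (u n)) f))%R (e / 2)%R).
  - exists N. intros m hm. specialize (K n m hn hm). change (nrm2 _ ipU (psub _ lcU (u n) (u m)) < e / 2)%R in K.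
    rewrite nrm2_sub in K by exact PV. unfold nrm2 in K. lra.
  - apply is_lim_seq_minus'; [apply is_lim_seq_plus'|]; [exact A1|exact A2|].
    apply (is_lim_seq_scal_l _ 2 (Re (ma_ip (comb k (proj1_sig (u n))) (proj1_sig f)))). exact A3.
  - apply is_lim_seq_const.
Qed.

(** Each [g n] is replaced by a combination at squared distance below [/ INR (S n)]. These
    combinations form a Cauchy sequence, which represents the required limit by the definition of
    the space. *)
Lemma ma_complete : pcomplete _ (hlc ma_space ma_lin) (hip ma_space ma_ip).
Proof.
  intros g Hg.
  assert (D : forall n, exists l : fsub U,
    (nrm2 _ (hip ma_space ma_ip) (psub _ (hlc ma_space ma_lin) (cb l) (g n)) < / INR (S n))%R).
  { intros n. destruct (proj2_sig (g n)) as [u Hu].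
    assert (hp : (0 < / INR (S n))%R) by (apply Rinv_0_lt_compat, lt_0_INR; lia).
    destruct (ma_approx u (g n) Hu _ hp) as [N K]. exists (u N). apply K. lia. }
  set (l := fun n => proj1_sig (constructive_indefinite_description _ (D n))).
  assert (Hl : forall n, (nrm2 _ (hip ma_space ma_ip) (psub _ (hlc ma_space ma_lin) (cb (l n)) (g n)) < / INR (S n))%R).
  { intros n. unfold l. destruct (constructive_indefinite_description _ _); auto. }
  clearbody l.
  assert (E : forall a b, nrm2 _ ipU (psub _ lcU a b) =
    nrm2 _ (hip ma_space ma_ip) (psub _ (hlc ma_space ma_lin) (cb a) (cb b))).
  { assert (E0 : forall a b, ipU a b = hip ma_space ma_ip (cb a) (cb b)).
    { intros a b. apply (ctends_unique _ _ _ (ctends_const (ipU a b))). apply (ma_ip_spec (fun _ => a) (fun _ => b)); apply ma_rep_const. }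
    intros a b. rewrite nrm2_sub by exact PV. rewrite nrm2_sub by exact PH. unfold nrm2. rewrite !E0. reflexivity. }
  assert (small : forall e : R, (0 < e)%R -> exists N, forall n, (N <= n)%nat -> (/ INR (S n) < e)%R).
  { intros e he. assert (T := inv_INR_lim). apply is_lim_seq_spec in T. destruct (T (mkposreal e he)) as [N K].
    exists N. intros n hn. specialize (K n hn). simpl pos in K. rewrite Rminus_0_r in K. assert (A := Rle_abs (/ INR (S n))).
    lra. }
  assert (sym : forall a b : hsub ma_space, nrm2 _ (hip ma_space ma_ip) (psub _ (hlc ma_space ma_lin) a b) =
     nrm2 _ (hip ma_space ma_ip) (psub _ (hlc ma_space ma_lin) b a)).
  { intros a b. rewrite !nrm2_sub by exact PH. rewrite (ph_conj _ _ _ PH a b), re_conj. ring. }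
  assert (Cl : pcauchy _ lcU ipU l).
  { intros e he. destruct (small (e / 16)%R ltac:(lra)) as [N1 K1]. destruct (Hg (e / 16)%R ltac:(lra)) as [N2 K2].
    exists (N1 + N2)%nat. intros n m hn hm. rewrite E.
    assert (A1 := nrm2_sub3 _ _ _ PH (cb (l n)) (g n) (cb (l m))).
    assert (A2 := nrm2_sub3 _ _ _ PH (g n) (g m) (cb (l m))). rewrite (sym (g m)) in A2.
    assert (B1 := Hl n). assert (B2 := Hl m). assert (B3 := K1 n ltac:(lia)). assert (B4 := K1 m ltac:(lia)).
    specialize (K2 n m ltac:(lia) ltac:(lia)). lra. }
  assert (Pt : forall z, U z -> exists y, ctends (fun n => comb k (proj1_sig (l n)) z) y).
  { intros z hz. assert (O : over U ((RtoC 1, z) :: nil)) by (constructor; [exact hz|constructor]).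
    destruct (pcauchy_ip _ _ _ PV l (fun _ => exist _ _ O) Cl (pcauchy_const _ _ _ PV _)) as [y Hy].
    exists y. apply (ctends_ext (fun n => ipU (l n) (exist _ _ O))); [|exact Hy]. intros n. apply gram_single. }
  set (F := fun z => clim (fun n => comb k (proj1_sig (l n)) z)).
  assert (RF : ma_rep l F) by (split; [exact Cl|]; intros z hz; apply clim_correct, Pt, hz).
  set (f := exist _ F (ex_intro _ l RF) : hsub ma_space).
  exists f. intros e he. destruct (ma_approx l f RF (e / 4)%R ltac:(lra)) as [N1 K1].
  destruct (small (e / 4)%R ltac:(lra)) as [N2 K2]. exists (N1 + N2)%nat. intros n hn.
  assert (A := nrm2_sub3 _ _ _ PH (g n) (cb (l n)) f). rewrite (sym (g n) (cb (l n))) in A.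
  specialize (K1 n ltac:(lia)). specialize (K2 n ltac:(lia)). specialize (Hl n). lra.
Qed.

Theorem moore_aronszajn : RKHS U k ma_space ma_ip.
Proof.
  split; [split|].
  - intros f g [u [A B]] E. exists u. split; [exact A|]. intros z hz. rewrite <- E; auto.
  - exact (ma_comb (exist _ nil (List.Forall_nil _))).
  - apply ma_lin.
  - intros f g h [u Hu] [v Hv] [w Hw] E.
    apply (ctends_unique (fun n => ipU (u n) (w n))); [apply ma_ip_spec; auto|].
    apply ma_ip_spec; [|exact Hw]. destruct Hu as [A B]. split; [exact A|]. intros z hz. rewrite <- E; auto.
  - apply ma_ip_lin.
  - apply ma_ip_conj.
  - apply ma_ip_pos.
  - intros f hf E z hz. apply Cmod_eq_0.
    rewrite (ma_eval z f hz hf).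
    assert (CS := cauchy_schwarz _ _ _ PH (exist _ f hf) (exist _ _ (ma_section z hz))).
    unfold nrm2, hip in CS. simpl in CS. rewrite E, re_RtoC, Rmult_0_l in CS.
    assert (T := Cmod_ge_0 (ma_ip f (fun y => k y z))). nra.
  - intros u hu dist Hu.
    set (g := fun n => exist _ (u n) (hu n) : hsub ma_space).
    destruct (ma_complete g) as [f Hf].
    + intros e he. assert (hs := sqrt_lt_R0 e he). destruct (Hu (mkposreal _ hs)) as [N K]. exists N.
      intros n m hn hm. specialize (K n m hn hm). simpl in K. unfold dist in K.
      apply sqrt_lt_sq in K; [|exact hs]. rewrite sqrt_sqrt in K by lra.
      unfold nrm2, hip. rewrite hsub_sub. exact K.
    + exists (proj1_sig f). split; [exact (proj2_sig f)|]. apply is_lim_seq_spec. intros e. assert (he := cond_pos e).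
      destruct (Hf (e * e)%R ltac:(nra)) as [N K]. exists N. intros n hn. specialize (K n hn).
      unfold nrm2, hip in K. rewrite hsub_sub in K. rewrite Rminus_0_r, Rabs_pos_eq by apply sqrt_pos.
      rewrite <- (sqrt_square e) by lra. apply sqrt_lt_1_alt. split; [|exact K].
      assert (T := ph_pos _ _ _ PH (psub _ (hlc ma_space ma_lin) (g n) f)). unfold hip in T. rewrite hsub_sub in T. exact T.
  - intros w hw. split; [apply ma_section, hw|]. intros f hf. apply ma_eval; auto.
Qed.

(** Prepares the use of [vitali]: the approximants are locally bounded wherever the diagonal of the
    kernel is. *)
Lemma ma_bounded (f : C -> C) : ma_space f -> exists (u : nat -> flist) (B : R), (0 <= B)%R /\
  (forall n, over U (u n)) /\ (forall z, U z -> ctends (fun n => comb k (u n) z) (f z)) /\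
  (forall n z, U z -> Cmod (comb k (u n) z) * Cmod (comb k (u n) z) <= B * Re (k z z))%R.
Proof.
  intros [u [Hu Ru]]. destruct (pcauchy_bounded _ _ _ PV u Hu) as [B [hB [N HB]]].
  exists (fun n => proj1_sig (u (N + n)%nat)), B. split; [exact hB|]. split; [|split].
  - intros n. apply proj2_sig.
  - intros z hz. apply (ctends_extract (fun n => comb k (proj1_sig (u n)) z)); [intros; lia|]. apply Ru, hz.
  - intros n z hz. assert (O : over U ((RtoC 1, z) :: nil)) by (constructor; [exact hz|constructor]).
    assert (CS := cauchy_schwarz _ _ _ PV (u (N + n)%nat) (exist _ _ O)).
    replace (ipU (u (N + n)%nat) (exist _ _ O)) with (comb k (proj1_sig (u (N + n)%nat)) z) in CS by (symmetry; apply gram_single).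
    unfold nrm2 at 2 in CS. replace (ipU (exist _ _ O) (exist _ _ O)) with (k z z) in CS.
    2:{ unfold ipU. simpl. rewrite gram_single. simpl. ring. }
    eapply Rle_trans; [exact CS|]. apply Rmult_le_compat_r; [|apply HB; lia].
    assert (T := ph_pos _ _ _ PV (exist _ _ O)). replace (ipU (exist _ _ O) (exist _ _ O)) with (k z z) in T; [exact T|].
    unfold ipU. simpl. rewrite gram_single. simpl. ring.
Qed.

End MooreAronszajn.

(** * Schur functions and their symmetric extensions *)

Definition schur (g : C -> C) : Prop :=
  holo upper_half g /\ (forall z, upper_half z -> (Cmod (g z) <= 1)%R) /\ nonzero_on upper_half g.

(** The canonical representative of an element of [S0]. Its values on the real line and at the zeros
    of [SR g] carry no information. *)
Definition ext (g : C -> C) (z : C) : C := if Rlt_dec 0 (Im z) then g z else / SR g z.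

Lemma ext_upper (g : C -> C) (z : C) : upper_half z -> ext g z = g z.
Proof. intros h. unfold ext. destruct (Rlt_dec 0 (Im z)); [reflexivity|contradiction]. Qed.

Lemma ext_lower (g : C -> C) (z : C) : lower_half z -> ext g z = / SR g z.
Proof. intros h. unfold ext, lower_half in *. destruct (Rlt_dec 0 (Im z)); [lra|reflexivity]. Qed.

Lemma mero_eq_disc (Om : C -> Prop) (f g : C -> C) : mero_eq Om f g <->
  forall z, Om z -> exists d : R, (0 < d)%R /\ forall w, disc z d w -> w <> z -> f w = g w.
Proof.
  unfold mero_eq. split; intros H z hz; [apply locally'_C_ball, H, hz|].
  apply locally'_C_ball. exact (H z hz).
Qed.

Lemma mero_eq_sym (Om : C -> Prop) (f g : C -> C) : mero_eq Om f g -> mero_eq Om g f.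
Proof.
  rewrite !mero_eq_disc. intros H z hz. destruct (H z hz) as [d [hd K]]. exists d. split; [exact hd|].
  intros. symmetry. auto.
Qed.

Lemma disc_min (z : C) (d e : R) (w : C) : disc z (Rmin d e) w -> disc z d w /\ disc z e w.
Proof.
  unfold disc. intros h. split; [exact (Rlt_le_trans _ _ _ h (Rmin_l _ _))|exact (Rlt_le_trans _ _ _ h (Rmin_r _ _))].
Qed.

Lemma mero_eq_trans (Om : C -> Prop) (f g h : C -> C) : mero_eq Om f g -> mero_eq Om g h -> mero_eq Om f h.
Proof.
  rewrite !mero_eq_disc. intros A B z hz. destruct (A z hz) as [d [hd K]], (B z hz) as [e [he K']].
  exists (Rmin d e). split; [apply Rmin_pos; auto|]. intros w hw nw. apply disc_min in hw.
  rewrite K, K'; tauto.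
Qed.

Lemma conj_lower (z : C) : lower_half z -> upper_half (Cconj z).
Proof. unfold lower_half, upper_half. rewrite im_conj. lra. Qed.

Lemma conj_upper (z : C) : upper_half z -> lower_half (Cconj z).
Proof. unfold lower_half, upper_half. rewrite im_conj. lra. Qed.

Lemma off_real_cases (z : C) : off_real z -> upper_half z \/ lower_half z.
Proof. unfold off_real, upper_half, lower_half. intros h. destruct (Rdichotomy _ _ h); auto. Qed.

Lemma upper_off (z : C) : upper_half z -> off_real z.
Proof. unfold off_real, upper_half. lra. Qed.

Lemma lower_off (z : C) : lower_half z -> off_real z.
Proof. unfold off_real, lower_half. lra. Qed.

Lemma disc_conj (z w : C) (d : R) : disc (Cconj z) d w <-> disc z d (Cconj w).
Proof.
  unfold disc. rewrite <- (Cmod_conj (w - Cconj z)), Cminus_conj, Cconj_conj. reflexivity.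
Qed.

Lemma lower_open : isopen lower_half.
Proof.
  intros z hz. destruct (upper_open _ (conj_lower z hz)) as [d [hd K]]. exists d. split; [exact hd|].
  intros w hw. rewrite <- (Cconj_conj w). apply conj_upper, K, disc_conj. rewrite Cconj_conj. exact hw.
Qed.

Lemma off_open : isopen off_real.
Proof.
  intros z hz. destruct (off_real_cases z hz) as [h|h].
  - destruct (upper_open z h) as [d [hd K]]. exists d. split; [exact hd|]. intros w hw. apply upper_off, K, hw.
  - destruct (lower_open z h) as [d [hd K]]. exists d. split; [exact hd|]. intros w hw. apply lower_off, K, hw.
Qed.

Lemma SR_holo_lower (g : C -> C) : holo upper_half g -> holo lower_half (SR g).
Proof. intros H. apply (holo_sub _ _ _ conj_lower), holo_SR, H. Qed.

Lemma SR_neq (g : C -> C) (z : C) : g (Cconj z) <> 0 <-> SR g z <> 0.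
Proof.
  unfold SR. split; intros h; [apply conj_nz, h|]. intros e. apply h. rewrite e. apply conj_RtoC.
Qed.

Lemma SR_zeros_isolated (g : C -> C) (z : C) : lower_half z -> schur g ->
  exists d : R, (0 < d)%R /\ forall w, disc z d w -> w <> z -> lower_half w /\ SR g w <> 0.
Proof.
  intros hz [H [_ N]]. destruct (zeros_isolated g (Cconj z) (conj_lower z hz) H N) as [d [hd K]].
  exists d. split; [exact hd|]. intros w hw nw. destruct (K (Cconj w)) as [A B].
  - apply disc_conj. rewrite Cconj_conj. exact hw.
  - intros e. apply nw. rewrite <- (Cconj_conj w), e, Cconj_conj. reflexivity.
  - split; [rewrite <- (Cconj_conj w); apply conj_upper, A|apply SR_neq, B].
Qed.

Lemma sup_norm_le (Om : C -> Prop) (g : C -> C) (M : R) : Rbar_le (sup_norm Om g) M ->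
  forall z, Om z -> (Cmod (g z) <= M)%R.
Proof.
  intros H z hz. assert (L := proj1 (Lub_Rbar_correct (fun r => exists z, Om z /\ r = Cmod (g z)))).
  assert (T := L _ (ex_intro _ z (conj hz eq_refl))).
  exact (Rbar_le_trans (Cmod (g z)) _ M T H).
Qed.

Lemma le_sup_norm (Om : C -> Prop) (g : C -> C) (M : R) : (forall z, Om z -> (Cmod (g z) <= M)%R) ->
  Rbar_le (sup_norm Om g) M.
Proof.
  intros H. apply (proj2 (Lub_Rbar_correct (fun r => exists z, Om z /\ r = Cmod (g z)))).
  intros r [z [hz ->]]. apply H, hz.
Qed.

Lemma Hinf_holo (Om : C -> Prop) (g : C -> C) (M : R) : isopen Om -> holo Om g ->
  (forall z, Om z -> (Cmod (g z) <= M)%R) -> Hinf Om g.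
Proof.
  intros HO H HM. split; [apply holo_analytic_on; auto|].
  apply (Rbar_le_lt_trans _ M); [apply le_sup_norm, HM|exact I].
Qed.

Lemma Hinf_bound (Om : C -> Prop) (g : C -> C) : Hinf Om g ->
  exists M : R, (0 < M)%R /\ forall z, Om z -> (Cmod (g z) <= M)%R.
Proof.
  intros [_ H].
  destruct (sup_norm Om g) as [s| |] eqn:E; [|contradiction|].
  - exists (Rmax s 1). split; [assert (T := Rmax_r s 1); lra|]. intros z hz.
    eapply Rle_trans; [|apply Rmax_l]. revert z hz. apply sup_norm_le. rewrite E. apply Rbar_le_refl.
  - exists 1%R. split; [lra|]. apply sup_norm_le. rewrite E. exact I.
Qed.

Lemma mero_on_holo (Om : C -> Prop) (f : C -> C) : isopen Om -> holo Om f -> mero_on Om f.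
Proof.
  intros HO H z hz. exists 0%nat, f. split; [apply (holo_analytic_on Om); auto|].
  apply locally'_C_ball. exists 1%R. split; [lra|]. intros w _ _. simpl. field.
Qed.

Lemma mero_on_ext (Om : C -> Prop) (f g : C -> C) : mero_eq Om f g -> mero_on Om g -> mero_on Om f.
Proof.
  intros E H z hz. destruct (H z hz) as [n [p [Hp K]]]. exists n, p. split; [exact Hp|].
  apply locally'_C_ball in K. destruct K as [d [hd K]].
  rewrite mero_eq_disc in E. destruct (E z hz) as [d' [hd' K']].
  apply locally'_C_ball. exists (Rmin d d'). split; [apply Rmin_pos; auto|].
  intros w hw nw. apply disc_min in hw. rewrite K' by tauto. apply K; tauto.
Qed.

Lemma mero_on_inv_SR (g : C -> C) : schur g -> mero_on lower_half (fun z => / SR g z).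
Proof.
  intros [H [_ N]] z hz.
  destruct (zero_factor g (Cconj z) (conj_lower z hz) H N) as [n [u [Hu [uz E]]]].
  destruct (ccont_nz_near u _ (holo_ccont _ _ _ Hu (conj_lower z hz)) uz) as [d [hd K]].
  destruct (lower_open z hz) as [d' [hd' K']].
  assert (hm : (0 < Rmin d d')%R) by (apply Rmin_pos; auto).
  assert (S : forall w, disc z (Rmin d d') w -> lower_half w /\ SR u w <> 0).
  { intros w hw. apply disc_min in hw. split; [apply K', hw|]. apply SR_neq, K. apply disc_conj. rewrite Cconj_conj. apply hw. }
  exists n, (fun w => / SR u w). split.
  - apply analytic_at_holo. exists (Rmin d d'). split; [exact hm|].
    apply holo_inv; [|apply S]. apply (holo_sub lower_half); [apply S|]. apply SR_holo_lower, Hu.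
  - apply locally'_C_ball. exists (Rmin d d'). split; [exact hm|]. intros w hw nw. destruct (S w hw) as [lw sw].
    replace (SR g w) with ((w - z) ^ n * SR u w).
    2:{ unfold SR. rewrite (E _ (conj_lower w lw)), Cmult_conj, Cpow_conj, Cminus_conj, !Cconj_conj. reflexivity. }
    field. split; [exact sw|]. apply Cpow_nz, Cminus_eq_contra, nw.
Qed.

Lemma S0_schur (h : C -> C) : S0 h -> exists g, schur g /\ mero_eq off_real h (ext g).
Proof.
  intros [_ [g [[A B] [N [Le [E1 E2]]]]]]. exists g.
  split; [split; [apply analytic_on_holo, A|split; [apply sup_norm_le, Le|exact N]]|].
  rewrite mero_eq_disc in *. intros z hz. destruct (off_real_cases z hz) as [h1|h1].
  - destruct (E1 z h1) as [d [hd K]]. destruct (upper_open z h1) as [d' [hd' K']].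
    exists (Rmin d d'). split; [apply Rmin_pos; auto|]. intros w hw nw. apply disc_min in hw.
    rewrite ext_upper by (apply K', hw). apply K; tauto.
  - destruct (E2 z h1) as [d [hd K]]. destruct (lower_open z h1) as [d' [hd' K']].
    exists (Rmin d d'). split; [apply Rmin_pos; auto|]. intros w hw nw. apply disc_min in hw.
    rewrite ext_lower by (apply K', hw). apply K; tauto.
Qed.

Lemma ext_eq_upper (g : C -> C) : mero_eq upper_half (ext g) g.
Proof.
  apply mero_eq_disc. intros z hz. destruct (upper_open z hz) as [d [hd K]]. exists d. split; [exact hd|].
  intros w hw _. apply ext_upper, K, hw.
Qed.

Lemma ext_eq_lower (g : C -> C) : mero_eq lower_half (ext g) (fun z => / SR g z).
Proof.
  apply mero_eq_disc. intros z hz. destruct (lower_open z hz) as [d [hd K]]. exists d. split; [exact hd|].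
  intros w hw _. apply ext_lower, K, hw.
Qed.

Lemma mero_eq_refl (Om : C -> Prop) (f : C -> C) : mero_eq Om f f.
Proof. apply mero_eq_disc. intros z _. exists 1%R. split; [lra|auto]. Qed.

Lemma mero_eq_fun (Om : C -> Prop) (f g : C -> C) : (forall z, f z = g z) -> mero_eq Om f g.
Proof. intros E. apply mero_eq_disc. intros z _. exists 1%R. split; [lra|auto]. Qed.

Lemma nonzero_one (Om : C -> Prop) (z : C) : Om z -> nonzero_on Om (fun _ => 1).
Proof. intros h. exists z. split; [exact h|exact C1_nz]. Qed.

Lemma schur_S0 (g : C -> C) : schur g -> S0 (ext g).
Proof.
  intros S. assert (S' := S). destruct S as [H [Le [z0 [hz0 nz0]]]].
  assert (M1 : mero_on upper_half (ext g)) by (apply (mero_on_ext _ _ g); [apply ext_eq_upper|apply mero_on_holo; [apply upper_open|exact H]]).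
  assert (M2 : mero_on lower_half (ext g)) by (apply (mero_on_ext _ _ _ (ext_eq_lower g)), mero_on_inv_SR, S').
  assert (I1 : forall M, (1 <= M)%R -> forall z : C, (Cmod 1 <= M)%R) by (intros; rewrite Cmod_1; lra).
  split; [split; [|split; split]|].
  - intros z hz. destruct (off_real_cases z hz) as [h|h]; [apply M1, h|apply M2, h].
  - exact M1.
  - exists g, (fun _ => 1). split; [apply (Hinf_holo _ _ 1); auto; apply upper_open|].
    split; [apply (Hinf_holo _ _ 1); [apply upper_open|apply holo_const|intros; rewrite Cmod_1; lra]|].
    split; [exact (nonzero_one _ z0 hz0)|].
    eapply mero_eq_trans; [apply ext_eq_upper|]. apply mero_eq_fun. intros z. field.
  - exact M2.
  - exists (fun _ => 1), (SR g).
    split; [apply (Hinf_holo _ _ 1); [apply lower_open|apply holo_const|intros; rewrite Cmod_1; lra]|].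
    split; [apply (Hinf_holo _ _ 1); [apply lower_open|apply SR_holo_lower, H|]|].
    { intros z hz. unfold SR. rewrite Cmod_conj. apply Le, conj_lower, hz. }
    split.
    { exists (Cconj z0). split; [apply conj_upper, hz0|]. apply (proj1 (SR_neq g (Cconj z0))). rewrite Cconj_conj. exact nz0. }
    eapply mero_eq_trans; [apply ext_eq_lower|]. apply mero_eq_fun. intros z. unfold Cdiv. ring.
  - exists g. split; [apply (Hinf_holo _ _ 1); auto; apply upper_open|].
    split; [exists z0; auto|]. split; [apply le_sup_norm, Le|]. split; [apply ext_eq_upper|apply ext_eq_lower].
Qed.

(** * Analytic extension across the real line *)

Lemma eq_by_cont (f g : C -> C) (z : C) (d : R) : (0 < d)%R -> ccont f z -> ccont g z ->
  (forall w, disc z d w -> w <> z -> f w = g w) -> f z = g z.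
Proof.
  intros hd Hf Hg E. destruct (seq_to_center z d hd) as [u [Hu Hu']].
  apply (ctends_unique (fun n => f (u n))); [apply ctends_comp; auto|].
  apply (ctends_ext (fun n => g (u n))); [|apply ctends_comp; auto].
  intros n. symmetry. apply E; apply Hu'.
Qed.

Lemma open_isopen (V : C -> Prop) : open V -> isopen V.
Proof. intros H z hz. apply (proj1 (locally_C_ball z V)), H, hz. Qed.

Lemma U_ext_open (h : C -> C) : isopen (U_ext h).
Proof.
  intros z [[hz [g [Hg K]]]|[hz [a [b [hab [V [g [HV [HI [Hg E]]]]]]]]]].
  - apply analytic_at_holo in Hg. destruct Hg as [d [hd Hg]]. apply locally'_C_ball in K. destruct K as [e [he K]].
    destruct (off_open z hz) as [e' [he' K']].
    exists (Rmin d (Rmin e e')). split; [apply Rmin_pos; [|apply Rmin_pos]; auto|].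
    intros w hw. apply disc_min in hw. destruct hw as [h1 hw]. apply disc_min in hw. destruct hw as [h2 h3].
    left. split; [apply K', h3|]. exists g. split.
    + apply analytic_at_holo. destruct (disc_open _ _ _ h1) as [r [hr Kr]]. exists r. split; [exact hr|].
      apply (holo_sub (disc z d)); auto.
    + destruct (Ceq_dec w z) as [->|nw]; [apply locally'_C_ball; exists e; auto|].
      assert (p := proj1 (Cmod_gt_0 _) (Cminus_eq_contra _ _ nw)).
      destruct (disc_open _ _ _ h2) as [r [hr Kr]].
      apply locally'_C_ball. exists (Rmin r (Cmod (w - z))). split; [apply Rmin_pos; auto|].
      intros x hx _. apply disc_min in hx. apply K; [apply Kr, hx|]. intros ->. unfold disc in hx.
      rewrite Cmod_sub_sym in hx. lra.
  - assert (Vz : V z).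
    { replace z with (RtoC (Re z)); [apply HI, hab|]. apply Ceq; rewrite ?re_RtoC, ?im_RtoC; auto. }
    destruct (open_isopen V HV z Vz) as [d [hd K]].
    set (m := Rmin (Re z - a) (b - Re z)). assert (hm : (0 < m)%R) by (apply Rmin_pos; lra).
    exists (Rmin d m). split; [apply Rmin_pos; auto|]. intros w hw. apply disc_min in hw. destruct hw as [h1 h2].
    destruct (Req_dec (Im w) 0) as [iw|iw].
    + right. split; [exact iw|]. exists a, b. split; [|exists V, g; auto].
      unfold disc in h2. assert (T := Re_lip w z). apply Rle_lt_trans with (2 := h2) in T. apply Rabs_lt_between in T.
      assert (T1 := Rmin_l (Re z - a) (b - Re z)). assert (T2 := Rmin_r (Re z - a) (b - Re z)). fold m in T1, T2. lra.
    + left. split; [exact iw|]. exists g. split; [apply Hg, K, h1|]. apply E. split; [apply K, h1|exact iw].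
Qed.

Definition extension (h he : C -> C) : Prop := analytic_on (U_ext h) he /\ mero_eq off_real h he.

Lemma extension_exists (h : C -> C) : mero_on off_real h -> exists he, extension h he.
Proof.
  (* One pass is not enough: junk values of [h] off the real line may accumulate at a real point
     along its vertical sequence. The first [reg] removes them, the second takes the boundary
     values. *)
  intros HM. exists (reg (reg h)).
  assert (L1 : forall (G : C -> C) z d, (0 < d)%R -> (forall w, disc z d w -> ccont G w) ->
    (forall w, disc z d w -> w <> z -> h w = G w) -> forall w, disc z d w -> reg (reg h) w = G w).
  { intros G z d hd CG E. assert (E1 := reg_eq_disc h G z d E CG). apply (reg_eq_disc (reg h) G z d); auto. }
  split.
  - intros z [[hz [g [Hg K]]]|[hz [a [b [hab [V [g [HV [HI [Hg E]]]]]]]]]]; apply analytic_at_holo.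
    + apply analytic_at_holo in Hg. destruct Hg as [d [hd Hg]]. apply locally'_C_ball in K. destruct K as [e [he K]].
      exists (Rmin d e). assert (hm : (0 < Rmin d e)%R) by (apply Rmin_pos; auto). split; [exact hm|].
      assert (Q := L1 g z (Rmin d e) hm).
      apply (holo_ext _ g).
      * intros w hw. destruct (disc_open _ _ _ hw) as [r [hr Kr]]. exists r. split; [exact hr|].
        intros x hx. symmetry. apply Q; [| |apply Kr, hx].
        -- intros y hy. apply (holo_ccont _ _ _ Hg). apply disc_min in hy. tauto.
        -- intros y hy ny. apply disc_min in hy. apply K; [exact (proj2 hy)|exact ny].
      * apply (holo_sub (disc z d)); [|exact Hg]. intros w hw. apply disc_min in hw. tauto.
    + assert (Vz : V z).
      { replace z with (RtoC (Re z)); [apply HI, hab|]. apply Ceq; rewrite ?re_RtoC, ?im_RtoC; auto. }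
      apply analytic_on_holo in Hg.
      destruct (open_isopen V HV z Vz) as [d [hd K]]. exists d. split; [exact hd|].
      rewrite mero_eq_disc in E.
      assert (R1 : forall w, V w -> off_real w -> reg h w = g w).
      { intros w vw ow. destruct (E w (conj vw ow)) as [e [he Ke]].
        apply (reg_eq h g w e he); [|apply (holo_ccont _ _ _ Hg vw)]. intros x hx ix. apply Ke; [exact hx|]. intros ->. lra. }
      assert (R2 : forall w, V w -> reg (reg h) w = g w).
      { intros w vw. destruct (open_isopen V HV w vw) as [e [he Ke]].
        destruct (Req_dec (Im w) 0) as [iw|iw].
        - apply (reg_eq (reg h) g w e he); [|apply (holo_ccont _ _ _ Hg vw)].
          intros x hx ix. apply R1; [apply Ke, hx|]. unfold off_real. lra.
        - destruct (off_open w iw) as [e' [he' Ke']].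
          apply (reg_eq (reg h) g w (Rmin e e')); [apply Rmin_pos; auto| |apply (holo_ccont _ _ _ Hg vw)].
          intros x hx _. apply disc_min in hx. apply R1; [apply Ke, hx|apply Ke', hx]. }
      apply (holo_ext _ g).
      * intros w hw. destruct (disc_open _ _ _ hw) as [r [hr Kr]]. exists r. split; [exact hr|].
        intros x hx. symmetry. apply R2, K, Kr, hx.
      * apply (holo_sub V); auto.
  - apply mero_eq_disc. intros z hz. destruct (HM z hz) as [n [p [Hp K]]].
    apply analytic_at_holo in Hp. destruct Hp as [d [hd Hp]]. apply locally'_C_ball in K. destruct K as [e [he K]].
    exists (Rmin d e). split; [apply Rmin_pos; auto|]. intros w hw nw.
    set (G := fun w => p w / (w - z) ^ n).
    assert (hp := proj1 (Cmod_gt_0 _) (Cminus_eq_contra _ _ nw)).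
    destruct (disc_open _ _ _ hw) as [r [hr Kr]].
    assert (hm : (0 < Rmin r (Cmod (w - z)))%R) by (apply Rmin_pos; auto).
    assert (NZ : forall x, disc w (Rmin r (Cmod (w - z))) x -> x <> z).
    { intros x hx ->. apply disc_min in hx. unfold disc in hx. rewrite (Cmod_sub_sym z w) in hx. lra. }
    assert (IN : forall x, disc w (Rmin r (Cmod (w - z))) x -> disc z d x /\ disc z e x).
    { intros x hx. apply disc_min in hx. apply disc_min. apply Kr, hx. }
    rewrite (L1 G w (Rmin r (Cmod (w - z))) hm); [| | |apply disc_center, hm].
    + apply K; [|exact nw]. apply disc_min in hw. tauto.
    + intros x hx. apply ccont_mult; [apply (holo_ccont _ _ _ Hp), IN, hx|].
      apply (ccont_inv_comp (fun w => (w - z) ^ n)); [apply Cpow_nz, Cminus_eq_contra, NZ, hx|].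
      apply (ccont_comp (fun y => y ^ n) (fun w => w - z)); [apply ccont_pow|].
      apply ccont_plus; [apply ccont_id|apply ccont_const].
    + intros x hx _. apply K; [apply IN, hx|apply NZ, hx].
Qed.

Section Extension.

Variables (h g he : C -> C).
Hypothesis Sg : schur g.
Hypothesis Hh : mero_eq off_real h (ext g).
Hypothesis Ee : extension h he.

Lemma he_holo : holo (U_ext h) he.
Proof. apply analytic_on_holo, Ee. Qed.

Lemma he_eq_ext (z : C) : off_real z -> exists d : R, (0 < d)%R /\ forall w, disc z d w -> w <> z -> he w = ext g w.
Proof.
  intros hz. assert (T := mero_eq_trans _ _ _ _ (mero_eq_sym _ _ _ (proj2 Ee)) Hh).
  rewrite mero_eq_disc in T. apply T, hz.
Qed.

Lemma upper_U (z : C) : upper_half z -> U_ext h z.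
Proof.
  intros hz. left. split; [apply upper_off, hz|]. exists g.
  split; [apply (holo_analytic_on upper_half); [apply upper_open|apply Sg|exact hz]|].
  assert (T := proj1 (mero_eq_disc _ _ _) Hh z (upper_off z hz)). destruct T as [d [hd K]].
  destruct (upper_open z hz) as [e [hee Ke]].
  apply locally'_C_ball. exists (Rmin d e). split; [apply Rmin_pos; auto|]. intros w hw nw.
  apply disc_min in hw. rewrite K by tauto. apply ext_upper, Ke, hw.
Qed.

Lemma he_upper (z : C) : upper_half z -> he z = g z.
Proof.
  intros hz. destruct (he_eq_ext z (upper_off z hz)) as [d [hd K]].
  destruct (upper_open z hz) as [e [hee Ke]].
  apply (eq_by_cont he g z (Rmin d e)); [apply Rmin_pos; auto| | |].
  - apply (holo_ccont _ _ _ he_holo), upper_U, hz.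
  - apply (holo_ccont _ _ _ (proj1 Sg) hz).
  - intros w hw nw. apply disc_min in hw. rewrite K by tauto. apply ext_upper, Ke, hw.
Qed.

(** Stated as a product, the identity passes by continuity to every point of the domain, and it then
    shows that [SR g] does not vanish there. *)
Lemma he_lower (z : C) : lower_half z -> U_ext h z -> he z * SR g z = 1.
Proof.
  intros hz uz. destruct (he_eq_ext z (lower_off z hz)) as [d [hd K]].
  destruct (SR_zeros_isolated g z hz Sg) as [e [hee Ke]].
  apply (eq_by_cont (fun w => he w * SR g w) (fun _ => 1) z (Rmin d e)); [apply Rmin_pos; auto| | |].
  - apply ccont_mult; [apply (holo_ccont _ _ _ he_holo uz)|].
    apply (holo_ccont _ _ _ (SR_holo_lower g (proj1 Sg)) hz).
  - apply ccont_const.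
  - intros w hw nw. apply disc_min in hw. rewrite K by tauto. destruct (Ke w (proj2 hw) nw) as [lw sw].
    rewrite ext_lower by exact lw. apply Cinv_l, sw.
Qed.

Lemma lower_U (z : C) : lower_half z -> SR g z <> 0 -> U_ext h z.
Proof.
  intros hz nz. left. split; [apply lower_off, hz|].
  destruct (ccont_nz_near (SR g) z (holo_ccont _ _ _ (SR_holo_lower g (proj1 Sg)) hz) nz) as [d [hd K]].
  destruct (lower_open z hz) as [d' [hd' K']].
  assert (hm : (0 < Rmin d d')%R) by (apply Rmin_pos; auto).
  exists (fun w => / SR g w). split.
  - apply analytic_at_holo. exists (Rmin d d'). split; [exact hm|]. apply holo_inv.
    + apply (holo_sub lower_half); [|apply SR_holo_lower, Sg]. intros w hw. apply disc_min in hw. apply K', hw.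
    + intros w hw. apply disc_min in hw. apply K, hw.
  - destruct (proj1 (mero_eq_disc _ _ _) Hh z (lower_off z hz)) as [e [hee Ke]].
    apply locally'_C_ball. exists (Rmin d' e). split; [apply Rmin_pos; auto|]. intros w hw nw.
    apply disc_min in hw. rewrite Ke by tauto. apply ext_lower, K', hw.
Qed.

(** For real [z] this says that [he z] has modulus one. It is then the limit of the identity at
    conjugate pairs approaching [z] vertically, which lie in the domain because it is open. *)
Lemma he_conj (z : C) : U_ext h z -> U_ext h (Cconj z) -> he z * Cconj (he (Cconj z)) = 1.
Proof.
  assert (L : forall z, lower_half z -> U_ext h z -> he z * Cconj (he (Cconj z)) = 1).
  { intros w hw uw. rewrite (he_upper (Cconj w)) by (apply conj_lower, hw). apply (he_lower w hw uw). }
  intros uz uz'. destruct (Req_dec (Im z) 0) as [iz|iz].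
  - assert (cz : Cconj z = z) by (apply Ceq; rewrite ?re_conj, ?im_conj; lra).
    destruct (U_ext_open h z uz) as [d [hd K]].
    assert (V := vert_tends z). assert (V' := ctends_conj _ _ V). rewrite cz in V'.
    assert (Cz := holo_ccont _ _ _ he_holo uz).
    rewrite cz. apply (ctends_unique (fun n => he (Cconj (z + Ci * RtoC (/ INR (S n)))) * Cconj (he (z + Ci * RtoC (/ INR (S n)))))).
    + apply ctends_mult; [apply (ctends_comp he (fun n => Cconj (z + Ci * RtoC (/ INR (S n))))); auto|].
      apply ctends_conj. apply (ctends_comp he); auto.
    + destruct (V' d hd) as [N HN]. apply (ctends_ev_ext (fun _ => 1) _ _ N); [|apply ctends_const].
      intros n hn. symmetry. set (v := z + Ci * RtoC (/ INR (S n))).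
      rewrite <- (Cconj_conj v) at 2. apply L; [|apply K, HN, hn].
      apply conj_upper. unfold upper_half, v. assert (T := vert_above z n). lra.
  - destruct (off_real_cases z iz) as [hz|hz]; [|apply L; auto].
    assert (T := L (Cconj z) (conj_upper z hz) uz'). rewrite Cconj_conj in T.
    apply (f_equal Cconj) in T. rewrite Cmult_conj, Cconj_conj, conj_RtoC in T. rewrite Cmult_comm. exact T.
Qed.

Lemma he_lower_nz (z : C) : lower_half z -> U_ext h z -> he z = / SR g z /\ SR g z <> 0.
Proof.
  intros hz uz. assert (E := he_lower z hz uz).
  assert (nz : SR g z <> 0) by (intros e; rewrite e, Cmult_0_r in E; exact (C1_nz (eq_sym E))).
  split; [|exact nz]. replace (he z) with (he z * SR g z / SR g z) by (field; exact nz). rewrite E. unfold Cdiv. ring.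
Qed.

End Extension.

(** * Positivity of the kernel *)

Section Poisson.

Variables (p : C -> C) (c : C) (r R0 : R).
Hypothesis Hp : holo (disc c R0) p.
Hypothesis Hr : (0 < r < R0)%R.
Hypothesis Hpos : forall z, disc c R0 z -> (0 <= Re (p z))%R.

Definition pois_rho (t : R) : C := RtoC (Re (p (circ c r t))).
Definition pois_phi (z : C) (t : R) : C := / (RtoC r * cexp t - (z - c)).
(** A mean of rank-one kernels with the nonnegative weight [pois_rho], hence positive definite. *)
Definition pois_S (z w : C) : C := mean (fun t => pois_rho t * (pois_phi z t * Cconj (pois_phi w t))).
(* The Herglotz representation of [p] on the disc; outside the closed disc it is [- conj (p (refl z))]. *)
Definition pois_P (z : C) : C :=
  mean (fun t => pois_rho t * ((RtoC r * cexp t + (z - c)) * pois_phi z t)) + Ci * RtoC (Im (p c)).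

Definition off_circ (z : C) : Prop := Cmod (z - c) <> r.

Lemma pois_nz (z : C) (t : R) : off_circ z -> RtoC r * cexp t - (z - c) <> 0.
Proof.
  intros h. apply Cminus_eq_contra. intros e. apply h. rewrite <- e.
  rewrite Cmod_mult, Cmod_R, Cmod_cexp, Rabs_pos_eq; lra.
Qed.

Lemma p_rcont : rcont (fun t => p (circ c r t)).
Proof. exact (holo_circ_rcont p c r R0 Hp Hr). Qed.

Lemma rho_half (t : R) : pois_rho t = RtoC (1 / 2) * (p (circ c r t) + Cconj (p (circ c r t))).
Proof.
  unfold pois_rho. apply Ceq; rewrite ?re_RtoC, ?im_RtoC, ?re_scal_l, ?im_scal_l, ?re_plus, ?im_plus, ?re_conj, ?im_conj; field.
Qed.

Lemma rho_rcont : rcont pois_rho.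
Proof.
  apply (rcont_ext _ _ (fun t => eq_sym (rho_half t))).
  apply rcont_mult; [apply rcont_const|]. apply rcont_plus; [apply p_rcont|apply rcont_conj, p_rcont].
Qed.

Lemma rcexp_rcont : rcont (fun t => RtoC r * cexp t).
Proof. apply rcont_mult; [apply rcont_const|apply rcont_cexp]. Qed.

Lemma phi_rcont (z : C) : off_circ z -> rcont (pois_phi z).
Proof.
  intros h. apply rcont_inv; [intros; apply pois_nz, h|].
  apply rcont_plus; [apply rcexp_rcont|apply rcont_const].
Qed.

Fixpoint pois_psi (l : flist) (t : R) : C :=
  match l with nil => 0 | q :: l' => fst q * Cconj (pois_phi (snd q) t) + pois_psi l' t end.

Lemma psi_rcont (l : flist) : over off_circ l -> rcont (pois_psi l).
Proof.
  intros H. induction H as [|q l hq H IH]; [exact (rcont_const 0)|].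
  apply (rcont_plus (fun t => fst q * Cconj (pois_phi (snd q) t))); [|exact IH].
  apply rcont_mult; [apply rcont_const|apply rcont_conj, phi_rcont, hq].
Qed.

Lemma comb_S (l : flist) (z : C) : over off_circ l -> off_circ z ->
  comb pois_S l z = mean (fun t => pois_rho t * (pois_phi z t * pois_psi l t)).
Proof.
  intros H hz. assert (A := rho_rcont). assert (B := phi_rcont z hz).
  induction H as [|q l hq H IH].
  - symmetry. transitivity (mean (fun _ => 0)); [|apply mean_const]. apply mean_ext. intros t. simpl. ring.
  - simpl. rewrite IH. unfold pois_S. rewrite <- mean_scal, <- mean_plus.
    + apply mean_ext. intros t. ring.
    + apply rcont_mult; [apply rcont_const|]. repeat apply rcont_mult; auto. apply rcont_conj, phi_rcont, hq.
    + repeat apply rcont_mult; auto. apply psi_rcont, H.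
    + repeat apply rcont_mult; auto. apply rcont_conj, phi_rcont, hq.
Qed.

Lemma pair_S (l m : flist) : over off_circ l -> over off_circ m ->
  pair (comb pois_S l) m = mean (fun t => pois_rho t * (pois_psi m t * Cconj (pois_psi l t))).
Proof.
  intros Hl H. assert (A := rho_rcont). assert (B := psi_rcont l Hl).
  assert (cr : forall t, Cconj (pois_rho t) = pois_rho t) by (intros; apply conj_RtoC).
  induction H as [|q m hq H IH].
  - symmetry. transitivity (mean (fun _ => 0)); [|apply mean_const]. apply mean_ext. intros t. simpl. ring.
  - assert (D := phi_rcont (snd q) hq).
    simpl. rewrite IH, comb_S by auto. rewrite <- mean_conj, <- mean_scal, <- mean_plus.
    + apply mean_ext. intros t. rewrite !Cmult_conj, cr. ring.
    + apply rcont_mult; [apply rcont_const|]. apply rcont_conj. repeat apply rcont_mult; auto.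
    + repeat apply rcont_mult; auto; [apply psi_rcont, H|apply rcont_conj, B].
    + apply rcont_conj. repeat apply rcont_mult; auto.
    + repeat apply rcont_mult; auto.
Qed.

(** The form is the mean of [pois_rho t] times the squared modulus of [pois_psi l t]. *)
Lemma pois_S_pos (l : flist) : over off_circ l -> (0 <= Re (gram pois_S l l))%R.
Proof.
  intros H. unfold gram. rewrite re_conj, pair_S by auto. rewrite mean_Re, <- (rmean_const 0).
  apply rmean_le; [apply ex_RInt_const| |].
  - apply (rcont_int_Re (fun t => pois_rho t * (pois_psi l t * Cconj (pois_psi l t)))).
    assert (B := psi_rcont l H). repeat apply rcont_mult; auto using rho_rcont. apply rcont_conj, B.
  - intros t. rewrite mult_conj_re. unfold pois_rho. rewrite re_scal_l, re_RtoC.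
    apply Rmult_le_pos.
    + apply Hpos. unfold disc. rewrite circ_dist; lra.
    + assert (T := Cmod_ge_0 (pois_psi l t)). nra.
Qed.

(** With [ka] the Cauchy kernel, the Herglotz kernel is [2 * ka - 1]. The mean of [p * ka] is [p z]
    by the Cauchy formula, and that of [p * Cconj ka] is [p c], because [Cconj ka] is the boundary
    value of a holomorphic function equal to [1] at the centre. *)
Lemma pois_P_inside (z : C) : disc c r z -> pois_P z = p z.
Proof.
  intros hz. assert (oz : off_circ z) by (unfold off_circ; unfold disc in hz; lra).
  assert (A := phi_rcont z oz). assert (Ap := p_rcont). assert (Ae := rcexp_rcont).
  set (ka := fun t => RtoC r * cexp t * pois_phi z t).
  assert (Ak : rcont ka) by (apply rcont_mult; auto).
  assert (M1 : mean (fun t => p (circ c r t) * ka t) = p z).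
  { rewrite <- (cauchy_formula p c z r R0 Hp Hr hz). apply mean_ext. intros t. unfold ka, pois_phi, Cdiv.
    replace (circ c r t - z) with (RtoC r * cexp t - (z - c)) by (unfold circ; ring). reflexivity. }
  assert (M2 : mean (fun t => p (circ c r t) * Cconj (ka t)) = p c).
  { set (ze := z - c) in *. unfold disc in hz. fold ze in hz. assert (z0 := Cmod_ge_0 ze).
    (* The denominator [r^2 - Cconj ze * (x - c)] can vanish only at distance [r^2 / |ze|] from [c];
       the second entry lies strictly between [r] and that distance. *)
    set (R1 := Rmin R0 (2 * (r * r) / (r + Cmod ze))).
    assert (hR2 : (r < 2 * (r * r) / (r + Cmod ze))%R).
    { apply (Rmult_lt_reg_r (r + Cmod ze)); [lra|]. unfold Rdiv. rewrite Rmult_assoc, Rinv_l by lra. nra. }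
    assert (hR1 : (r < R1)%R) by (apply Rmin_glb_lt; lra).
    assert (hlt : (Cmod ze * (2 * (r * r) / (r + Cmod ze)) < r * r)%R).
    { apply (Rmult_lt_reg_r (r + Cmod ze)); [lra|]. replace (Cmod ze * (2 * (r * r) / (r + Cmod ze)) * (r + Cmod ze))%R with (Cmod ze * (2 * (r * r)))%R by (field; lra).
      assert (0 < r * r * (r - Cmod ze))%R by (apply Rmult_lt_0_compat; nra). lra. }
    assert (NZ : forall x, disc c R1 x -> RtoC (r * r) - Cconj ze * (x - c) <> 0).
    { intros x hx. apply Cnz_Cmod. assert (T := Cmod_triangle_rev (RtoC (r * r)) (Cconj ze * (x - c))).
      rewrite Cmod_mult, Cmod_conj, Cmod_R, Rabs_pos_eq in T by nra.
      unfold disc in hx. assert (T2 := Rmin_r R0 (2 * (r * r) / (r + Cmod ze))). fold R1 in T2.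
      assert (Cmod ze * Cmod (x - c) <= Cmod ze * (2 * (r * r) / (r + Cmod ze)))%R by (apply Rmult_le_compat_l; lra). lra. }
    assert (HF : holo (disc c R1) (fun x => p x * (RtoC (r * r) / (RtoC (r * r) - Cconj ze * (x - c))))).
    { apply holo_mult; [apply (holo_sub (disc c R0)); [|exact Hp]; intros x; apply disc_le, Rmin_l|].
      apply holo_div; [apply holo_const| |exact NZ]. apply holo_minus; [apply holo_const|].
      apply holo_mult; [apply holo_const|]. apply holo_minus; [apply holo_id|apply holo_const]. }
    assert (MV := mean_value _ c r R1 HF ltac:(lra)). cbv beta in MV.
    assert (rr : RtoC (r * r) <> 0) by (apply RtoC_nz; nra).
    replace (p c * (RtoC (r * r) / (RtoC (r * r) - Cconj ze * (c - c)))) with (p c) in MV.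
    2:{ replace (c - c) with (RtoC 0) by ring. rewrite Cmult_0_r. field. exact rr. }
    rewrite <- MV. apply mean_ext. intros t. f_equal. unfold ka, pois_phi. fold ze.
    assert (nz := pois_nz z t oz). fold ze in nz.
    rewrite Cmult_conj, Cinv_conj by exact nz. apply conj_nz in nz. rewrite Cminus_conj in *.
    rewrite Cmult_conj, conj_RtoC in *.
    assert (U : cexp t * Cconj (cexp t) = 1) by (rewrite mult_conj_re, Cmod_cexp; f_equal; ring).
    replace (circ c r t - c) with (RtoC r * cexp t) by (unfold circ; ring).
    assert (D : RtoC (r * r) - Cconj ze * (RtoC r * cexp t) = (RtoC r * cexp t) * (RtoC r * Cconj (cexp t) - Cconj ze)).
    { rewrite RtoC_mult. transitivity (RtoC r * RtoC r * (cexp t * Cconj (cexp t)) - Cconj ze * (RtoC r * cexp t)); [rewrite U; ring|ring]. }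
    rewrite D. unfold Cdiv.
    transitivity (RtoC r * RtoC r * (cexp t * Cconj (cexp t)) * / (RtoC r * cexp t * (RtoC r * Cconj (cexp t) - Cconj ze))).
    - field. repeat split; [exact nz|apply cexp_nz|apply RtoC_nz; lra].
    - rewrite U, RtoC_mult. ring. }
  assert (E : forall t, (RtoC r * cexp t + (z - c)) * pois_phi z t = RtoC 2 * ka t - 1).
  { intros t. unfold ka, pois_phi. field. apply pois_nz, oz. }
  unfold pois_P.
  rewrite (mean_ext _ (fun t => (p (circ c r t) * ka t + Cconj (p (circ c r t) * Cconj (ka t)))
     + RtoC (- (1 / 2)) * (p (circ c r t) + Cconj (p (circ c r t))))).
  2:{ intros t. rewrite E, rho_half, Cmult_conj, Cconj_conj, RtoC_opp.
      replace (RtoC 2) with (RtoC 1 + RtoC 1) by (rewrite <- RtoC_plus; f_equal; ring).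
      assert (H2 : RtoC (1 / 2) + RtoC (1 / 2) = 1) by (rewrite <- RtoC_plus; f_equal; field).
      set (a := p (circ c r t)). set (b := Cconj a).
      transitivity ((RtoC (1 / 2) + RtoC (1 / 2)) * ((a + b) * ka t) - RtoC (1 / 2) * (a + b)); [ring|rewrite H2; ring]. }
  assert (B1 : rcont (fun t => p (circ c r t) * ka t)) by (apply rcont_mult; auto).
  assert (B2 : rcont (fun t => p (circ c r t) * Cconj (ka t))) by (apply rcont_mult; auto; apply rcont_conj; auto).
  assert (B3 : rcont (fun t => Cconj (p (circ c r t)))) by (apply rcont_conj; auto).
  rewrite mean_plus, mean_plus, mean_scal, mean_plus, !mean_conj, M1, M2; auto.
  - rewrite (mean_value p c r R0 Hp Hr).
    apply Ceq.
    + rewrite !re_plus, re_scal_l, !re_plus, re_scal_r, !re_conj. change (Re Ci) with 0%R. field.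
    + rewrite !im_plus, im_scal_l, !im_plus, im_scal_r, !im_conj. change (Im Ci) with 1%R. field.
  - apply rcont_plus; auto.
  - apply rcont_conj; auto.
  - apply rcont_plus; auto. apply rcont_conj; auto.
  - apply rcont_mult; [apply rcont_const|apply rcont_plus; auto].
Qed.

Definition refl (z : C) : C := c + RtoC (r * r) / Cconj (z - c).

Lemma refl_disc (z : C) : (r < Cmod (z - c))%R -> disc c r (refl z).
Proof.
  intros h. unfold disc, refl.
  assert (nz : z - c <> 0) by (apply Cnz_Cmod; lra).
  replace (c + RtoC (r * r) / Cconj (z - c) - c) with (RtoC (r * r) / Cconj (z - c)) by ring.
  rewrite Cmod_div by (apply conj_nz, nz). rewrite Cmod_conj, Cmod_R, Rabs_pos_eq by nra.
  apply (Rmult_lt_reg_r (Cmod (z - c))); [lra|]. unfold Rdiv. rewrite Rmult_assoc, Rinv_l by lra. nra.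
Qed.

(** On the unit circle [Cconj e = / e], and this makes the Herglotz kernel at [z] minus the
    conjugate of the one at [refl z]. *)
Lemma pois_P_outside (z : C) : (r < Cmod (z - c))%R -> pois_P z = - Cconj (p (refl z)).
Proof.
  intros h. assert (oz : off_circ z) by (unfold off_circ; lra).
  assert (hs := refl_disc z h). assert (os : off_circ (refl z)) by (unfold off_circ; unfold disc in hs; lra).
  assert (nz : z - c <> 0) by (apply Cnz_Cmod; lra).
  rewrite <- (pois_P_inside _ hs). unfold pois_P.
  assert (A1 := rho_rcont). assert (A2 := phi_rcont (refl z) os). assert (Ae := rcexp_rcont).
  assert (RC : rcont (fun t => pois_rho t * ((RtoC r * cexp t + (refl z - c)) * pois_phi (refl z) t))).
  { repeat apply rcont_mult; auto. apply rcont_plus; auto. apply rcont_const. }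
  rewrite Cplus_conj, <- mean_conj, Cmult_conj, conj_Ci, conj_RtoC by exact RC.
  rewrite Copp_plus_distr. f_equal; [|ring].
  replace (- mean (fun t => Cconj (pois_rho t * ((RtoC r * cexp t + (refl z - c)) * pois_phi (refl z) t))))
    with (- (1) * mean (fun t => Cconj (pois_rho t * ((RtoC r * cexp t + (refl z - c)) * pois_phi (refl z) t)))) by ring.
  rewrite <- mean_scal by (apply rcont_conj, RC). apply mean_ext. intros t.
  assert (n1 := pois_nz z t oz). assert (n2 := pois_nz (refl z) t os). unfold pois_phi.
  rewrite !Cmult_conj, Cinv_conj by exact n2. apply conj_nz in n2. rewrite Cminus_conj in *.
  rewrite Cplus_conj, Cmult_conj, !conj_RtoC in *. unfold pois_rho. rewrite conj_RtoC.
  assert (Z : Cconj (refl z - c) = RtoC (r * r) / (z - c)).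
  { unfold refl. replace (c + RtoC (r * r) / Cconj (z - c) - c) with (RtoC (r * r) / Cconj (z - c)) by ring.
    rewrite Cdiv_conj by (apply conj_nz, nz). rewrite conj_RtoC, Cconj_conj. reflexivity. }
  rewrite Z in *. set (ze := z - c) in *. set (e := cexp t) in *.
  assert (ne : e <> 0) by apply cexp_nz. assert (nr : RtoC r <> 0) by (apply RtoC_nz; lra).
  assert (U : Cconj e = / e).
  { assert (U : e * Cconj e = 1) by (unfold e; rewrite mult_conj_re, Cmod_cexp; f_equal; ring).
    replace (Cconj e) with (e * Cconj e / e) by (field; exact ne). rewrite U. unfold Cdiv. ring. }
  rewrite U, RtoC_mult in *.
  assert (n3 : ze - RtoC r * e <> 0).
  { intros E. apply n1. transitivity (- (ze - RtoC r * e)); [ring|rewrite E; ring]. }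
  assert (D : RtoC r * / e - RtoC r * RtoC r / ze = RtoC r * (ze - RtoC r * e) / (e * ze)) by (field; auto).
  rewrite D. field. repeat split; auto.
Qed.

(** The identity holds already for the integrands, since [r^2] is [RtoC r * e] times its conjugate.
    It does not matter on which side of the circle the two points lie, so it covers the reflected
    function too. *)
Lemma pois_P_S (z w : C) : off_circ z -> off_circ w ->
  pois_P z + Cconj (pois_P w) = RtoC 2 * (RtoC (r * r) - (z - c) * Cconj (w - c)) * pois_S z w.
Proof.
  intros hz hw. assert (A1 := rho_rcont). assert (A2 := phi_rcont z hz). assert (A3 := phi_rcont w hw). assert (Ae := rcexp_rcont).
  assert (RC : forall x, off_circ x -> rcont (fun t => pois_rho t * ((RtoC r * cexp t + (x - c)) * pois_phi x t))).
  { intros x hx. assert (T := phi_rcont x hx). repeat apply rcont_mult; auto. apply rcont_plus; auto. apply rcont_const. }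
  unfold pois_P, pois_S. rewrite Cplus_conj, <- mean_conj, Cmult_conj, conj_Ci, conj_RtoC by auto.
  rewrite <- mean_scal by (repeat apply rcont_mult; auto; apply rcont_conj; auto).
  set (m1 := mean _). set (m2 := mean _). transitivity (m1 + m2); [ring|]. unfold m1, m2.
  rewrite <- mean_plus by (auto; apply rcont_conj; auto). apply mean_ext. intros t.
  assert (n1 := pois_nz z t hz). assert (n2 := pois_nz w t hw). unfold pois_phi.
  rewrite !Cmult_conj, Cinv_conj by exact n2. apply conj_nz in n2. rewrite Cminus_conj in *.
  rewrite Cplus_conj, Cmult_conj, !conj_RtoC in *. unfold pois_rho. rewrite conj_RtoC.
  assert (U : cexp t * Cconj (cexp t) = 1) by (rewrite mult_conj_re, Cmod_cexp; f_equal; ring).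
  set (ze := z - c) in *. set (om := Cconj (w - c)) in *. set (e := cexp t) in *.
  set (s := RtoC (Re (p (circ c r t)))).
  assert (D : RtoC (r * r) = (RtoC r * e) * (RtoC r * Cconj e)).
  { rewrite RtoC_mult. transitivity (RtoC r * RtoC r * (e * Cconj e)); [rewrite U; ring|ring]. }
  rewrite D. field. split; auto.
Qed.

End Poisson.

(** * Transformations and limits of Gram forms, and the exhausting discs *)

Lemma gram_eq (k k' : C -> C -> C) (X : C -> Prop) (l m : flist) : over X l -> over X m ->
  (forall z w, X z -> X w -> k z w = k' z w) -> gram k l m = gram k' l m.
Proof.
  intros Hl Hm E. unfold gram. f_equal. apply (pair_ext X); [exact Hm|]. intros z hz.
  induction Hl as [|q l hq Hl IH]; [reflexivity|]. simpl. rewrite IH, E; auto.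
Qed.

(** The change of coefficients that corresponds to multiplying a kernel by [b z * Cconj (b w)]. *)
Definition lmul (b : C -> C) (l : flist) : flist := map (fun p => (fst p * Cconj (b (snd p)), snd p)) l.

Lemma lmul_over (X : C -> Prop) (b : C -> C) (l : flist) : over X l -> over X (lmul b l).
Proof. intros H. induction H; constructor; auto. Qed.

Lemma gram_lmul (k : C -> C -> C) (b : C -> C) (l m : flist) :
  gram (fun z w => b z * Cconj (b w) * k z w) l m = gram k (lmul b l) (lmul b m).
Proof.
  unfold gram. f_equal.
  assert (E : forall z, comb (fun z w => b z * Cconj (b w) * k z w) l z = b z * comb k (lmul b l) z).
  { intros z. induction l as [|q l IH]; simpl; [ring|]. rewrite IH. ring. }
  induction m as [|q m IH]; simpl; [reflexivity|]. rewrite IH, E, Cmult_conj. ring.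
Qed.

Definition pts (l : flist) (z : C) : Prop := In z (map snd l).

Lemma over_pts (l : flist) : over (pts l) l.
Proof.
  apply List.Forall_forall. intros q hq. unfold pts. apply in_map, hq.
Qed.

Lemma gram_tends (k : C -> C -> C) (kn : nat -> C -> C -> C) (X : C -> Prop) (l m : flist) : over X l -> over X m ->
  (forall z w, X z -> X w -> ctends (fun n => kn n z w) (k z w)) ->
  ctends (fun n => gram (kn n) l m) (gram k l m).
Proof.
  intros Hl Hm H. apply ctends_conj.
  assert (E : forall z, X z -> ctends (fun n => comb (kn n) l z) (comb k l z)).
  { intros z hz. induction Hl as [|q l hq Hl IH]; [exact (ctends_const 0)|].
    simpl. apply ctends_plus; [|exact IH]. apply ctends_mult; [apply ctends_const|auto]. }
  induction Hm as [|q m hq Hm IH]; [exact (ctends_const 0)|].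
  simpl. apply ctends_plus; [|exact IH]. apply ctends_mult; [apply ctends_const|]. apply ctends_conj; auto.
Qed.

Lemma Re_limit_pos (u : nat -> C) (l : C) (N : nat) : ctends u l ->
  (forall n, (N <= n)%nat -> (0 <= Re (u n))%R) -> (0 <= Re l)%R.
Proof.
  intros H K. apply Rnot_lt_le. intros h. destruct (H (- Re l)%R ltac:(lra)) as [N' K'].
  specialize (K (N + N')%nat ltac:(lia)). specialize (K' (N + N')%nat ltac:(lia)).
  assert (T := re_le (u (N + N')%nat - l)). rewrite re_minus in T. lra.
Qed.

Lemma ev_all (A : Type) (l : list A) (Q : nat -> A -> Prop) :
  (forall a, In a l -> exists N, forall n, (N <= n)%nat -> Q n a) ->
  exists N, forall n, (N <= n)%nat -> forall a, In a l -> Q n a.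
Proof.
  induction l as [|a l IH]; intros H; [exists 0%nat; intros ? ? ? []|].
  destruct (H a (or_introl eq_refl)) as [N1 K1]. destruct IH as [N2 K2].
  { intros b hb. apply H. right. exact hb. }
  exists (N1 + N2)%nat. intros n hn b [<-|hb]; [apply K1; lia|apply K2; [lia|exact hb]].
Qed.

(* Data of the discs exhausting the upper half-plane: scale, centre, radius, and a factor making [tn n * g] strictly contractive. *)
Definition mm (n : nat) : R := INR (S (S n)).
Definition cn (n : nat) : C := Ci * RtoC (mm n).
Definition rn (n : nat) : R := (mm n - / mm n)%R.
Definition tn (n : nat) : R := (1 - / mm n)%R.

Lemma mm_ge (n : nat) : (2 <= mm n)%R.
Proof. unfold mm. rewrite !S_INR. assert (T := pos_INR n). lra. Qed.

Lemma mm_inv (n : nat) : (0 < / mm n <= 1 / 2)%R.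
Proof.
  assert (T := mm_ge n). split; [apply Rinv_0_lt_compat; lra|].
  replace (1 / 2)%R with (/ 2)%R by field. apply Rinv_le_contravar; lra.
Qed.

Lemma mm_small (e : R) : (0 < e)%R -> exists N, forall n, (N <= n)%nat -> (/ mm n < e)%R.
Proof.
  intros he. assert (T := inv_INR_lim). apply is_lim_seq_spec in T. destruct (T (mkposreal e he)) as [N K].
  exists N. intros n hn. specialize (K (S n) ltac:(lia)). simpl pos in K. rewrite Rminus_0_r in K.
  assert (A := Rle_abs (/ INR (S (S n)))). unfold mm. lra.
Qed.

Lemma mm_tends (u : nat -> C) (l : C) (B : R) : (forall n, (Cmod (u n - l) <= B * / mm n)%R) -> ctends u l.
Proof.
  intros H e he. destruct (mm_small (e / (Rabs B + 1))%R) as [N K].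
  { apply Rdiv_lt_0_compat; [exact he|]. assert (T := Rabs_pos B). lra. }
  exists N. intros n hn. specialize (K n hn). eapply Rle_lt_trans; [apply H|].
  assert (T := Rabs_pos B). assert (T' := Rle_abs B). assert (M := mm_inv n).
  apply (Rmult_lt_compat_r (Rabs B + 1)) in K; [|lra].
  unfold Rdiv in K. rewrite Rmult_assoc, Rinv_l, Rmult_1_r in K by lra. nra.
Qed.

Lemma rn_sq (n : nat) : (rn n * rn n = mm n * mm n - 2 + / mm n * / mm n)%R.
Proof. unfold rn. assert (T := mm_ge n). field. lra. Qed.

Lemma rn_range (n : nat) : (0 < rn n < mm n)%R.
Proof. unfold rn. assert (T := mm_ge n). assert (T' := mm_inv n). lra. Qed.

Lemma cn_disc_upper (n : nat) (z : C) : disc (cn n) (mm n) z -> upper_half z.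
Proof.
  unfold disc, upper_half, cn. intros h. assert (T := Im_lip z (Ci * RtoC (mm n))).
  rewrite im_scal_r in T. change (Im Ci) with 1%R in T.
  apply Rle_lt_trans with (2 := h) in T. apply Rabs_lt_between in T. lra.
Qed.

Lemma cn_inside (z : C) : upper_half z -> exists N, forall n, (N <= n)%nat -> disc (cn n) (rn n) z.
Proof.
  (* Expanding [|z - i m|^2 < (m - 1/m)^2] shows that [S < 2 * Im z * mm n] is sufficient. *)
  unfold upper_half. intros hz. set (S := (Re z * Re z + Im z * Im z + 2)%R).
  assert (hS : (0 < S)%R) by (unfold S; nra).
  destruct (mm_small (2 * Im z / S)%R) as [N K]. { apply Rdiv_lt_0_compat; lra. }
  exists N. intros n hn. specialize (K n hn). assert (M := mm_inv n). assert (M2 := mm_ge n).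
  assert (K' : (S < 2 * Im z * mm n)%R).
  { apply (Rmult_lt_compat_r (S * mm n)) in K; [|apply Rmult_lt_0_compat; lra].
    replace (/ mm n * (S * mm n))%R with S in K by (field; lra).
    replace (2 * Im z / S * (S * mm n))%R with (2 * Im z * mm n)%R in K by (field; lra). exact K. }
  unfold disc. assert (Q := Cmod_sqr (z - cn n)). rewrite re_minus, im_minus in Q. unfold cn in Q.
  rewrite re_scal_r, im_scal_r in Q. change (Re Ci) with 0%R in Q. change (Im Ci) with 1%R in Q. fold (cn n) in Q.
  assert (R2 := rn_sq n). assert (R0 := rn_range n). assert (p := Cmod_ge_0 (z - cn n)).
  apply Rnot_le_lt. intros h. unfold S in K'. nra.
Qed.

Lemma cn_outside (z : C) (n : nat) : lower_half z -> (mm n < Cmod (z - cn n))%R.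
Proof.
  unfold lower_half. intros hz. assert (T := im_le_Cmod (z - cn n)). rewrite im_minus in T. unfold cn in T at 1.
  rewrite im_scal_r in T. change (Im Ci) with 1%R in T.
  assert (T' := Rle_abs (- (Im z - 1 * mm n))). rewrite Rabs_Ropp in T'. lra.
Qed.

Definition zs (n : nat) (z : C) : C := refl (cn n) (rn n) z.

Lemma Ci2 : Ci * Ci = - (1).
Proof. apply Ceq; unfold Ci, RtoC, Re, Im, Copp, Cmult; simpl; ring. Qed.

Lemma zs_disc (z : C) (n : nat) : lower_half z -> disc (cn n) (rn n) (zs n z).
Proof.
  intros hz. assert (T := cn_outside z n hz). assert (T' := rn_range n).
  apply (refl_disc _ _ (mm n)); lra.
Qed.

Lemma rn_mm_bound (n : nat) (x : C) : (Cmod (RtoC (rn n * rn n) - RtoC (mm n * mm n) - x) <= 2 + Cmod x)%R.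
Proof.
  unfold Cminus at 1. eapply Rle_trans; [apply Cmod_triangle|]. rewrite Cmod_opp, <- RtoC_minus, Cmod_R, rn_sq.
  assert (M := mm_inv n). apply Rplus_le_compat_r.
  replace (mm n * mm n - 2 + / mm n * / mm n - mm n * mm n)%R with (- (2 - / mm n * / mm n))%R by ring.
  rewrite Rabs_Ropp, Rabs_pos_eq; nra.
Qed.

(** As the circles grow, reflection in them tends to reflection in the real line. *)
Lemma zs_tends (z : C) : lower_half z -> ctends (fun n => zs n z) (Cconj z).
Proof.
  intros hz. apply (mm_tends _ _ (2 + Cmod (Cconj z * Cconj z))). intros n.
  assert (O := cn_outside z n hz). assert (M := mm_ge n).
  assert (nz : z - cn n <> 0) by (apply Cnz_Cmod; lra). apply conj_nz in nz.
  assert (cc : Cconj (z - cn n) = Cconj z + Ci * RtoC (mm n)).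
  { unfold cn. rewrite Cminus_conj, Cmult_conj, conj_Ci, conj_RtoC. ring. }
  assert (E : zs n z - Cconj z = (RtoC (rn n * rn n) - RtoC (mm n * mm n) - Cconj z * Cconj z) / Cconj (z - cn n)).
  { unfold zs, refl. rewrite cc in *. unfold cn.
    transitivity ((RtoC (rn n * rn n) + (Ci * Ci) * RtoC (mm n * mm n) - Cconj z * Cconj z) / (Cconj z + Ci * RtoC (mm n))).
    - rewrite (RtoC_mult (mm n)). field. exact nz.
    - rewrite Ci2. f_equal. ring. }
  rewrite E, Cmod_div by exact nz. rewrite Cmod_conj.
  apply Rmult_le_compat; [apply Cmod_ge_0|left; apply Rinv_0_lt_compat; lra|apply rn_mm_bound|].
  apply Rinv_le_contravar; lra.
Qed.

(* The denominator of the Poisson kernel of the n-th disc, scaled so as to tend to [- i (z - conj w)]. *)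
Definition dn (n : nat) (z w : C) : C :=
  (RtoC (rn n * rn n) - (z - cn n) * Cconj (w - cn n)) / RtoC (mm n).

Lemma dn_tends (z w : C) : ctends (fun n => dn n z w) (- Ci * (z - Cconj w)).
Proof.
  apply (mm_tends _ _ (2 + Cmod (z * Cconj w))). intros n. assert (M := mm_ge n).
  assert (nm : RtoC (mm n) <> 0) by (apply RtoC_nz; lra).
  assert (E : dn n z w - - Ci * (z - Cconj w)
    = (RtoC (rn n * rn n) - RtoC (mm n * mm n) - z * Cconj w) / RtoC (mm n)).
  { unfold dn, cn. rewrite Cminus_conj, Cmult_conj, conj_Ci, conj_RtoC.
    transitivity ((RtoC (rn n * rn n) + (Ci * Ci) * RtoC (mm n * mm n) - z * Cconj w) / RtoC (mm n)).
    - rewrite (RtoC_mult (mm n)). field. exact nm.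
    - rewrite Ci2. f_equal. ring. }
  rewrite E, Cmod_div by exact nm. rewrite Cmod_R, (Rabs_pos_eq (mm n)) by lra.
  apply Rmult_le_compat_r; [left; apply Rinv_0_lt_compat; lra|apply rn_mm_bound].
Qed.

Definition kq (f : C -> C) (z w : C) : C := (1 - f z * Cconj (f w)) / (- Ci * (z - Cconj w)).

Section SchurPositive.

Variable g : C -> C.
Hypothesis Sg : schur g.

Definition nice_pt (z : C) : Prop := off_real z /\ (lower_half z -> SR g z <> 0).

Let tg (n : nat) (z : C) : C := RtoC (tn n) * g z.
Let pn (n : nat) (z : C) : C := (1 + tg n z) / (1 - tg n z).

Lemma tn_range (n : nat) : (0 < tn n < 1)%R.
Proof. unfold tn. assert (M := mm_inv n). lra. Qed.

Lemma tg_lt (n : nat) (z : C) : upper_half z -> (Cmod (tg n z) < 1)%R.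
Proof.
  intros hz. unfold tg. rewrite Cmod_mult, Cmod_R. assert (T := tn_range n). rewrite Rabs_pos_eq by lra.
  assert (L := proj1 (proj2 Sg) z hz). assert (p := Cmod_ge_0 (g z)). nra.
Qed.

Lemma tg_nz (n : nat) (z : C) : upper_half z -> 1 - tg n z <> 0.
Proof.
  intros hz. apply Cnz_Cmod. assert (T := tg_lt n z hz). assert (T' := Cmod_triangle_rev 1 (tg n z)).
  rewrite Cmod_1 in T'. lra.
Qed.

(** This is why [rn n] is smaller than [mm n]: the Poisson formulas on the disc of radius [rn n]
    need holomorphy on a larger concentric disc, and the one of radius [mm n] still lies in the
    half-plane. *)
Lemma pn_holo (n : nat) : holo (disc (cn n) (mm n)) (pn n).
Proof.
  apply (holo_sub upper_half); [apply cn_disc_upper|].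
  assert (T : holo upper_half (tg n)) by (apply holo_mult; [apply holo_const|apply Sg]).
  apply holo_div; [apply holo_plus; [apply holo_const|exact T]|apply holo_minus; [apply holo_const|exact T]|apply tg_nz].
Qed.

Lemma Re_div (a b : C) : b <> 0 -> (Re (a / b) = Re (a * Cconj b) / (Cmod b * Cmod b))%R.
Proof.
  intros hb. assert (hm := proj1 (Cmod_gt_0 b) hb).
  assert (E : a / b = a * Cconj b * RtoC (/ (Cmod b * Cmod b))).
  { rewrite RtoC_inv by nra. rewrite <- mult_conj_re. field. split; [apply conj_nz|]; exact hb. }
  rewrite E, re_scal_r. reflexivity.
Qed.

Lemma pn_pos (n : nat) (z : C) : disc (cn n) (mm n) z -> (0 <= Re (pn n z))%R.
Proof.
  intros hz. apply cn_disc_upper in hz. assert (nz := tg_nz n z hz). unfold pn. rewrite Re_div by exact nz.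
  assert (hm := proj1 (Cmod_gt_0 _) nz). assert (T := tg_lt n z hz). assert (Q := Cmod_sqr (tg n z)).
  assert (p := Cmod_ge_0 (tg n z)).
  apply Rmult_le_pos; [|left; apply Rinv_0_lt_compat; nra].
  rewrite Cminus_conj, conj_RtoC, re_mult, re_plus, im_plus, re_minus, im_minus, re_conj, im_conj, !re_RtoC, !im_RtoC. nra.
Qed.

(** The analogue of [ext] for the [n]-th disc: above the line the contraction [tg n], below it the
    inverse of its conjugate at the point reflected in the circle. *)
Definition hn (n : nat) (z : C) : C :=
  if Rlt_dec 0 (Im z) then tg n z else / Cconj (tg n (zs n z)).

Lemma hn_tends (z : C) : nice_pt z -> ctends (fun n => hn n z) (ext g z).
Proof.
  intros [oz nz].
  assert (Tt : ctends (fun n => RtoC (tn n)) 1).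
  { apply (mm_tends _ _ 1). intros n. rewrite <- RtoC_minus, Cmod_R. unfold tn. assert (M := mm_inv n).
    replace (1 - / mm n - 1)%R with (- / mm n)%R by ring. rewrite Rabs_Ropp, Rabs_pos_eq; lra. }
  unfold hn, ext. destruct (Rlt_dec 0 (Im z)) as [hz|hz].
  - assert (T := ctends_mult _ _ _ _ Tt (ctends_const (g z))). rewrite Cmult_1_l in T. exact T.
  - assert (lz : lower_half z) by (unfold lower_half, off_real in *; lra).
    apply ctends_inv; [apply nz, lz|]. apply ctends_conj.
    assert (G : ctends (fun n => g (zs n z)) (g (Cconj z))).
    { apply (ctends_comp g (fun n => zs n z)); [apply (holo_ccont _ _ _ (proj1 Sg)), conj_lower, lz|apply zs_tends, lz]. }
    assert (T := ctends_mult _ _ _ _ Tt G). rewrite Cmult_1_l in T. exact T.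
Qed.

(* The disc [|z - i m| < m] and its reflection approximate the two half-planes. *)
Definition good (n : nat) (z : C) : Prop :=
  (upper_half z /\ disc (cn n) (rn n) z) \/ (lower_half z /\ g (zs n z) <> 0).

Lemma good_ev (z : C) : nice_pt z -> exists N, forall n, (N <= n)%nat -> good n z.
Proof.
  intros [oz nz]. destruct (off_real_cases z oz) as [hz|hz].
  - destruct (cn_inside z hz) as [N K]. exists N. intros n hn. left. auto.
  - assert (gz : g (Cconj z) <> 0) by (apply SR_neq, nz, hz).
    destruct (ccont_nz_near g _ (holo_ccont _ _ _ (proj1 Sg) (conj_lower z hz)) gz) as [d [hd K]].
    destruct (zs_tends z hz d hd) as [N HN]. exists N. intros n hn. right. split; [exact hz|]. apply K, HN, hn.
Qed.

Lemma good_off (n : nat) (z : C) : good n z -> off_circ (cn n) (rn n) z.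
Proof.
  unfold off_circ. intros [[_ hz]|[hz _]].
  - unfold disc in hz. lra.
  - assert (T := cn_outside z n hz). assert (T' := rn_range n). lra.
Qed.

Let Pn (n : nat) : C -> C := pois_P (pn n) (cn n) (rn n).

(** Inside the disc the Cayley transform of [pn] gives back [tg n]. Outside, [pois_P] is minus a
    conjugate, and changing the sign inverts the Cayley transform. *)
Lemma good_P (n : nat) (z : C) : good n z -> Pn n z + 1 <> 0 /\ (Pn n z - 1) / (Pn n z + 1) = hn n z.
Proof.
  assert (two : RtoC 2 <> 0) by (apply RtoC_nz; lra).
  assert (T := tn_range n). assert (R1 := rn_range n).
  assert (tz : RtoC (tn n) <> 0) by (apply RtoC_nz; lra).
  intros [[uz hz]|[lz gz]]; unfold Pn, hn.
  - rewrite (pois_P_inside _ _ _ _ (pn_holo n) R1 z hz). destruct (Rlt_dec 0 (Im z)); [|contradiction].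
    assert (nz := tg_nz n z uz). unfold pn.
    assert (E : (1 + tg n z) / (1 - tg n z) + 1 = RtoC 2 / (1 - tg n z)).
    { replace (RtoC 2) with (RtoC 1 + RtoC 1) by (rewrite <- RtoC_plus; f_equal; ring). field. exact nz. }
    assert (E' : (1 + tg n z) / (1 - tg n z) - 1 = RtoC 2 * tg n z / (1 - tg n z)).
    { replace (RtoC 2) with (RtoC 1 + RtoC 1) by (rewrite <- RtoC_plus; f_equal; ring). field. exact nz. }
    rewrite E, E'. split; [apply Cmult_neq_0; [exact two|]|field; auto].
    intros e. apply (f_equal (Cmult (1 - tg n z))) in e. rewrite Cinv_r, Cmult_0_r in e by exact nz. exact (C1_nz e).
  - assert (O := cn_outside z n lz).
    rewrite (pois_P_outside _ _ _ _ (pn_holo n) R1 z ltac:(lra)).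
    destruct (Rlt_dec 0 (Im z)); [unfold lower_half in lz; lra|].
    change (refl (cn n) (rn n) z) with (zs n z).
    assert (uz : upper_half (zs n z)).
    { apply (cn_disc_upper n). apply (disc_le _ (rn n)); [lra|]. apply zs_disc, lz. }
    assert (nz := tg_nz n _ uz). unfold pn.
    assert (tgz : tg n (zs n z) <> 0) by (apply Cmult_neq_0; auto).
    set (u := tg n (zs n z)) in *.
    assert (E : - Cconj ((1 + u) / (1 - u)) + 1 = Cconj (- (RtoC 2 * u) / (1 - u))).
    { rewrite <- (conj_RtoC 1) at 3. rewrite <- Copp_conj, <- Cplus_conj. f_equal.
      replace (RtoC 2) with (RtoC 1 + RtoC 1) by (rewrite <- RtoC_plus; f_equal; ring). field. exact nz. }
    assert (E' : - Cconj ((1 + u) / (1 - u)) - 1 = Cconj (- RtoC 2 / (1 - u))).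
    { rewrite <- (conj_RtoC 1) at 3. rewrite <- Copp_conj, <- Cminus_conj. f_equal.
      replace (RtoC 2) with (RtoC 1 + RtoC 1) by (rewrite <- RtoC_plus; f_equal; ring). field. exact nz. }
    rewrite E, E'.
    assert (nu : - (RtoC 2 * u) / (1 - u) <> 0).
    { intros e. apply (f_equal (fun x => x * (1 - u))) in e. rewrite Cmult_0_l in e.
      replace (- (RtoC 2 * u) / (1 - u) * (1 - u)) with (- (RtoC 2 * u)) in e by (field; exact nz).
      apply (Cmult_neq_0 _ _ two tgz). replace (RtoC 2 * u) with (- - (RtoC 2 * u)) by ring. rewrite e. ring. }
    split; [apply conj_nz, nu|]. rewrite <- Cdiv_conj by exact nu. rewrite <- Cinv_conj by exact tgz. f_equal. field. auto.
Qed.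

Definition kn (n : nat) (z w : C) : C := (1 - hn n z * Cconj (hn n w)) / dn n z w.

Lemma good_gram (n : nat) (l : flist) : over (good n) l ->
  (forall z w, pts l z -> pts l w -> dn n z w <> 0) ->
  (0 <= Re (gram (kn n) l l))%R.
Proof.
  intros Hl Hd. assert (R1 := rn_range n). assert (M := mm_ge n).
  (* With [P], [Q] the Herglotz values at [z] and, conjugated, at [w], one has [1 - hn z * conj (hn
     w) = 2 (P + Q) / ((P + 1) (Q + 1))]. By [pois_P_S], division by [dn] leaves [4 mm n] times
     [pois_S], hence the factor [2 * sqrt (mm n)]. *)
  set (b := fun z => RtoC (2 * sqrt (mm n)) / (Pn n z + 1)).
  assert (E : gram (kn n) l l =
    gram (fun z w => b z * Cconj (b w) * pois_S (pn n) (cn n) (rn n) z w) l l).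
  { assert (O : over (fun z => good n z /\ pts l z) l).
    { apply List.Forall_forall. intros q hq. split.
      - apply (proj1 (List.Forall_forall _ _) Hl q hq).
      - unfold pts. apply in_map, hq. }
    apply (gram_eq _ _ _ _ _ O O). intros z w [gz pz] [gw pw].
    assert (PS := pois_P_S _ _ _ _ (pn_holo n) R1 z w (good_off n z gz) (good_off n w gw)).
    specialize (Hd z w pz pw). unfold kn, dn in *. fold (Pn n z) in PS. fold (Pn n w) in PS.
    set (D := RtoC (rn n * rn n) - (z - cn n) * Cconj (w - cn n)) in *.
    destruct (good_P n z gz) as [nz <-]. destruct (good_P n w gw) as [nw <-].
    rewrite Cdiv_conj by exact nw. unfold b. rewrite Cdiv_conj, conj_RtoC by exact nw.
    assert (nw' := conj_nz _ nw). rewrite Cplus_conj, Cminus_conj, conj_RtoC in *.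
    set (P := Pn n z) in *. set (Q := Cconj (Pn n w)) in *. set (S := pois_S _ _ _ _ _) in *.
    assert (nm : RtoC (mm n) <> 0) by (apply RtoC_nz; lra).
    assert (nD : D <> 0).
    { intros e. apply Hd. rewrite e. unfold Cdiv. ring. }
    assert (sq : RtoC (2 * sqrt (mm n)) * RtoC (2 * sqrt (mm n)) = RtoC 2 * RtoC 2 * RtoC (mm n)).
    { rewrite <- !RtoC_mult. f_equal. assert (SS := sqrt_sqrt (mm n) ltac:(lra)). nra. }
    transitivity (RtoC 2 * (P + Q) * RtoC (mm n) / ((P + 1) * (Q + 1) * D)).
    - replace (RtoC 2) with (RtoC 1 + RtoC 1) by (rewrite <- RtoC_plus; f_equal; ring). field. auto.
    - rewrite PS. transitivity (RtoC (2 * sqrt (mm n)) * RtoC (2 * sqrt (mm n)) * S / ((P + 1) * (Q + 1))).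
      + rewrite sq. field. auto.
      + field. auto. }
  rewrite E, gram_lmul.
  apply (pois_S_pos _ _ _ _ (pn_holo n) R1 (pn_pos n)). apply lmul_over.
  revert Hl. apply List.Forall_impl. intros q. apply good_off.
Qed.

(** Only finitely many points occur, so from some [n] on all of them are [good], all denominators
    are nonzero, and the Gram forms converge. *)
Lemma schur_nice_pos (l : flist) : over nice_pt l ->
  (forall z w, pts l z -> pts l w -> z <> Cconj w) ->
  (0 <= Re (gram (kq (ext g)) l l))%R.
Proof.
  intros Hl Hc.
  assert (Nc : forall z, pts l z -> nice_pt z).
  { unfold pts. intros z hz. apply in_map_iff in hz. destruct hz as [q [<- hq]].
    apply (proj1 (List.Forall_forall _ _) Hl q hq). }
  assert (ND : forall z w, pts l z -> pts l w -> - Ci * (z - Cconj w) <> 0).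
  { intros z w hz hw. apply Cmult_neq_0; [|apply Cminus_eq_contra, Hc; auto].
    intros e. apply Ci_nz. replace Ci with (- - Ci) by ring. rewrite e. ring. }
  destruct (ev_all C (map snd l) good) as [N1 K1].
  { intros z hz. apply good_ev, Nc, hz. }
  destruct (ev_all (C * C) (list_prod (map snd l) (map snd l)) (fun n q => dn n (fst q) (snd q) <> 0)) as [N2 K2].
  { intros [z w] hq. apply in_prod_iff in hq. destruct hq as [hz hw]. simpl.
    assert (p := proj1 (Cmod_gt_0 _) (ND z w hz hw)). destruct (dn_tends z w _ p) as [N K]. exists N.
    intros n hn e. specialize (K n hn). rewrite e in K. rewrite Cmod_sub_sym in K.
    replace (- Ci * (z - Cconj w) - 0) with (- Ci * (z - Cconj w)) in K by ring. lra. }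
  apply (Re_limit_pos (fun n => gram (kn n) l l) _ (N1 + N2)%nat).
  - apply (gram_tends _ _ (pts l)); [apply over_pts|apply over_pts|].
    intros z w hz hw. apply ctends_div; [apply ND; auto| |apply dn_tends].
    apply ctends_minus; [apply ctends_const|]. apply ctends_mult; [apply hn_tends, Nc, hz|].
    apply ctends_conj, hn_tends, Nc, hw.
  - intros n hn. apply good_gram.
    + assert (O := over_pts l). revert O. apply List.Forall_impl. intros q hq. apply K1; [lia|exact hq].
    + intros z w hz hw. apply (K2 n ltac:(lia) (z, w)). apply in_prod_iff. auto.
Qed.

End SchurPositive.

(** * The space B(h) *)

Lemma taylor_center (f : C -> C) (z : C) (d : R) : (0 < d)%R -> holo (disc z d) f ->
  exists a : nat -> C, a 0%nat = f z /\ (forall w, disc z d w -> pser a (w - z) (f w)) /\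
    (forall r, (0 < r < d)%R -> exists M, cbound a r M).
Proof.
  intros hd H. destruct (taylor f z d hd H) as [a [Ha [HB _]]]. exists a. split; [|split; auto].
  apply (ctends_unique _ _ _ (pser_0 a)). assert (T := Ha z (disc_center z d hd)).
  replace (z - z) with (RtoC 0) in T by ring. exact T.
Qed.

Lemma lipschitz_near (f : C -> C) (z : C) (d : R) : (0 < d)%R -> holo (disc z d) f ->
  exists L : R, forall x y, disc z (d / 4) x -> disc z (d / 4) y -> (Cmod (f x - f y) <= L * Cmod (x - y))%R.
Proof.
  intros hd H. destruct (taylor_center f z d hd H) as [a [_ [Ha HB]]].
  destruct (HB (3 * d / 4)%R ltac:(lra)) as [M HM].
  destruct (cbound_deriv a (3 * d / 4) (d / 2) M ltac:(lra) HM) as [M' HM'].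
  exists (M' * (1 / 2) ^ 0 / (1 - 1 / 2))%R. intros x y hx hy.
  assert (hx' := hx). assert (hy' := hy). unfold disc in hx', hy'.
  assert (B : forall k, (Cmod (a (S k) * hsym (x - z) (y - z) k) <= M' * (1 / 2) ^ k)%R).
  { intros k. assert (G := cbound_geom _ (d / 2) M' (RtoC (d / 4)) ltac:(lra) HM' k).
    rewrite !Cmod_mult, Cmod_pow, !Cmod_R in G.
    rewrite !Rabs_pos_eq in G by (try apply pos_INR; lra).
    replace (d / 4 / (d / 2))%R with (1 / 2)%R in G by (field; lra).
    eapply Rle_trans; [|exact G]. rewrite Cmod_mult.
    assert (Y := hsym_bound (x - z) (y - z) (d / 4) k ltac:(lra) ltac:(lra)).
    assert (ca := Cmod_ge_0 (a (S k))). nra. }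
  apply (ctends_Cmod_le (fun n => csum (fun k => a k * (x - z) ^ k) (S n) - csum (fun k => a k * (y - z) ^ k) (S n))).
  - apply ctends_minus.
    + apply (proj1 (ctends_shift (csum (fun k => a k * (x - z) ^ k)) _)). apply Ha. apply (disc_le _ (d / 4)); [lra|exact hx].
    + apply (proj1 (ctends_shift (csum (fun k => a k * (y - z) ^ k)) _)). apply Ha. apply (disc_le _ (d / 4)); [lra|exact hy].
  - intros n. replace (csum (fun k => a k * (x - z) ^ k) (S n) - csum (fun k => a k * (y - z) ^ k) (S n))
      with (csum (fun k => a (S k) * hsym (x - z) (y - z) k) n * (x - y)).
    + rewrite Cmod_mult. apply Rmult_le_compat_r; [apply Cmod_ge_0|].
      assert (T := csum_tail _ M' (1 / 2) ltac:(lra) B 0 n). simpl Nat.add in T. simpl (csum _ 0) in T.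
      replace (csum (fun k => a (S k) * hsym (x - z) (y - z) k) n - 0)
        with (csum (fun k => a (S k) * hsym (x - z) (y - z) k) n) in T by ring. exact T.
    + induction n as [|n IH]; [simpl; ring|].
      simpl csum in IH |- *. rewrite Cmult_plus_distr_r, IH.
      replace (x - y) with ((x - z) - (y - z)) by ring.
      replace (a (S n) * hsym (x - z) (y - z) n * (x - z - (y - z)))
        with (a (S n) * (hsym (x - z) (y - z) n * (x - z - (y - z)))) by ring.
      rewrite <- hsym_spec. simpl. ring.
Qed.

Lemma difference_quotient (f : C -> C) (z : C) (d : R) : (0 < d)%R -> holo (disc z d) f ->
  exists D, holo (disc z (d / 2)) D /\ forall w, disc z (d / 2) w -> f w - f z = D w * (w - z).
Proof.
  intros hd H. destruct (taylor_center f z d hd H) as [a [a0 [Ha HB]]].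
  destruct (HB (d / 2)%R ltac:(lra)) as [M HM].
  assert (HS := pser_shift_bound a (d / 2) M ltac:(lra) HM).
  exists (fun w => pfun (fun k => a (S k)) (w - z)). split.
  - apply (holo_comp _ (disc 0 (d / 2)) (pfun (fun k => a (S k))) (fun w => w - z)).
    + apply (pfun_holo _ _ (M / (d / 2))); [lra|exact HS].
    + apply holo_minus; [apply holo_id|apply holo_const].
    + intros w hw. unfold disc in *. replace (w - z - 0) with (w - z) by ring. exact hw.
  - intros w hw. destruct (Ceq_dec w z) as [->|nw]; [ring|].
    assert (nz := Cminus_eq_contra _ _ nw).
    assert (h2 : (d / 2 <= d)%R) by lra.
    assert (P := pser_shift a (w - z) (f w) nz (Ha w (disc_le _ (d / 2) _ _ h2 hw))).
    unfold disc in hw.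
    rewrite (ctends_unique _ _ _ (pfun_correct _ (d / 2) _ (w - z) ltac:(lra) HS hw) P), a0. field. exact nz.
Qed.

Definition ks (he : C -> C) (z w : C) : C :=
  if Ceq_dec z (Cconj w) then reg (fun x => kq he x w) z else kq he z w.

Lemma ks_off (he : C -> C) (z w : C) : z <> Cconj w -> ks he z w = kq he z w.
Proof. intros h. unfold ks. destruct (Ceq_dec z (Cconj w)); [contradiction|reflexivity]. Qed.

Lemma mCi_nz : - Ci <> 0.
Proof. intros e. apply Ci_nz. replace Ci with (- - Ci) by ring. rewrite e. ring. Qed.

(** All points of a list are shifted at once, so a Gram form of the shifted kernel is again a Gram
    form, while [z - Cconj w] gains a positive imaginary part. *)
Definition sh (n : nat) (z : C) : C := z + Ci * RtoC (/ INR (S n)).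

Section SpaceB.

Variables (h g he : C -> C).
Hypothesis Sg : schur g.
Hypothesis Hh : mero_eq off_real h (ext g).
Hypothesis Ee : extension h he.

Let hc := he_conj h g he Sg Hh Ee.
Let hol : holo (U_ext h) he := he_holo h he Ee.

(** On a conjugate pair [he z * Cconj (he w) = 1], so nearby the numerator is
    [- (he x - he z) * Cconj (he w)] and the kernel is a multiple of the holomorphic difference
    quotient [D]. *)
Lemma ks_near (z w : C) : U_ext h z -> U_ext h w -> z = Cconj w ->
  exists (d : R) (D : C -> C), (0 < d)%R /\ holo (disc z d) D /\ he z * Cconj (he w) = 1 /\
    (forall x, disc z d x -> he x - he z = D x * (x - z)) /\
    (forall x, disc z d x -> ks he x w = - Ci * Cconj (he w) * D x).
Proof.
  intros uz uw e. destruct (U_ext_open h z uz) as [d [hd K]].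
  destruct (difference_quotient he z d hd (holo_sub _ _ _ K hol)) as [D [HD ED]].
  assert (E1 : he z * Cconj (he w) = 1).
  { assert (T := hc z uz). rewrite e, Cconj_conj in T. rewrite e. apply T, uw. }
  assert (Eq : forall x, disc z (d / 2) x -> x <> z -> kq he x w = - Ci * Cconj (he w) * D x).
  { intros x hx nx. unfold kq. rewrite <- e. assert (nz := Cminus_eq_contra _ _ nx). specialize (ED x hx).
    rewrite <- E1. replace (he z * Cconj (he w) - he x * Cconj (he w)) with (- ((he x - he z) * Cconj (he w))) by ring.
    rewrite ED. transitivity (/ Ci * Cconj (he w) * D x); [|rewrite Ci_inv; reflexivity].
    field. split; [apply Ci_nz|exact nz]. }
  exists (d / 2)%R, D. split; [lra|]. split; [exact HD|]. split; [exact E1|]. split; [exact ED|].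
  intros x hx. unfold ks. destruct (Ceq_dec x (Cconj w)) as [ex|nx].
  - rewrite <- e in ex. subst x. apply (reg_eq _ (fun x => - Ci * Cconj (he w) * D x) z (d / 2)); [lra| |].
    + intros y hy iy. apply Eq; [exact hy|]. intros ->. lra.
    + apply ccont_mult; [apply ccont_const|]. apply (holo_ccont _ _ _ HD hx).
  - apply Eq; [exact hx|]. rewrite e. exact nx.
Qed.

Lemma neq_near (z a : C) : z <> a -> exists d : R, (0 < d)%R /\ forall x, disc z d x -> x <> a.
Proof.
  intros n. exists (Cmod (z - a)). split; [apply Cmod_gt_0, Cminus_eq_contra, n|].
  intros x hx ->. unfold disc in hx. rewrite Cmod_sub_sym in hx. lra.
Qed.

Lemma ks_holo (w : C) : U_ext h w -> holo (U_ext h) (fun z => ks he z w).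
Proof.
  intros uw. apply holo_local. intros z uz. destruct (Ceq_dec z (Cconj w)) as [e|n].
  - destruct (ks_near z w uz uw e) as [d [D [hd [HD [_ [_ E]]]]]]. exists d. split; [exact hd|].
    apply (holo_ext _ (fun x => - Ci * Cconj (he w) * D x)).
    + intros x hx. destruct (disc_open _ _ _ hx) as [r [hr Kr]]. exists r. split; [exact hr|].
      intros y hy. symmetry. apply E, Kr, hy.
    + apply holo_mult; [apply holo_const|exact HD].
  - destruct (U_ext_open h z uz) as [d [hd K]]. destruct (neq_near _ _ n) as [d' [hd' K']].
    exists (Rmin d d'). split; [apply Rmin_pos; auto|].
    apply (holo_ext _ (fun x => kq he x w)).
    + intros x hx. destruct (disc_open _ _ _ hx) as [r [hr Kr]]. exists r. split; [exact hr|].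
      intros y hy. symmetry. apply ks_off, K'. apply Kr in hy. apply disc_min in hy. tauto.
    + apply holo_div.
      * apply holo_minus; [apply holo_const|]. apply holo_mult; [|apply holo_const].
        apply (holo_sub (U_ext h)); [|exact hol]. intros x hx. apply disc_min in hx. apply K, hx.
      * apply holo_mult; [apply holo_const|]. apply holo_minus; [apply holo_id|apply holo_const].
      * intros x hx. apply disc_min in hx. apply Cmult_neq_0; [apply mCi_nz|]. apply Cminus_eq_contra, K', hx.
Qed.

Lemma ks_s_kernel : s_kernel h (ks he).
Proof.
  exists he. split; [apply Ee|]. split; [apply Ee|]. intros z w uz uw. split; [apply ks_off|].
  intros _ P HP. assert (CC := holo_ccont _ _ _ (ks_holo w uw) uz).
  apply (proj1 (locally_C_ball _ _)) in HP. destruct HP as [e [hpos K]]. destruct (CC e hpos) as [d [hd Kd]].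
  apply (proj2 (locally'_C_ball z (fun x => P (ks he x w)))). exists d. split; [exact hd|].
  intros x hx _. apply K, Kd, hx.
Qed.

Lemma sh_tends (z : C) : ctends (fun n => sh n z) z.
Proof. apply vert_tends. Qed.

Lemma sh_ev (U : C -> Prop) (z : C) : isopen U -> U z -> exists N, forall n, (N <= n)%nat -> U (sh n z).
Proof.
  intros HU uz. destruct (HU z uz) as [d [hd K]]. destruct (sh_tends z d hd) as [N HN]. exists N.
  intros n hn. apply K, HN, hn.
Qed.

Lemma sh_conj (n : nat) (w : C) : Cconj (sh n w) = Cconj w - Ci * RtoC (/ INR (S n)).
Proof. unfold sh. rewrite Cplus_conj, Cmult_conj, conj_Ci, conj_RtoC. ring. Qed.

Lemma invINR_pos (n : nat) : (0 < / INR (S n))%R.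
Proof. apply Rinv_0_lt_compat, lt_0_INR. lia. Qed.

Lemma sh_diff (n : nat) (z w : C) : sh n z - Cconj (sh n w) = z - Cconj w + RtoC (2 * / INR (S n)) * Ci.
Proof. rewrite sh_conj. unfold sh. rewrite RtoC_mult. replace (RtoC 2) with (RtoC 1 + RtoC 1) by (rewrite <- RtoC_plus; f_equal; ring). ring. Qed.

Lemma sh_noconj (z w : C) : exists N, forall n, (N <= n)%nat -> sh n z <> Cconj (sh n w).
Proof.
  destruct (Ceq_dec z (Cconj w)) as [e|n].
  - exists 0%nat. intros n _ E. apply Ceq_minus in E. rewrite sh_diff, e in E.
    apply (f_equal Im) in E. rewrite im_plus, im_minus, im_scal_l, im_RtoC in E. change (Im Ci) with 1%R in E.
    assert (T := invINR_pos n). lra.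
  - assert (p := proj1 (Cmod_gt_0 _) (Cminus_eq_contra _ _ n)).
    assert (T : ctends (fun n => sh n z - Cconj (sh n w)) (z - Cconj w)).
    { apply ctends_minus; [apply sh_tends|apply ctends_conj, sh_tends]. }
    destruct (T _ p) as [N K]. exists N. intros k hk E. apply Ceq_minus in E. specialize (K k hk).
    rewrite E, Cmod_sub_sym in K. replace (z - Cconj w - 0) with (z - Cconj w) in K by ring. lra.
Qed.

Lemma ks_shift (z w : C) : U_ext h z -> U_ext h w -> ctends (fun n => ks he (sh n z) (sh n w)) (ks he z w).
Proof.
  intros uz uw. destruct (sh_noconj z w) as [N1 K1].
  apply (ctends_ev_ext (fun n => kq he (sh n z) (sh n w)) _ _ N1).
  { intros n hn. symmetry. apply ks_off, K1, hn. }
  assert (cz := holo_ccont _ _ _ hol uz). assert (cw := holo_ccont _ _ _ hol uw).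
  destruct (Ceq_dec z (Cconj w)) as [e|n].
  - destruct (ks_near z w uz uw e) as [d [D [hd [HD [E1 [ED EK]]]]]].
    assert (hcen := disc_center z d hd). rewrite (EK z hcen).
    assert (cD := holo_ccont _ _ _ HD hcen).
    set (lo := fun n => Cconj (sh n w)).
    assert (Tlo : ctends lo z) by (rewrite e; apply ctends_conj, sh_tends).
    destruct (U_ext_open h z uz) as [d2 [hd2 KU]].
    destruct (Tlo d hd) as [N2 K2]. destruct (Tlo d2 hd2) as [N3 K3].
    destruct (sh_tends z d hd) as [N4 K4].
    destruct (sh_ev (U_ext h) w (U_ext_open h) uw) as [N5 K5].
    (* [lo n] lies as far below [z] as [sh n z] lies above it, so the quotient becomes the average
       of the two values of [D]. *)
    apply (ctends_ev_ext (fun n => - Ci * (RtoC (1 / 2) * (D (lo n) + D (sh n z)) / he (lo n))) _ _ (N2 + N3 + N4 + N5)%nat).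
    + intros n hn.
      assert (A : he (lo n) * Cconj (he (sh n w)) = 1).
      { unfold lo. rewrite <- (Cconj_conj (sh n w)) at 2. apply hc.
        - apply KU, K3. lia.
        - rewrite Cconj_conj. apply K5. lia. }
      assert (nz : he (lo n) <> 0) by (intros E; rewrite E, Cmult_0_l in A; exact (C1_nz (eq_sym A))).
      assert (A' : Cconj (he (sh n w)) = / he (lo n)).
      { replace (Cconj (he (sh n w))) with (he (lo n) * Cconj (he (sh n w)) / he (lo n)) by (field; exact nz).
        rewrite A. unfold Cdiv. ring. }
      unfold kq. rewrite A', sh_diff, e, <- e.
      assert (B1 := ED (lo n) (K2 n ltac:(lia))). assert (B2 := ED (sh n z) (K4 n ltac:(lia))).
      assert (L1 : lo n - z = - (Ci * RtoC (/ INR (S n)))) by (unfold lo; rewrite sh_conj, e; ring).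
      assert (L2 : sh n z - z = Ci * RtoC (/ INR (S n))) by (unfold sh; ring).
      rewrite L1 in B1. rewrite L2 in B2.
      assert (ne : RtoC (/ INR (S n)) <> 0) by (apply RtoC_nz; assert (T := invINR_pos n); lra).
      assert (two : RtoC 2 <> 0) by (apply RtoC_nz; lra).
      assert (Hf : RtoC (1 / 2) = / RtoC 2) by (rewrite <- RtoC_inv by lra; f_equal; field). rewrite Hf, RtoC_mult.
      set (E := RtoC (/ INR (S n))) in *.
      replace (1 - he (sh n z) * / he (lo n)) with (((he (lo n) - he z) - (he (sh n z) - he z)) / he (lo n)) by (field; exact nz).
      rewrite B1, B2.
      replace (z - z + RtoC 2 * E * Ci) with (RtoC 2 * E * Ci) by ring.
      transitivity (/ Ci * (/ RtoC 2 * (D (lo n) + D (sh n z)) / he (lo n))); [rewrite Ci_inv; reflexivity|].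
      field. repeat split; auto using Ci_nz.
    + replace (- Ci * Cconj (he w) * D z) with (- Ci * (RtoC (1 / 2) * (D z + D z) / he z)).
      * assert (nz : he z <> 0) by (intros E; rewrite E, Cmult_0_l in E1; exact (C1_nz (eq_sym E1))).
        apply ctends_mult; [apply ctends_const|]. apply ctends_div; [exact nz| |apply (ctends_comp he); auto].
        apply ctends_mult; [apply ctends_const|]. apply ctends_plus; apply (ctends_comp D); auto. apply sh_tends.
      * assert (nz : he z <> 0) by (intros E; rewrite E, Cmult_0_l in E1; exact (C1_nz (eq_sym E1))).
        replace (Cconj (he w)) with (he z * Cconj (he w) / he z) by (field; exact nz). rewrite E1.
        assert (H2 : RtoC (1 / 2) + RtoC (1 / 2) = 1) by (rewrite <- RtoC_plus; f_equal; field).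
        transitivity (- Ci * ((RtoC (1 / 2) + RtoC (1 / 2)) * D z / he z)); [unfold Cdiv; ring|rewrite H2; unfold Cdiv; ring].
  - rewrite ks_off by exact n. unfold kq. apply ctends_div.
    + apply Cmult_neq_0; [apply mCi_nz|apply Cminus_eq_contra, n].
    + apply ctends_minus; [apply ctends_const|]. apply ctends_mult; [|apply ctends_conj]; apply (ctends_comp he); auto using sh_tends.
    + apply ctends_mult; [apply ctends_const|]. apply ctends_minus; [apply sh_tends|apply ctends_conj, sh_tends].
Qed.

Lemma kq_herm (f : C -> C) (z w : C) : z <> Cconj w -> kq f w z = Cconj (kq f z w).
Proof.
  intros n. assert (n' : - Ci * (z - Cconj w) <> 0) by (apply Cmult_neq_0; [apply mCi_nz|apply Cminus_eq_contra, n]).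
  unfold kq. rewrite Cdiv_conj by exact n'.
  rewrite !Cminus_conj, !Cmult_conj, Cminus_conj, Copp_conj, conj_Ci, !Cconj_conj, conj_RtoC. f_equal; ring.
Qed.

Lemma ks_herm : herm (U_ext h) (ks he).
Proof.
  intros z w uz uw. apply (ctends_unique _ _ _ (ks_shift w z uw uz)).
  destruct (sh_noconj z w) as [N K].
  apply (ctends_ev_ext (fun n => Cconj (ks he (sh n z) (sh n w))) _ _ N).
  - intros n hn. specialize (K n hn). rewrite !ks_off; [symmetry; apply kq_herm, K| |exact K].
    intros e. apply K. rewrite e, Cconj_conj. reflexivity.
  - apply ctends_conj, ks_shift; auto.
Qed.

Definition lsh (n : nat) (l : flist) : flist := map (fun q => (fst q, sh n (snd q))) l.

Lemma gram_lsh (k : C -> C -> C) (n : nat) (l m : flist) :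
  gram (fun z w => k (sh n z) (sh n w)) l m = gram k (lsh n l) (lsh n m).
Proof.
  unfold gram. f_equal.
  assert (E : forall z, comb (fun z w => k (sh n z) (sh n w)) l z = comb k (lsh n l) (sh n z)).
  { intros z. induction l as [|q l IH]; simpl; [reflexivity|]. rewrite IH. reflexivity. }
  induction m as [|q m IH]; simpl; [reflexivity|]. rewrite IH, E. reflexivity.
Qed.

Lemma off_sh (z : C) : exists N, forall n, (N <= n)%nat -> off_real (sh n z).
Proof.
  destruct (sh_noconj z z) as [N K]. exists N. intros n hn e. apply (K n hn).
  apply Ceq; [rewrite re_conj|rewrite im_conj, e]; [reflexivity|ring].
Qed.

(* For a finite list a small vertical shift removes real points and pairs of conjugate points. *)
Lemma lsh_nice (l : flist) : over (U_ext h) l -> exists N, forall n, (N <= n)%nat ->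
  over (fun z => off_real z /\ U_ext h z) (lsh n l) /\
  (forall z w, pts (lsh n l) z -> pts (lsh n l) w -> z <> Cconj w).
Proof.
  intros Hl.
  destruct (ev_all _ l (fun n q => off_real (sh n (snd q)) /\ U_ext h (sh n (snd q)))) as [N1 K1].
  { intros q hq. destruct (off_sh (snd q)) as [N K].
    destruct (sh_ev (U_ext h) (snd q) (U_ext_open h)) as [N' K'].
    { apply (proj1 (List.Forall_forall _ _) Hl q hq). }
    exists (N + N')%nat. intros n hn. split; [apply K|apply K']; lia. }
  destruct (ev_all _ (list_prod l l) (fun n q => sh n (snd (fst q)) <> Cconj (sh n (snd (snd q))))) as [N2 K2].
  { intros [p q] _. apply sh_noconj. }
  exists (N1 + N2)%nat. intros n hn. split.
  - apply List.Forall_forall. intros q hq. apply in_map_iff in hq. destruct hq as [p [<- hp]]. apply (K1 n ltac:(lia) p hp).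
  - intros z w hz hw. unfold pts, lsh in hz, hw. rewrite map_map in hz, hw.
    apply in_map_iff in hz, hw. destruct hz as [p [<- hp]], hw as [q [<- hq]].
    apply (K2 n ltac:(lia) (p, q)). apply in_prod; auto.
Qed.

Lemma ks_posdef : posdef (U_ext h) (ks he).
Proof.
  split; [apply ks_herm|]. intros l Hl. destruct (lsh_nice l Hl) as [N K].
  apply (Re_limit_pos (fun n => gram (fun z w => ks he (sh n z) (sh n w)) l l) _ N).
  - apply (gram_tends _ _ (U_ext h)); auto. apply ks_shift.
  - intros n hn. rewrite gram_lsh. destruct (K n hn) as [O NC]. 
    rewrite (gram_eq (ks he) (kq (ext g)) (fun z => (off_real z /\ U_ext h z) /\ pts (lsh n l) z)).
    + apply (schur_nice_pos g Sg); [|exact NC]. revert O. apply List.Forall_impl. intros q [oq uq]. split; [exact oq|].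
      intros lq. apply (he_lower_nz h g he Sg Hh Ee _ lq uq).
    + apply List.Forall_forall. intros q hq. split; [apply (proj1 (List.Forall_forall _ _) O q hq)|apply in_map, hq].
    + apply List.Forall_forall. intros q hq. split; [apply (proj1 (List.Forall_forall _ _) O q hq)|apply in_map, hq].
    + assert (HE : forall z, off_real z -> U_ext h z -> he z = ext g z).
      { intros z oz uz. destruct (off_real_cases z oz) as [hz|hz].
        - rewrite ext_upper by exact hz. apply (he_upper h g he Sg Hh Ee z hz).
        - rewrite ext_lower by exact hz. apply (he_lower_nz h g he Sg Hh Ee z hz uz). }
      intros z w [[oz uz] pz] [[ow uw] pw]. rewrite ks_off by (apply NC; auto). unfold kq. rewrite !HE by auto. reflexivity.
Qed.

(** At nonreal points the diagonal is continuous. Near a real point its numerator is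
    [he (Cconj x) - he x] up to a bounded factor, and a Lipschitz estimate for [he] cancels the
    denominator. *)
Lemma ks_diag_bound (z : C) : U_ext h z -> exists d B : R, (0 < d)%R /\ (0 <= B)%R /\
  forall x, disc z d x -> U_ext h x /\ (Cmod (ks he x x) <= B)%R.
Proof.
  intros uz.
  (* Diagonal values at the remaining points are limits of nonreal ones under vertical shifts. *)
  enough (Q : exists d B : R, (0 < d)%R /\ forall x, disc z d x -> off_real x -> (Cmod (kq he x x) <= B)%R).
  { destruct Q as [d [B [hd K]]]. destruct (U_ext_open h z uz) as [d' [hd' K']].
    exists (Rmin d d'), (Rmax B 0). split; [apply Rmin_pos; auto|]. split; [apply Rmax_r|].
    intros x hx. assert (hx' := hx). apply disc_min in hx. split; [apply K', hx|].
    destruct (disc_open _ _ _ (proj1 hx)) as [e [hpos Ke]]. destruct (sh_tends x e hpos) as [N1 K1].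
    destruct (off_sh x) as [N2 K2]. destruct (sh_noconj x x) as [N3 K3].
    assert (T : ctends (fun n => ks he (sh (N1 + N2 + N3 + n) x) (sh (N1 + N2 + N3 + n) x)) (ks he x x)).
    { apply (ctends_extract (fun n => ks he (sh n x) (sh n x)) _ (fun n => (N1 + N2 + N3 + n)%nat)); [intros; lia|].
      apply ks_shift; apply K', hx. }
    apply (ctends_Cmod_le _ _ _ T). intros n. rewrite ks_off by (apply K3; lia).
    eapply Rle_trans; [|apply Rmax_l]. apply K; [apply Ke, K1; lia|apply K2; lia]. }
  destruct (U_ext_open h z uz) as [d [hd K]].
  destruct (Req_dec (Im z) 0) as [iz|iz].
  - assert (zc : Cconj z = z) by (apply Ceq; rewrite ?re_conj, ?im_conj; lra).
    destruct (lipschitz_near he z d hd (holo_sub _ _ _ K hol)) as [L HL].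
    assert (E1 := hc z uz). rewrite zc in E1. specialize (E1 uz).
    assert (nz : he z <> 0) by (intros E; rewrite E, Cmult_0_l in E1; exact (C1_nz (eq_sym E1))).
    assert (cin := ccont_inv_comp he z nz (holo_ccont _ _ _ hol uz)).
    destruct (cin 1%R ltac:(lra)) as [d2 [hd2 K2]].
    exists (Rmin (d / 4) d2), (L * (Cmod (/ he z) + 1))%R. split; [apply Rmin_pos; lra|].
    intros x hx ox. assert (cx : disc z (Rmin (d / 4) d2) (Cconj x)) by (apply disc_conj; rewrite zc; exact hx).
    apply disc_min in hx, cx. destruct hx as [h1 h2], cx as [c1 c2].
    assert (ux : U_ext h x) by (apply K, (disc_le _ (d / 4)); [lra|exact h1]).
    assert (ucx : U_ext h (Cconj x)) by (apply K, (disc_le _ (d / 4)); [lra|exact c1]).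
    assert (A := hc (Cconj x) ucx). rewrite Cconj_conj in A. specialize (A ux).
    assert (nx : he (Cconj x) <> 0) by (intros E; rewrite E, Cmult_0_l in A; exact (C1_nz (eq_sym A))).
    assert (nxx : x - Cconj x <> 0).
    { intros E. apply ox. apply (f_equal Im) in E. rewrite im_minus, im_conj, im_RtoC in E. lra. }
    assert (F : kq he x x = (he (Cconj x) - he x) * / he (Cconj x) / (- Ci * (x - Cconj x))).
    { unfold kq. f_equal. replace (Cconj (he x)) with (he (Cconj x) * Cconj (he x) / he (Cconj x)) by (field; exact nx).
      rewrite A. field. exact nx. }
    rewrite F. assert (nd : - Ci * (x - Cconj x) <> 0) by (apply Cmult_neq_0; [apply mCi_nz|exact nxx]).
    rewrite Cmod_div by exact nd. rewrite !Cmod_mult, Cmod_opp, Cmod_Ci, Rmult_1_l.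
    assert (B1 := HL (Cconj x) x c1 h1). rewrite (Cmod_sub_sym (Cconj x) x) in B1.
    assert (B2 := K2 _ c2). assert (B3 := Cmod_triangle_rev (/ he (Cconj x)) (/ he z)).
    assert (px := proj1 (Cmod_gt_0 _) nxx). assert (p1 := Cmod_ge_0 (/ he (Cconj x))). assert (p2 := Cmod_ge_0 (he (Cconj x) - he x)).
    assert (p3 := Cmod_ge_0 (/ he z)).
    apply (Rmult_le_reg_r (Cmod (x - Cconj x))); [exact px|]. unfold Rdiv. rewrite Rmult_assoc, Rinv_l, Rmult_1_r by lra.
    apply Rle_trans with (L * Cmod (x - Cconj x) * (Cmod (/ he z) + 1))%R; [|right; ring].
    apply Rmult_le_compat; lra.
  - assert (nd : - Ci * (z - Cconj z) <> 0).
    { apply Cmult_neq_0; [apply mCi_nz|]. intros E. apply iz. apply (f_equal Im) in E.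
      rewrite im_minus, im_conj, im_RtoC in E. lra. }
    assert (cz := holo_ccont _ _ _ hol uz).
    assert (CC : ccont (fun x => kq he x x) z).
    { apply ccont_seq. intros u hu. unfold kq. apply ctends_div; [exact nd| |].
      - apply ctends_minus; [apply ctends_const|]. apply ctends_mult; [|apply ctends_conj]; apply (ctends_comp he); auto.
      - apply ctends_mult; [apply ctends_const|]. apply ctends_minus; [exact hu|apply ctends_conj, hu]. }
    destruct (CC 1%R ltac:(lra)) as [d2 [hd2 K2]]. exists d2, (Cmod (kq he z z) + 1)%R. split; [exact hd2|].
    intros x hx _. specialize (K2 x hx). assert (T := Cmod_triangle_rev (kq he x x) (kq he z z)). lra.
Qed.

Lemma ks_analytic (F : C -> C) : ma_space (U_ext h) (ks he) F -> analytic_on (U_ext h) F.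
Proof.
  intros HF. destruct (ma_bounded _ _ ks_posdef F HF) as [u [B [hB [Hu [Lu Bu]]]]].
  intros z uz. apply analytic_at_holo. destruct (ks_diag_bound z uz) as [d [B' [hd [hB' K]]]].
  exists d. split; [exact hd|].
  apply (vitali (fun n => comb (ks he) (u n)) F z d (B * B' + 1)%R hd).
  - intros n. specialize (Hu n). induction Hu as [|q l hq Hl IH]; [exact (holo_const _ 0)|].
    simpl. apply holo_plus; [|exact IH]. apply holo_mult; [apply holo_const|].
    apply (holo_sub (U_ext h)); [apply K|apply ks_holo, hq].
  - intros n x hx. destruct (K x hx) as [ux bx]. specialize (Bu n x ux).
    assert (T := re_le (ks he x x)). assert (p := Cmod_ge_0 (comb (ks he) (u n) x)).
    assert (B * Re (ks he x x) <= B * B')%R by (apply Rmult_le_compat_l; lra).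
    assert (0 <= B * B')%R by (apply Rmult_le_pos; auto).
    apply Rnot_lt_le. intros hh. nra.
  - intros x hx. apply Lu, K, hx.
Qed.

Lemma B_space_intro (f F : C -> C) : ma_space (U_ext h) (ks he) F -> mero_eq off_real f F -> B_space h f.
Proof.
  intros HF E. exists (ks he), (ma_space (U_ext h) (ks he)), (ma_ip (U_ext h) (ks he)).
  split; [apply ks_s_kernel|]. split; [apply moore_aronszajn, ks_posdef|]. split; [apply ks_analytic|].
  exists F. auto.
Qed.

End SpaceB.

(** * Resolvent operators *)

Lemma pair_lmul (phi b : C -> C) (l : flist) : pair phi (lmul b l) = pair (fun z => b z * phi z) l.
Proof. induction l as [|q l IH]; simpl; [reflexivity|]. rewrite IH, Cmult_conj. ring. Qed.

Lemma imag_diff (a : C) : a - Cconj a = RtoC (2 * Im a) * Ci.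
Proof.
  apply Ceq; rewrite ?re_minus, ?im_minus, ?re_conj, ?im_conj, ?re_scal_l, ?im_scal_l.
  - change (Re Ci) with 0%R. ring.
  - change (Im Ci) with 1%R. ring.
Qed.

Section Resolvent.

Variables (U : C -> Prop) (k : C -> C -> C) (H : (C -> C) -> Prop) (ip : (C -> C) -> (C -> C) -> C).
Hypothesis HR : RKHS U k H ip.
Variables (X : C -> Prop) (f : C -> C) (al : C).
Hypothesis HX : forall z, X z -> U z.
Hypothesis Hk : forall z w, X z -> X w -> k z w * (- Ci * (z - Cconj w)) = 1 - f z * Cconj (f w).
Hypothesis Xal : X al.
Hypothesis Ial : (0 < Im al)%R.
Hypothesis Huniq : forall a F, H F -> (forall w, X w -> w <> a -> F w = 0) -> forall z, U z -> F z = 0.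

Let HH := proj1 HR.
Let Hlin := hs_lin _ _ _ HH.
Let PH := rk_preH U k H ip HR.

Lemma Hk' (z w : C) : X z -> X w -> (Cconj w - z) * k z w = - Ci * (1 - f z * Cconj (f w)).
Proof.
  intros hz hw. rewrite <- Hk by auto.
  transitivity ((Ci * Ci) * ((z - Cconj w) * k z w)); [rewrite Ci2; ring|ring].
Qed.

(** Weighting the coefficients acts on combinations as multiplication by [v - al], up to a multiple
    of the combination and two rank-one terms supplied by the kernel identity. *)
Lemma comb_weight (L : flist) (v : C) : over X L -> X v ->
  comb k (lmul (fun w => w - al) L) v =
  (v - al) * comb k L v + ((al - Cconj al) * comb k L v + - Ci * (pair (fun _ => 1) L - f v * pair f L)).
Proof.
  intros HL hv. induction HL as [|[c w] L hw HL IH]; simpl in *; [ring|].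
  rewrite IH, conj_RtoC, Cminus_conj. assert (E := Hk' v w hv hw).
  transitivity (c * ((Cconj w - v) * k v w) + (v - al) * (c * k v w) + (al - Cconj al) * (c * k v w)
    + ((v - al) * comb k L v + ((al - Cconj al) * comb k L v + - Ci * (pair (fun _ => 1) L - f v * pair f L)))); [ring|].
  rewrite E. ring.
Qed.

(** When the coefficients sum to zero one of those rank-one terms vanishes and the other contributes
    a square. Both terms on the right are nonnegative, so the imaginary part controls [Im al] times
    the squared norm of the combination. *)
Lemma gram_weight (L : flist) : over X L -> pair (fun _ => 1) L = 0 ->
  gram k (lmul (fun w => w - al) L) L - Cconj (gram k (lmul (fun w => w - al) L) L) =
  Ci * RtoC (Cmod (pair f L) * Cmod (pair f L) + 2 * Im al * Re (gram k L L)).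
Proof.
  intros HL H0.
  assert (OL := lmul_over X (fun w => w - al) L HL).
  assert (PD := rk_posdef U k H ip HR X HX).
  rewrite <- (gram_sym X k _ _ (proj1 PD) OL HL).
  assert (E : gram k (lmul (fun w => w - al) L) L = gram k L (lmul (fun w => w - al) L)
    + ((al - Cconj al) * gram k L L + Ci * (Cconj (pair f L) * pair f L))).
  { unfold gram at 1 2. rewrite (pair_ext X _ (fun v => (v - al) * comb k L v
      + ((al - Cconj al) * comb k L v + (Ci * pair f L) * f v)) L HL).
    2:{ intros v hv. rewrite comb_weight, H0 by auto. ring. }
    assert (A : forall phi psi : C -> C, pair (fun v => phi v + psi v) L = pair phi L + pair psi L).
    { intros phi psi. clear. induction L as [|q L IH]; simpl; [ring|]. rewrite IH, Cplus_conj. ring. }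
    rewrite A, (pair_lin (al - Cconj al) (comb k L) (fun v => Ci * pair f L * f v)).
    rewrite <- (pair_lmul (comb k L) (fun v => v - al)).
    assert (B : pair (fun v => Ci * pair f L * f v) L = Cconj (Ci * pair f L) * pair f L).
    { generalize (Ci * pair f L). intros c. clear. induction L as [|q L IH]; simpl; [ring|]. rewrite IH, Cmult_conj. ring. }
    rewrite B, !Cplus_conj, !Cmult_conj, Cconj_conj, !Cconj_conj. fold (gram k L L). ring. }
  rewrite E, imag_diff.
  assert (RG : gram k L L = RtoC (Re (gram k L L))).
  { assert (S := gram_sym X k L L (proj1 PD) HL HL). apply (f_equal Im) in S. rewrite im_conj in S.
    apply Ceq; rewrite ?re_RtoC, ?im_RtoC; lra. }
  rewrite RG at 1. rewrite (Cmult_comm (Cconj _) (pair f L)), mult_conj_re, RtoC_plus, (RtoC_mult (2 * Im al)). ring.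
Qed.

Definition dquot (a : C) (F : C -> C) (w : C) : C := (F w - F a) / (w - a).

(* The adjoint of the resolvent maps [k(., w)] to [(k(., w) - k(., al)) / (conj w - conj al)]; the weight identity
   [gram_weight] bounds it by [1 / Im al]. *)
Lemma res_bound (F : C -> C) (l : flist) : H F -> over (fun w => X w /\ w <> al) l ->
  (Cmod (pair (dquot al F) l) * Cmod (pair (dquot al F) l) <=
   Re (ip F F) / (Im al * Im al) * Re (gram k l l))%R.
Proof.
  intros hF Hl.
  (* Dividing the coefficients by [conj (w - al)] makes pairing with [dquot al F] a pairing with
     [F]. The extra point [al] makes the coefficients sum to zero and disappears when the weight
     [w - al] is restored. *)
  set (l1 := lmul (fun w => / (w - al)) l). set (L := (- pair (fun _ => 1) l1, al) :: l1).
  assert (Ol : over X l) by (revert Hl; apply List.Forall_impl; tauto).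
  assert (Ol1 : over X l1) by (apply lmul_over, Ol).
  assert (OL : over X L) by (constructor; [exact Xal|exact Ol1]).
  assert (OU : forall m, over X m -> over U m) by (intros m; apply List.Forall_impl; auto).
  assert (S0 : pair (fun _ => 1) L = 0) by (unfold L; simpl; rewrite conj_RtoC; ring).
  assert (E1 : pair (dquot al F) l = pair F L).
  { unfold dquot, L, l1. simpl. rewrite !pair_lmul. clear - Hl. induction Hl as [|[a w] l [hw nw] Hl IH]; simpl in *; [ring|].
    rewrite IH. assert (nz := Cminus_eq_contra _ _ nw). assert (nz' := conj_nz _ nz).
    rewrite Cdiv_conj, !Cmult_conj, Cinv_conj, conj_RtoC, Cminus_conj by exact nz. field. exact nz'. }
  assert (E2 : forall z, comb k (lmul (fun w => w - al) L) z = comb k l z).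
  { intros z. unfold L, l1. simpl. replace (al - al) with (RtoC 0) by ring. rewrite conj_RtoC.
    transitivity (comb k (lmul (fun w => w - al) (lmul (fun w => / (w - al)) l)) z); [ring|].
    clear - Hl. induction Hl as [|[a w] l [hw nw] Hl IH]; simpl in *; [reflexivity|].
    rewrite IH. assert (nz := Cminus_eq_contra _ _ nw). assert (nz' := conj_nz _ nz).
    rewrite Cinv_conj by exact nz. field. exact nz'. }
  set (W := lmul (fun w => w - al) L). assert (OW : over X W) by (apply lmul_over, OL).
  set (u := exist _ (comb k l) (rk_comb U k H ip HR _ (OU _ Ol)) : hsub H).
  set (v := exist _ (comb k L) (rk_comb U k H ip HR _ (OU _ OL)) : hsub H).
  set (FF := exist _ F hF : hsub H).
  assert (GW : gram k W L = hip H ip u v).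
  { rewrite (rk_gram U k H ip HR) by auto. change (ip (comb k W) (comb k L) = ip (comb k l) (comb k L)).
    replace (comb k W) with (comb k l); [reflexivity|]. apply functional_extensionality. intros z. symmetry. apply E2. }
  assert (GI := gram_weight L OL S0). fold W in GI.
  assert (nv : Re (gram k L L) = nrm2 _ (hip H ip) v) by (rewrite (rk_gram U k H ip HR) by auto; reflexivity).
  assert (nu : Re (gram k l l) = nrm2 _ (hip H ip) u) by (rewrite (rk_gram U k H ip HR) by auto; reflexivity).
  rewrite nv, GW in GI. apply (f_equal Im) in GI. rewrite im_minus, im_conj, im_scal_r in GI. change (Im Ci) with 1%R in GI.
  assert (C1 := cauchy_schwarz _ _ _ PH u v). assert (C2 := cauchy_schwarz _ _ _ PH v FF).
  replace (hip H ip v FF) with (pair F L) in C2 by (symmetry; apply (rk_ip_comb U k H ip HR); auto).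
  rewrite E1, nu. change (Re (ip F F)) with (nrm2 _ (hip H ip) FF).
  assert (v0 := nrm2_ge0 _ _ _ PH v). assert (u0 := nrm2_ge0 _ _ _ PH u). assert (F0 := nrm2_ge0 _ _ _ PH FF).
  set (nV := nrm2 _ _ v) in *. set (nU := nrm2 _ _ u) in *. set (nF := nrm2 _ _ FF) in *.
  assert (im := im_le_Cmod (hip H ip u v)). assert (im' := Rle_abs (Im (hip H ip u v))).
  assert (p0 := Cmod_ge_0 (pair f L)). assert (q0 := Cmod_ge_0 (hip H ip u v)).
  assert (A : (Im al * nV <= Cmod (hip H ip u v))%R) by nra.
  assert (A2 : (Im al * nV * (Im al * nV) <= nU * nV)%R).
  { eapply Rle_trans; [|exact C1]. assert (0 <= Im al * nV)%R by nra. apply Rmult_le_compat; lra. }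
  assert (A3 : (Im al * Im al * nV <= nU)%R).
  { destruct (Rle_lt_or_eq_dec _ _ v0) as [h|h]; [|rewrite <- h; lra].
    apply (Rmult_le_reg_r nV); [exact h|]. lra. }
  assert (aa : (0 < Im al * Im al)%R) by nra.
  apply (Rmult_le_reg_l (Im al * Im al)); [exact aa|].
  replace (Im al * Im al * (nF / (Im al * Im al) * nU))%R with (nF * nU)%R by (field; lra).
  apply Rle_trans with (Im al * Im al * (nV * nF))%R; [apply Rmult_le_compat_l; lra|].
  replace (Im al * Im al * (nV * nF))%R with (nF * (Im al * Im al * nV))%R by ring.
  apply Rmult_le_compat_l; lra.
Qed.

(** [G] is the difference quotient of [F] at [a], multiplied out. The condition is vacuous at
    [w = a], where the value is determined through [Huniq]. *)
Definition is_res (a : C) (F G : C -> C) : Prop := forall w, X w -> G w * (w - a) = F w - F a.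

Lemma res_exists (F : C -> C) : H F -> exists G, H G /\ is_res al F G /\
  (Re (ip G G) <= Re (ip F F) / (Im al * Im al))%R.
Proof.
  intros hF. assert (F0 := ip_pos _ _ _ HH F hF).
  destruct (rk_criterion U k H ip HR (fun w => X w /\ w <> al) (dquot al F)
    (Re (ip F F) / (Im al * Im al))) as [G [hG [EG NG]]].
  - intros z [hz _]. apply HX, hz.
  - apply Rmult_le_pos; [exact F0|]. left. apply Rinv_0_lt_compat. nra.
  - intros l Hl. apply res_bound; auto.
  - exists G. split; [exact hG|]. split; [|exact NG]. intros w hw.
    destruct (Ceq_dec w al) as [->|nw]; [ring|]. rewrite EG by auto. unfold dquot. field. apply Cminus_eq_contra, nw.
Qed.

Lemma res_unique (a : C) (F G G' : C -> C) : H G -> H G' -> is_res a F G -> is_res a F G' ->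
  forall z, U z -> G z = G' z.
Proof.
  intros hG hG' RG RG' z uz. apply Ceq_minus.
  replace (G z - G' z) with (- (1) * G' z + G z) by ring.
  apply (Huniq a (fun z => - (1) * G' z + G z)); [apply Hlin; auto| |exact uz].
  intros w hw nw. assert (nz := Cminus_eq_contra _ _ nw).
  assert (E := RG w hw). rewrite <- (RG' w hw) in E.
  replace (G w) with (G w * (w - a) / (w - a)) by (field; exact nz). rewrite E. field. exact nz.
Qed.

(** The chosen resolvent is linear up to values outside [U], which [res_unique] and [ip_ext] make
    harmless; Riesz then supplies the adjoint applied to [G]. *)
Lemma res_adjoint (G : C -> C) : H G -> exists G', H G' /\
  forall F RF, H F -> H RF -> is_res al F RF -> ip F G' = ip RF G.
Proof.
  intros hG.
  set (Rs := fun F : hsub H => proj1_sig (constructive_indefinite_description _ (res_exists (proj1_sig F) (proj2_sig F)))).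
  assert (HRs : forall F, H (Rs F) /\ is_res al (proj1_sig F) (Rs F) /\
    (Re (ip (Rs F) (Rs F)) <= Re (ip (proj1_sig F) (proj1_sig F)) / (Im al * Im al))%R).
  { intros F. unfold Rs. destruct (constructive_indefinite_description _ _); auto. }
  clearbody Rs.
  assert (aa : (0 < Im al * Im al)%R) by nra.
  set (GG := exist _ G hG : hsub H). assert (g0 := nrm2_ge0 _ _ _ PH GG).
  destruct (riesz _ _ _ PH (fun F => ip (Rs F) G) (nrm2 _ (hip H ip) GG / (Im al * Im al)) GG) as [G' [HG' _]].
  - intros c u v. destruct (HRs u) as [hu [ru _]], (HRs v) as [hv [rv _]], (HRs (hlc H Hlin c u v)) as [hw [rw _]].
    rewrite <- (ip_lin _ _ _ HH) by auto. apply (ip_ext _ _ _ HH); auto.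
    apply (res_unique al (fun z => c * proj1_sig u z + proj1_sig v z)); auto.
    intros w xw. assert (A := ru w xw). assert (B := rv w xw).
    transitivity (c * (Rs u w * (w - al)) + Rs v w * (w - al)); [ring|]. rewrite A, B. ring.
  - apply Rmult_le_pos; [exact g0|left; apply Rinv_0_lt_compat, aa].
  - intros F. destruct (HRs F) as [hF [_ NF]].
    assert (CS := cauchy_schwarz _ _ _ PH (exist _ (Rs F) hF) GG). unfold hip at 1 2 in CS. simpl in CS.
    eapply Rle_trans; [exact CS|]. change (nrm2 _ (hip H ip) (exist _ (Rs F) hF)) with (Re (ip (Rs F) (Rs F))).
    change (nrm2 _ (hip H ip) F) with (Re (ip (proj1_sig F) (proj1_sig F))).
    apply Rle_trans with (Re (ip (proj1_sig F) (proj1_sig F)) / (Im al * Im al) * nrm2 _ (hip H ip) GG)%R.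
    + apply Rmult_le_compat_r; auto.
    + right. field. nra.
  - apply (rk_complete U k H ip HR).
  - exists (proj1_sig G'). split; [exact (proj2_sig G')|]. intros F RF hF hRF rF.
    set (F1 := exist _ F hF : hsub H). destruct (HRs F1) as [h1 [r1 _]].
    transitivity (ip (Rs F1) G); [symmetry; exact (HG' F1)|].
    apply (ip_ext _ _ _ HH); auto. apply (res_unique al F); auto.
Qed.

Lemma adjoint_eval (G G' r : C -> C) (w : C) : H G -> H G' ->
  (forall F RF, H F -> H RF -> is_res al F RF -> ip F G' = ip RF G) ->
  X w -> H r -> is_res al (fun z => k z w) r -> G' w = Cconj (ip r G).
Proof.
  intros hG hG' E hw hr rr. assert (S := rk_section U k H ip HR w (HX w hw)).
  rewrite (rk_eval U k H ip HR w G' (HX w hw) hG'), (ip_conj _ _ _ HH (fun z => k z w) G') by auto.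
  f_equal. apply E; auto.
Qed.

Hypothesis Xcal : X (Cconj al).

Lemma f_conj : f al * Cconj (f (Cconj al)) = 1.
Proof.
  assert (E := Hk al (Cconj al) Xal Xcal). rewrite Cconj_conj in E.
  replace (k al (Cconj al) * (- Ci * (al - al))) with (RtoC 0) in E by ring.
  symmetry. apply Ceq_minus. symmetry. exact E.
Qed.

(* The resolvent of a section is again explicit, by the kernel identity and [f al * conj (f (conj al)) = 1]. *)
Lemma res_section (w : C) : X w -> w <> Cconj al ->
  is_res al (fun z => k z w)
    (fun z => / (Cconj w - al) * k z w + (- / (Cconj w - al) + Ci * k al w) * k z (Cconj al)).
Proof.
  intros hw nw z hz.
  assert (nz : Cconj w - al <> 0).
  { intros e. apply nw. apply Ceq_minus in e. rewrite <- e, Cconj_conj. reflexivity. }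
  assert (A := Hk' z w hz hw). assert (B := Hk' z (Cconj al) hz Xcal). assert (D := Hk' al w Xal hw).
  rewrite Cconj_conj in B. assert (F1 := f_conj).
  assert (K : Ci * Ci = - (1)) by apply Ci2.
  set (a := k z w) in *. set (b := k z (Cconj al)) in *. set (c := k al w) in *.
  set (fz := f z) in *. set (fa := f al) in *. set (fw := Cconj (f w)) in *. set (fc := Cconj (f (Cconj al))) in *.
  apply Ceq_minus.
  transitivity ((- ((Cconj w - z) * a) + (al - z) * b + (Cconj w - al) * c - Ci * ((Cconj w - al) * c) * ((al - z) * b)) / (Cconj w - al)).
  { field. exact nz. }
  rewrite A, B, D.
  transitivity ((Ci * (1 - fz * fw) - Ci * (1 - fz * fc) - Ci * (1 - fa * fw)
     - (Ci * Ci) * (Ci * ((1 - fa * fw) * (1 - fz * fc)))) / (Cconj w - al)); [field; exact nz|].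
  rewrite K. transitivity (Ci * (fz * fw) * ((fa * fc) - 1) / (Cconj w - al)); [field; exact nz|].
  rewrite F1. field. exact nz.
Qed.

(** The adjoint of the resolvent at [al] differs from the resolvent at [Cconj al] by the rank-one
    term [c * k z al] with [c = Ci * G (Cconj al)]. Pairing [F] with this term produces the boundary
    form. *)
Lemma res_conj_exists (G : C -> C) : H G -> exists G1, H G1 /\ is_res (Cconj al) G G1 /\
  forall F RF, H F -> H RF -> is_res al F RF -> ip F G1 - ip RF G = - Ci * F al * Cconj (G (Cconj al)).
Proof.
  intros hG. destruct (res_adjoint G hG) as [G' [hG' E]].
  assert (sec := fun w hw => rk_section U k H ip HR w (HX w hw)).
  assert (Sa := sec al Xal).
  set (c := Ci * G (Cconj al)).
  exists (fun z => c * k z al + G' z). split; [apply Hlin; auto|]. split.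
  - intros w hw. destruct (Ceq_dec w (Cconj al)) as [->|nw]; [ring|].
    assert (nz := Cminus_eq_contra _ _ nw).
    assert (Sw := sec w hw). assert (Sc := sec (Cconj al) Xcal).
    set (r := fun z => / (Cconj w - al) * k z w + (- / (Cconj w - al) + Ci * k al w) * k z (Cconj al)).
    assert (hr : H r).
    { unfold r. apply (Hlin (/ (Cconj w - al)) (fun z => k z w) (fun z => (- / (Cconj w - al) + Ci * k al w) * k z (Cconj al))); auto.
      apply (hs_ext _ _ _ HH (fun z => (- / (Cconj w - al) + Ci * k al w) * k z (Cconj al) + 0)).
      - apply Hlin; [exact Sc|apply (hs_zero _ _ _ HH)].
      - intros; ring. }
    rewrite (adjoint_eval G G' r w hG hG' E hw hr (res_section w hw nw)).
    assert (nz' : Cconj w - al <> 0).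
    { intros e. apply nw. apply Ceq_minus in e. rewrite <- e, Cconj_conj. reflexivity. }
    assert (Er : ip r G = / (Cconj w - al) * Cconj (G w) + (- / (Cconj w - al) + Ci * k al w) * Cconj (G (Cconj al))).
    { assert (T := rk_ip_comb U k H ip HR ((/ (Cconj w - al), w) :: ((- / (Cconj w - al) + Ci * k al w), Cconj al) :: nil) G).
      simpl in T. rewrite Cplus_0_r in T. rewrite <- T; [|repeat constructor; simpl; auto|exact hG].
      apply (ip_ext _ _ _ HH); auto.
      - apply (rk_comb U k H ip HR ((/ (Cconj w - al), w) :: ((- / (Cconj w - al) + Ci * k al w), Cconj al) :: nil)).
        repeat constructor; simpl; auto.
      - intros z _. unfold r. ring. }
    rewrite Er. assert (kh := rk_herm U k H ip HR al w (HX _ Xal) (HX _ hw)). rewrite kh.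
    rewrite !Cplus_conj, !Cmult_conj, !Cplus_conj, Copp_conj, !Cinv_conj, Cmult_conj, conj_Ci, !Cconj_conj by exact nz'.
    rewrite Cminus_conj, Cconj_conj. unfold c. field. exact nz.
  - intros F RF hF hRF rF.
    rewrite (ip_conj _ _ _ HH (fun z => c * k z al + G' z) F) by (auto; apply Hlin; auto).
    rewrite (ip_lin _ _ _ HH) by auto. rewrite Cplus_conj, Cmult_conj, <- !(ip_conj _ _ _ HH) by auto.
    rewrite <- (rk_eval U k H ip HR al F (HX _ Xal) hF), (E F RF hF hRF rF).
    unfold c. rewrite Cmult_conj, conj_Ci. ring.
Qed.

End Resolvent.

(** * Common divisors from common elements *)

(** The Szego kernel of the upper half-plane up to a constant factor, seen as the kernel belonging
    to the zero function. *)
Definition hardy_kernel (z w : C) : C := kq (fun _ => 0) z w.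

Lemma upper_noconj (z w : C) : upper_half z -> upper_half w -> z <> Cconj w.
Proof. unfold upper_half. intros hz hw e. apply (f_equal Im) in e. rewrite im_conj in e. lra. Qed.

Lemma upper_den (z w : C) : upper_half z -> upper_half w -> - Ci * (z - Cconj w) <> 0.
Proof. intros hz hw. apply Cmult_neq_0; [apply mCi_nz|apply Cminus_eq_contra, upper_noconj; auto]. Qed.

(** Exhibits the difference of the Hardy kernel and [kq f] as a positive kernel; this is what makes
    the embedding into the Hardy space contractive. *)
Lemma kq_k0 (f : C -> C) (z w : C) : upper_half z -> upper_half w ->
  hardy_kernel z w = kq f z w + f z * Cconj (f w) * hardy_kernel z w.
Proof. intros hz hw. assert (T := upper_den z w hz hw). unfold hardy_kernel, kq. rewrite conj_RtoC. field.
  split; [|apply Ci_nz]. apply Cminus_eq_contra, upper_noconj; auto. Qed.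

Lemma Ci_upper : upper_half Ci.
Proof. unfold upper_half, Ci, Im. simpl. lra. Qed.

Lemma gram_plus (k k' : C -> C -> C) (l m : flist) :
  gram (fun z w => k z w + k' z w) l m = gram k l m + gram k' l m.
Proof.
  unfold gram. rewrite <- Cplus_conj. f_equal.
  assert (E : forall z, comb (fun z w => k z w + k' z w) l z = comb k l z + comb k' l z).
  { intros z. induction l as [|q l IH]; simpl; [ring|]. rewrite IH. ring. }
  induction m as [|q m IH]; simpl; [ring|]. rewrite IH, E, Cplus_conj. ring.
Qed.

Lemma hardy_kernel_posdef : posdef upper_half hardy_kernel.
Proof.
  split.
  - intros z w hz hw. apply kq_herm, upper_noconj; auto.
  (* The zero function is excluded from [schur], so a nonzero constant takes its place. For [3 / 5]
     the numerator [1 - c^2 = 16 / 25] is a rational square, and the factor [5 / 4] normalises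
     it. *)
  - intros l Hl. set (c := RtoC (3 / 5)).
    assert (Sc : schur (fun _ => c)).
    { split; [apply holo_const|split].
      - intros z _. unfold c. rewrite Cmod_R, Rabs_pos_eq; lra.
      - exists Ci. split; [apply Ci_upper|apply RtoC_nz; lra]. }
    rewrite (gram_eq hardy_kernel (fun z w => RtoC (5 / 4) * Cconj (RtoC (5 / 4)) * kq (ext (fun _ => c)) z w) _ l l Hl Hl).
    + rewrite (gram_lmul (kq (ext (fun _ => c))) (fun _ => RtoC (5 / 4))).
      assert (O := lmul_over _ (fun _ => RtoC (5 / 4)) l Hl).
      apply (schur_nice_pos _ Sc).
      * revert O. apply List.Forall_impl. intros q hq. split; [apply upper_off, hq|].
        intros lq. unfold lower_half, upper_half in *. lra.
      * assert (P : forall z, pts (lmul (fun _ => RtoC (5 / 4)) l) z -> upper_half z).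
        { unfold pts. intros z hz. apply in_map_iff in hz. destruct hz as [q [<- hq]].
          apply (proj1 (List.Forall_forall _ _) O q hq). }
        intros z w hz hw. apply upper_noconj; auto.
    + intros z w hz hw. unfold hardy_kernel, kq. rewrite !ext_upper by auto. unfold c. rewrite !conj_RtoC.
      assert (T := upper_den z w hz hw).
      replace (1 - RtoC (3 / 5) * RtoC (3 / 5)) with (RtoC (16 / 25)) by (rewrite <- RtoC_mult, <- RtoC_minus; f_equal; field).
      assert (E : RtoC (5 / 4) * RtoC (5 / 4) * RtoC (16 / 25) = 1) by (rewrite <- !RtoC_mult; f_equal; field).
      transitivity (RtoC (5 / 4) * RtoC (5 / 4) * RtoC (16 / 25) / (- Ci * (z - Cconj w))); [rewrite E|]; unfold Cdiv; ring.
Qed.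

Definition hardy : (C -> C) -> Prop := ma_space upper_half hardy_kernel.
Definition hardy_ip : (C -> C) -> (C -> C) -> C := ma_ip upper_half hardy_kernel.

Lemma hardy_rkhs : RKHS upper_half hardy_kernel hardy hardy_ip.
Proof. apply moore_aronszajn, hardy_kernel_posdef. Qed.

Lemma hardy_kernel_holo (w : C) : upper_half w -> holo upper_half (fun z => hardy_kernel z w).
Proof.
  intros hw. apply holo_div; [apply holo_const| |].
  - apply holo_mult; [apply holo_const|]. apply holo_minus; [apply holo_id|apply holo_const].
  - intros z hz. apply upper_den; auto.
Qed.

Lemma hardy_kernel_diag (z : C) : upper_half z -> hardy_kernel z z = RtoC (/ (2 * Im z)).
Proof.
  intros hz. unfold hardy_kernel, kq. rewrite imag_diff, conj_RtoC. unfold upper_half in hz.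
  replace (- Ci * (RtoC (2 * Im z) * Ci)) with (- (Ci * Ci) * RtoC (2 * Im z)) by ring. rewrite Ci2, RtoC_inv by lra.
  field. apply RtoC_nz. lra.
Qed.

Lemma hardy_holo (F : C -> C) : hardy F -> holo upper_half F.
Proof.
  intros HF. destruct (ma_bounded _ _ hardy_kernel_posdef F HF) as [u [B [hB [Hu [Lu Bu]]]]].
  apply holo_local. intros z hz. assert (hz' := hz). unfold upper_half in hz'.
  assert (I : forall x, disc z (Im z / 2) x -> (Im z / 2 < Im x)%R).
  { intros x hx. unfold disc in hx. assert (T := Im_lip x z). apply Rle_lt_trans with (2 := hx) in T.
    apply Rabs_lt_between in T. lra. }
  exists (Im z / 2)%R. split; [lra|].
  apply (vitali (fun n => comb hardy_kernel (u n)) F z (Im z / 2) (B * / Im z + 1)%R); [lra| | |].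
  - intros n. specialize (Hu n). induction Hu as [|q l hq Hl IH]; [exact (holo_const _ 0)|].
    simpl. apply holo_plus; [|exact IH]. apply holo_mult; [apply holo_const|].
    apply (holo_sub upper_half); [|apply hardy_kernel_holo, hq]. intros x hx. unfold upper_half. specialize (I x hx). lra.
  - intros n x hx. specialize (I x hx). assert (ux : upper_half x) by (unfold upper_half; lra).
    specialize (Bu n x ux). rewrite hardy_kernel_diag, re_RtoC in Bu by exact ux.
    assert (p := Cmod_ge_0 (comb hardy_kernel (u n) x)). assert (iz : (0 < / Im z)%R) by (apply Rinv_0_lt_compat; lra).
    assert (B * / (2 * Im x) <= B * / Im z)%R.
    { apply Rmult_le_compat_l; [exact hB|]. apply Rinv_le_contravar; lra. }
    assert (0 <= B * / Im z)%R by (apply Rmult_le_pos; lra).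
    apply Rnot_lt_le. intros hh. nra.
  - intros x hx. apply Lu. unfold upper_half. specialize (I x hx). lra.
Qed.

Lemma hardy_uniq (a : C) (F : C -> C) : hardy F -> (forall w, upper_half w -> w <> a -> F w = 0) ->
  forall z, upper_half z -> F z = 0.
Proof.
  intros HF E z hz. destruct (Ceq_dec z a) as [->|n]; [|apply E; auto].
  destruct (upper_open a hz) as [d [hd K]].
  apply (eq_by_cont F (fun _ => 0) a d hd); [apply (holo_ccont _ _ _ (hardy_holo F HF) hz)|apply ccont_const|].
  intros w hw nw. apply E; auto.
Qed.

Lemma hardy_kernel_identity (z w : C) : upper_half z -> upper_half w ->
  hardy_kernel z w * (- Ci * (z - Cconj w)) = 1 - (fun _ : C => 0) z * Cconj ((fun _ : C => 0) w).
Proof.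
  intros hz hw. unfold hardy_kernel, kq. assert (T := upper_den z w hz hw). field.
  split; [|apply Ci_nz]. apply Cminus_eq_contra, upper_noconj; auto.
Qed.

(* In the Hardy space the adjoint of the resolvent at [al] is multiplication by [1 / (z - conj al)]. *)
Lemma hardy_star (al c : C) (F RF G G1 : C -> C) : upper_half al -> hardy F -> hardy RF -> hardy G -> hardy G1 ->
  is_res upper_half al F RF -> (forall w, upper_half w -> G1 w * (w - Cconj al) = G w - c) ->
  hardy_ip F G1 - hardy_ip RF G = - Ci * F al * Cconj c.
Proof.
  intros ha hF hRF hG hG1 rF r1. assert (HH := proj1 hardy_rkhs).
  destruct (res_adjoint upper_half hardy_kernel hardy hardy_ip hardy_rkhs upper_half (fun _ => 0) al (fun z h => h) hardy_kernel_identity ha ha hardy_uniq G hG)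
    as [G' [hG' E]].
  assert (Sa := rk_section _ _ _ _ hardy_rkhs al ha).
  assert (EG : forall w, upper_half w -> G' w = - Ci * c * hardy_kernel w al + G1 w).
  { intros w hw. assert (nz : w - Cconj al <> 0) by (apply conj_upper_neq; auto).
    assert (nz' : Cconj w - al <> 0).
    { intros e. apply nz. rewrite <- (Cconj_conj w), <- Cminus_conj, e. apply conj_RtoC. }
    (* In the Hardy space the resolvent of a section is a single multiple of that section. *)
    set (r := comb hardy_kernel ((/ (Cconj w - al), w) :: nil)).
    assert (hr : hardy r) by (apply (rk_comb _ _ _ _ hardy_rkhs); repeat constructor; exact hw).
    assert (rr : is_res upper_half al (fun z => hardy_kernel z w) r).
    { intros z hz. unfold r. simpl. rewrite Cplus_0_r. unfold hardy_kernel, kq. rewrite conj_RtoC.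
      assert (N1 := upper_noconj z w hz hw). apply Cminus_eq_contra in N1.
      assert (N2 := upper_noconj al w ha hw). apply Cminus_eq_contra in N2.
      assert (N3 := Ci_nz). field. repeat split; auto. }
    rewrite (adjoint_eval upper_half hardy_kernel hardy hardy_ip hardy_rkhs upper_half al (fun z h => h) G G' r w hG hG' E hw hr rr).
    unfold r. rewrite (rk_ip_comb _ _ _ _ hardy_rkhs) by (auto; repeat constructor; exact hw).
    simpl. rewrite Cplus_0_r, Cmult_conj, Cinv_conj, Cminus_conj, !Cconj_conj by exact nz'.
    replace (G w) with (G1 w * (w - Cconj al) + c) by (rewrite r1 by exact hw; ring).
    unfold hardy_kernel, kq. rewrite conj_RtoC. assert (N3 := Ci_nz).
    transitivity (G1 w + c / (w - Cconj al)); [field; exact nz|].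
    transitivity (G1 w + c * (Ci / Ci) / (w - Cconj al)); [field; auto|]. field. auto. }
  rewrite <- (E F RF hF hRF rF).
  rewrite (ip_conj _ _ _ HH G' F) by auto.
  rewrite (ip_ext _ _ _ HH G' (fun w => - Ci * c * hardy_kernel w al + G1 w) F) by (auto; apply (hs_lin _ _ _ HH); auto).
  rewrite (ip_lin _ _ _ HH) by auto. rewrite Cplus_conj, Cmult_conj, <- !(ip_conj _ _ _ HH) by auto.
  rewrite <- (rk_eval _ _ _ _ hardy_rkhs al F ha hF).
  rewrite Cmult_conj, Copp_conj, conj_Ci. ring.
Qed.

(** By [kq_k0] the Hardy Gram form is that of [k] plus a nonnegative one, so [rk_criterion] holds
    for [F] with its own squared norm as constant. *)
Lemma hardy_embed (U : C -> Prop) (k : C -> C -> C) (H : (C -> C) -> Prop) (ip : (C -> C) -> (C -> C) -> C) (f F : C -> C) :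
  RKHS U k H ip -> (forall z, upper_half z -> U z) ->
  (forall z w, upper_half z -> upper_half w -> k z w = kq f z w) -> H F ->
  hardy F /\ (Re (hardy_ip F F) <= Re (ip F F))%R.
Proof.
  intros HR HU Ek hF. assert (HH := proj1 HR). assert (F0 := ip_pos _ _ _ HH F hF).
  destruct (rk_criterion _ _ _ _ hardy_rkhs upper_half F (Re (ip F F))) as [G [hG [EG NG]]]; auto.
  - intros l Hl. assert (OU : over U l) by (revert Hl; apply List.Forall_impl; auto).
    assert (CS := cauchy_schwarz _ _ _ (rk_preH _ _ _ _ HR) (exist _ _ (rk_comb _ _ _ _ HR l OU)) (exist _ F hF)).
    unfold hip at 1 2 in CS. simpl in CS. rewrite (rk_ip_comb _ _ _ _ HR) in CS by auto.
    eapply Rle_trans; [exact CS|].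
    change (nrm2 _ (hip H ip) (exist _ F hF)) with (Re (ip F F)).
    change (nrm2 _ (hip H ip) (exist _ (comb k l) (rk_comb _ _ _ _ HR l OU))) with (Re (ip (comb k l) (comb k l))).
    rewrite <- (rk_gram _ _ _ _ HR) by auto.
    rewrite (gram_eq hardy_kernel (fun z w => kq f z w + f z * Cconj (f w) * hardy_kernel z w) upper_half l l Hl Hl)
      by (intros; apply kq_k0; auto).
    rewrite (gram_plus (kq f) (fun z w => f z * Cconj (f w) * hardy_kernel z w)), re_plus.
    rewrite (gram_eq (kq f) k upper_half l l Hl Hl) by (intros; symmetry; apply Ek; auto).
    rewrite gram_lmul. assert (P := proj2 hardy_kernel_posdef (lmul f l) (lmul_over _ f l Hl)). nra.
  - assert (HH0 := proj1 hardy_rkhs).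
    assert (h0 : hardy F) by (apply (hs_ext _ _ _ HH0 G); auto). split; [exact h0|].
    replace (hardy_ip F F) with (hardy_ip G G); [exact NG|].
    rewrite (ip_ext _ _ _ HH0 G F G), (ip_conj _ _ _ HH0 G F) by auto.
    rewrite (ip_ext _ _ _ HH0 G F F) by auto. symmetry. apply (ip_conj _ _ _ HH0); auto.
Qed.

Section CommonDivisor.

Variables (h1 h2 g1 g2 e1 e2 : C -> C).
Hypothesis S1 : schur g1.
Hypothesis S2 : schur g2.
Hypothesis M1 : mero_eq off_real h1 (ext g1).
Hypothesis M2 : mero_eq off_real h2 (ext g2).
Hypothesis X1 : extension h1 e1.
Hypothesis X2 : extension h2 e2.

Variables (k1 k2 : C -> C -> C) (H1 H2 : (C -> C) -> Prop) (ip1 ip2 : (C -> C) -> (C -> C) -> C).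
Hypothesis R1 : RKHS (U_ext h1) k1 H1 ip1.
Hypothesis R2 : RKHS (U_ext h2) k2 H2 ip2.
Hypothesis K1 : forall z w, U_ext h1 z -> U_ext h1 w -> z <> Cconj w -> k1 z w = kq e1 z w.
Hypothesis K2 : forall z w, U_ext h2 z -> U_ext h2 w -> z <> Cconj w -> k2 z w = kq e2 z w.
Hypothesis A1 : forall F, H1 F -> analytic_on (U_ext h1) F.
Hypothesis A2 : forall F, H2 F -> analytic_on (U_ext h2) F.

Definition common (z : C) : Prop := off_real z /\ U_ext h1 z /\ U_ext h2 z.

Lemma upper_common (z : C) : upper_half z -> common z.
Proof. intros hz. split; [apply upper_off, hz|]. split; [apply (upper_U h1 g1)|apply (upper_U h2 g2)]; auto. Qed.

Lemma lower_common (z : C) : lower_half z -> SR g1 z <> 0 -> SR g2 z <> 0 -> common z.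
Proof.
  intros hz n1 n2. split; [apply lower_off, hz|]. split; [apply (lower_U h1 g1)|apply (lower_U h2 g2)]; auto.
Qed.

Lemma common_punct (z : C) : off_real z -> exists d : R, (0 < d)%R /\ forall w, disc z d w -> w <> z -> common w.
Proof.
  intros oz. destruct (off_real_cases z oz) as [hz|hz].
  - destruct (upper_open z hz) as [d [hd K]]. exists d. split; [exact hd|]. intros. apply upper_common, K; auto.
  - destruct (SR_zeros_isolated g1 z hz S1) as [d [hd K]], (SR_zeros_isolated g2 z hz S2) as [d' [hd' K']].
    exists (Rmin d d'). split; [apply Rmin_pos; auto|]. intros w hw nw. apply disc_min in hw.
    destruct (K w (proj1 hw) nw), (K' w (proj2 hw) nw). apply lower_common; auto.
Qed.

(** Density of [common] with a point removed: real points are approached vertically, other points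
    through a punctured disc free of poles. Identities on [common] thereby extend by continuity. *)
Lemma common_seq (z a : C) : exists u : nat -> C, ctends u z /\ forall n, common (u n) /\ u n <> a.
Proof.
  assert (Q : exists u : nat -> C, ctends u z /\ forall n, common (u n) /\ u n <> z).
  { destruct (Req_dec (Im z) 0) as [iz|iz].
    - exists (fun n => sh n z). split; [apply sh_tends|]. intros n. assert (T := vert_above z n). fold (sh n z) in T. split.
      + apply upper_common. unfold upper_half. lra.
      + intros e. rewrite e in T. lra.
    - destruct (common_punct z iz) as [d [hd K]]. destruct (seq_to_center z d hd) as [u [Hu Hn]].
      exists u. split; [exact Hu|]. intros n. destruct (Hn n). auto. }
  destruct Q as [u [Hu Hn]].
  destruct (Ceq_dec z a) as [->|n]; [exists u; auto|].
  destruct (neq_near z a n) as [d [hd K]]. destruct (Hu d hd) as [N HN].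
  exists (fun n => u (N + n)%nat). split; [apply (ctends_extract u); [intros; lia|exact Hu]|].
  intros m. split; [apply Hn|]. apply K, HN. lia.
Qed.

Lemma common_uniq (h : C -> C) (F : C -> C) (a : C) : analytic_on (U_ext h) F ->
  (forall w, common w -> w <> a -> F w = 0) -> forall z, U_ext h z -> F z = 0.
Proof.
  intros HF E z uz. destruct (common_seq z a) as [u [Hu Hn]].
  apply (ctends_unique (fun n => F (u n))).
  - apply (ctends_comp F); [apply (holo_ccont (U_ext h)); [apply analytic_on_holo, HF|exact uz]|exact Hu].
  - apply (ctends_ext (fun _ => 0)); [|apply ctends_const]. intros n. symmetry. apply E; apply Hn.
Qed.

Lemma kernel_identity (h g e : C -> C) (k : C -> C -> C) : schur g -> mero_eq off_real h (ext g) -> extension h e ->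
  (forall z w, U_ext h z -> U_ext h w -> z <> Cconj w -> k z w = kq e z w) ->
  forall z w, U_ext h z -> U_ext h w -> k z w * (- Ci * (z - Cconj w)) = 1 - e z * Cconj (e w).
Proof.
  intros Sg Hh Ee Ek z w uz uw. destruct (Ceq_dec z (Cconj w)) as [E|n].
  - subst z. assert (T := he_conj h g e Sg Hh Ee _ uz). rewrite Cconj_conj in T. rewrite (T uw). ring.
  - rewrite Ek by auto. unfold kq. assert (T := Cminus_eq_contra _ _ n). assert (T' := Ci_nz). field. auto.
Qed.

Lemma id1 (z w : C) : common z -> common w -> k1 z w * (- Ci * (z - Cconj w)) = 1 - e1 z * Cconj (e1 w).
Proof. intros [_ [uz _]] [_ [uw _]]. apply (kernel_identity h1 g1 e1 k1); auto. Qed.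

Lemma id2 (z w : C) : common z -> common w -> k2 z w * (- Ci * (z - Cconj w)) = 1 - e2 z * Cconj (e2 w).
Proof. intros [_ [_ uz]] [_ [_ uw]]. apply (kernel_identity h2 g2 e2 k2); auto. Qed.

Lemma emb1 (F : C -> C) : H1 F -> hardy F /\ (Re (hardy_ip F F) <= Re (ip1 F F))%R.
Proof.
  intros hF. apply (hardy_embed _ _ _ _ e1 F R1); [intros z hz; apply (upper_common z hz)| |exact hF].
  intros z w hz hw. apply K1; [apply (upper_common z hz)|apply (upper_common w hw)|apply upper_noconj; auto].
Qed.

Lemma emb2 (F : C -> C) : H2 F -> hardy F /\ (Re (hardy_ip F F) <= Re (ip2 F F))%R.
Proof.
  intros hF. apply (hardy_embed _ _ _ _ e2 F R2); [intros z hz; apply (upper_common z hz)| |exact hF].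
  intros z w hz hw. apply K2; [apply (upper_common z hz)|apply (upper_common w hw)|apply upper_noconj; auto].
Qed.

(** The intersection of the two spaces. One meromorphic function is represented by two total
    functions, because the domains [U_ext h1] and [U_ext h2] differ. *)
Definition mspace : Type :=
  {p : hsub H1 * hsub H2 | forall z, common z -> proj1_sig (fst p) z = proj1_sig (snd p) z}.

Definition ma (p : mspace) : C -> C := proj1_sig (fst (proj1_sig p)).
Definition mb (p : mspace) : C -> C := proj1_sig (snd (proj1_sig p)).

Lemma ma_H (p : mspace) : H1 (ma p). Proof. exact (proj2_sig (fst (proj1_sig p))). Qed.
Lemma mb_H (p : mspace) : H2 (mb p). Proof. exact (proj2_sig (snd (proj1_sig p))). Qed.
Lemma mab (p : mspace) (z : C) : common z -> ma p z = mb p z. Proof. exact (proj2_sig p z). Qed.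
Lemma ma_hardy (p : mspace) : hardy (ma p). Proof. apply emb1, ma_H. Qed.
Lemma mb_hardy (p : mspace) : hardy (mb p). Proof. apply emb2, mb_H. Qed.

Definition mmk (F G : C -> C) (hF : H1 F) (hG : H2 G) (E : forall z, common z -> F z = G z) : mspace :=
  exist (fun p : hsub H1 * hsub H2 => forall z, common z -> proj1_sig (fst p) z = proj1_sig (snd p) z)
    (exist _ F hF, exist _ G hG) E.

Lemma mlc_agree (c : C) (p q : mspace) (z : C) : common z ->
  proj1_sig (hlc H1 (hs_lin _ _ _ (proj1 R1)) c (fst (proj1_sig p)) (fst (proj1_sig q))) z =
  proj1_sig (hlc H2 (hs_lin _ _ _ (proj1 R2)) c (snd (proj1_sig p)) (snd (proj1_sig q))) z.
Proof.
  intros hz. change (c * ma p z + ma q z = c * mb p z + mb q z). rewrite !mab by exact hz. reflexivity.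
Qed.

Definition mlc (c : C) (p q : mspace) : mspace :=
  exist (fun p : hsub H1 * hsub H2 => forall z, common z -> proj1_sig (fst p) z = proj1_sig (snd p) z)
    (hlc H1 (hs_lin _ _ _ (proj1 R1)) c (fst (proj1_sig p)) (fst (proj1_sig q)),
     hlc H2 (hs_lin _ _ _ (proj1 R2)) c (snd (proj1_sig p)) (snd (proj1_sig q)))
    (mlc_agree c p q).

(* Subtracting the Hardy norm on the upper half-plane keeps the norm above both given norms, while the
   boundary form of the resolvent identity is normalised to [1 + 1 - 1 = 1]. *)
Definition mip (p q : mspace) : C := ip1 (ma p) (ma q) + ip2 (mb p) (mb q) - hardy_ip (ma p) (ma q).

Lemma hardy_ip_ab (p : mspace) : hardy_ip (ma p) (ma p) = hardy_ip (mb p) (mb p).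
Proof.
  assert (HH0 := proj1 hardy_rkhs). assert (a := ma_hardy p). assert (b := mb_hardy p).
  assert (E : forall z, upper_half z -> ma p z = mb p z) by (intros z hz; apply mab, upper_common, hz).
  rewrite (ip_ext _ _ _ HH0 (ma p) (mb p) (ma p)), (ip_conj _ _ _ HH0 (ma p) (mb p)) by auto.
  rewrite (ip_ext _ _ _ HH0 (ma p) (mb p) (mb p)) by auto. symmetry. apply (ip_conj _ _ _ HH0); auto.
Qed.

Lemma m_norm1 (p : mspace) : (Re (ip1 (ma p) (ma p)) <= Re (mip p p))%R.
Proof.
  unfold mip. rewrite re_minus, re_plus, hardy_ip_ab. assert (T := proj2 (emb2 (mb p) (mb_H p))). lra.
Qed.

Lemma m_norm2 (p : mspace) : (Re (ip2 (mb p) (mb p)) <= Re (mip p p))%R.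
Proof.
  unfold mip. rewrite re_minus, re_plus. assert (T := proj2 (emb1 (ma p) (ma_H p))). lra.
Qed.

Lemma m_preH : preH mspace mlc mip.
Proof.
  split.
  - intros c p q r. unfold mip.
    change (ma (mlc c p q)) with (fun z => c * ma p z + ma q z). change (mb (mlc c p q)) with (fun z => c * mb p z + mb q z).
    rewrite (ip_lin _ _ _ (proj1 R1)), (ip_lin _ _ _ (proj1 R2)), (ip_lin _ _ _ (proj1 hardy_rkhs)) by (apply ma_H || apply mb_H || apply ma_hardy). ring.
  - intros p q. unfold mip. rewrite Cminus_conj, Cplus_conj.
    rewrite (ip_conj _ _ _ (proj1 R1) (ma p) (ma q)), (ip_conj _ _ _ (proj1 R2) (mb p) (mb q)), (ip_conj _ _ _ (proj1 hardy_rkhs) (ma p) (ma q))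
      by (apply ma_H || apply mb_H || apply ma_hardy). reflexivity.
  - intros p. eapply Rle_trans; [|apply m_norm1]. apply (ip_pos _ _ _ (proj1 R1)), ma_H.
Qed.

Lemma plim_eval (U : C -> Prop) (k : C -> C -> C) (H : (C -> C) -> Prop) (ip : (C -> C) -> (C -> C) -> C)
  (HR : RKHS U k H ip) (u : nat -> hsub H) (F : hsub H) (z : C) : U z ->
  plim _ (hlc H (hs_lin _ _ _ (proj1 HR))) (hip H ip) u F -> ctends (fun n => proj1_sig (u n) z) (proj1_sig F z).
Proof.
  intros uz HF. assert (S := rk_section _ _ _ _ HR z uz).
  assert (T := ip_cont _ _ _ (rk_preH _ _ _ _ HR) u F (exist _ _ S) HF).
  rewrite (rk_eval _ _ _ _ HR z (proj1_sig F) uz (proj2_sig F)).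
  apply (ctends_ext (fun n => hip H ip (u n) (exist _ _ S))); [|exact T].
  intros n. symmetry. apply (rk_eval _ _ _ _ HR z (proj1_sig (u n)) uz (proj2_sig (u n))).
Qed.

(** The norm dominates those of both components, so the components converge, with limits agreeing on
    [common]. Conversely it is at most the sum of the two, which gives convergence of the pairs. *)
Lemma m_complete : pcomplete mspace mlc mip.
Proof.
  intros u Hu.
  set (u1 := fun n => fst (proj1_sig (u n))). set (u2 := fun n => snd (proj1_sig (u n))).
  destruct (rk_complete _ _ _ _ R1 u1) as [F HF].
  { intros e he. destruct (Hu e he) as [N K]. exists N. intros n m hn hm. specialize (K n m hn hm).
    eapply Rle_lt_trans; [|exact K]. exact (m_norm1 (psub _ mlc (u n) (u m))). }
  destruct (rk_complete _ _ _ _ R2 u2) as [G HG].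
  { intros e he. destruct (Hu e he) as [N K]. exists N. intros n m hn hm. specialize (K n m hn hm).
    eapply Rle_lt_trans; [|exact K]. exact (m_norm2 (psub _ mlc (u n) (u m))). }
  assert (E : forall z, common z -> proj1_sig F z = proj1_sig G z).
  { intros z [oz [uz uz']]. apply (ctends_unique (fun n => proj1_sig (u1 n) z)); [apply (plim_eval _ _ _ _ R1); auto|].
    apply (ctends_ext (fun n => proj1_sig (u2 n) z)); [|apply (plim_eval _ _ _ _ R2); auto].
    intros n. symmetry. apply (proj2_sig (u n)). split; auto. }
  set (p := mmk (proj1_sig F) (proj1_sig G) (proj2_sig F) (proj2_sig G) E).
  exists p. intros e he. destruct (HF (e / 2)%R ltac:(lra)) as [N1 K3]. destruct (HG (e / 2)%R ltac:(lra)) as [N2 K4].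
  exists (N1 + N2)%nat. intros n hn. specialize (K3 n ltac:(lia)). specialize (K4 n ltac:(lia)).
  set (q := psub _ mlc (u n) p).
  assert (B1 : (Re (ip1 (ma q) (ma q)) < e / 2)%R) by exact K3. assert (B2 : (Re (ip2 (mb q) (mb q)) < e / 2)%R) by exact K4.
  unfold nrm2, mip. rewrite re_minus, re_plus. assert (T := ip_pos _ _ _ (proj1 hardy_rkhs) _ (ma_hardy q)). lra.
Qed.

Lemma m_riesz (w : C) : common w -> exists K : mspace, forall p, ma p w = mip p K.
Proof.
  intros hw. assert (uw := proj1 (proj2 hw)).
  set (z0 := mmk (fun _ => 0) (fun _ => 0) (hs_zero _ _ _ (proj1 R1)) (hs_zero _ _ _ (proj1 R2)) (fun z _ => eq_refl)).
  assert (kp : (0 <= Re (k1 w w))%R).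
  { rewrite (rk_eval _ _ _ _ R1 w _ uw (rk_section _ _ _ _ R1 w uw)). apply (ip_pos _ _ _ (proj1 R1)), (rk_section _ _ _ _ R1 w uw). }
  destruct (riesz _ _ _ m_preH (fun p => ma p w) (Re (k1 w w)) z0) as [K [HK _]].
  - intros c p q. reflexivity.
  - exact kp.
  - intros p. eapply Rle_trans; [apply (rk_eval_bound _ _ _ _ R1 w _ uw (ma_H p))|].
    rewrite Rmult_comm. apply Rmult_le_compat_l; [exact kp|apply m_norm1].
  - exact m_complete.
  - exists K. exact HK.
Qed.

Lemma res_agree (a : C) (F1 F2 G1 G2 : C -> C) : H1 G1 -> H2 G2 -> common a -> (forall z, common z -> F1 z = F2 z) ->
  is_res common a F1 G1 -> is_res common a F2 G2 -> forall z, common z -> G1 z = G2 z.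
Proof.
  intros hG1 hG2 ca E r1 r2.
  assert (Q : forall z, common z -> z <> a -> G1 z = G2 z).
  { intros z hz nz. apply Cminus_eq_contra in nz. assert (T := r1 z hz).
    rewrite (E z hz), (E a ca), <- (r2 z hz) in T.
    replace (G1 z) with (G1 z * (z - a) / (z - a)) by (field; exact nz). rewrite T. field. exact nz. }
  intros z hz. destruct (common_seq z a) as [u [Hu Hn]]. destruct hz as [oz [u1 u2]].
  apply (ctends_unique (fun n => G1 (u n))).
  - apply (ctends_comp G1); [apply (holo_ccont (U_ext h1)); [apply analytic_on_holo, A1, hG1|exact u1]|exact Hu].
  - apply (ctends_ext (fun n => G2 (u n))); [intros n; symmetry; apply Q; apply Hn|].
    apply (ctends_comp G2); [apply (holo_ccont (U_ext h2)); [apply analytic_on_holo, A2, hG2|exact u2]|exact Hu].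
Qed.

Section AtPoint.

Variable al : C.
Hypothesis ual : upper_half al.
Hypothesis nz1 : g1 al <> 0.
Hypothesis nz2 : g2 al <> 0.

Lemma cal : common al. Proof. apply upper_common, ual. Qed.

(** Here the choice of [al] enters: since [g1] and [g2] do not vanish at it, its conjugate is a pole
    of neither function. *)
Lemma ccal : common (Cconj al).
Proof.
  apply lower_common; [apply conj_upper, ual| |]; [apply (proj1 (SR_neq g1 _))|apply (proj1 (SR_neq g2 _))];
    rewrite Cconj_conj; auto.
Qed.

Let c1 : forall z, common z -> U_ext h1 z := fun z h => proj1 (proj2 h).
Let c2 : forall z, common z -> U_ext h2 z := fun z h => proj2 (proj2 h).

Lemma uniq1 (a : C) (F : C -> C) : H1 F -> (forall w, common w -> w <> a -> F w = 0) -> forall z, U_ext h1 z -> F z = 0.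
Proof. intros hF. apply common_uniq, A1, hF. Qed.
Lemma uniq2 (a : C) (F : C -> C) : H2 F -> (forall w, common w -> w <> a -> F w = 0) -> forall z, U_ext h2 z -> F z = 0.
Proof. intros hF. apply common_uniq, A2, hF. Qed.

Lemma m_res (p : mspace) : exists q : mspace, is_res common al (ma p) (ma q) /\ is_res common al (mb p) (mb q).
Proof.
  destruct (res_exists _ _ _ _ R1 common e1 al c1 id1 cal ual (ma p) (ma_H p)) as [G [hG [r _]]].
  destruct (res_exists _ _ _ _ R2 common e2 al c2 id2 cal ual (mb p) (mb_H p)) as [G' [hG' [r' _]]].
  exists (mmk G G' hG hG' (res_agree al _ _ G G' hG hG' cal (mab p) r r')). split; assumption.
Qed.

Lemma m_res_conj (q : mspace) : exists q' : mspace, is_res common (Cconj al) (ma q) (ma q') /\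
  forall p r, is_res common al (ma p) (ma r) -> is_res common al (mb p) (mb r) ->
    mip p q' - mip r q = - Ci * ma p al * Cconj (ma q (Cconj al)).
Proof.
  destruct (res_conj_exists _ _ _ _ R1 common e1 al c1 id1 cal ual uniq1 ccal (ma q) (ma_H q)) as [G [hG [r E]]].
  destruct (res_conj_exists _ _ _ _ R2 common e2 al c2 id2 cal ual uniq2 ccal (mb q) (mb_H q)) as [G' [hG' [r' E']]].
  set (q' := mmk G G' hG hG' (res_agree (Cconj al) _ _ G G' hG hG' ccal (mab q) r r')).
  exists q'. split; [exact r|]. intros p s rp rp'.
  assert (T1 := E (ma p) (ma s) (ma_H p) (ma_H s) rp).
  assert (T2 := E' (mb p) (mb s) (mb_H p) (mb_H s) rp').
  rewrite <- (mab p al cal), <- (mab q (Cconj al) ccal) in T2.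
  (* The free constant of the Hardy identity is set to the value at [Cconj al] shared by both
     components, so all three boundary terms are equal. *)
  assert (T3 := hardy_star al (ma q (Cconj al)) (ma p) (ma s) (ma q) (ma q') ual (ma_hardy p) (ma_hardy s) (ma_hardy q) (ma_hardy q')).
  unfold mip. change (ma q') with G in *. change (mb q') with G'.
  transitivity ((ip1 (ma p) G - ip1 (ma s) (ma q)) + (ip2 (mb p) G' - ip2 (mb s) (mb q)) - (hardy_ip (ma p) G - hardy_ip (ma s) (ma q))); [ring|].
  rewrite T1, T2, T3.
  - ring.
  - intros w hw. apply rp, upper_common, hw.
  - intros w hw. apply r, upper_common, hw.
Qed.

(** [ka] is the reproducing kernel of the intersection. The resolvent identity for two of its
    sections shows that [1 - ka z w * (- Ci * (z - Cconj w))] has rank one, and symmetry turns it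
    into [g z * Cconj (g w)] for a multiple [g] of [v]. The last clause serves to show that the
    divisor is nontrivial. *)
Lemma m_divisor : exists g, schur g /\
  (forall z, upper_half z -> (Cmod (g1 z) <= Cmod (g z))%R /\ (Cmod (g2 z) <= Cmod (g z))%R) /\
  (forall z, upper_half z -> Cmod (g z) = 1%R -> forall p, ma p z = 0).
Proof.
  assert (KE : exists K : C -> mspace, forall w, common w -> forall p, ma p w = mip p (K w)).
  { set (z0 := mmk (fun _ => 0) (fun _ => 0) (hs_zero _ _ _ (proj1 R1)) (hs_zero _ _ _ (proj1 R2)) (fun z _ => eq_refl)).
    exists (fun w => epsilon (inhabits z0) (fun K => forall p, ma p w = mip p K)).
    intros w hw. apply (epsilon_spec (inhabits z0) (fun K => forall p, ma p w = mip p K)), m_riesz, hw. }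
  destruct KE as [K HK]. set (ka := fun z w => ma (K w) z).
  assert (mc := ph_conj _ _ _ m_preH).
  assert (kh : forall z w, common z -> common w -> ka z w = Cconj (ka w z)).
  { intros z w hz hw. unfold ka. rewrite (HK z hz), (HK w hw). apply mc. }
  set (u := fun z => (z - al) * ka z (Cconj al) - Ci). set (v := fun z => (z - Cconj al) * ka z al - Ci).
  (* [r] is the resolvent at [al] of the section at [w], and [s] the one at [Cconj al] of the
     section at [z]. The identity for this pair involves [r] at [z] and [s] at [w], both of which
     the resolvent equations express through [ka]. *)
  assert (ID : forall z w, upper_half z -> upper_half w -> 1 - ka z w * (- Ci * (z - Cconj w)) = u z * Cconj (v w)).
  { intros z w hz hw. assert (cz := upper_common z hz). assert (cw := upper_common w hw).
    destruct (m_res (K w)) as [r [r1 r2]]. destruct (m_res_conj (K z)) as [s [s1 Es]].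
    specialize (Es (K w) r r1 r2). rewrite <- (HK z cz r) in Es. rewrite (mc s (K w)), <- (HK w cw s) in Es.
    specialize (r1 z cz). specialize (s1 w cw).
    change (ma (K w) z) with (ka z w) in *. change (ma (K w) al) with (ka al w) in *.
    change (ma (K z) w) with (ka w z) in *. change (ma (K z) (Cconj al)) with (ka (Cconj al) z) in *.
    assert (nw : w - Cconj al <> 0) by (apply conj_upper_neq; auto).
    assert (nw' := conj_nz _ nw). rewrite Cminus_conj, Cconj_conj in nw'.
    apply (f_equal Cconj) in s1. rewrite Cmult_conj, !Cminus_conj, Cconj_conj, <- (kh z w cz cw), <- (kh z (Cconj al) cz ccal) in s1.
    rewrite <- (kh z (Cconj al) cz ccal) in Es.
    assert (Er : ma r z = (ka z w - ka z (Cconj al)) / (Cconj w - al) + Ci * ka al w * ka z (Cconj al)).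
    { rewrite <- s1. transitivity (Cconj (ma s w) - (Cconj (ma s w) - ma r z)); [ring|]. rewrite Es. field. exact nw'. }
    rewrite Er in r1. unfold u, v.
    rewrite Cminus_conj, Cmult_conj, Cminus_conj, Cconj_conj, conj_Ci, <- (kh al w cal cw).
    set (x := ka z w) in *. set (y := ka z (Cconj al)) in *. set (t := ka al w) in *.
    assert (R : ((x - y) + Ci * t * y * (Cconj w - al)) * (z - al) = (x - t) * (Cconj w - al)).
    { rewrite <- r1. field. exact nw'. }
    assert (I2 := Ci2).
    apply Ceq_minus.
    transitivity (Ci * (((x - y) + Ci * t * y * (Cconj w - al)) * (z - al) - (x - t) * (Cconj w - al))
      + (1 + Ci * Ci) * (1 - (z - al) * (Cconj w - al) * t * y)); [ring|].
    rewrite R, I2. ring. }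
  assert (diag : forall z, upper_half z -> ka z z = RtoC (Re (ka z z)) /\ (0 <= Re (ka z z))%R).
  { intros z hz. assert (cz := upper_common z hz). split.
    - assert (T := kh z z cz cz). apply (f_equal Im) in T. rewrite im_conj in T. apply Ceq; rewrite ?re_RtoC, ?im_RtoC; lra.
    - unfold ka. rewrite (HK z cz). apply (ph_pos _ _ _ m_preH). }
  assert (ID2 : forall z, upper_half z -> u z * Cconj (v z) = RtoC (1 - 2 * Im z * Re (ka z z))).
  { intros z hz. rewrite <- ID by auto. destruct (diag z hz) as [-> _]. rewrite imag_diff, RtoC_minus, !RtoC_mult, re_RtoC.
    replace (- Ci * (RtoC 2 * RtoC (Im z) * Ci)) with (- (Ci * Ci) * (RtoC 2 * RtoC (Im z))) by ring. rewrite Ci2. ring. }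
  (* The larger norm has the smaller kernel: the section at [z] gives [ka z z ^ 2 <= ka z z * k z z]
     on the diagonal, which is the inequality for the moduli. *)
  assert (bd : forall (e : C -> C) (U : C -> Prop) k H ip (HR : RKHS U k H ip) z F, upper_half z -> U z -> k z z = kq e z z ->
     H F -> F z = ka z z -> (Re (ip F F) <= Re (mip (K z) (K z)))%R ->
     (Cmod (e z) * Cmod (e z) <= 1 - 2 * Im z * Re (ka z z))%R).
  { intros e U k H ip HR z F hz uz Ek hF EF hN. assert (cz := upper_common z hz). assert (hz' := hz). unfold upper_half in hz'.
    assert (B := rk_eval_bound _ _ _ _ HR z F uz hF). rewrite EF in B.
    destruct (diag z hz) as [D D0]. rewrite <- (HK z cz) in hN. change (ma (K z) z) with (ka z z) in hN.
    assert (Ekr : Re (k z z) = ((1 - Cmod (e z) * Cmod (e z)) / (2 * Im z))%R).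
    { rewrite Ek. unfold kq. rewrite mult_conj_re, imag_diff, <- RtoC_minus.
      replace (- Ci * (RtoC (2 * Im z) * Ci)) with (- (Ci * Ci) * RtoC (2 * Im z)) by ring. rewrite Ci2.
      replace (- - (1) * RtoC (2 * Im z)) with (RtoC (2 * Im z)) by ring.
      rewrite <- RtoC_div by lra. apply re_RtoC. }
    rewrite D, Cmod_R, Rabs_pos_eq in B by exact D0.
    set (x := Re (ka z z)) in *. assert (k0p : (0 <= Re (k z z))%R).
    { rewrite (rk_eval _ _ _ _ HR z _ uz (rk_section _ _ _ _ HR z uz)). apply (ip_pos _ _ _ (proj1 HR)), (rk_section _ _ _ _ HR z uz). }
    assert (B2 : (x * x <= x * Re (k z z))%R) by nra.
    assert (B3 : (x <= Re (k z z))%R).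
    { destruct (Rle_lt_or_eq_dec _ _ D0) as [h|h]; [|rewrite <- h; exact k0p]. apply (Rmult_le_reg_l x); auto. }
    rewrite Ekr in B3. apply (Rmult_le_compat_l (2 * Im z)) in B3; [|lra].
    replace (2 * Im z * ((1 - Cmod (e z) * Cmod (e z)) / (2 * Im z)))%R with (1 - Cmod (e z) * Cmod (e z))%R in B3 by (field; lra). lra. }
  assert (bd1 : forall z, upper_half z -> (Cmod (g1 z) * Cmod (g1 z) <= 1 - 2 * Im z * Re (ka z z))%R).
  { intros z hz. destruct (upper_common z hz) as [_ [uz _]].
    rewrite <- (he_upper h1 g1 e1 S1 M1 X1 z hz). apply (bd e1 _ _ _ _ R1 z (ma (K z))); auto; [|apply ma_H|apply m_norm1].
    apply K1; auto. apply upper_noconj; auto. }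
  assert (bd2 : forall z, upper_half z -> (Cmod (g2 z) * Cmod (g2 z) <= 1 - 2 * Im z * Re (ka z z))%R).
  { intros z hz. destruct (upper_common z hz) as [_ [_ uz]].
    rewrite <- (he_upper h2 g2 e2 S2 M2 X2 z hz). apply (bd e2 _ _ _ _ R2 z (mb (K z))); auto; [|apply mb_H| |apply m_norm2].
    - apply K2; auto. apply upper_noconj; auto.
    - symmetry. apply mab, upper_common, hz. }
  (* [u * conj v] is hermitian, so [u] is a real multiple of [v]. *)
  assert (prop : forall z, upper_half z -> u z * Cconj (v al) = v z * Cconj (u al)).
  { intros z hz. rewrite <- (ID z al hz ual). rewrite <- (Cconj_conj (v z)), <- Cmult_conj, (Cmult_comm (Cconj (v z))), <- (ID al z ual hz).
    rewrite Cminus_conj, !Cmult_conj, Cminus_conj, Cconj_conj, Copp_conj, conj_Ci, conj_RtoC, <- (kh z al) by (apply upper_common; auto). ring. }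
  assert (dpos : (0 < 1 - 2 * Im al * Re (ka al al))%R).
  { eapply Rlt_le_trans; [|apply (bd1 al ual)]. assert (p := proj1 (Cmod_gt_0 _) nz1). nra. }
  set (de := (1 - 2 * Im al * Re (ka al al))%R) in *.
  assert (uv := ID2 al ual). fold de in uv.
  assert (vn : v al <> 0).
  { intros e. rewrite e, conj_RtoC, Cmult_0_r in uv. symmetry in uv. apply RtoC_inj in uv. lra. }
  set (mv := Cmod (v al)) in *. assert (mvp : (0 < mv)%R) by (apply Cmod_gt_0, vn).
  (* Since [u] equals [de / mv^2] times [v], this factor makes [g * Cconj g] equal to
     [u * Cconj v]. *)
  set (c := RtoC (sqrt de / mv)). set (g := fun z => c * v z).
  assert (Eg : forall z, upper_half z -> (Cmod (g z) * Cmod (g z) = 1 - 2 * Im z * Re (ka z z))%R).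
  { intros z hz. apply RtoC_inj. rewrite <- (ID2 z hz), <- mult_conj_re. unfold g. rewrite Cmult_conj. unfold c at 2. rewrite conj_RtoC.
    assert (nv' := conj_nz _ vn).
    assert (Eu : u z = v z * RtoC (de / (mv * mv))).
    { replace (u z) with (u z * Cconj (v al) / Cconj (v al)) by (field; exact nv'). rewrite (prop z hz).
      apply (f_equal Cconj) in uv. rewrite Cmult_conj, Cconj_conj, conj_RtoC in uv.
      assert (Em : RtoC (mv * mv) = v al * Cconj (v al)) by (symmetry; apply mult_conj_re).
      rewrite RtoC_div by nra. rewrite <- uv, Em. field. split; assumption. }
    rewrite Eu. unfold c.
    transitivity (RtoC (sqrt de / mv) * RtoC (sqrt de / mv) * (v z * Cconj (v z))); [ring|].
    rewrite <- RtoC_mult.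
    replace (sqrt de / mv * (sqrt de / mv))%R with (de / (mv * mv))%R; [ring|].
    rewrite <- (sqrt_sqrt de) at 1 by lra. field. lra. }
  assert (le2 : forall a b : R, (0 <= a)%R -> (0 <= b)%R -> (a * a <= b * b)%R -> (a <= b)%R).
  { intros a b ha hb h. apply Rnot_lt_le. intros h'. nra. }
  exists g. split; [split; [|split]|split].
  - unfold g, v. apply holo_mult; [apply holo_const|]. apply holo_minus; [|apply holo_const].
    apply holo_mult; [apply holo_minus; [apply holo_id|apply holo_const]|].
    apply (holo_sub (U_ext h1)); [intros z hz; apply c1, upper_common, hz|]. apply analytic_on_holo, A1, ma_H.
  - intros z hz. apply le2; [apply Cmod_ge_0|lra|]. rewrite (Eg z hz). destruct (diag z hz) as [_ D]. unfold upper_half in hz. nra.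
  - exists al. split; [exact ual|]. intros e. assert (T := Eg al ual). fold de in T. rewrite e, Cmod_0 in T. lra.
  - intros z hz. split; apply le2; try apply Cmod_ge_0; rewrite (Eg z hz); [apply bd1|apply bd2]; exact hz.
  (* If [g] has modulus one at [z], the section at [z] has norm zero, so evaluation at [z]
     annihilates every element. *)
  - intros z hz E p. assert (T := Eg z hz). rewrite E in T. assert (cz := upper_common z hz).
    assert (Z : Re (mip (K z) (K z)) = 0%R).
    { rewrite <- (HK z cz). change (ma (K z) z) with (ka z z). unfold upper_half in hz. nra. }
    rewrite (HK z cz p). assert (CS := cauchy_schwarz _ _ _ m_preH p (K z)).
    change (nrm2 mspace mip (K z)) with (Re (mip (K z) (K z))) in CS. rewrite Z, Rmult_0_r in CS.
    apply Cmod_eq_0. assert (T' := Cmod_ge_0 (mip p (K z))). nra.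
Qed.

End AtPoint.

End CommonDivisor.

(** * Divisors *)

Lemma ext_upper_eq (g g' : C -> C) : schur g -> holo upper_half g' -> mero_eq upper_half (ext g) g' ->
  forall z, upper_half z -> g z = g' z.
Proof.
  intros Sg Hg' E z hz. rewrite mero_eq_disc in E. destruct (E z hz) as [d [hd K]].
  destruct (upper_open z hz) as [d' [hd' K']].
  apply (eq_by_cont g g' z (Rmin d d')); [apply Rmin_pos; auto| | |].
  - apply (holo_ccont _ _ _ (proj1 Sg) hz).
  - apply (holo_ccont _ _ _ Hg' hz).
  - intros w hw nw. apply disc_min in hw. rewrite <- (ext_upper g w) by (apply K', hw). apply K; tauto.
Qed.

Lemma mero_eq_sub (Om Om' : C -> Prop) (f g : C -> C) : (forall z, Om' z -> Om z) -> mero_eq Om f g -> mero_eq Om' f g.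
Proof. intros S H z hz. apply H, S, hz. Qed.

Lemma divides_schur (h h1 g g1 : C -> C) : schur g -> schur g1 ->
  mero_eq off_real h (ext g) -> mero_eq off_real h1 (ext g1) -> divides h h1 ->
  exists h3 g3, S0 h3 /\ schur g3 /\ mero_eq off_real h3 (ext g3) /\ forall z, upper_half z -> g1 z = g z * g3 z.
Proof.
  intros Sg Sg1 Hh Hh1 [h3 [S3 E]]. destruct (S0_schur h3 S3) as [g3 [Sg3 Hh3]].
  exists h3, g3. split; [exact S3|]. split; [exact Sg3|]. split; [exact Hh3|].
  apply ext_upper_eq; [exact Sg1|apply holo_mult; [apply Sg|apply Sg3]|].
  rewrite mero_eq_disc in *. intros z hz. assert (oz := upper_off z hz).
  destruct (Hh1 z oz) as [d1 [hd1 L1]], (E z oz) as [d2 [hd2 L2]], (Hh z oz) as [d3 [hd3 L3]],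
    (Hh3 z oz) as [d4 [hd4 L4]], (upper_open z hz) as [d5 [hd5 L5]].
  exists (Rmin d1 (Rmin d2 (Rmin d3 (Rmin d4 d5)))). split; [repeat apply Rmin_pos; auto|].
  intros w hw nw. apply disc_min in hw. destruct hw as [w1 hw]. apply disc_min in hw. destruct hw as [w2 hw].
  apply disc_min in hw. destruct hw as [w3 hw]. apply disc_min in hw. destruct hw as [w4 w5].
  rewrite <- L1, L2, L3, L4 by auto. rewrite !ext_upper by auto. reflexivity.
Qed.

Lemma schur_mult_lower (g g3 : C -> C) (z : C) : lower_half z -> SR g z <> 0 -> SR g3 z <> 0 ->
  forall g1, (forall w, upper_half w -> g1 w = g w * g3 w) -> ext g1 z = ext g z * ext g3 z.
Proof.
  intros hz n n3 g1 E. rewrite !ext_lower by exact hz. unfold SR in *. rewrite (E _ (conj_lower z hz)), Cmult_conj.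
  field. auto.
Qed.

Lemma dominated_divides (g g1 h1 : C -> C) : schur g -> schur g1 -> mero_eq off_real h1 (ext g1) ->
  (forall z, upper_half z -> (Cmod (g1 z) <= Cmod (g z))%R) -> divides (ext g) h1.
Proof.
  intros Sg Sg1 Hh1 Le.
  destruct (quotient_holo g1 g (proj1 Sg1) (proj2 (proj2 Sg1)) (proj1 Sg) Le) as [k [Hk [Ek Lk]]].
  assert (Sk : schur k).
  { split; [exact Hk|]. split; [exact Lk|]. destruct Sg1 as [_ [_ [z [hz nz]]]]. exists z. split; [exact hz|].
    intros e. apply nz. rewrite Ek, e by exact hz. ring. }
  exists (ext k). split; [apply schur_S0, Sk|]. eapply mero_eq_trans; [exact Hh1|].
  apply mero_eq_disc. intros z oz. destruct (off_real_cases z oz) as [hz|hz].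
  - destruct (upper_open z hz) as [d [hd K]]. exists d. split; [exact hd|]. intros w hw _.
    rewrite !ext_upper by (apply K, hw). rewrite Ek by (apply K, hw). ring.
  - destruct (SR_zeros_isolated g z hz Sg) as [d [hd K]], (SR_zeros_isolated k z hz Sk) as [d' [hd' K']].
    exists (Rmin d d'). split; [apply Rmin_pos; auto|]. intros w hw nw. apply disc_min in hw.
    destruct (K w (proj1 hw) nw) as [lw n1], (K' w (proj2 hw) nw) as [_ n2].
    apply (schur_mult_lower g k w lw n1 n2). intros x hx. rewrite Ek by exact hx. ring.
Qed.

Lemma schur_mero (h g : C -> C) : mero_eq off_real h (ext g) -> schur g -> mero_on off_real h.
Proof. intros E S. apply (mero_on_ext _ _ _ E). apply (proj1 (proj1 (schur_S0 g S))). Qed.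

Lemma kq_diag (f : C -> C) (z : C) : upper_half z -> kq f z z = RtoC ((1 - Cmod (f z) * Cmod (f z)) / (2 * Im z)).
Proof.
  intros hz. unfold upper_half in hz. unfold kq. rewrite mult_conj_re, imag_diff, <- RtoC_minus.
  replace (- Ci * (RtoC (2 * Im z) * Ci)) with (- (Ci * Ci) * RtoC (2 * Im z)) by ring. rewrite Ci2.
  replace (- - (1) * RtoC (2 * Im z)) with (RtoC (2 * Im z)) by ring. rewrite <- RtoC_div by lra. reflexivity.
Qed.

(* The maximum principle, from the Cauchy-Schwarz inequality for the kernel. *)
Lemma schur_max (g : C -> C) (w : C) : schur g -> upper_half w -> Cmod (g w) = 1%R ->
  forall z, upper_half z -> g z = g w.
Proof.
  intros Sg hw Ew z hz. assert (Eh := mero_eq_refl off_real (ext g)).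
  destruct (extension_exists (ext g) (schur_mero _ _ Eh Sg)) as [e Ee].
  assert (R := moore_aronszajn _ _ (ks_posdef (ext g) g e Sg Eh Ee)).
  assert (U := upper_U (ext g) g Sg Eh).
  assert (B := rk_eval_bound _ _ _ _ R z _ (U z hz) (rk_section _ _ _ _ R w (U w hw))).
  rewrite <- (rk_eval _ _ _ _ R w _ (U w hw) (rk_section _ _ _ _ R w (U w hw))) in B.
  assert (HE : forall x, upper_half x -> e x = g x) by (intros x hx; apply (he_upper (ext g) g e Sg Eh Ee x hx)).
  rewrite !ks_off in B by (apply upper_noconj; auto). rewrite (kq_diag e w hw), HE, Ew in B by exact hw.
  rewrite re_RtoC in B. replace ((1 - 1 * 1) / (2 * Im w))%R with 0%R in B by (unfold upper_half in hw; field; lra).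
  rewrite Rmult_0_l in B.
  assert (Z : kq e z w = 0) by (apply Cmod_eq_0; assert (T := Cmod_ge_0 (kq e z w)); nra).
  unfold kq in Z. rewrite !HE in Z by auto. assert (D := upper_den z w hz hw).
  apply (f_equal (fun x => x * (- Ci * (z - Cconj w)))) in Z. rewrite Cmult_0_l in Z.
  replace ((1 - g z * Cconj (g w)) / (- Ci * (z - Cconj w)) * (- Ci * (z - Cconj w))) with (1 - g z * Cconj (g w)) in Z.
  2:{ unfold Cdiv. rewrite <- Cmult_assoc, Cinv_l by exact D. ring. }
  assert (Q : g w * Cconj (g w) = 1) by (rewrite mult_conj_re, Ew; f_equal; ring).
  transitivity (g z * (g w * Cconj (g w))); [rewrite Q; ring|].
  transitivity (g w * (1 - (1 - g z * Cconj (g w)))); [ring|]. rewrite Z. ring.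
Qed.

Lemma nontrivial_ext (h g : C -> C) : schur g -> mero_eq off_real h (ext g) ->
  (nontrivial h <-> exists w, upper_half w /\ (Cmod (g w) < 1)%R).
Proof.
  intros Sg Hh. split.
  - intros N. apply NNPP. intros Q. apply N.
    assert (E : Cmod (g Ci) = 1%R).
    { apply Rle_antisym; [apply Sg, Ci_upper|]. apply Rnot_lt_le. intros h'. apply Q. exists Ci. split; [apply Ci_upper|exact h']. }
    exists (g Ci). split; [exact E|].
    apply (mero_eq_trans _ _ (ext g)); [apply (mero_eq_sub off_real); [apply upper_off|exact Hh]|].
    apply mero_eq_disc. intros z hz. destruct (upper_open z hz) as [d [hd K]]. exists d. split; [exact hd|].
    intros w hw _. rewrite ext_upper by (apply K, hw). apply schur_max; auto. apply Ci_upper.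
  - intros [w [hw lt]] [c [Ec E]].
    assert (T := ext_upper_eq g (fun _ => c) Sg (holo_const _ c)).
    rewrite T in lt; [lra| |exact hw]. apply (mero_eq_trans _ _ h); [|exact E].
    apply mero_eq_sym, (mero_eq_sub off_real); [apply upper_off|exact Hh].
Qed.

(** * Relative primality and intersections *)

Lemma common_element_divisor (h1 h2 f : C -> C) : S0 h1 -> S0 h2 -> B_space h1 f -> B_space h2 f ->
  ~ mero_eq off_real f (fun _ => 0) -> ~ relatively_prime h1 h2.
Proof.
  intros T1 T2 B1 B2 N RP.
  destruct (S0_schur h1 T1) as [g1 [S1 M1]], (S0_schur h2 T2) as [g2 [S2 M2]].
  destruct B1 as [k1 [H1 [ip1 [[e1 [Ea1 [Em1 EK1]]] [R1 [A1 [F1 [HF1 E1]]]]]]]].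
  destruct B2 as [k2 [H2 [ip2 [[e2 [Ea2 [Em2 EK2]]] [R2 [A2 [F2 [HF2 E2]]]]]]]].
  assert (X1 : extension h1 e1) by (split; auto). assert (X2 : extension h2 e2) by (split; auto).
  assert (K1 : forall z w, U_ext h1 z -> U_ext h1 w -> z <> Cconj w -> k1 z w = kq e1 z w) by (intros z w uz uw; apply EK1; auto).
  assert (K2 : forall z w, U_ext h2 z -> U_ext h2 w -> z <> Cconj w -> k2 z w = kq e2 z w) by (intros z w uz uw; apply EK2; auto).
  assert (punct := common_punct h1 h2 g1 g2 S1 S2 M1 M2).
  rewrite mero_eq_disc in E1, E2.
  assert (E : forall z, common h1 h2 z -> F1 z = F2 z).
  { intros z [oz [u1 u2]]. destruct (E1 z oz) as [d [hd L]], (E2 z oz) as [d' [hd' L']].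
    apply (eq_by_cont F1 F2 z (Rmin d d')); [apply Rmin_pos; auto| | |].
    - apply (holo_ccont (U_ext h1)); [apply analytic_on_holo, A1, HF1|exact u1].
    - apply (holo_ccont (U_ext h2)); [apply analytic_on_holo, A2, HF2|exact u2].
    - intros w hw nw. apply disc_min in hw. rewrite <- L, <- L' by tauto. reflexivity. }
  assert (NZ : exists z, common h1 h2 z /\ F1 z <> 0).
  { apply NNPP. intros Q. apply N. apply mero_eq_disc. intros z oz.
    destruct (E1 z oz) as [d [hd L]], (punct z oz) as [d' [hd' L']].
    exists (Rmin d d'). split; [apply Rmin_pos; auto|]. intros w hw nw. apply disc_min in hw.
    rewrite L by tauto. apply NNPP. intros Q'. apply Q. exists w. split; [apply L'; tauto|exact Q']. }
  destruct NZ as [z0 [cz0 nz0]].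
  set (p := mmk h1 h2 H1 H2 F1 F2 HF1 HF2 E).
  (* If the nonzero value is taken at [z0] below the line, [al] is its conjugate, which is
     admissible because [z0] lies in both domains. Otherwise any point where [g1] and [g2] are
     nonzero will do. *)
  assert (AL : exists al, upper_half al /\ g1 al <> 0 /\ g2 al <> 0 /\ (lower_half z0 -> Cconj al = z0)).
  { destruct cz0 as [oz [u1 u2]]. destruct (off_real_cases z0 oz) as [hz|hz].
    - destruct (zeros_isolated g1 Ci Ci_upper (proj1 S1) (proj2 (proj2 S1))) as [d [hd L]],
        (zeros_isolated g2 Ci Ci_upper (proj1 S2) (proj2 (proj2 S2))) as [d' [hd' L']].
      destruct (seq_to_center Ci (Rmin d d')) as [u [_ Hu]]; [apply Rmin_pos; auto|].
      destruct (Hu 0%nat) as [nu du]. apply disc_min in du. exists (u 0%nat).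
      destruct (L _ (proj1 du) nu), (L' _ (proj2 du) nu). repeat split; auto.
      unfold lower_half, upper_half in *. lra.
    - exists (Cconj z0). split; [apply conj_lower, hz|]. 
      split; [apply SR_neq, (he_lower_nz h1 g1 e1 S1 M1 X1 z0 hz u1)|].
      split; [apply SR_neq, (he_lower_nz h2 g2 e2 S2 M2 X2 z0 hz u2)|]. intros _. apply Cconj_conj. }
  destruct AL as [al [ual [n1 [n2 Eal]]]].
  destruct (m_divisor h1 h2 g1 g2 e1 e2 S1 S2 M1 M2 X1 X2 k1 k2 H1 H2 ip1 ip2 R1 R2 K1 K2 A1 A2 al ual n1 n2)
    as [g [Sg [Le One]]].
  apply RP. exists (ext g). split; [apply schur_S0, Sg|]. split; [|split].
  - apply (nontrivial_ext (ext g) g Sg (mero_eq_refl _ _)). apply NNPP. intros Q.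
    assert (V : forall z, upper_half z -> forall q, ma h1 h2 H1 H2 q z = 0).
    { intros z hz. apply One; [exact hz|]. apply Rle_antisym; [apply Sg, hz|]. apply Rnot_lt_le. intros h'.
      apply Q. exists z. auto. }
    destruct (off_real_cases z0 (proj1 cz0)) as [hz|hz].
    + apply nz0. exact (V z0 hz p).
    (* If all elements vanished on the upper half-plane, so would the resolvent of [p] at
       [Cconj al = z0]; the resolvent equation at [Ci] then forces the value at [z0] to vanish. *)
    + destruct (m_res_conj h1 h2 g1 g2 e1 e2 S1 S2 M1 M2 X1 X2 k1 k2 H1 H2 ip1 ip2 R1 R2 K1 K2 A1 A2 al ual n1 n2 p)
        as [q [rq _]].
      specialize (rq Ci (upper_common h1 h2 g1 g2 S1 S2 M1 M2 Ci Ci_upper)).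
      rewrite !(V Ci Ci_upper), (Eal hz) in rq. change (ma h1 h2 H1 H2 p z0) with (F1 z0) in rq.
      apply nz0. replace (F1 z0) with (- (0 - F1 z0)) by ring. rewrite <- rq. ring.
  - apply (dominated_divides g g1 h1 Sg S1 M1). intros z hz. apply Le, hz.
  - apply (dominated_divides g g2 h2 Sg S2 M2). intros z hz. apply Le, hz.
Qed.

(** From [e1 = e * e3] the kernel of [h1] is that of [h] plus [e z * Cconj (e w)] times that of
    [h3], so the Gram forms differ by a nonnegative one. Conjugate pairs are again avoided by
    vertical shifts. *)
Lemma gram_divisor (h g e h1 g1 e1 h3 g3 : C -> C) : schur g -> schur g1 -> schur g3 ->
  mero_eq off_real h (ext g) -> mero_eq off_real h1 (ext g1) -> mero_eq off_real h3 (ext g3) ->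
  extension h e -> extension h1 e1 ->
  (forall z, upper_half z -> g1 z = g z * g3 z) ->
  (forall z, off_real z -> U_ext h1 z -> U_ext h z) /\
  (forall l, over (fun z => off_real z /\ U_ext h1 z) l -> (Re (gram (ks e) l l) <= Re (gram (ks e1) l l))%R).
Proof.
  intros Sg S1 S3 Mh M1 M3 Xh X1 Em.
  destruct (extension_exists h3 (schur_mero _ _ M3 S3)) as [e3 X3].
  assert (FA : forall z, off_real z -> U_ext h1 z -> U_ext h z /\ U_ext h3 z /\ e1 z = e z * e3 z).
  { intros z oz u1. destruct (off_real_cases z oz) as [hz|hz].
    - split; [apply (upper_U h g); auto|]. split; [apply (upper_U h3 g3); auto|].
      rewrite (he_upper h1 g1 e1), (he_upper h g e), (he_upper h3 g3 e3) by auto. apply Em, hz.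
    - destruct (he_lower_nz h1 g1 e1 S1 M1 X1 z hz u1) as [E1 n1].
      assert (ES : SR g1 z = SR g z * SR g3 z) by (unfold SR; rewrite (Em _ (conj_lower z hz)); apply Cmult_conj).
      assert (n : SR g z <> 0) by (intros E; apply n1; rewrite ES, E; ring).
      assert (n3 : SR g3 z <> 0) by (intros E; apply n1; rewrite ES, E; ring).
      assert (u : U_ext h z) by (apply (lower_U h g); auto). assert (u3 : U_ext h3 z) by (apply (lower_U h3 g3); auto).
      split; [exact u|]. split; [exact u3|].
      rewrite E1, (proj1 (he_lower_nz h g e Sg Mh Xh z hz u)), (proj1 (he_lower_nz h3 g3 e3 S3 M3 X3 z hz u3)), ES.
      field. auto. }
  split; [intros z oz u1; apply FA; auto|].
  intros l Hl.
  assert (O1 : over (U_ext h1) l) by (revert Hl; apply List.Forall_impl; tauto).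
  assert (O : over (U_ext h) l) by (revert Hl; apply List.Forall_impl; intros q [a b]; apply FA; auto).
  destruct (lsh_nice h1 l O1) as [N K].
  assert (P : (0 <= Re (gram (ks e1) l l - gram (ks e) l l))%R).
  { apply (Re_limit_pos (fun n => gram (fun z w => ks e1 (sh n z) (sh n w)) l l - gram (fun z w => ks e (sh n z) (sh n w)) l l) _ N).
    - apply ctends_minus.
      + apply (gram_tends _ _ (U_ext h1)); auto. apply (ks_shift h1 g1 e1); auto.
      + apply (gram_tends _ _ (U_ext h)); auto. apply (ks_shift h g e); auto.
    - intros n hn. destruct (K n hn) as [On NC]. rewrite !gram_lsh.
      set (m := lsh n l) in *.
      set (Y := fun z => (off_real z /\ U_ext h1 z) /\ pts m z).
      assert (OY : over Y m).
      { apply List.Forall_forall. intros q hq. split; [apply (proj1 (List.Forall_forall _ _) On q hq)|apply in_map, hq]. }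
      rewrite (gram_eq (ks e1) (fun z w => ks e z w + e z * Cconj (e w) * ks e3 z w) Y m m OY OY).
      + rewrite (gram_plus (ks e) (fun z w => e z * Cconj (e w) * ks e3 z w)), gram_lmul.
        assert (PD := proj2 (ks_posdef h3 g3 e3 S3 M3 X3) (lmul e m)).
        replace (gram (ks e) m m + gram (ks e3) (lmul e m) (lmul e m) - gram (ks e) m m)
          with (gram (ks e3) (lmul e m) (lmul e m)) by ring.
        apply PD, lmul_over. revert On. apply List.Forall_impl. intros q [a b]. apply FA; auto.
      + intros z w [[oz uz] pz] [[ow uw] pw]. assert (nc := NC z w pz pw).
        rewrite !ks_off by exact nc. unfold kq.
        destruct (FA z oz uz) as [_ [_ ->]], (FA w ow uw) as [_ [_ ->]]. rewrite Cmult_conj.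
        assert (T := Cminus_eq_contra _ _ nc). assert (T' := Ci_nz). field. auto. }
  rewrite re_minus in P. lra.
Qed.

(** Cauchy-Schwarz in the space of [h] bounds the pairing by the Gram form of [h], which is at most
    that of [h1]. Interpolation then produces an element of the space of [h1] with the values of the
    section. *)
Lemma divisor_section_in (h g e h1 g1 : C -> C) (w0 : C) : schur g -> schur g1 ->
  mero_eq off_real h (ext g) -> mero_eq off_real h1 (ext g1) -> extension h e -> upper_half w0 ->
  divides h h1 -> B_space h1 (fun z => ks e z w0).
Proof.
  intros Sg S1 Mh M1 Xh hw D.
  destruct (divides_schur h h1 g g1 Sg S1 Mh M1 D) as [h3 [g3 [_ [S3 [M3 Em]]]]].
  destruct (extension_exists h1 (schur_mero _ _ M1 S1)) as [e1 X1].
  destruct (gram_divisor h g e h1 g1 e1 h3 g3 Sg S1 S3 Mh M1 M3 Xh X1 Em) as [UU GG].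
  assert (R := moore_aronszajn _ _ (ks_posdef h g e Sg Mh Xh)).
  assert (R1 := moore_aronszajn _ _ (ks_posdef h1 g1 e1 S1 M1 X1)).
  assert (uw := upper_U h g Sg Mh w0 hw). assert (Sw := rk_section _ _ _ _ R w0 uw).
  assert (kp : (0 <= Re (ks e w0 w0))%R).
  { rewrite (rk_eval _ _ _ _ R w0 _ uw Sw). apply (ip_pos _ _ _ (proj1 R)), Sw. }
  destruct (rk_criterion _ _ _ _ R1 (fun z => off_real z /\ U_ext h1 z) (fun z => ks e z w0) (Re (ks e w0 w0)))
    as [F [HF [EF _]]].
  - tauto.
  - exact kp.
  - intros l Hl. assert (Ol : over (U_ext h) l) by (revert Hl; apply List.Forall_impl; intros q [a b]; apply UU; auto).
    assert (CS := cauchy_schwarz _ _ _ (rk_preH _ _ _ _ R) (exist _ _ (rk_comb _ _ _ _ R l Ol)) (exist _ _ Sw)).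
    unfold hip at 1 2 in CS. simpl in CS. rewrite (rk_ip_comb _ _ _ _ R) in CS by auto.
    eapply Rle_trans; [exact CS|]. rewrite Rmult_comm. unfold nrm2, hip. simpl.
    rewrite <- (rk_gram _ _ _ _ R) by auto. rewrite <- (rk_eval _ _ _ _ R w0 _ uw Sw).
    apply Rmult_le_compat_l; [exact kp|]. apply GG, Hl.
  - apply (B_space_intro h1 g1 e1 S1 M1 X1 _ F HF). apply mero_eq_disc. intros z oz.
    destruct (common_punct h1 h1 g1 g1 S1 S1 M1 M1 z oz) as [d [hd K]]. exists d. split; [exact hd|].
    intros w hww nw. symmetry. apply EF. destruct (K w hww nw) as [a [b _]]. auto.
Qed.

Lemma zero_in_B (h f : C -> C) : S0 h -> mero_eq off_real f (fun _ => 0) -> B_space h f.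
Proof.
  intros T E. destruct (S0_schur h T) as [g [Sg Mh]].
  destruct (extension_exists h (schur_mero _ _ Mh Sg)) as [e X].
  apply (B_space_intro h g e Sg Mh X f (fun _ => 0)); [|exact E].
  apply (hs_zero _ _ _ (proj1 (moore_aronszajn _ _ (ks_posdef h g e Sg Mh X)))).
Qed.

Lemma relatively_prime_iff (h1 h2 : C -> C) : S0 h1 -> S0 h2 ->
  (relatively_prime h1 h2 <->
   (forall f : C -> C, (B_space h1 f /\ B_space h2 f) <-> mero_eq off_real f (fun _ => 0))).
Proof.
  intros T1 T2. split.
  - intros RP f. split.
    + intros [B1 B2]. apply NNPP. intros N. exact (common_element_divisor h1 h2 f T1 T2 B1 B2 N RP).
    + intros E. split; apply zero_in_B; auto.
  - intros HI [h [T [NT [D1 D2]]]].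
    destruct (S0_schur h T) as [g [Sg Mh]], (S0_schur h1 T1) as [g1 [S1 M1]], (S0_schur h2 T2) as [g2 [S2 M2]].
    destruct (extension_exists h (schur_mero _ _ Mh Sg)) as [e X].
    destruct (proj1 (nontrivial_ext h g Sg Mh) NT) as [w0 [hw lt]].
    (* The section at a point where [g] has modulus below one cannot vanish: its diagonal value is
       positive. *)
    assert (Z : mero_eq off_real (fun z => ks e z w0) (fun _ => 0)).
    { apply HI. split; [apply (divisor_section_in h g e h1 g1)|apply (divisor_section_in h g e h2 g2)]; auto. }
    assert (uw := upper_U h g Sg Mh w0 hw).
    rewrite mero_eq_disc in Z. destruct (Z w0 (upper_off w0 hw)) as [d [hd K]].
    assert (E0 : ks e w0 w0 = 0).
    { apply (eq_by_cont (fun z => ks e z w0) (fun _ => 0) w0 d hd); [|apply ccont_const|exact K].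
      apply (holo_ccont _ _ _ (ks_holo h g e Sg Mh X w0 uw) uw). }
    rewrite ks_off in E0 by (apply upper_noconj; auto). rewrite kq_diag in E0 by exact hw. apply RtoC_inj in E0.
    rewrite (he_upper h g e Sg Mh X w0 hw) in E0. unfold upper_half in hw. assert (p := Cmod_ge_0 (g w0)).
    assert (Q : (0 < (1 - Cmod (g w0) * Cmod (g w0)) / (2 * Im w0))%R) by (apply Rdiv_lt_0_compat; nra). lra.
Qed.

(** * Representation of symmetric functions *)

(* A common divisor of smallest modulus at one point, which exists by Montel's theorem, leaves coprime quotients. *)
Lemma coprime_quotients (a1 a2 : C -> C) : schur a1 -> schur a2 ->
  exists b1 b2 g, schur b1 /\ schur b2 /\ schur g /\
    (forall z, upper_half z -> a1 z = b1 z * g z) /\ (forall z, upper_half z -> a2 z = b2 z * g z) /\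
    forall d, schur d -> (forall z, upper_half z -> (Cmod (b1 z) <= Cmod (d z))%R) ->
      (forall z, upper_half z -> (Cmod (b2 z) <= Cmod (d z))%R) -> forall z, upper_half z -> Cmod (d z) = 1%R.
Proof.
  intros S1 S2. destruct S1 as [Ha1 [La1 N1]]. destruct S2 as [Ha2 [La2 N2]]. assert (N1' := N1).
  destruct N1' as [z0 [hz0 nz0]]. assert (p0 := proj1 (Cmod_gt_0 _) nz0).
  set (Dv := fun g => schur g /\ (forall z, upper_half z -> (Cmod (a1 z) <= Cmod (g z))%R) /\
    (forall z, upper_half z -> (Cmod (a2 z) <= Cmod (g z))%R)).
  destruct (completeness (fun x => exists g, Dv g /\ x = (- Cmod (g z0))%R)) as [m [Hm1 Hm2]].
  { exists 0%R. intros x [g [_ ->]]. assert (T := Cmod_ge_0 (g z0)). lra. }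
  { exists (- Cmod 1)%R, (fun _ => 1). split; [|reflexivity].
    split; [split; [apply holo_const|split; [intros; rewrite Cmod_1; lra|exact (nonzero_one _ Ci Ci_upper)]]|].
    rewrite Cmod_1. auto. }
  assert (Seq : forall n, exists g, Dv g /\ (Cmod (g z0) < - m + / INR (S n))%R).
  { intros n. apply NNPP. intros Q. assert (T := invINR_pos n).
    assert (T' : (m <= m - / INR (S n))%R); [|lra]. apply Hm2. intros x [g [Dg ->]].
    apply Rnot_lt_le. intros h'. apply Q. exists g. split; [exact Dg|lra]. }
  set (gn := fun n => proj1_sig (constructive_indefinite_description _ (Seq n))).
  assert (Hgn : forall n, Dv (gn n) /\ (Cmod (gn n z0) < - m + / INR (S n))%R).
  { intros n. unfold gn. destruct (constructive_indefinite_description _ _); auto. }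
  clearbody gn.
  destruct (montel_upper gn 1) as [psi [hpsi [g [Hg Lim]]]].
  { intros n. apply (proj1 (Hgn n)). }
  { intros n. apply (proj1 (Hgn n)). }
  assert (low : forall (a : C -> C), (forall n z, upper_half z -> (Cmod (a z) <= Cmod (gn n z))%R) ->
     forall z, upper_half z -> (Cmod (a z) <= Cmod (g z))%R).
  { intros a Ha z hz. apply (is_lim_seq_le (fun _ => Cmod (a z)) (fun n => Cmod (gn (psi n) z)) (Cmod (a z)) (Cmod (g z))).
    - intros n. apply Ha, hz.
    - apply is_lim_seq_const.
    - apply ctends_Cmod, Lim, hz. }
  assert (L1 : forall z, upper_half z -> (Cmod (a1 z) <= Cmod (g z))%R) by (apply low; intros n; apply (proj1 (Hgn n))).
  assert (L2 : forall z, upper_half z -> (Cmod (a2 z) <= Cmod (g z))%R) by (apply low; intros n; apply (proj1 (Hgn n))).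
  assert (gz0 : (0 < Cmod (g z0))%R) by (specialize (L1 z0 hz0); lra).
  assert (Sg : schur g).
  { split; [exact Hg|split].
    - intros z hz. apply (ctends_Cmod_le _ _ _ (Lim z hz)). intros n. apply (proj1 (Hgn (psi n))), hz.
    - exists z0. split; [exact hz0|]. apply Cmod_gt_0, gz0. }
  assert (gm : (Cmod (g z0) <= - m)%R).
  { apply (is_lim_seq_le (fun n => Cmod (gn (psi n) z0)) (fun n => - m + / INR (S (psi n)))%R (Cmod (g z0)) (- m)%R).
    - intros n. left. apply Hgn.
    - apply ctends_Cmod, Lim, hz0.
    - replace (Finite (- m)) with (Finite (- m + 0)) by (f_equal; ring).
      apply is_lim_seq_plus'; [apply is_lim_seq_const|].
      apply (is_lim_seq_extract (fun n => / INR (S n))%R); [exact hpsi|apply inv_INR_lim]. }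
  assert (quot : forall a, holo upper_half a -> nonzero_on upper_half a -> (forall z, upper_half z -> (Cmod (a z) <= Cmod (g z))%R) ->
    exists b, schur b /\ forall z, upper_half z -> a z = b z * g z).
  { intros a Ha Na La. destruct (quotient_holo a g Ha Na Hg La) as [b [Hb [Eb Lb]]]. exists b. split; [|exact Eb].
    split; [exact Hb|split; [exact Lb|]]. destruct Na as [z [hz nz]]. exists z. split; [exact hz|].
    intros e. apply nz. rewrite Eb, e by exact hz. ring. }
  destruct (quot a1 Ha1 N1 L1) as [b1 [Sb1 Eb1]], (quot a2 Ha2 N2 L2) as [b2 [Sb2 Eb2]].
  exists b1, b2, g. repeat (split; [assumption|]).
  intros d Sd Ld1 Ld2.
  assert (D1 : forall z, upper_half z -> (Cmod (a1 z) <= Cmod (g z * d z))%R).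
  { intros z hz. rewrite Eb1, !Cmod_mult, Rmult_comm by exact hz. apply Rmult_le_compat_l; [apply Cmod_ge_0|auto]. }
  assert (D2 : forall z, upper_half z -> (Cmod (a2 z) <= Cmod (g z * d z))%R).
  { intros z hz. rewrite Eb2, !Cmod_mult, Rmult_comm by exact hz. apply Rmult_le_compat_l; [apply Cmod_ge_0|auto]. }
  (* A further common divisor [d] of the quotients makes [g * d] a common divisor of [a1] and [a2];
     minimality of [g] at [z0] gives [d] modulus one there, and the maximum principle does so
     everywhere. *)
  assert (Dg : Dv (fun z => g z * d z)).
  { split; [|split; assumption]. split; [apply holo_mult; [exact Hg|apply Sd]|split].
    - intros z hz. rewrite Cmod_mult. assert (A := proj1 (proj2 Sg) z hz). assert (B := proj1 (proj2 Sd) z hz).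
      assert (p1 := Cmod_ge_0 (g z)). assert (p2 := Cmod_ge_0 (d z)). nra.
    - exists z0. split; [exact hz0|]. apply Cmod_gt_0. specialize (D1 z0 hz0). lra. }
  assert (M := Hm1 _ (ex_intro _ _ (conj Dg eq_refl))). cbv beta in M. rewrite Cmod_mult in M.
  assert (dz : Cmod (d z0) = 1%R).
  { apply Rle_antisym; [apply Sd, hz0|]. apply Rnot_lt_le. intros h'. assert (p1 := Cmod_ge_0 (d z0)). nra. }
  intros z hz. rewrite (schur_max d z0 Sd hz0 dz z hz). exact dz.
Qed.

Lemma symmetric_representation (f : C -> C) : N_sym f ->
  ~ (exists c : C, mero_eq upper_half f (fun _ => c)) ->
  exists h1 h2 : C -> C, S0 h1 /\ S0 h2 /\
    mero_eq off_real f (fun z => Ci * ((h2 z - h1 z) / (h2 z + h1 z))) /\ relatively_prime h1 h2.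
Proof.
  intros [[_ [[_ [f1 [f2 [B1 [B2 [N2 E]]]]]] _]] Sym] NC.
  destruct (Hinf_bound _ _ B1) as [m1 [hm1 Lm1]], (Hinf_bound _ _ B2) as [m2 [hm2 Lm2]].
  assert (Hf1 := analytic_on_holo _ _ (proj1 B1)). assert (Hf2 := analytic_on_holo _ _ (proj1 B2)).
  rewrite mero_eq_disc in E, Sym.
  (* [m1 + m2] bounds the modulus of [Ci * f2] plus or minus [f1], so this factor makes both
     combinations bounded by one. *)
  set (c := RtoC (/ (m1 + m2))).
  assert (hc : (0 < / (m1 + m2))%R) by (apply Rinv_0_lt_compat; lra).
  assert (nc : c <> 0) by (apply RtoC_nz; lra).
  assert (Ep : forall z, upper_half z -> exists d : R, (0 < d)%R /\ forall w, disc z d w -> w <> z ->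
    upper_half w /\ f2 w <> 0 /\ f w = f1 w / f2 w).
  { intros z hz. destruct (E z hz) as [d [hd K]], (zeros_isolated f2 z hz Hf2 N2) as [d' [hd' K']].
    exists (Rmin d d'). split; [apply Rmin_pos; auto|]. intros w hw nw. apply disc_min in hw.
    destruct (K' w (proj2 hw) nw). repeat split; auto. apply K; tauto. }
  assert (comb_schur : forall s : C, Cmod s = 1%R -> schur (fun z => c * (Ci * f2 z + s * f1 z))).
  { intros s hs. split; [|split].
    - apply holo_mult; [apply holo_const|]. apply holo_plus; apply holo_mult; auto using holo_const.
    - intros z hz. rewrite Cmod_mult. unfold c. rewrite Cmod_R, Rabs_pos_eq by lra.
      assert (T := Cmod_triangle (Ci * f2 z) (s * f1 z)). rewrite !Cmod_mult, Cmod_Ci, hs in T.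
      assert (A := Lm1 z hz). assert (B := Lm2 z hz).
      apply (Rmult_le_reg_l (m1 + m2)); [lra|]. rewrite <- Rmult_assoc, Rinv_r, Rmult_1_l by lra. lra.
    (* If the combination vanished identically, [f] would be the constant [- Ci / s]; this is where
       nonconstancy is used. *)
    - apply NNPP. intros Q.
      assert (Z : forall z, upper_half z -> Ci * f2 z + s * f1 z = 0).
      { intros z hz. apply NNPP. intros Q'. apply Q. exists z. split; [exact hz|]. apply Cmult_neq_0; auto. }
      assert (sn : s <> 0) by (apply Cnz_Cmod; lra).
      apply NC. exists (- Ci / s). apply mero_eq_disc. intros z hz. destruct (Ep z hz) as [d [hd K]].
      exists d. split; [exact hd|]. intros w hw nw. destruct (K w hw nw) as [uw [n2 ->]].
      replace (f1 w) with ((Ci * f2 w + s * f1 w - Ci * f2 w) / s) by (field; exact sn). rewrite Z by exact uw.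
      field. auto. }
  assert (Sa1 := comb_schur (- (1)) Cmod_m1). assert (Sa2 := comb_schur 1 Cmod_1).
  destruct (coprime_quotients _ _ Sa1 Sa2) as [b1 [b2 [g [Sb1 [Sb2 [Sg [Eb1 [Eb2 Max]]]]]]]].
  cbv beta in Eb1, Eb2.
  exists (ext b1), (ext b2). split; [apply schur_S0, Sb1|]. split; [apply schur_S0, Sb2|].
  (* The sum and difference of the two combinations are [2 c i f2] and [2 c f1], and the common
     factor [g] cancels in their quotient. *)
  assert (Q : forall w, upper_half w -> f2 w <> 0 -> g w <> 0 -> b2 w + b1 w <> 0 /\
    f1 w / f2 w = Ci * ((b2 w - b1 w) / (b2 w + b1 w))).
  { intros w uw n2 ng. assert (e1 := Eb1 w uw). assert (e2 := Eb2 w uw).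
    assert (two : RtoC 2 = RtoC 1 + RtoC 1) by (rewrite <- RtoC_plus; f_equal; ring).
    assert (two0 : RtoC 2 <> 0) by (apply RtoC_nz; lra).
    assert (s1 : b2 w + b1 w = RtoC 2 * (c * Ci * f2 w) / g w).
    { replace (b2 w + b1 w) with ((b2 w * g w + b1 w * g w) / g w) by (field; exact ng). rewrite <- e1, <- e2, two. field. exact ng. }
    assert (s2 : b2 w - b1 w = RtoC 2 * (c * f1 w) / g w).
    { replace (b2 w - b1 w) with ((b2 w * g w - b1 w * g w) / g w) by (field; exact ng). rewrite <- e1, <- e2, two. field. exact ng. }
    assert (nCi := Ci_nz).
    split.
    - rewrite s1. intros e. apply (f_equal (fun x => x * g w)) in e.
      replace (RtoC 2 * (c * Ci * f2 w) / g w * g w) with (RtoC 2 * (c * Ci * f2 w)) in e by (field; exact ng).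
      rewrite Cmult_0_l in e. revert e. repeat apply Cmult_neq_0; auto.
    - rewrite s1, s2. field. repeat split; auto. }
  split.
  - apply mero_eq_disc. intros z oz. destruct (off_real_cases z oz) as [hz|hz].
    + destruct (Ep z hz) as [d [hd K]], (zeros_isolated g z hz (proj1 Sg) (proj2 (proj2 Sg))) as [d' [hd' K']].
      exists (Rmin d d'). split; [apply Rmin_pos; auto|]. intros w hw nw. apply disc_min in hw.
      destruct (K w (proj1 hw) nw) as [uw [n2 ->]], (K' w (proj2 hw) nw) as [_ ng].
      rewrite !ext_upper by exact uw. apply Q; auto.
    (* Below the line [f] is the conjugate of its value at the conjugate point. Conjugation turns
       [Ci] into [- Ci], and passing from [SR b1], [SR b2] to their inverses changes the sign of the
       quotient once more. *)
    + destruct (Sym z hz) as [d [hd K]], (Ep (Cconj z) (conj_lower z hz)) as [d2 [hd2 K2]],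
        (zeros_isolated g (Cconj z) (conj_lower z hz) (proj1 Sg) (proj2 (proj2 Sg))) as [d3 [hd3 K3]],
        (SR_zeros_isolated b1 z hz Sb1) as [d4 [hd4 K4]], (SR_zeros_isolated b2 z hz Sb2) as [d5 [hd5 K5]].
      exists (Rmin d (Rmin d2 (Rmin d3 (Rmin d4 d5)))). split; [repeat apply Rmin_pos; auto|].
      intros w hw nw. apply disc_min in hw. destruct hw as [w1 hw]. apply disc_min in hw. destruct hw as [w2 hw].
      apply disc_min in hw. destruct hw as [w3 hw]. apply disc_min in hw. destruct hw as [w4 w5].
      assert (ncw : Cconj w <> Cconj z) by (intros e; apply nw; rewrite <- (Cconj_conj w), e, Cconj_conj; reflexivity).
      assert (DC : forall r, disc z r w -> disc (Cconj z) r (Cconj w)) by (intros r hr; apply disc_conj; rewrite Cconj_conj; exact hr).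
      destruct (K2 _ (DC _ w2) ncw) as [uw [n2 Ef]], (K3 _ (DC _ w3) ncw) as [_ ng].
      destruct (K4 w w4 nw) as [lw nb1], (K5 w w5 nw) as [_ nb2].
      rewrite (K w w1 nw). unfold SR at 1. rewrite Ef, !ext_lower by exact lw.
      destruct (Q _ uw n2 ng) as [ns ->]. unfold SR in *.
      rewrite Cmult_conj, conj_Ci, Cdiv_conj, Cminus_conj, Cplus_conj by exact ns.
      apply conj_nz in ns. rewrite Cplus_conj in ns. field. repeat split; auto. rewrite Cplus_comm. exact ns.
  - intros [h [Th [NT [D1 D2]]]]. destruct (S0_schur h Th) as [d [Sd Mh]].
    destruct (proj1 (nontrivial_ext h d Sd Mh) NT) as [w [hw lt]].
    assert (Dom : forall b, schur b -> divides h (ext b) -> forall z, upper_half z -> (Cmod (b z) <= Cmod (d z))%R).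
    { intros b Sb D z hz. destruct (divides_schur h (ext b) d b Sd Sb Mh (mero_eq_refl _ _) D) as [h3 [g3 [_ [S3 [_ Em]]]]].
      rewrite Em, Cmod_mult by exact hz. assert (T := proj1 (proj2 S3) z hz). assert (p := Cmod_ge_0 (d z)).
      rewrite <- (Rmult_1_r (Cmod (d z))) at 2. apply Rmult_le_compat_l; auto. }
    rewrite (Max d Sd (Dom b1 Sb1 D1) (Dom b2 Sb2 D2) w hw) in lt. lra.
Qed.

Theorem theorem3p3 :
  (forall h1 h2 : C -> C, S0 h1 -> S0 h2 ->
     (relatively_prime h1 h2 <->
      (forall f : C -> C,
         (B_space h1 f /\ B_space h2 f) <-> mero_eq off_real f (fun _ => 0))))
  /\
  (forall f : C -> C, N_sym f ->
     ~ (exists c : C, mero_eq upper_half f (fun _ => c)) ->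
     exists h1 h2 : C -> C,
       S0 h1 /\ S0 h2 /\
       mero_eq off_real f (fun z => Ci * ((h2 z - h1 z) / (h2 z + h1 z))) /\
       (forall g : C -> C,
          (B_space h1 g /\ B_space h2 g) <-> mero_eq off_real g (fun _ => 0))).
Proof.
  split; [exact relatively_prime_iff|].
  intros f Hf NC. destruct (symmetric_representation f Hf NC) as [h1 [h2 [T1 [T2 [E RP]]]]].
  exists h1, h2. split; [exact T1|]. split; [exact T2|]. split; [exact E|].
  apply relatively_prime_iff; assumption.
Qed.
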